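(* Let $f\in L^p(\Omega)$ with $p>2+\sigma$, let $q=\frac{p}{p-1}$ and $\tau=\frac{\sigma}{\sigma+1}$ (so that $q<2-\tau$). If $u$ satisfies $Lu=f$ in $\Omega$, then $u\in C^\alpha(\Omega)$ with $\alpha=\dfrac{2-q-\tau}{q}$.
   Context: Setting. $C^{1+\epsilon}$ denotes $C^1$ with first derivatives Hölder continuous of exponent $\epsilon$, for some $\epsilon>0$. $\tilde\Omega\subset\mathbb{R}^2$ is open, $L=A(x,y)\partial/\partial x+B(x,y)\partial/\partial y$ is a complex vector field on $\tilde\Omega$ with $\mathbb{C}$-valued Hölder continuous coefficients, $|A|+|B|>0$, and $\Omega$ is a relatively compact open set, $\overline\Omega\subset\tilde\Omega$, with $\partial\Omega$ piecewise of class $C^1$. The characteristic set is $\Sigma=\{\mathsf p\in\overline\Omega:\ \Im(A\overline B)(\mathsf p)=0\}$. It is assumed that: (i) $L$ is hypocomplex in $\overline\Omega$: for every $\mathsf p\in\overline\Omega$ there are an open set $\mathcal U\ni\mathsf p$ and a $C^{1+\epsilon}$ function $Z:\mathcal U\to\mathbb{C}$ (a first integral) with $dZ\neq0$, $LZ=0$, and $Z:\mathcal U\to Z(\mathcal U)$ a homeomorphism; (ii) $\Sigma$ is a $C^{1+\epsilon}$ curve nontangent to $L$ (i.e. $L_{\mathsf p}\notin\mathbb{C}\otimes T_{\mathsf p}\Sigma$ for $\mathsf p\in\Sigma$); (iii) for every $\mathsf p\in\Sigma$ there is an open set $\mathcal U\ni\mathsf p$ in which $\Sigma\cap\mathcal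 U$ is given by a $C^{1+\epsilon}$ defining function $\rho$ and $\Im(A\overline B)(x,y)=|\rho(x,y)|^{\sigma_{\mathsf p}}g(x,y)$ for some $\sigma_{\mathsf p}>0$ and some continuous $g$ nowhere zero in $\mathcal U$. $\Sigma$ has finitely many connected components $\Sigma_1,\dots,\Sigma_N$; the exponent in (iii) equals a constant $\sigma_j>0$ along $\Sigma_j$ (the type of $L$ along $\Sigma_j$), and $\sigma=\max_j\sigma_j$. $Z:\overline\Omega\to Z(\overline\Omega)\subset\mathbb{C}$ is a fixed global first integral of $L$: it is of class $C^{1+\epsilon}$, a homeomorphism onto its image, with $LZ=0$ and $dZ\neq0$. It is assumed that $L=Z_x\,\partial/\partial y-Z_y\,\partial/\partial x$. The equation $Lu=f$ is understood in the weak sense: $u\in L^1_{loc}(\Omega)$ and $-\int_\Omega u\,L\phi\,dxdy=\int_\Omega f\phi\,dxdy$ for all $\phi\in C_0^\infty(\Omega)$. $C^\alpha(\Omega)$ (as opposed to $C^\alpha(\overline\Omega)$) denotes the functions that are Hölder continuous with exponent $\alpha$ on compact subsets of $\Omega$. *)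

(* Defs.v *)
From HB Require Import structures.
From mathcomp Require Import all_boot all_order all_algebra.
From mathcomp Require Import complex.
From mathcomp Require Import all_classical all_reals all_analysis.
Set Implicit Arguments.
Unset Strict Implicit.
Unset Printing Implicit Defensive.
Import Order.TTheory GRing.Theory Num.Theory.
Import numFieldNormedType.Exports.
Local Open Scope classical_set_scope.
Local Open Scope ring_scope.

Notation plane R := (R * R)%type.

Notation Rec f := (fun q => complex.Re (f q)).
Notation Imc f := (fun q => complex.Im (f q)).

(* Rcomplex R is R[i] normed by the R-valued complex modulus. *)
Definition modc (R : realType) (z : R[i]) : R := `|z : Rcomplex R|.

(* The norm on R * R is the sup norm; being equivalent to the Euclidean one it
   defines the same Hoelder classes. *)
Definition holder (R : realType) (V : normedModType R) (W : normedZmodType R)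
    (e : R) (S : set V) (f : V -> W) : Prop :=
  exists C : R, forall x y : V, S x -> S y ->
    `|f x - f y| <= C * `|x - y| `^ e.

(* The class C^e(S) of an open set S: Hoelder on the compact subsets of S. *)
Definition loc_holder (R : realType) (V : normedModType R)
    (W : normedZmodType R) (e : R) (S : set V) (f : V -> W) : Prop :=
  forall K : set V, compact K -> K `<=` S -> holder e K f.

Definition dirx (R : realType) : plane R := (1, 0).
Definition diry (R : realType) : plane R := (0, 1).

Definition C1holder (R : realType) (e : R) (U : set (plane R))
    (f : plane R -> R) : Prop :=
  [/\ forall p, U p -> differentiable f p,
      loc_holder e U (fun p => 'D_(dirx R) f p : R) &
      loc_holder e U (fun p => 'D_(diry R) f p : R)].

Definition cdifferentiable (R : realType) (f : plane R -> R[i])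
    (p : plane R) : Prop :=
  differentiable (Rec f) p /\ differentiable (Imc f) p.

Definition pdx (R : realType) (f : plane R -> R[i]) (p : plane R) : R[i] :=
  Complex ('D_(dirx R) (Rec f) p) ('D_(dirx R) (Imc f) p).

Definition pdy (R : realType) (f : plane R -> R[i]) (p : plane R) : R[i] :=
  Complex ('D_(diry R) (Rec f) p) ('D_(diry R) (Imc f) p).

Definition vfield (R : realType) (A B f : plane R -> R[i]) (p : plane R) :
    R[i] :=
  A p * pdx f p + B p * pdy f p.

Definition cC1holder (R : realType) (U : set (plane R))
    (f : plane R -> R[i]) : Prop :=
  exists e : R, [/\ 0 < e, C1holder e U (Rec f) & C1holder e U (Imc f)].

(* Z is C^{1+e} up to the boundary of the open set Om: Zx and Zy are the first
   derivatives of Z in Om, extended to the closure as Hoelder functions. *)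
Definition cC1holder_closure (R : realType) (Om : set (plane R))
    (Z Zx Zy : plane R -> R[i]) : Prop :=
  [/\ {within closure Om, continuous (Z : plane R -> R[i]^o)},
      forall p, Om p -> [/\ cdifferentiable Z p, pdx Z p = Zx p
                          & pdy Z p = Zy p] &
      exists e : R, [/\ 0 < e,
        holder e (closure Om) (Zx : plane R -> Rcomplex R) &
        holder e (closure Om) (Zy : plane R -> Rcomplex R)]].

Definition homeo_onto_image (T1 T2 : topologicalType) (S : set T1)
    (f : T1 -> T2) : Prop :=
  {within S, continuous f} /\
  exists g : T2 -> T1, {within f @` S, continuous g} /\
    forall x, S x -> g (f x) = x.

Definition first_integral (R : realType) (A B : plane R -> R[i])
    (U : set (plane R)) (Z : plane R -> R[i]) : Prop :=
  [/\ cC1holder U Z,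
      forall p, U p -> pdx Z p != 0 \/ pdy Z p != 0,
      forall p, U p -> vfield A B Z p = 0 &
      homeo_onto_image U (Z : plane R -> R[i]^o)].

(* Omt is the open set on which the coefficients of L are given. *)
Definition hypocomplex (R : realType) (A B : plane R -> R[i])
    (Omt S : set (plane R)) : Prop :=
  forall p, S p -> exists U Z,
    [/\ open U, U p, U `<=` Omt & first_integral A B U Z].

Definition C1_arc (R : realType) (g : R -> plane R) : Prop :=
  [/\ forall t, derivable g t 1,
      continuous (derive1 g),
      forall t, 0 <= t <= 1 -> derive1 g t != 0 &
      forall s t, 0 <= s <= 1 -> 0 <= t <= 1 -> g s = g t -> s = t].

(* A finite union of regular C^1 arcs meeting at most at their endpoints; a
   closed C^1 curve is the union of two such arcs. *)
Definition piecewise_C1 (R : realType) (S : set (plane R)) : Prop :=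
  exists (n : nat) (g : 'I_n -> R -> plane R),
    [/\ forall i, C1_arc (g i),
        S = \bigcup_(i in [set: 'I_n]) (g i @` [set t | 0 <= t <= 1]) &
        forall i j s t, i != j -> 0 <= s <= 1 -> 0 <= t <= 1 ->
          g i s = g j t -> (s = 0 \/ s = 1) /\ (t = 0 \/ t = 1)].

(* J may contain its endpoints: a curve in the closure of a domain may end on
   the boundary of the domain. *)
Definition curve_chart (R : realType) (S U : set (plane R)) (J : set R)
    (g : R -> plane R) : Prop :=
  [/\ open U,
      is_interval J /\ (exists s t, [/\ J s, J t & s < t]),
      (forall t, derivable g t 1) /\
        (exists e : R, 0 < e /\ loc_holder e [set: R] (derive1 g)),
      forall t, J t -> derive1 g t != 0 &
      S `&` U = g @` J /\ homeo_onto_image J g].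

Definition C1holder_curve (R : realType) (S : set (plane R)) : Prop :=
  forall p, S p -> exists U J g, U p /\ curve_chart S U J g.

Definition tangent (R : realType) (S : set (plane R)) (p v : plane R) : Prop :=
  exists U J g t (c : R),
    [/\ curve_chart S U J g, J t, g t = p & v = c *: derive1 g t].

(* As T_pS is a real line, its complexification consists of the complex
   multiples of tangent vectors. *)
Definition nontangent (R : realType) (A B : plane R -> R[i])
    (S : set (plane R)) : Prop :=
  forall p v, S p -> tangent S p v ->
    ~ exists z : R[i], A p = z * (v.1)%:C%C /\ B p = z * (v.2)%:C%C.

Definition ImAB (R : realType) (A B : plane R -> R[i]) (p : plane R) : R :=
  complex.Im (A p * conjc (B p)).

Definition char_set (R : realType) (A B : plane R -> R[i])
    (Om : set (plane R)) : set (plane R) :=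
  [set p | closure Om p /\ ImAB A B p = 0].

Definition has_type (R : realType) (A B : plane R -> R[i])
    (Omt Om : set (plane R)) (p : plane R) (s : R) : Prop :=
  0 < s /\ exists (U : set (plane R)) (rho g : plane R -> R),
    [/\ [/\ open U, U p & U `<=` Omt],
        (exists e : R, 0 < e /\ C1holder e U rho),
        (forall q, (char_set A B Om `&` U) q ->
           'D_(dirx R) rho q != 0 \/ 'D_(diry R) rho q != 0) /\
        char_set A B Om `&` U = closure Om `&` U `&` [set q | rho q = 0],
        {within U, continuous g} /\ (forall q, U q -> g q != 0) &
        forall q, U q -> ImAB A B q = `|rho q| `^ s * g q].

(* Lebesgue measure on the plane; measurability is with respect to the Borel
   sets, so Lebesgue classes of functions are given by Borel representatives. *)
Definition mplane (R : realType) : measurableType _ :=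
  (measurableTypeR R * measurableTypeR R)%type.

Definition leb2 (R : realType) : {measure set (mplane R) -> \bar R} :=
  (@lebesgue_measure R \x @lebesgue_measure R)%E.

Definition cmeasurable (R : realType) (D : set (plane R))
    (f : plane R -> R[i]) : Prop :=
  measurable_fun (D : set (mplane R)) (Rec f : mplane R -> R) /\
  measurable_fun (D : set (mplane R)) (Imc f : mplane R -> R).

Definition cLp (R : realType) (p : R) (D : set (plane R))
    (f : plane R -> R[i]) : Prop :=
  cmeasurable D f /\
  ('N[leb2 R]_(p%:E)[((fun x => (modc (f x))%:E) \_ D : mplane R -> \bar R)]
     < +oo)%E.

Definition cL1loc (R : realType) (D : set (plane R))
    (f : plane R -> R[i]) : Prop :=
  cmeasurable D f /\
  forall K : set (plane R), compact K -> K `<=` D -> cLp 1 K f.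

Definition cintegral (R : realType) (D : set (plane R))
    (f : plane R -> R[i]) : R[i] :=
  Complex (\int[leb2 R]_(x in (D : set (mplane R))) complex.Re (f x))
          (\int[leb2 R]_(x in (D : set (mplane R))) complex.Im (f x)).

Definition iter_pd (R : realType) (s : seq bool) (f : plane R -> R) :
    plane R -> R :=
  foldr (fun b h => (fun p => 'D_(if b then dirx R else diry R) h p : R)) f s.

Definition smooth (R : realType) (f : plane R -> R) : Prop :=
  forall s p, differentiable (iter_pd s f) p.

Definition test_function (R : realType) (D : set (plane R))
    (phi : plane R -> R[i]) : Prop :=
  [/\ smooth (Rec phi), smooth (Imc phi),
      compact (closure [set x | phi x != 0]) &
      closure [set x | phi x != 0] `<=` D].

(* No derivative of the coefficients occurs on the left: this is Lu = f in the
   sense of distributions for a divergence free L, such as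
   L = Z_x d/dy - Z_y d/dx. *)
Definition weak_solution (R : realType) (A B : plane R -> R[i])
    (Om : set (plane R)) (u f : plane R -> R[i]) : Prop :=
  cL1loc Om u /\
  forall phi, test_function Om phi ->
    - cintegral Om (fun x => u x * vfield A B phi x) =
    cintegral Om (fun x => f x * phi x).

(* Main.v *)
(* Let J = Im (conj Z_x Z_y).  Testing the equation for u with
   chi * conj (Z - z) / (|Z - z|^2 + d^2), where chi is a cutoff, gives
     2i int u chi J d^2 / (|Z - z|^2 + d^2)^2
       = int (chi f + u L chi) conj (Z - z) / (|Z - z|^2 + d^2).
   As d tends to 0, the left side concentrates at Z = z.  Integrating in z = Z(p)
   against J(p) dp and letting d tend to 0 yields u H(Z) = T(Z) almost everywhere
   where chi = 1, with H and T the Cauchy transforms along Z of L chi and of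
   chi f + u L chi.  H is holomorphic on the values of Z there and imaginary valued,
   hence constant, and it does not vanish at the elliptic points.  Near a
   characteristic curve J has constant sign and |J| is at least k |rho|^s; following a
   level curve of the real or imaginary part of Z, which crosses the curve
   transversally, one finds that Z has a Hoelder inverse and that the set |Z - z| < r
   has area O(r^m), m = 2 - tau.  Young's inequality and a summation over dyadic
   layers then make T Hoelder of exponent (m - q) / q along Z, and Z is Lipschitz. *)
Require Import Defs.
From HB Require Import structures.
From mathcomp Require Import all_boot all_order all_algebra.
From mathcomp Require Import complex ring lra.
From mathcomp Require Import all_classical all_reals all_analysis.
From mathcomp Require Import measurable_realfun.
Set Implicit Arguments.
Unset Strict Implicit.
Unset Printing Implicit Defensive.
Import Order.TTheory GRing.Theory Num.Theory.
Import numFieldNormedType.Exports.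
Local Open Scope classical_set_scope.
Local Open Scope ring_scope.

(** In the variable [Z] the equation becomes an inhomogeneous Cauchy-Riemann equation with a
    singular weight. The proof stays in the original coordinates instead: the density J stands for
    the area element of the image, and no change of variables is made. So the mass of the
    approximate identity is never computed. The constant solution 1 is put through the same kernel
    identity, its transform H takes the place of that mass, and a nonzero constant suffices. The
    limit is taken only after integration over rectangles. A pointwise limit would require
    differentiating integrals of u along [Z]; over a rectangle, u multiplies means of an indicator
    function, which converge off the sides and are bounded by the means of chi because J has a
    constant sign. The kernel is only as regular as [Z], whereas test functions are smooth.
    Bernstein polynomials bridge the gap, since they approximate a C^1 function and its gradient
    under common bounds. The exponent m is 1 + 1 / (1 + sigma): where |Z - z| < r, one coordinate
    varies by O(r) once the other is fixed, and the other by O(r^(1 / (1 + sigma))). Elliptic points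
    are treated as the case s = 0. *)

(** * Lebesgue measure and null sets in the plane *)

Lemma plane_ballE (R : realType) (p : plane R) (r : R) :
  ball p r = (ball p.1 r `*` ball p.2 r : set (plane R)).
Proof. by []. Qed.

Lemma plane_normE (R : realType) (p : plane R) :
  `|p| = Num.max `|p.1| `|p.2|.
Proof. by []. Qed.

Lemma plane_ballP (R : realType) (p q : plane R) (r : R) :
  ball p r q <-> `|q - p| < r.
Proof. by rewrite -ball_normE /ball_ /= distrC. Qed.

Lemma measurable_plane_ball (R : realType) (p : plane R) (r : R) :
  measurable (ball p r : set (mplane R)).
Proof.
rewrite plane_ballE; apply: measurableX; exact: measurable_ball.
Qed.

Lemma leb2_ball (R : realType) (p : plane R) (r : R) : 0 <= r ->
  leb2 R (ball p r) = ((r *+ 2) ^+ 2)%:E.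
Proof.
move=> r0; rewrite plane_ballE /leb2 /=.
rewrite product_measure1E; try exact: measurable_ball.
rewrite expr2 EFinM; congr (_ * _)%E; exact: lebesgue_measure_ball.
Qed.

(** Lindelöf's argument, with rational centres and radii [1 / (k + 1)] enumerated by [unpickle]. As
    [Q] is any property inherited by subsets, the lemma serves both the measurability of open sets
    and the local character of null sets. *)
Lemma countable_ball_cover (R : realType) (Q : set (plane R) -> Prop)
    (U : set (plane R)) : Q set0 ->
  (forall A B, A `<=` B -> Q B -> Q A) ->
  (forall p, U p -> exists2 r, 0 < r & Q (ball p r)) ->
  exists c : nat -> plane R, exists r : nat -> R,
    (forall n, 0 <= r n /\ Q (ball (c n) (r n))) /\
    U `<=` \bigcup_n ball (c n) (r n).
Proof.
move=> Q0 QS UQ.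
pose cr (n : nat) : plane R * R :=
  if (unpickle n : option (rat * rat * nat)) is Some (q1, q2, k) then
    ((ratr q1, ratr q2), k.+1%:R^-1) else ((0, 0), 0).
(* A candidate that fails [Q] is given the radius 0: its ball is then empty and [Q set0] applies. *)
pose r n := if `[< Q (ball (cr n).1 (cr n).2) >] then (cr n).2 else 0.
have cr0 n : 0 <= (cr n).2.
  by rewrite /cr; case: unpickle => [[[? ?] ?]|] //=; rewrite invr_ge0.
exists (fun n => (cr n).1), r; split=> [n|p Up].
  rewrite /r; case: asboolP => [//|_]; split=> //.
  suff -> : ball (cr n).1 0 = set0 by [].
  by apply/seteqP; split=> // x /plane_ballP; rewrite ltNge normr_ge0.
have [e e0 Qe] := UQ _ Up.
(* Two radii have to fit into [e]: the rational ball must contain [p] and still lie in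
   [ball p e]. *)
have [k ke] : exists k : nat, k.+1%:R^-1 + k.+1%:R^-1 < e.
  have e2 : 0 < e / 2 by rewrite divr_gt0.
  have [k _ /(_ k (leqnn _))] := near_infty_natSinv_lt (PosNum e2).
  by move=> /= h; exists k; rewrite (splitr e) ltrD.
set d : R := k.+1%:R^-1 in ke.
have d0 : 0 < d by rewrite /d invr_gt0.
have app (x : R) : exists q : rat, `|x - ratr q| < d.
  have : x - d < x + d by rewrite ltrD2l (lt_trans _ d0)// oppr_lt0.
  move=> /rat_in_itvoo[q]; rewrite in_itv/= => /andP[h1 h2]; exists q.
  by rewrite ltr_norml; apply/andP; split; lra.
have [q1 h1] := app p.1; have [q2 h2] := app p.2.
exists (pickle (q1, q2, k)) => //.
have -> : r (pickle (q1, q2, k)) = d.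
  rewrite /r /cr pickleK /=; case: asboolP => // [[]].
  apply: QS Qe => y /plane_ballP; rewrite plane_normE gt_max /= => /andP[y1 y2].
  apply/plane_ballP; rewrite plane_normE gt_max /=.
  move: h1 h2 y1 y2; rewrite -/d !ltr_norml.
  by move=> /andP[? ?] /andP[? ?] /andP[? ?] /andP[? ?]; apply/andP; split;
    apply/andP; split; lra.
rewrite /cr pickleK /=; apply/plane_ballP.
by rewrite plane_normE gt_max /= h1 h2.
Qed.

Lemma open_plane_measurable (R : realType) (U : set (plane R)) :
  open U -> measurable (U : set (mplane R)).
Proof.
move=> oU.
have [|||c [r [crU Ucov]]] := @countable_ball_cover _ (fun A => A `<=` U) U.
- by [].
- by move=> A B AB BU; exact: subset_trans BU.
- move=> p Up; have /nbhs_ballP[e /= e0 eU] := open_nbhs_nbhs (conj oU Up).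
  by exists e.
suff -> : U = \bigcup_n (ball (c n) (r n)).
  by apply: bigcupT_measurable => n; exact: measurable_plane_ball.
by apply/seteqP; split=> // x [n _]; exact: (crU n).2.
Qed.

Lemma continuous_measurable_plane (R : realType) (U : set (plane R))
    (f : plane R -> R) : open U -> (forall p, U p -> {for p, continuous f}) ->
  measurable_fun (U : set (mplane R)) (f : mplane R -> R).
Proof.
move=> oU cf; apply: (measurability _ (RGenOpens.measurableE R)).
move=> _ [_ [a [b ->] <-]]; apply: open_plane_measurable.
rewrite openE => p [Up /= fp]; apply: filterI; first exact: open_nbhs_nbhs.
by apply: cf => //; apply: open_nbhs_nbhs; split=> //; exact: interval_open.
Qed.

Lemma locally_negligible (R : realType) (U A : set (plane R)) :
  (forall p, U p -> exists2 r, 0 < r & (leb2 R).-negligible (A `&` ball p r)) ->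
  (leb2 R).-negligible (A `&` U).
Proof.
move=> h.
have [|||c [r [cr Uc]]] := @countable_ball_cover _
    (fun B => (leb2 R).-negligible (A `&` B)) U.
- by rewrite setI0; exact: negligible_set0.
- by move=> B C BC; apply: negligibleS; exact: setIS.
- by [].
have sub : A `&` U `<=` \bigcup_n (A `&` ball (c n) (r n)).
  by rewrite -setI_bigcupr; exact: setIS.
apply: (@negligibleS _ _ _ (leb2 R) _ _ sub).
by apply: negligible_bigcup => n; exact: (cr n).2.
Qed.

Lemma lebesgue_measure_itvcc (R : realType) (a b : R) : a <= b ->
  lebesgue_measure (`[a, b]%classic : set R) = (b - a)%:E.
Proof.
move=> ab; rewrite lebesgue_measure_itv/= lte_fin; case: ltP => // ba.
by have -> : a = b by [apply/eqP; rewrite eq_le ab]; rewrite subrr.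
Qed.

(** Fubini over horizontal sections. A section of diameter at most [h] lies in the interval of
    length [2 h] centred at any of its points. Besides areas of sublevel sets, the case [h = 0]
    yields null sets. *)
Lemma leb2_ysection_le (R : realType) (E : set (plane R)) (c l h : R) :
  measurable (E : set (mplane R)) -> 0 <= h -> 0 <= l ->
  (forall p, E p -> c <= p.2 <= c + l) ->
  (forall p q, E p -> E q -> p.2 = q.2 -> `|p.1 - q.1| <= h) ->
  (leb2 R E <= (h *+ 2 * l)%:E)%E.
Proof.
move=> mE h0 l0 El Eh.
have -> : leb2 R E = (\int[lebesgue_measure]_y lebesgue_measure (ysection E y))%E.
  have /= -> := @product_measure_unique _ _ _ _ _ lebesgue_measure
    lebesgue_measure (lebesgue_measure \x^ lebesgue_measure)%E _ E mE.
    by [].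
  by move=> A B mA mB; exact: product_measure2E.
have mI : measurable (`[c, c + l]%classic : set R) by [].
have -> : (h *+ 2 * l)%:E =
    (\int[lebesgue_measure]_y ((h *+ 2)%:E * (\1_`[c, (c + l)%R] y)%:E))%E.
  rewrite ge0_integralZl//; last by rewrite lee_fin mulrn_wge0.
    rewrite integral_indic// setIT EFinM; congr (_ * _)%E; apply/esym.
    by rewrite -[RHS](_ : (c + l - c)%:E = _); [apply: lebesgue_measure_itvcc; rewrite lerDl|congr EFin; lra].
  by apply/measurable_EFinP; exact: measurable_indic.
apply: ge0_le_integral => //.
- exact: measurable_fun_ysection.
- apply: emeasurable_funM; first exact: measurable_cst.
  by apply/measurable_EFinP; exact: measurable_indic.
move=> y _.
have [[x xy]|none] := pselect (exists x, E (x, y)); last first.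
  have -> : ysection E y = set0.
    apply/seteqP; split=> // x; rewrite /ysection /= inE => Exy.
    by apply: none; exists x.
  rewrite measure0; apply: mule_ge0; first by rewrite lee_fin mulrn_wge0.
  by rewrite lee_fin indicE.
have -> : \1_`[c, (c + l)%R] y = 1 :> R.
  by rewrite indicE mem_set//= in_itv/= (El _ xy).
rewrite mule1; have -> : (h *+ 2)%:E =
    lebesgue_measure (`[x - h, x + h]%classic : set R).
  by rewrite lebesgue_measure_itvcc; [congr EFin; lra|lra].
apply: le_measure; rewrite ?inE//.
- exact: measurable_ysection.
move=> x'; rewrite /ysection /= inE => Ex'.
have := Eh _ _ Ex' xy erefl; rewrite in_itv/= ler_norml /= => /andP[? ?].
by apply/andP; split; lra.
Qed.

Lemma leb2_xsection_le (R : realType) (E : set (plane R)) (c l h : R) :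
  measurable (E : set (mplane R)) -> 0 <= h -> 0 <= l ->
  (forall p, E p -> c <= p.1 <= c + l) ->
  (forall p q, E p -> E q -> p.1 = q.1 -> `|p.2 - q.2| <= h) ->
  (leb2 R E <= (h *+ 2 * l)%:E)%E.
Proof.
move=> mE h0 l0 El Eh.
(* Exchanging the coordinates preserves the measure, by uniqueness of the product measure. *)
have -> : leb2 R E = leb2 R [set p | E (p.2, p.1)].
  have mS : measurable_fun setT (fun p : mplane R => (p.2, p.1) : mplane R).
    by apply/measurable_fun_pairP; split; [exact: measurable_snd|exact: measurable_fst].
  have /= -> := @product_measure_unique _ _ _ _ _ lebesgue_measure
    lebesgue_measure (pushforward (leb2 R) (fun p : mplane R => (p.2, p.1) : mplane R)) _ E mE.
  - by [].
  - exact: mS.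
  move=> A B mA mB; rewrite /pushforward.
  have -> : (fun p : mplane R => (p.2, p.1)) @^-1` (A `*` B) = B `*` A.
    by apply/seteqP; split=> -[x y] [].
  by rewrite muleC; exact: product_measure1E.
apply: (@leb2_ysection_le _ _ c) => //.
- rewrite -[X in measurable X]setTI.
  have mS : measurable_fun setT (fun p : mplane R => (p.2, p.1) : mplane R).
    by apply/measurable_fun_pairP; split; [exact: measurable_snd|exact: measurable_fst].
  exact: mS.
- by move=> p; exact: El.
- by move=> p q Ep Eq pq; exact: (Eh _ _ Ep Eq).
Qed.

Lemma leb2_sigma_finite (R : realType) : sigma_finite setT (leb2 R).
Proof.
exists (fun n => ball (0 : plane R) n%:R) => [|n].
  apply/seteqP; split=> // p _.
  exists (Num.truncn `|p|).+1 => //; apply/plane_ballP.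
  by rewrite subr0 truncnS_gt.
split; first exact: measurable_plane_ball.
by have -> := @leb2_ball R 0 n%:R (ler0n _ _); rewrite ltry.
Qed.

(** A second name for [leb2], to carry the structure of a sigma-finite measure that Fubini's theorem
    on pairs of points of the plane asks for. *)
Definition leb2_sf (R : realType) : set (mplane R) -> \bar R := leb2 R.

HB.instance Definition _ (R : realType) :=
  Measure.copy (@leb2_sf R) (leb2 R).
HB.instance Definition _ (R : realType) :=
  Measure_isSigmaFinite.Build _ _ _ (@leb2_sf R) (@leb2_sigma_finite R).

(** * The real-valued complex modulus and complex sequences *)

Section modulus.
Variable R : realType.
Implicit Types (z w : R[i]).

Lemma modcE z : modc z = Num.sqrt (complex.Re z ^+ 2 + complex.Im z ^+ 2).
Proof. by case: z. Qed.

Lemma modc_ge0 z : 0 <= modc z. Proof. exact: normr_ge0. Qed.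

Lemma modcM z w : modc (z * w) = modc z * modc w.
Proof. exact: Normc.normcM. Qed.

Lemma modcV z : modc z^-1 = (modc z)^-1.
Proof. exact: Normc.normcV. Qed.

Lemma modcN z : modc (- z) = modc z.
Proof. exact: (@normrN _ (Rcomplex R)). Qed.

Lemma modcD z w : modc (z + w) <= modc z + modc w.
Proof. exact: (@ler_normD _ (Rcomplex R)). Qed.

Lemma modcB z w : modc (z - w) <= modc z + modc w.
Proof. by rewrite -(modcN w); exact: modcD. Qed.

Lemma modc_distC z w : modc (z - w) = modc (w - z).
Proof. by rewrite -modcN opprB. Qed.

Lemma modc0 : modc (0 : R[i]) = 0.
Proof. exact: (@normr0 _ (Rcomplex R)). Qed.

Lemma modc_eq0 z : (modc z == 0) = (z == 0).
Proof. exact: (@normr_eq0 _ (Rcomplex R)). Qed.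

Lemma modc_gt0 z : (0 < modc z) = (z != 0).
Proof. exact: (@normr_gt0 _ (Rcomplex R)). Qed.

Lemma modcR (x : R) : modc x%:C%C = `|x|.
Proof. by rewrite modcE /= expr0n /= addr0 sqrtr_sqr. Qed.

Lemma normr_Re_le z : `|complex.Re z| <= modc z.
Proof.
by rewrite modcE -sqrtr_sqr; apply: ler_wsqrtr; rewrite lerDl sqr_ge0.
Qed.

Lemma normr_Im_le z : `|complex.Im z| <= modc z.
Proof.
by rewrite modcE -sqrtr_sqr; apply: ler_wsqrtr; rewrite lerDr sqr_ge0.
Qed.

Lemma modc_le_ReIm z : modc z <= `|complex.Re z| + `|complex.Im z|.
Proof.
rewrite modcE -[leRHS]ger0_norm ?addr_ge0// -sqrtr_sqr; apply: ler_wsqrtr.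
rewrite sqrrD !real_normK ?num_real//.
have := mulr_ge0 (normr_ge0 (complex.Re z)) (normr_ge0 (complex.Im z)).
by move=> h; nra.
Qed.

Lemma sqr_modc z : modc z ^+ 2 = complex.Re z ^+ 2 + complex.Im z ^+ 2.
Proof. by rewrite modcE sqr_sqrtr// addr_ge0 ?sqr_ge0. Qed.

Lemma ReD z w : complex.Re (z + w) = complex.Re z + complex.Re w.
Proof. by case: z; case: w. Qed.
Lemma ImD z w : complex.Im (z + w) = complex.Im z + complex.Im w.
Proof. by case: z; case: w. Qed.
Lemma ReN z : complex.Re (- z) = - complex.Re z. Proof. by case: z. Qed.
Lemma ImN z : complex.Im (- z) = - complex.Im z. Proof. by case: z. Qed.
Lemma ReM z w : complex.Re (z * w) =
  complex.Re z * complex.Re w - complex.Im z * complex.Im w.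
Proof. by case: z; case: w. Qed.
Lemma ImM z w : complex.Im (z * w) =
  complex.Re z * complex.Im w + complex.Im z * complex.Re w.
Proof. by case: z; case: w. Qed.
Lemma ReV z : complex.Re z^-1 =
  complex.Re z / (complex.Re z ^+ 2 + complex.Im z ^+ 2).
Proof. by case: z. Qed.
Lemma ImV z : complex.Im z^-1 =
  - complex.Im z / (complex.Re z ^+ 2 + complex.Im z ^+ 2).
Proof. by case: z => a b /=; rewrite mulNr. Qed.
Lemma complex_ext z w : complex.Re z = complex.Re w ->
  complex.Im z = complex.Im w -> z = w.
Proof. by case: z; case: w => /= ? ? ? ? -> ->. Qed.

Definition ccvg (u : nat -> R[i]) (l : R[i]) :=
  (fun n => modc (u n - l)) @ \oo --> (0 : R).

Lemma ccvgP (u : nat -> R[i]) (l : R[i]) : ccvg u l <->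
  (fun n => complex.Re (u n)) @ \oo --> complex.Re l /\
  (fun n => complex.Im (u n)) @ \oo --> complex.Im l.
Proof.
split=> [h|[hr hi]].
  split; apply/subr_cvg0/norm_cvg0P;
    apply: (squeeze_cvgr _ (cvg_cst 0) h);
    apply: nearW => n; rewrite normr_ge0 /=.
  - by rewrite -ReN -ReD normr_Re_le.
  - by rewrite -ImN -ImD normr_Im_le.
have h : (fun n => `|complex.Re (u n) - complex.Re l| +
    `|complex.Im (u n) - complex.Im l|) @ \oo --> (0 : R).
  rewrite -[X in _ --> X](addr0 0); apply: cvgD; apply/norm_cvg0P/subr_cvg0 => //.
apply: (squeeze_cvgr _ (cvg_cst 0) h).
apply: nearW => n; rewrite modc_ge0 /=.
by rewrite -!ReN -!ImN -ReD -ImD modc_le_ReIm.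
Qed.

Lemma ccvg_unique (u : nat -> R[i]) l l' : ccvg u l -> ccvg u l' -> l = l'.
Proof.
move=> /ccvgP[h1 h2] /ccvgP[h3 h4]; apply: complex_ext.
- exact: (cvg_unique _ h1 h3).
- exact: (cvg_unique _ h2 h4).
Qed.

Lemma ccvg_cst l : ccvg (fun=> l) l.
Proof. by apply/ccvgP; split; exact: cvg_cst. Qed.

Lemma ccvgM (u v : nat -> R[i]) l m : ccvg u l -> ccvg v m ->
  ccvg (fun n => u n * v n) (l * m).
Proof.
move=> /ccvgP[h1 h2] /ccvgP[h3 h4]; apply/ccvgP; split.
- under eq_fun do rewrite ReM.
  by rewrite ReM; apply: cvgB; apply: cvgM.
- under eq_fun do rewrite ImM.
  by rewrite ImM; apply: cvgD; apply: cvgM.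
Qed.

Lemma ccvgB (u v : nat -> R[i]) l m : ccvg u l -> ccvg v m ->
  ccvg (fun n => u n - v n) (l - m).
Proof.
move=> /ccvgP[h1 h2] /ccvgP[h3 h4]; apply/ccvgP; split.
- under eq_fun do rewrite ReD ReN.
  by rewrite ReD ReN; apply: cvgB.
- under eq_fun do rewrite ImD ImN.
  by rewrite ImD ImN; apply: cvgB.
Qed.

Lemma ccvg_ext (u v : nat -> R[i]) l : u =1 v -> ccvg u l -> ccvg v l.
Proof. by move=> /funext ->. Qed.

End modulus.

(** * Complex integrals: dominated convergence and Fubini's theorem *)

Section complex_integral.
Variable R : realType.
Local Notation mu := (leb2 R).
Implicit Types (f g : plane R -> R[i]) (c : R[i]).

Definition cintegrable f :=
  mu.-integrable setT (EFin \o Rec f : mplane R -> \bar R) /\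
  mu.-integrable setT (EFin \o Imc f : mplane R -> \bar R).

Lemma cmeasurableD D f g : cmeasurable D f -> cmeasurable D g ->
  cmeasurable D (fun x => f x + g x).
Proof.
move=> [f1 f2] [g1 g2]; split.
- by under eq_fun do rewrite ReD; exact: measurable_funD.
- by under eq_fun do rewrite ImD; exact: measurable_funD.
Qed.

Lemma cmeasurableN D f : cmeasurable D f -> cmeasurable D (fun x => - f x).
Proof.
move=> [f1 f2]; split.
- by under eq_fun do rewrite ReN; apply: measurableT_comp.
- by under eq_fun do rewrite ImN; apply: measurableT_comp.
Qed.

Lemma cmeasurableM D f g : cmeasurable D f -> cmeasurable D g ->
  cmeasurable D (fun x => f x * g x).
Proof.
move=> [f1 f2] [g1 g2]; split.
- by under eq_fun do rewrite ReM; apply: measurable_funB; exact: measurable_funM.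
- by under eq_fun do rewrite ImM; apply: measurable_funD; exact: measurable_funM.
Qed.

Lemma cmeasurable_cst D c : cmeasurable D (fun=> c).
Proof. by split; exact: measurable_cst. Qed.

Lemma cmeasurable_real D (h : mplane R -> R) : measurable_fun D h ->
  cmeasurable D (fun x => (h x)%:C%C).
Proof. by move=> mh; split=> //=; exact: measurable_cst. Qed.

Lemma cmeasurableV D f : cmeasurable D f -> cmeasurable D (fun x => (f x)^-1).
Proof.
move=> [f1 f2].
have m1 : measurable_fun (D : set (mplane R)) (fun x => (complex.Re (f x) ^+ 2 +
    complex.Im (f x) ^+ 2)^-1 : R).
  under eq_fun do rewrite -powR_inv1 ?addr_ge0 ?sqr_ge0//.
  apply: (measurableT_comp (measurable_powR _)).
  by apply: measurable_funD; exact: measurable_funX.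
split.
- by under eq_fun do rewrite ReV; apply: measurable_funM.
- by under eq_fun do rewrite ImV; apply: measurable_funM => //; apply: measurableT_comp.
Qed.

Lemma measurable_modc D f : cmeasurable D f ->
  measurable_fun (D : set (mplane R)) (fun x => modc (f x) : R).
Proof.
move=> [f1 f2]; under eq_fun do rewrite modcE.
apply: (measurableT_comp (continuous_measurable_fun (@sqrt_continuous R))).
by apply: measurable_funD; exact: measurable_funX.
Qed.

Lemma cintegrable_le f (g : plane R -> R) : cmeasurable setT f ->
  mu.-integrable setT (EFin \o g : mplane R -> \bar R) ->
  (forall x, modc (f x) <= g x) -> cintegrable f.
Proof.
move=> [f1 f2] ig fg; split; apply: (le_integrable measurableT _ _ ig) => //=.
- exact/measurable_EFinP.
- move=> x _; rewrite lee_fin (le_trans (normr_Re_le _))//.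
  by rewrite (le_trans (fg x))// ler_norm.
- exact/measurable_EFinP.
- move=> x _; rewrite lee_fin (le_trans (normr_Im_le _))//.
  by rewrite (le_trans (fg x))// ler_norm.
Qed.

Lemma cintegrable_measurable f : cintegrable f -> cmeasurable setT f.
Proof.
by move=> [/measurable_int/measurable_EFinP ? /measurable_int/measurable_EFinP ?].
Qed.

Lemma integrable_modc f : cintegrable f ->
  mu.-integrable setT (EFin \o (fun x => modc (f x)) : mplane R -> \bar R).
Proof.
move=> cf; have [f1 f2] := cf.
have /(le_integrable measurableT) := integrableD measurableT
  (integrable_abse f1) (integrable_abse f2).
apply=> [|x _ /=].
  apply/measurable_EFinP; apply: measurable_modc.
  exact: cintegrable_measurable.
rewrite lee_fin ger0_norm ?modc_ge0// (le_trans (modc_le_ReIm _))//.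
exact: ler_norm.
Qed.

Lemma cintegrableD f g : cintegrable f -> cintegrable g ->
  cintegrable (fun x => f x + g x).
Proof.
move=> cf cg; apply: (@cintegrable_le _ (fun x => modc (f x) + modc (g x))).
- by apply: cmeasurableD; exact: cintegrable_measurable.
- exact: (integrableD measurableT (integrable_modc cf) (integrable_modc cg)).
- by move=> x; exact: modcD.
Qed.

Lemma cintegrableZ c f : cintegrable f -> cintegrable (fun x => c * f x).
Proof.
move=> cf; apply: (@cintegrable_le _ (fun x => modc c * modc (f x))).
- by apply: cmeasurableM; [exact: cmeasurable_cst|exact: cintegrable_measurable].
- exact: (integrableZl measurableT _ (integrable_modc cf)).
- by move=> x; rewrite modcM.
Qed.

Lemma cintegrableN f : cintegrable f -> cintegrable (fun x => - f x).
Proof.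
move=> /(cintegrableZ (-1)); congr cintegrable.
by apply/funext => x; rewrite mulN1r.
Qed.

Lemma cintegralD f g : cintegrable f -> cintegrable g ->
  cintegral setT (fun x => f x + g x) = cintegral setT f + cintegral setT g.
Proof.
move=> [f1 f2] [g1 g2]; apply: complex_ext; rewrite /= ?ReD ?ImD /=.
- by under eq_Rintegral do rewrite ReD; exact: RintegralD.
- by under eq_Rintegral do rewrite ImD; exact: RintegralD.
Qed.

Lemma cintegralZ c f : cintegrable f ->
  cintegral setT (fun x => c * f x) = c * cintegral setT f.
Proof.
move=> [f1 f2]; apply: complex_ext; rewrite /= ?ReM ?ImM /=.
- under eq_Rintegral do rewrite ReM.
  rewrite RintegralB// ?RintegralZl//; first exact: (integrableZl measurableT _ f1).
  exact: (integrableZl measurableT _ f2).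
- under eq_Rintegral do rewrite ImM.
  rewrite RintegralD// ?RintegralZl//; first exact: (integrableZl measurableT _ f2).
  exact: (integrableZl measurableT _ f1).
Qed.

Lemma cintegralN f : cintegrable f ->
  cintegral setT (fun x => - f x) = - cintegral setT f.
Proof.
move=> cf; rewrite -mulN1r -cintegralZ//; congr cintegral.
by apply/funext => x; rewrite mulN1r.
Qed.

Lemma cintegralB f g : cintegrable f -> cintegrable g ->
  cintegral setT (fun x => f x - g x) = cintegral setT f - cintegral setT g.
Proof.
move=> cf cg; rewrite cintegralD ?cintegralN//; exact: cintegrableN.
Qed.

Lemma cintegral_mkcond (D : set (plane R)) f :
  cintegral D f = cintegral setT (fun x => (\1_D x)%:C%C * f x).
Proof.
rewrite /cintegral Rintegral_mkcond [in X in Complex _ X]Rintegral_mkcond.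
congr Complex; apply: eq_Rintegral => x _; rewrite ?ReM ?ImM /= !mul0r.
- by rewrite subr0 /patch indicE; case: ifP => _; rewrite ?mul1r ?mul0r.
- by rewrite addr0 /patch indicE; case: ifP => _; rewrite ?mul1r ?mul0r.
Qed.

(** By rotation: [conjc I] times the integral is the real number [|I| ^ 2], so that only the real
    part of [conjc I * f] counts, and this is at most [|I| |f|]. *)
Lemma modc_cintegral_le f : cintegrable f ->
  modc (cintegral setT f) <= (\int[mu]_x (modc (f x) : R)).
Proof.
move=> cf; set I := cintegral setT f.
have [->|I0] := eqVneq (modc I) 0.
  by apply: Rintegral_ge0 => x _; exact: modc_ge0.
have mI : 0 < modc I by rewrite lt_neqAle eq_sym I0 modc_ge0.
rewrite -(ler_pM2l mI) -RintegralZl//; last exact: integrable_modc.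
have -> : modc I * modc I = complex.Re (cintegral setT (fun x => conjc I * f x)).
  rewrite cintegralZ// -/I -expr2 sqr_modc ReM.
  by case: I {I0 mI} => a b /=; rewrite mulNr opprK !expr2.
apply: le_Rintegral => //.
- exact: (cintegrableZ (conjc I) cf).1.
- exact: (integrableZl measurableT _ (integrable_modc cf)).
- move=> x _; rewrite (le_trans (ler_norm _))// (le_trans (normr_Re_le _))//.
  by rewrite modcM; case: I {I0 mI} => a b; rewrite !modcE /= sqrrN.
Qed.

Lemma ae_leb2_impl (P Q : mplane R -> Prop) : (forall x, P x -> Q x) ->
  {ae mu, forall x, P x} -> {ae mu, forall x, Q x}.
Proof.
by move=> PQ; apply: (@filterS (mplane R) _ (ae_filter_ringOfSetsType mu)).
Qed.

Lemma cintegral_dominated (f_ : nat -> plane R -> R[i]) f (g : plane R -> R) :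
  (forall n, cmeasurable setT (f_ n)) -> cmeasurable setT f ->
  mu.-integrable setT (EFin \o g : mplane R -> \bar R) ->
  (forall n x, modc (f_ n x) <= g x) ->
  {ae mu, forall x, ccvg (f_ ^~ x) (f x)} ->
  cintegrable f /\ ccvg (fun n => cintegral setT (f_ n)) (cintegral setT f).
Proof.
move=> mf_ mf ig fg fcv.
have dct (h : nat -> mplane R -> R) (l : mplane R -> R) :
    (forall n, measurable_fun setT (h n)) -> measurable_fun setT l ->
    (forall n x, `|h n x| <= g x) ->
    {ae mu, forall x, h ^~ x @ \oo --> l x} ->
    mu.-integrable setT (EFin \o l) /\
    (fun n => (\int[mu]_x h n x)) @ \oo --> (\int[mu]_x l x).
  move=> mh ml hg hl.
  have [il _ cv] : [/\ mu.-integrable setT (EFin \o l),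
     [sequence \int[mu]_(x in setT) `|(h n x)%:E - (l x)%:E|]_n @ \oo --> 0 &
     [sequence \int[mu]_(x in setT) (h n x)%:E]_n @ \oo -->
        \int[mu]_(x in setT) (l x)%:E]%E.
    apply: (@dominated_convergence _ (mplane R) R mu setT measurableT
      (fun n => EFin \o h n) (EFin \o l) (EFin \o g)) => //.
    - by move=> n; exact/measurable_EFinP.
    - exact/measurable_EFinP.
    - apply: ae_leb2_impl hl => x hx _; apply/fine_cvgP; split; first exact: nearW.
      exact: hx.
    - by apply: aeW => x n _; rewrite lee_fin hg.
  split=> //; apply: (fine_cvg _ ).
  rewrite /Rintegral fineK//; exact: integrable_fin_num.
have [||||i1 c1] := dct (fun n x => complex.Re (f_ n x)) (fun x => complex.Re (f x)).
- by move=> n; case: (mf_ n).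
- by case: mf.
- by move=> n x; rewrite (le_trans (normr_Re_le _)).
- by apply: ae_leb2_impl fcv => x /ccvgP[].
have [||||i2 c2] := dct (fun n x => complex.Im (f_ n x)) (fun x => complex.Im (f x)).
- by move=> n; case: (mf_ n).
- by case: mf.
- by move=> n x; rewrite (le_trans (normr_Im_le _)).
- by apply: ae_leb2_impl fcv => x /ccvgP[].
by split=> //; apply/ccvgP; split.
Qed.

(** A majorant [a x * b y] makes [h] integrable on the product. It also makes every section
    integrable, not merely almost every one, so that no inner integral takes a default value. *)
Lemma Rintegral_Fubini_dominated (h : plane R -> plane R -> R)
    (a b : plane R -> R) :
  measurable_fun setT (fun z : mplane R * mplane R => h z.1 z.2) ->
  mu.-integrable setT (EFin \o a : mplane R -> \bar R) ->
  mu.-integrable setT (EFin \o b : mplane R -> \bar R) ->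
  (forall x y, `|h x y| <= a x * b y) ->
  mu.-integrable setT (EFin \o (fun x => \int[mu]_y h x y) : mplane R -> \bar R) /\
  (\int[mu]_x (\int[mu]_y h x y)) = (\int[mu]_y (\int[mu]_x h x y)).
Proof.
move=> mh ia ib hab.
pose m : {sigma_finite_measure set (mplane R) -> \bar R} := @leb2_sf R.
have ia' := integrable_abse ia; have ib' := integrable_abse ib.
have hab' x y : `|h x y| <= `|a x| * `|b y|.
  by rewrite (le_trans (hab x y))// -normrM ler_norm.
have i1 x : mu.-integrable setT (EFin \o h x : mplane R -> \bar R).
  apply: (le_integrable measurableT _ _ (integrableZl measurableT `|a x| ib')).
    apply/measurable_EFinP.
    exact: (measurableT_comp mh (measurable_pair1 x)).
  by move=> y _ /=; rewrite lee_fin [leRHS]ger0_norm ?mulr_ge0.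
have i2 y : mu.-integrable setT (EFin \o (h ^~ y) : mplane R -> \bar R).
  apply: (le_integrable measurableT _ _ (integrableZr measurableT `|b y| ia')).
    apply/measurable_EFinP.
    exact: (measurableT_comp mh (measurable_pair2 y)).
  by move=> x _ /=; rewrite lee_fin [leRHS]ger0_norm ?mulr_ge0.
have ih : (m \x m)%E.-integrable setT
    (EFin \o (fun z : mplane R * mplane R => h z.1 z.2)).
  apply/integrable12ltyP; first exact/measurable_EFinP.
  apply: (@le_lt_trans _ _ (\int[m]_x ((`|a x|)%:E * \int[m]_y (`|b y|)%:E))%E).
    apply: ge0_le_integral => //=.
    - by move=> x _; exact: integral_ge0.
    - apply: (@measurable_fun_fubini_tonelli_F _ _ _ _ _ m
        (fun z => (`|h z.1 z.2|)%:E)) => //.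
      by apply/measurable_EFinP; apply: measurableT_comp.
    - apply: emeasurable_funM => //.
      by move/measurable_int: ia'.
    move=> x _; rewrite -ge0_integralZl//; last by move/measurable_int: ib'.
    apply: ge0_le_integral => //=.
    - apply/measurable_EFinP; apply: measurableT_comp => //.
      by apply/measurable_EFinP; exact: measurable_int (i1 x).
    - by apply: emeasurable_funM => //; exact: measurable_int ib'.
    by move=> y _; rewrite lee_fin.
  rewrite ge0_integralZr//; last 2 first.
  - by move/measurable_int: ia'.
  - exact: integral_ge0.
  apply: lte_mul_pinfty.
  - exact: integral_ge0.
  - by apply: integrable_fin_num.
  - by move: ib' => /integrable_lty; apply.
split.
  have := integrable_fubini_F ih; congr (integrable _ _ _).
  apply/funext => x; rewrite /= /Rintegral /fubini_F fineK//.
  exact: (integrable_fin_num measurableT (i1 x)).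
rewrite /Rintegral; congr fine.
transitivity (\int[m]_x \int[m]_y (h x y)%:E)%E.
  apply: eq_integral => x _; rewrite /= fineK//.
  exact: (integrable_fin_num measurableT (i1 x)).
rewrite (Fubini ih).
apply: eq_integral => y _; rewrite /= fineK//.
exact: (integrable_fin_num measurableT (i2 y)).
Qed.

Lemma cintegral_Fubini_dominated (h : plane R -> plane R -> R[i])
    (a b : plane R -> R) :
  measurable_fun setT (fun z : mplane R * mplane R => complex.Re (h z.1 z.2)) ->
  measurable_fun setT (fun z : mplane R * mplane R => complex.Im (h z.1 z.2)) ->
  mu.-integrable setT (EFin \o a : mplane R -> \bar R) ->
  mu.-integrable setT (EFin \o b : mplane R -> \bar R) ->
  (forall x y, modc (h x y) <= a x * b y) ->
  cintegrable (fun x => cintegral setT (h x)) /\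
  cintegral setT (fun x => cintegral setT (h x)) =
  cintegral setT (fun y => cintegral setT (h ^~ y)).
Proof.
move=> m1 m2 ia ib hab.
have [|i1 e1] := @Rintegral_Fubini_dominated (fun x y => complex.Re (h x y)) _ _ m1 ia ib.
  by move=> x y; exact: le_trans (normr_Re_le _) _.
have [|i2 e2] := @Rintegral_Fubini_dominated (fun x y => complex.Im (h x y)) _ _ m2 ia ib.
  by move=> x y; exact: le_trans (normr_Im_le _) _.
by split; [split|rewrite /cintegral /=; congr Complex].
Qed.

End complex_integral.

(** * Gradients, smooth functions and cutoffs *)

Section gradients.
Variable R : realType.
Implicit Types (f g : plane R -> R) (p : plane R).

Definition has_grad f p (a b : R) : Prop :=
  is_diff p f (fun v : plane R => a * v.1 + b * v.2).

Lemma has_grad_differentiable f p a b : has_grad f p a b -> differentiable f p.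
Proof. by case. Qed.

Lemma has_grad_continuous f p a b : has_grad f p a b -> {for p, continuous f}.
Proof. by move=> /has_grad_differentiable/differentiable_continuous. Qed.

Lemma has_gradE f p a b : has_grad f p a b ->
  'D_(dirx R) f p = a /\ 'D_(diry R) f p = b.
Proof.
move=> [df eq]; rewrite !deriveE// eq /=; split; ring.
Qed.

Lemma differentiable_has_grad f p : differentiable f p ->
  has_grad f p ('D_(dirx R) f p) ('D_(diry R) f p).
Proof.
move=> df; split=> //; rewrite !deriveE//; apply/funext => -[x y] /=.
have -> : (x, y) = x *: dirx R + y *: diry R.
  by rewrite /dirx /diry; congr pair; rewrite /= /GRing.scale /=; ring.
by rewrite linearD !linearZ /= /GRing.scale/= mulrC [y * _]mulrC.
Qed.

Lemma has_grad_eq f p a b a' b' : has_grad f p a b -> a = a' -> b = b' ->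
  has_grad f p a' b'.
Proof. by move=> h <- <-. Qed.

Lemma has_grad_cst (c : R) p : has_grad (fun=> c) p 0 0.
Proof.
by apply: is_diff_eq; apply/funext => v /=; rewrite !mul0r addr0.
Qed.

Lemma has_grad_fst p : has_grad fst p 1 0.
Proof.
have cf : continuous (fst : plane R -> R) by move=> q; exact: cvg_fst.
split; first exact: linear_differentiable.
by rewrite diff_lin//; apply/funext => v /=; rewrite mul1r mul0r addr0.
Qed.

Lemma has_grad_snd p : has_grad snd p 0 1.
Proof.
have cf : continuous (snd : plane R -> R) by move=> q; exact: cvg_snd.
split; first exact: linear_differentiable.
by rewrite diff_lin//; apply/funext => v /=; rewrite mul1r mul0r add0r.
Qed.

Lemma has_gradD f g p a b c d : has_grad f p a b -> has_grad g p c d ->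
  has_grad (fun q => f q + g q) p (a + c) (b + d).
Proof.
move=> hf hg; have := is_diffD hf hg; rewrite /has_grad.
by move=> h; apply: (is_diff_eq h); apply/funext => v /=; rewrite fctE; ring.
Qed.

Lemma has_gradM f g p a b c d : has_grad f p a b -> has_grad g p c d ->
  has_grad (fun q => f q * g q) p (f p * c + a * g p) (f p * d + b * g p).
Proof.
move=> hf hg; have := is_diffM hf hg; rewrite /has_grad.
move=> h; apply: (is_diff_eq h); apply/funext => v /=.
rewrite -[LHS]/(f p * (c * v.1 + d * v.2) + g p * (a * v.1 + b * v.2)); ring.
Qed.

Lemma has_grad_comp (h : R -> R) f p a b c : has_grad f p a b ->
  is_derive (f p) 1 h c -> has_grad (fun q => h (f q)) p (c * a) (c * b).
Proof.
move=> hf [dh hc].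
have dh' : differentiable h (f p) by apply/derivable1_diffP.
have h1 : is_diff (f p) h ('d h (f p)) by split.
have := is_diff_comp hf h1; rewrite /has_grad => h2.
apply: (is_diff_eq h2); apply/funext => v /=.
have -> : a * v.1 + b * v.2 = (a * v.1 + b * v.2) *: (1 : R).
  by rewrite /GRing.scale/= mulr1.
rewrite linearZ /= -deriveE// hc /GRing.scale /=; ring.
Qed.

Lemma has_gradV f p a b : f p != 0 -> has_grad f p a b ->
  has_grad (fun q => (f q)^-1) p (- a / f p ^+ 2) (- b / f p ^+ 2).
Proof.
move=> fp0 hf.
have := @has_grad_comp (fun x => x^-1) f p a b (- (f p)^-2) hf.
have -> : - (f p)^-2 * a = - a / f p ^+ 2 by rewrite mulrC mulrN mulNr.
have -> : - (f p)^-2 * b = - b / f p ^+ 2 by rewrite mulrC mulrN mulNr.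
apply; have /= h := is_deriveV fp0 (is_derive_id (f p) 1).
by apply: (is_derive_eq h); rewrite /GRing.scale/= mulr1.
Qed.

(** The power [k] is carried along so that these functions, flat at 0, form a family closed under
    derivation. *)
Definition flat (k : nat) (t : R) : R :=
  if 0 < t then t^-1 ^+ k * expR (- t^-1) else 0.

Lemma flat_ge0 k t : 0 <= flat k t.
Proof.
rewrite /flat; case: ifP => // t0.
by rewrite mulr_ge0 ?expR_ge0// exprn_ge0// invr_ge0 ltW.
Qed.

(** From the term of order [k + 2] of the exponential series at [1 / t]. A quadratic bound is what
    makes the derivative at 0 vanish. *)
Lemma flat_le k t : flat k t <= (k.+2)`!%:R * t ^+ 2.
Proof.
rewrite /flat; case: ifP => t0; last by rewrite mulr_ge0 ?sqr_ge0.
have x0 : 0 < t^-1 by rewrite invr_gt0.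
have /(le_trans _) h := expR_ge1Dxn k.+1 (ltW x0).
have : t^-1 ^+ k.+2 / (k.+2)`!%:R <= expR t^-1 by apply: h; rewrite lerDr.
rewrite ler_pdivrMr ?ltr0n ?fact_gt0// => h2.
have -> : t^-1 ^+ k = t^-1 ^+ k.+2 * t ^+ 2.
  by rewrite -addn2 exprD -mulrA -exprMn mulVf ?gt_eqF// expr1n mulr1.
rewrite mulrAC; apply: ler_wpM2r; first exact: sqr_ge0.
by rewrite expRN ler_pdivrMr ?expR_gt0// mulrC.
Qed.

Lemma is_derive_flat k (t : R) :
  is_derive t 1 (flat k) (- k%:R * flat k.+1 t + flat k.+2 t).
Proof.
have [t0|t0|->] := ltgtP t 0.
- have -> : - k%:R * flat k.+1 t + flat k.+2 t = 0.
    by rewrite /flat !ifN ?mulr0 ?addr0// -leNgt ltW.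
  apply: (@near_eq_is_derive _ _ _ (cst 0)); rewrite ?oner_eq0//.
  near=> s; rewrite /flat ifN// -leNgt ltW//; near: s.
  exact: lt_nbhsl.
- have t0' : t != 0 by rewrite gt_eqF.
  apply: (@near_eq_is_derive R R R (fun s : R => s^-1 ^+ k * expR (- s^-1))).
    by near=> s; rewrite /flat ifT//; near: s; exact: lt_nbhsr.
  have h1 : is_derive t 1 (fun t => t^-1) (- t ^- 2).
    have /= h := is_deriveV t0' (is_derive_id t 1).
    by apply: (is_derive_eq h); rewrite /GRing.scale/= mulr1.
  have h2 : is_derive t 1 (fun t => expR (- t^-1)) (t ^- 2 * expR (- t^-1)).
    have h3 : is_derive t 1 (fun t => - t^-1) (t ^- 2).
      by have h := is_deriveN h1; apply: (is_derive_eq h); rewrite opprK.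
    by have h4 := @is_derive1_comp R expR (fun s : R => - s^-1) t _ _ (is_derive_expR _) h3; apply: (is_derive_eq h4); rewrite mulrC.
  have h5 := is_deriveX k h1.
  have h6 := is_deriveM h5 h2.
  rewrite (_ : (fun s : R => _) = (GRing.inv : R -> R) ^+ k *
    (fun s : R => expR (- s^-1))); last by apply/funext => s; rewrite !fctE.
  apply: (is_derive_eq h6); rewrite /GRing.scale/= fctE /flat t0.
  case: k {h5 h6} => [|k]; rewrite ?expr0 ?exprS /=.
    by field.
  by rewrite -natr1; field.
have -> : - k%:R * flat k.+1 0 + flat k.+2 0 = 0 :> R.
  by rewrite /flat ltxx mulr0 addr0.
have H : (fun h => h^-1 *: ((flat k \o shift 0) (h *: 1) - flat k 0)) @ 0^' --> (0 : R).
  have hM : (fun h : R => (k.+2)`!%:R * `|h|) @ 0^' --> (0 : R).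
    rewrite -[X in _ --> X](mulr0 (k.+2)`!%:R); apply: cvgM; first exact: cvg_cst.
    apply: cvg_within_filter; have := @norm_continuous R R^o 0.
    by rewrite /continuous_at normr0.
  apply/norm_cvg0P; apply: (squeeze_cvgr _ (cvg_cst 0) hM).
  near=> h; rewrite normr_ge0 /= addr0 /GRing.scale /= mulr1.
  have h0 : h != 0 by near: h; exact: nbhs_dnbhs_neq.
  rewrite {2}/flat ltxx subr0 normrM normfV mulrC ler_pdivrMr ?normr_gt0//.
  rewrite (ger0_norm (flat_ge0 _ _)) -mulrA -expr2 real_normK ?num_real//.
  exact: flat_le.
by split; [apply/cvg_ex; exists 0|apply/cvg_lim].
Unshelve. all: by end_near.
Qed.

(** Smoothness by construction: the class is closed under partial derivation, which reduces the
    iterated derivatives in [smooth] to a single induction. It contains the cutoffs and all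
    polynomials. *)
Inductive smooth_expr : (plane R -> R) -> Prop :=
| smooth_cst c : smooth_expr (fun=> c)
| smooth_fst : smooth_expr fst
| smooth_snd : smooth_expr snd
| smooth_add f g : smooth_expr f -> smooth_expr g ->
    smooth_expr (fun p => f p + g p)
| smooth_mul f g : smooth_expr f -> smooth_expr g ->
    smooth_expr (fun p => f p * g p)
| smooth_inv f : (forall p, f p != 0) -> smooth_expr f ->
    smooth_expr (fun p => (f p)^-1)
| smooth_flat k f : smooth_expr f -> smooth_expr (fun p => flat k (f p)).

(* Besides closing the class under derivation, this yields the symmetry of
   second derivatives. *)
Lemma smooth_expr_grad f : smooth_expr f -> exists fx fy fxx fxy fyy,
  [/\ smooth_expr fx, smooth_expr fy, forall p, has_grad f p (fx p) (fy p),
      forall p, has_grad fx p (fxx p) (fxy p) &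
      forall p, has_grad fy p (fxy p) (fyy p)].
Proof.
elim=> {f} [c| | |f g sf [fx [fy [fxx [fxy [fyy [s1 s2 h1 h2 h3]]]]]]
      sg [gx [gy [gxx [gxy [gyy [t1 t2 k1 k2 k3]]]]]]
    |f g sf [fx [fy [fxx [fxy [fyy [s1 s2 h1 h2 h3]]]]]]
      sg [gx [gy [gxx [gxy [gyy [t1 t2 k1 k2 k3]]]]]]
    |f f0 sf [fx [fy [fxx [fxy [fyy [s1 s2 h1 h2 h3]]]]]]
    |k f sf [fx [fy [fxx [fxy [fyy [s1 s2 h1 h2 h3]]]]]]].
- exists (fun=> 0), (fun=> 0), (fun=> 0), (fun=> 0), (fun=> 0).
  by split; [exact: smooth_cst|exact: smooth_cst|move=> p; exact: has_grad_cst..].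
- exists (fun=> 1), (fun=> 0), (fun=> 0), (fun=> 0), (fun=> 0).
  split; [exact: smooth_cst|exact: smooth_cst|exact: has_grad_fst|
    move=> p; exact: has_grad_cst..].
- exists (fun=> 0), (fun=> 1), (fun=> 0), (fun=> 0), (fun=> 0).
  split; [exact: smooth_cst|exact: smooth_cst|exact: has_grad_snd|
    move=> p; exact: has_grad_cst..].
- exists (fun p => fx p + gx p), (fun p => fy p + gy p),
    (fun p => fxx p + gxx p), (fun p => fxy p + gxy p),
    (fun p => fyy p + gyy p).
  by split=> [||p|p|p]; try exact: smooth_add; exact: has_gradD.
- exists (fun p => f p * gx p + fx p * g p), (fun p => f p * gy p + fy p * g p).
  do 3 eexists; split=> [||p|p|p].
  + by apply: smooth_add; exact: smooth_mul.
  + by apply: smooth_add; exact: smooth_mul.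
  + exact: has_gradM.
  + apply: has_gradD; [exact: has_gradM|exact: has_gradM].
  + rewrite /=.
    apply: has_grad_eq (has_gradD (has_gradM (h1 p) (k3 p))
      (has_gradM (h3 p) (k1 p))) _ erefl; ring.
(* [w] is the derivative of the inverse at [f p], written as a product so that it visibly stays in
   the class. *)
- pose w p := - (f p)^-1 * (f p)^-1.
  have wE p : w p = - (f p)^-1 * (f p)^-1 by [].
  have hV p : has_grad (fun q => (f q)^-1) p (w p * fx p) (w p * fy p).
    have := has_gradV (f0 p) (h1 p).
    by congr (has_grad _ _ _ _); rewrite /w; field; exact: f0.
  have hN p : has_grad (fun q => - (f q)^-1) p (- (w p * fx p)) (- (w p * fy p)).
    have := has_gradM (has_grad_cst (-1) p) (hV p).
    by congr (has_grad _ _ _ _); [apply/funext => q|..]; rewrite ?mul0r ?addr0 mulN1r.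
  have hw p := has_gradM (hN p) (hV p).
  have sw : smooth_expr w.
    have sV := smooth_inv f0 sf.
    have := smooth_mul (smooth_mul (smooth_cst (-1)) sV) sV.
    by congr smooth_expr; apply/funext => q; rewrite /w mulN1r.
  exists (fun p => w p * fx p), (fun p => w p * fy p).
  do 3 eexists; split=> [||p|p|p].
  + exact: smooth_mul.
  + exact: smooth_mul.
  + exact: hV.
  + exact: has_gradM.
  + apply: has_grad_eq (has_gradM (hw p) (h3 p)) _ erefl.
    by rewrite /= /w; field; exact: f0.
- pose w p := - k%:R * flat k.+1 (f p) + flat k.+2 (f p).
  have hF j p : has_grad (fun q => flat j (f q)) p
    ((- j%:R * flat j.+1 (f p) + flat j.+2 (f p)) * fx p)
    ((- j%:R * flat j.+1 (f p) + flat j.+2 (f p)) * fy p).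
    exact: has_grad_comp (h1 p) (is_derive_flat j (f p)).
  pose w1 p := - k%:R * (- k.+1%:R * flat k.+2 (f p) + flat k.+3 (f p)) +
    (- k.+2%:R * flat k.+3 (f p) + flat k.+4 (f p)).
  have hw p : has_grad w p (w1 p * fx p) (w1 p * fy p).
    apply: has_grad_eq (has_gradD (has_gradM (has_grad_cst (- k%:R) p)
      (hF k.+1 p)) (hF k.+2 p)) _ _; rewrite /w1 mul0r addr0 mulrA -mulrDl//.
  exists (fun p => w p * fx p), (fun p => w p * fy p).
  have sw : smooth_expr w.
    apply: smooth_add; last exact: smooth_flat.
    by apply: smooth_mul; [exact: smooth_cst|exact: smooth_flat].
  do 3 eexists; split=> [||p|p|p].
  + exact: smooth_mul.
  + exact: smooth_mul.
  + exact: hF.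
  + apply: has_gradM; [exact: hw|exact: h2].
  + apply: has_grad_eq (has_gradM (hw p) (h3 p)) _ erefl.
    by rewrite /= -!mulrA [fx p * fy p]mulrC.
Qed.

Lemma smooth_expr_smooth f : smooth_expr f -> smooth f.
Proof.
move=> sf s; suff : smooth_expr (iter_pd s f).
  by move=> /smooth_expr_grad[fx [fy [? [? [? [_ _ h _ _]]]]]] p;
    exact: has_grad_differentiable (h p).
elim: s => [//|b s /smooth_expr_grad[fx [fy [? [? [? [s1 s2 h _ _]]]]]]] /=.
case: b.
- by rewrite (_ : (fun p => _) = fx)//; apply/funext => p; case: (has_gradE (h p)).
- by rewrite (_ : (fun p => _) = fy)//; apply/funext => p; case: (has_gradE (h p)).
Qed.

Lemma smooth_bump (c : plane R) (r r' : R) : 0 < r -> r < r' ->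
  exists chi : plane R -> R, [/\ smooth_expr chi,
    forall p, 0 <= chi p <= 1, forall p, `|p - c| <= r -> chi p = 1 &
    forall p, r' <= `|p - c| -> chi p = 0].
Proof.
move=> r0 rr'.
(* A smooth step, 0 for [t <= 0] and 1 for [t >= 1]. The denominator is positive since [t] and
   [1 - t] are not both nonpositive. *)
pose st t := flat 0 t / (flat 0 t + flat 0 (1 - t)).
have flat_gt0 t : 0 < t -> 0 < flat 0 t.
  by move=> t0; rewrite /flat t0 expr0 mul1r expR_gt0.
have den0 t : 0 < flat 0 t + flat 0 (1 - t).
  have [t0|t0] := ltP 0 t; first by rewrite ltr_pwDl ?flat_gt0 ?flat_ge0.
  by rewrite ltr_wpDl ?flat_ge0// flat_gt0// subr_gt0 (le_lt_trans t0).
have st01 t : 0 <= st t <= 1.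
  rewrite /st divr_ge0 ?flat_ge0 ?(ltW (den0 t))//=.
  by rewrite ler_pdivrMr// mul1r lerDl flat_ge0.
have st0 t : t <= 0 -> st t = 0.
  by move=> t0; rewrite /st {1}/flat ifN ?mul0r// -leNgt.
have st1 t : 1 <= t -> st t = 1.
  move=> t1; rewrite /st (_ : flat 0 (1 - t) = 0) ?addr0.
    by rewrite divff// gt_eqF// flat_gt0// (lt_le_trans ltr01).
  by rewrite /flat ifN// -leNgt subr_le0.
have sst f : smooth_expr f -> smooth_expr (fun p => st (f p)).
  move=> sf; apply: smooth_mul; first exact: smooth_flat.
  apply: smooth_inv => [p|]; first by rewrite gt_eqF.
  apply: smooth_add; apply: smooth_flat => //.
  apply: smooth_add; first exact: smooth_cst.
  have := smooth_mul (smooth_cst (-1)) sf.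
  by congr smooth_expr; apply/funext => p; rewrite mulN1r.
pose d := r' - r.
have d0 : 0 < d by rewrite subr_gt0.
(* One step for each end of the interval. The product over the two coordinates is then a plateau on
   squares, which are the balls of the sup norm. *)
pose e (x0 : R) (x : R) := st ((r' - (x - x0)) * d^-1) * st ((r' + (x - x0)) * d^-1).
have e01 x0 x : 0 <= e x0 x <= 1.
  have /andP[h1 h2] := st01 ((r' - (x - x0)) * d^-1).
  have /andP[h3 h4] := st01 ((r' + (x - x0)) * d^-1).
  by rewrite /e mulr_ge0//= mulr_ile1.
have e1 x0 x : `|x - x0| <= r -> e x0 x = 1.
  rewrite ler_norml => /andP[h1 h2].
  by rewrite /e !st1 ?mulr1// ler_pdivlMr// mul1r /d; lra.
have e0 x0 x : r' <= `|x - x0| -> e x0 x = 0.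
  rewrite ler_normr => /orP[h|h].
    by rewrite /e st0 ?mul0r// pmulr_lle0 ?invr_gt0//; lra.
  by rewrite /e [X in _ * X]st0 ?mulr0// pmulr_lle0 ?invr_gt0//; lra.
have se x0 f : smooth_expr f -> smooth_expr (fun p => e x0 (f p)).
  move=> sf; have sh : smooth_expr (fun p => f p - x0).
    by apply: smooth_add => //; exact: smooth_cst.
  apply: smooth_mul; apply: sst; (apply: smooth_mul; last exact: smooth_cst).
    apply: smooth_add; first exact: smooth_cst.
    have := smooth_mul (smooth_cst (-1)) sh.
    by congr smooth_expr; apply/funext => p; rewrite mulN1r.
  by apply: smooth_add => //; exact: smooth_cst.
exists (fun p => e c.1 p.1 * e c.2 p.2); split.
- by apply: smooth_mul; apply: se; [exact: smooth_fst|exact: smooth_snd].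
- move=> p; have /andP[h1 h2] := e01 c.1 p.1; have /andP[h3 h4] := e01 c.2 p.2.
  by rewrite mulr_ge0//= mulr_ile1.
- move=> p; rewrite plane_normE ge_max => /andP[h1 h2].
  by rewrite !e1 ?mulr1.
- move=> p; rewrite plane_normE le_max => /orP[h|h].
    by rewrite e0// mul0r.
  by rewrite [X in _ * X]e0// mulr0.
Qed.

End gradients.

(** * Bernstein approximation of C^1 functions with their gradients *)

Section bernstein.
Variable R : realType.

(* The mean of [g] under the binomial law of parameters [n] and [x]. *)
Fixpoint binmean (n : nat) (x : R) (g : nat -> R) : R :=
  if n is m.+1 then
    x * binmean m x (fun i => g i.+1) + (1 - x) * binmean m x g
  else g 0%N.

Lemma eq_binmean n x g h : (forall i, g i = h i) -> binmean n x g = binmean n x h.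
Proof. by move=> /funext ->. Qed.

Lemma binmean_cst n x c : binmean n x (fun=> c) = c.
Proof. by elim: n => //= n ->; ring. Qed.

Lemma binmean_lin n x a g h : binmean n x (fun i => a * g i + h i) =
  a * binmean n x g + binmean n x h.
Proof.
by elim: n g h => //= n IH g h; rewrite !IH; ring.
Qed.

Lemma binmeanB n x g h : binmean n x (fun i => g i - h i) =
  binmean n x g - binmean n x h.
Proof.
by elim: n g h => //= n IH g h; rewrite !IH; ring.
Qed.

Lemma binmean_le n x g h : 0 <= x <= 1 ->
  (forall i, (i <= n)%N -> g i <= h i) -> binmean n x g <= binmean n x h.
Proof.
move=> /andP[x0 x1]; elim: n g h => [|n IH] g h gh /=; first exact: gh.
apply: lerD; apply: ler_wpM2l; rewrite ?subr_ge0//.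
  by apply: IH => i ni; exact: gh.
by apply: IH => i ni; apply: gh; exact: leqW.
Qed.

Lemma binmeanN n x g : binmean n x (fun i => - g i) = - binmean n x g.
Proof. by elim: n g => //= n IH g; rewrite !IH; ring. Qed.

Lemma binmean_norm_le n x g h : 0 <= x <= 1 ->
  (forall i, (i <= n)%N -> `|g i| <= h i) -> `|binmean n x g| <= binmean n x h.
Proof.
move=> x01 gh; rewrite ler_norml -binmeanN.
by apply/andP; split; apply: binmean_le => // i /gh; rewrite ler_norml => /andP[].
Qed.

(** The shift [t] is left free because the recursion on [n] raises the index, hence replaces [t] by
    [1 + t]. At [t = - n x] this is the binomial variance. *)
Lemma binmean_sqr n x t : binmean n x (fun i => (i%:R + t) ^+ 2) =
  n%:R * x * (1 - x) + (n%:R * x + t) ^+ 2.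
Proof.
elim: n t => [|n IH] t /=; first by ring.
rewrite IH (@eq_binmean _ _ _ (fun i => (i%:R + (1 + t)) ^+ 2)) ?IH.
  by rewrite -natr1; ring.
by move=> i; rewrite -natr1; ring.
Qed.

Lemma binmean_variance n x : 0 <= x <= 1 ->
  binmean n.+1 x (fun i => (i%:R / n.+1%:R - x) ^+ 2) <= n.+1%:R^-1.
Proof.
move=> /andP[x0 x1].
have n0 : 0 < n.+1%:R :> R by rewrite ltr0n.
rewrite (@eq_binmean _ _ _ (fun i => n.+1%:R^-1 ^+ 2 *
    (i%:R + (- (n.+1%:R * x))) ^+ 2 + 0)); last first.
  by move=> i; field; rewrite gt_eqF.
rewrite binmean_lin binmean_cst binmean_sqr subrr expr0n /= !addr0.
have -> : n.+1%:R^-1 ^+ 2 * (n.+1%:R * x * (1 - x)) = n.+1%:R^-1 * (x * (1 - x)).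
  by field; rewrite gt_eqF.
rewrite -[leRHS]mulr1 ler_pM2l ?invr_gt0//; nra.
Qed.

(** The derivative of a Bernstein polynomial is [n] times the mean, one degree lower, of the first
    differences. The values [h i] also depend on the point, so that two such polynomials can be
    nested. *)
Lemma has_grad_binmean n (a : plane R -> R) (h : nat -> plane R -> R) p ax ay
    (hx hy : nat -> R) : has_grad a p ax ay ->
  (forall i, has_grad (h i) p (hx i) (hy i)) ->
  has_grad (fun q => binmean n (a q) (h ^~ q)) p
    (ax * (n%:R * binmean n.-1 (a p) (fun i => h i.+1 p - h i p)) +
      binmean n (a p) hx)
    (ay * (n%:R * binmean n.-1 (a p) (fun i => h i.+1 p - h i p)) +
      binmean n (a p) hy).
Proof.
move=> ha; elim: n h hx hy => [|n IH] h hx hy hh /=.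
  by apply: has_grad_eq (hh 0%N) _ _; rewrite mul0r mulr0 add0r.
have h1 := IH _ _ _ (fun i => hh i.+1).
have h2 := IH _ _ _ hh.
have hN : has_grad (fun q => 1 - a q) p (- ax) (- ay).
  have := has_gradD (has_grad_cst 1 p) (has_gradM (has_grad_cst (-1) p) ha).
  move=> h3; have := has_grad_eq h3.
  rewrite (_ : (fun q => 1 + -1 * a q) = (fun q => 1 - a q)).
    by apply; ring.
  by apply/funext => q; rewrite mulN1r.
apply: has_grad_eq (has_gradD (has_gradM ha h1) (has_gradM hN h2)) _ _.
- rewrite binmeanB; case: n {IH h1 h2} => [|n] /=; first by ring.
  by rewrite -[n.+2%:R]natr1 !binmeanB; ring.
- rewrite binmeanB; case: n {IH h1 h2} => [|n] /=; first by ring.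
  by rewrite -[n.+2%:R]natr1 !binmeanB; ring.
Qed.

Lemma smooth_binmean n (a : plane R -> R) (h : nat -> plane R -> R) :
  smooth_expr a -> (forall i, smooth_expr (h i)) ->
  smooth_expr (fun q => binmean n (a q) (h ^~ q)).
Proof.
move=> sa; elim: n h => [|n IH] h sh /=; first exact: sh.
apply: smooth_add; apply: smooth_mul => //; try exact: IH.
apply: smooth_add; first exact: smooth_cst.
have := smooth_mul (smooth_cst (-1)) sa.
by congr smooth_expr; apply/funext => p; rewrite mulN1r.
Qed.

(** Bernstein's argument through Chebyshev's inequality: near [(u, v)] the oscillation is at most
    [e], and farther away [2 M] is at most [2 M / d ^ 2] times a squared distance, whose mean is a
    variance. The nodes may miss the grid by one mesh, because gradients of the approximants are
    evaluated at mean value points. *)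
Lemma binmean_approx (G : R -> R -> R) (u v M d e : R) (a b : nat)
    (th et : nat -> nat -> R) :
  0 <= u <= 1 -> 0 <= v <= 1 -> 0 < d ->
  (forall s t, 0 <= s <= 1 -> 0 <= t <= 1 -> `|G s t| <= M) ->
  (forall s t, 0 <= s <= 1 -> 0 <= t <= 1 ->
    `|s - u| < d -> `|t - v| < d -> `|G s t - G u v| <= e) ->
  (forall i j, (i <= a.+1)%N -> (j <= b.+1)%N -> [/\ 0 <= th i j <= 1,
     0 <= et i j <= 1, `|th i j - i%:R / a.+1%:R| <= a.+1%:R^-1 &
     `|et i j - j%:R / b.+1%:R| <= b.+1%:R^-1]) ->
  `|binmean a.+1 u (fun i => binmean b.+1 v (fun j => G (th i j) (et i j))) -
    G u v| <= e + 2 * M / d ^+ 2 * (4 / a.+1%:R + 4 / b.+1%:R).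
Proof.
move=> u01 v01 d0 GM Gc node.
have M0 : 0 <= M by apply: le_trans (GM u v u01 v01).
have e0 : 0 <= e.
  by have := Gc u v u01 v01; rewrite !subrr normr0; exact.
pose K := 2 * M / d ^+ 2.
have K0 : 0 <= K by rewrite divr_ge0 ?sqr_ge0 ?mulr_ge0.
have sqd (x : R) : d <= `|x| -> 2 * M <= K * x ^+ 2.
  move=> dx; rewrite /K -mulrA [_ ^-1 * _]mulrC mulrA ler_pdivlMr ?exprn_gt0//.
  apply: ler_wpM2l; first by rewrite mulr_ge0.
  by rewrite -[x ^+ 2]real_normK ?num_real// lerXn2r ?nnegrE ?(ltW d0).
have Gq s t : 0 <= s <= 1 -> 0 <= t <= 1 ->
    `|G s t - G u v| <= e + K * ((s - u) ^+ 2 + (t - v) ^+ 2).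
  move=> s01 t01.
  have s2 : 0 <= K * (s - u) ^+ 2 by rewrite mulr_ge0 ?sqr_ge0.
  have t2 : 0 <= K * (t - v) ^+ 2 by rewrite mulr_ge0 ?sqr_ge0.
  have far : `|G s t - G u v| <= 2 * M.
    rewrite (le_trans (ler_normB _ _))//.
    by have := GM _ _ s01 t01; have := GM _ _ u01 v01; lra.
  have [su|su] := ltP `|s - u| d; last by have := sqd _ su; lra.
  have [tv|tv] := ltP `|t - v| d; last by have := sqd _ tv; lra.
  by have := Gc _ _ s01 t01 su tv; lra.
(* As the mesh [k] is at most 1, the squared error [k ^ 2] of a node is at most [k], the order of
   the variance. *)
have sq2 (x y z k : R) : `|x - y| <= k -> k <= 1 -> (x - z) ^+ 2 <= 2 * (y - z) ^+ 2 + 2 * k.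
  move=> xy k1; have k0 : 0 <= k by exact: le_trans xy.
  have : (x - y) ^+ 2 <= k.
    rewrite -[_ ^+ 2]real_normK ?num_real// expr2.
    by have := normr_ge0 (x - y); nra.
  have := sqr_ge0 ((y - z) - (x - y)); rewrite !expr2; nra.
rewrite -[X in _ - X](binmean_cst a.+1 u) -binmeanB.
have inv1 n : n.+1%:R^-1 <= 1 :> R by rewrite invf_le1 ?ltr0n// ler1n.
pose B i := e + K * (2 * (i%:R / a.+1%:R - u) ^+ 2 + 2 / a.+1%:R + 4 / b.+1%:R).
have step i : (i <= a.+1)%N ->
    `|binmean b.+1 v (fun j => G (th i j) (et i j)) - G u v| <= B i.
  move=> ia; rewrite -[X in _ - X](binmean_cst b.+1 v) -binmeanB.
  pose C j := 2 * K * (j%:R / b.+1%:R - v) ^+ 2 +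
     (e + K * (2 * (i%:R / a.+1%:R - u) ^+ 2 + 2 / a.+1%:R + 2 / b.+1%:R)).
  have CB : binmean b.+1 v C <= B i.
    rewrite /C binmean_lin binmean_cst /B.
    have := binmean_variance b v01; set V := binmean _ _ _ => hV.
    have : 2 * K * V <= 2 * K * b.+1%:R^-1 by apply: ler_wpM2l => //; rewrite mulr_ge0.
    by move=> h; apply: le_trans (lerD h (lexx _)) _; rewrite le_eqVlt; apply/orP; left; apply/eqP; ring.
  have HC j : (j <= b.+1)%N -> `|G (th i j) (et i j) - G u v| <= C j.
    move=> jb; have [t01 e01 h1 h2] := node _ _ ia jb.
    apply: le_trans (Gq _ _ t01 e01) _.
    have q1 := sq2 _ _ u _ h1 (inv1 _); have q2 := sq2 _ _ v _ h2 (inv1 _).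
    have := ler_wpM2l K0 (lerD q1 q2); rewrite /C => h.
    apply: le_trans (lerD (lexx e) h) _.
    by rewrite le_eqVlt; apply/orP; left; apply/eqP; ring.
  exact: le_trans (binmean_norm_le v01 HC) CB.
have BB : binmean a.+1 u B <= e + K * (4 / a.+1%:R + 4 / b.+1%:R).
  rewrite (@eq_binmean _ _ _ (fun i => 2 * K * (i%:R / a.+1%:R - u) ^+ 2 +
    (e + K * (2 / a.+1%:R + 4 / b.+1%:R)))); last by move=> i; rewrite /B; ring.
  rewrite binmean_lin binmean_cst.
  have := binmean_variance a u01; set V := binmean _ _ _ => hV.
  have : 2 * K * V <= 2 * K * a.+1%:R^-1 by apply: ler_wpM2l => //; rewrite mulr_ge0.
  by move=> h; apply: le_trans (lerD h (lexx _)) _; rewrite le_eqVlt; apply/orP; left; apply/eqP; ring.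
exact: le_trans (binmean_norm_le u01 step) BB.
Qed.

Lemma has_grad_curve (f : plane R -> R) (x y : R -> R) (t a b x' y' : R) :
  is_derive t 1 x x' -> is_derive t 1 y y' -> has_grad f (x t, y t) a b ->
  is_derive t 1 (fun s => f (x s, y s)) (a * x' + b * y').
Proof.
move=> [dx hx] [dy hy] hf.
have dx' : differentiable x t := (derivable1_diffP x t).1 dx.
have dy' : differentiable y t := (derivable1_diffP y t).1 dy.
have d1 : is_diff t x ('d x t) by split.
have d2 : is_diff t y ('d y t) by split.
have [d3 e3] := is_diff_comp (is_diff_pair d1 d2) hf.
change (is_derive t 1 (f \o (fun s => (x s, y s))) (a * x' + b * y')).
split; first by apply/derivable1_diffP.
rewrite deriveE// e3 /=; congr (a * _ + b * _).
- by rewrite -deriveE.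
- by rewrite -deriveE.
Qed.

Lemma cvg_of_bound (u : nat -> R) (l : R) :
  (forall e, 0 < e -> exists C, forall n, `|u n - l| <= e + C / n.+1%:R) ->
  u @ \oo --> l.
Proof.
move=> h; apply/cvgrPdist_le => e e0.
have e2 : 0 < e / 2 by rewrite divr_gt0.
have [C hC] := h _ e2.
have C1 : 0 < `|C| + 1 by rewrite ltr_wpDl.
have e3 : 0 < e / 2 / (`|C| + 1) by rewrite divr_gt0.
near=> n; rewrite distrC (le_trans (hC n))// [leRHS](splitr e) lerD2l.
have hn : n.+1%:R^-1 < e / 2 / (`|C| + 1) :> R.
  by near: n; exact: (near_infty_natSinv_lt (PosNum e3)).
have n0 : 0 < n.+1%:R^-1 :> R by rewrite invr_gt0 ltr0n.
move: hn; rewrite ltr_pdivlMr// => /ltW; apply: le_trans.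
rewrite mulrC; apply: ler_wpM2l; first exact: ltW.
by rewrite (le_trans (ler_norm C))// lerDl.
Unshelve. all: by end_near. Qed.

(** [N / k] times an increment between neighbouring nodes is a difference quotient in the unscaled
    variable, hence a value of the derivative. *)
Lemma MVT_scaled (g dg : R -> R) (x0 k N : R) (i : nat) : 0 < k -> 0 < N ->
  (forall s, i%:R / N <= s <= i.+1%:R / N ->
     is_derive (x0 + k * s) 1 g (dg (x0 + k * s))) ->
  exists th, i%:R / N <= th <= i.+1%:R / N /\
    N / k * (g (x0 + k * (i.+1%:R / N)) - g (x0 + k * (i%:R / N))) =
    dg (x0 + k * th).
Proof.
move=> k0 N0 hg.
pose F s := g (x0 + k * s).
have dF s : i%:R / N <= s <= i.+1%:R / N -> is_derive s 1 F (k * dg (x0 + k * s)).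
  move=> hs; have h1 : is_derive s 1 (fun s : R => x0 + k * s) k.
    by apply: is_derive_eq; rewrite /GRing.scale /=; ring.
  have h2 := @is_derive1_comp R g (fun s : R => x0 + k * s) s _ _ (hg _ hs) h1.
  by apply: is_derive_eq h2 _; rewrite mulrC.
have ab : i%:R / N < i.+1%:R / N by rewrite ltr_pM2r ?invr_gt0// ltr_nat.
have [||th th1 e] := @MVT_segment R F (fun s => k * dg (x0 + k * s)) _ _ (ltW ab).
- move=> s; rewrite in_itv/= => /andP[h1 h2]; apply: dF.
  by rewrite !ltW.
- apply: derivable_within_continuous => s; rewrite in_itv/= => hs.
  by have [] := dF _ hs.
exists th; move: th1; rewrite in_itv/= => th1; split=> //.
rewrite /F in e; rewrite e -natr1; field.
by rewrite !gt_eqF.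
Qed.

(** Derivation lowers the degree: the nodes come from the grid of mesh [1 / (m + 1)], whereas the
    mean refers to the grid of mesh [1 / m]. *)
Lemma grid_dist (s t m : R) : 0 < m -> 0 <= t -> t <= m ->
  t <= s * (m + 1) -> s * (m + 1) <= t + 1 -> `|s - t / m| <= m^-1.
Proof.
move=> m0 t0 tm h1 h2; rewrite -[s - t / m](@mulfK _ m) ?gt_eqF// normrM.
have -> : (s - t / m) * m = s * m - t by field; rewrite gt_eqF.
have mi : 0 < m^-1 by rewrite invr_gt0.
rewrite (gtr0_norm mi) -[leRHS]mul1r ler_pM2r// ler_norml; apply/andP; split; nra.
Qed.

(** Nested Bernstein polynomials of [phi]. By the mean value theorem their gradients are Bernstein
    means of values of [fx] and [fy], so they obey the bound [M] itself and converge at interior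
    points. Bounded pointwise convergence is all that dominated convergence will need. *)
Lemma C1_approx (phi fx fy : plane R -> R) (c : plane R) (rho M : R) :
  0 < rho ->
  (forall p, `|p - c| <= rho -> has_grad phi p (fx p) (fy p)) ->
  (forall p, `|p - c| <= rho -> [/\ `|phi p| <= M, `|fx p| <= M & `|fy p| <= M]) ->
  (forall p, `|p - c| < rho -> {for p, continuous fx} /\ {for p, continuous fy}) ->
  exists P Px Py : nat -> plane R -> R, [/\ forall n, smooth_expr (P n),
    forall n p, has_grad (P n) p (Px n p) (Py n p),
    forall n p, `|p - c| <= rho ->
      [/\ `|P n p| <= M, `|Px n p| <= M & `|Py n p| <= M] &
    forall p, `|p - c| < rho -> [/\ P ^~ p @ \oo --> phi p,
      Px ^~ p @ \oo --> fx p & Py ^~ p @ \oo --> fy p]].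
Proof.
move=> rho0 hphi bnd cont.
pose k := 2 * rho; have k0 : 0 < k by rewrite mulr_gt0.
pose X s := c.1 - rho + k * s; pose Y t := c.2 - rho + k * t.
pose S (p : plane R) := (p.1 - (c.1 - rho)) / k.
pose T (p : plane R) := (p.2 - (c.2 - rho)) / k.
have XS p : X (S p) = p.1 by rewrite /X /S; field; rewrite gt_eqF.
have YT p : Y (T p) = p.2 by rewrite /Y /T; field; rewrite gt_eqF.
have inS s t : 0 <= s <= 1 -> 0 <= t <= 1 -> `|(X s, Y t) - c| <= rho.
  move=> /andP[s0 s1] /andP[t0 t1]; rewrite plane_normE ge_max /= !ler_norml /X /Y /k.
  by apply/andP; split; apply/andP; split; nra.
have S01 p : `|p - c| <= rho -> 0 <= S p <= 1 /\ 0 <= T p <= 1.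
  rewrite plane_normE ge_max /= !ler_norml => /andP[/andP[? ?] /andP[? ?]].
  by split; rewrite /S /T divr_ge0 ?(ltW k0)//= ?ler_pdivrMr// /k; lra.
(* Degree [n + 2], so that the gradient keeps the degree [n + 1] and its mesh has a nonzero
   denominator. *)
pose N (n : nat) : R := n.+2%:R.
have N0 n : 0 < N n by rewrite /N ltr0n.
pose nd n (i : nat) : R := i%:R / N n.
have nd01 n i : (i <= n.+2)%N -> 0 <= nd n i <= 1.
  by move=> h; rewrite /nd divr_ge0 ?ler0n//= ler_pdivrMr// mul1r ler_nat.
pose F s t := phi (X s, Y t).
pose D1 n i j := N n / k * (F (nd n i.+1) (nd n j) - F (nd n i) (nd n j)).
pose D2 n i j := N n / k * (F (nd n i) (nd n j.+1) - F (nd n i) (nd n j)).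
have between n i s : (i <= n.+1)%N -> nd n i <= s <= nd n i.+1 ->
    0 <= s <= 1 /\ `|s - i%:R / n.+1%:R| <= n.+1%:R^-1.
  move=> hi /andP[h1 h2]; have /andP[a0 _] := nd01 n i (leqW hi).
  have /andP[_ b1] := nd01 n i.+1 hi.
  split; first by apply/andP; split; lra.
  have n10 : 0 < n.+1%:R :> R by rewrite ltr0n.
  have e1 : N n = n.+1%:R + 1 by rewrite natr1.
  move: h1 h2; rewrite /nd ler_pdivrMr// ler_pdivlMr// e1 -[i.+1%:R]natr1.
  by apply: grid_dist; rewrite ?ler0n ?ler_nat.
have mv1 n i j : (i <= n.+1)%N -> (j <= n.+2)%N -> exists th,
    nd n i <= th <= nd n i.+1 /\ D1 n i j = fx (X th, Y (nd n j)).
  move=> hi hj; apply: (@MVT_scaled (fun x => phi (x, Y (nd n j)))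
    (fun x => fx (x, Y (nd n j)))) => // s hs.
  have [s01 _] := between _ _ _ hi hs.
  have := has_grad_curve (is_derive_id (X s) 1) (is_derive_cst (Y (nd n j)) (X s) 1)
    (hphi _ (inS _ _ s01 (nd01 _ _ hj))).
  by move=> h; apply: is_derive_eq h _; rewrite mulr1 mulr0 addr0.
have mv2 n i j : (i <= n.+2)%N -> (j <= n.+1)%N -> exists th,
    nd n j <= th <= nd n j.+1 /\ D2 n i j = fy (X (nd n i), Y th).
  move=> hi hj; apply: (@MVT_scaled (fun y => phi (X (nd n i), y))
    (fun y => fy (X (nd n i), y))) => // s hs.
  have [s01 _] := between _ _ _ hj hs.
  have := has_grad_curve (is_derive_cst (X (nd n i)) (Y s) 1) (is_derive_id (Y s) 1)
    (hphi _ (inS _ _ (nd01 _ _ hi) s01)).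
  by move=> h; apply: is_derive_eq h _; rewrite mulr1 mulr0 add0r.
(* A choice of the mean value points, as functions of the grid indices. *)
pose th1 n i j := get [set th | nd n i <= th <= nd n i.+1 /\
  D1 n i j = fx (X th, Y (nd n j))].
pose th2 n i j := get [set th | nd n j <= th <= nd n j.+1 /\
  D2 n i j = fy (X (nd n i), Y th)].
have th1P n i j : (i <= n.+1)%N -> (j <= n.+2)%N ->
    nd n i <= th1 n i j <= nd n i.+1 /\ D1 n i j = fx (X (th1 n i j), Y (nd n j)).
  by move=> hi hj; exact: (getPex (mv1 n i j hi hj)).
have th2P n i j : (i <= n.+2)%N -> (j <= n.+1)%N ->
    nd n j <= th2 n i j <= nd n j.+1 /\ D2 n i j = fy (X (nd n i), Y (th2 n i j)).
  by move=> hi hj; exact: (getPex (mv2 n i j hi hj)).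
pose P n p := binmean n.+2 (S p) (fun i => binmean n.+2 (T p)
  (fun j => F (nd n i) (nd n j))).
pose Px n p := binmean n.+1 (S p) (fun i => binmean n.+2 (T p) (D1 n i)).
pose Py n p := binmean n.+2 (S p) (fun i => binmean n.+1 (T p) (D2 n i)).
have affine (f : plane R -> R) (a : R) : smooth_expr f ->
    smooth_expr (fun p => (f p - a) / k).
  move=> sf; apply: smooth_mul; last exact: smooth_cst.
  by apply: smooth_add => //; exact: smooth_cst.
have hS p : has_grad S p k^-1 0.
  apply: has_grad_eq (has_gradM (has_gradD (has_grad_fst p)
    (has_grad_cst (- (c.1 - rho)) p)) (has_grad_cst k^-1 p)) _ _; ring.
have hT p : has_grad T p 0 k^-1.
  apply: has_grad_eq (has_gradM (has_gradD (has_grad_snd p)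
    (has_grad_cst (- (c.2 - rho)) p)) (has_grad_cst k^-1 p)) _ _; ring.
exists P, Px, Py; split.
- move=> n; apply: (@smooth_binmean _ S).
    by apply: affine; exact: smooth_fst.
  move=> i; apply: (@smooth_binmean _ T (fun j _ => F (nd n i) (nd n j))) => [|j].
    by apply: affine; exact: smooth_snd.
  exact: smooth_cst.
- move=> n p.
  have hh i := has_grad_binmean n.+2 (hT p)
    (fun j => has_grad_cst (F (nd n i) (nd n j)) p).
  have h := has_grad_binmean n.+2 (hS p) hh.
  apply: has_grad_eq h _ _; rewrite -/(N n) ![_.-1]/=.
  + rewrite [X in _ + X = _](_ : _ = 0); last first.
      rewrite -[RHS](binmean_cst n.+2 (S p)); apply: eq_binmean => i.
      by rewrite mul0r add0r binmean_cst.
    rewrite addr0 mulrA [_ * N n]mulrC /Px.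
    rewrite -[LHS]addr0 -(binmean_cst n.+1 (S p) 0) -binmean_lin.
    apply: eq_binmean => i; rewrite addr0 -binmeanB.
    rewrite -[LHS]addr0 -(binmean_cst n.+2 (T p) 0) -binmean_lin.
    by apply: eq_binmean => j; rewrite addr0.
  + rewrite mul0r add0r /Py; apply: eq_binmean => i.
    rewrite binmean_cst addr0 mulrA [_ * N n]mulrC.
    rewrite -[LHS]addr0 -(binmean_cst n.+1 (T p) 0) -binmean_lin.
    by apply: eq_binmean => j; rewrite addr0.
- move=> n p /S01[sp tp]; split.
  + rewrite -(binmean_cst n.+2 (S p) M); apply: binmean_norm_le => // i hi.
    rewrite -(binmean_cst n.+2 (T p) M); apply: binmean_norm_le => // j hj.
    by have [] := bnd _ (inS _ _ (nd01 _ _ hi) (nd01 _ _ hj)).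
  + rewrite -(binmean_cst n.+1 (S p) M); apply: binmean_norm_le => // i hi.
    rewrite -(binmean_cst n.+2 (T p) M); apply: binmean_norm_le => // j hj.
    have [hb ->] := th1P _ _ _ hi hj; have [t01 _] := between _ _ _ hi hb.
    by have [] := bnd _ (inS _ _ t01 (nd01 _ _ hj)).
  + rewrite -(binmean_cst n.+2 (S p) M); apply: binmean_norm_le => // i hi.
    rewrite -(binmean_cst n.+1 (T p) M); apply: binmean_norm_le => // j hj.
    have [hb ->] := th2P _ _ _ hi hj; have [t01 _] := between _ _ _ hj hb.
    by have [] := bnd _ (inS _ _ (nd01 _ _ hi) t01).
move=> p pc; have [sp tp] := S01 _ (ltW pc).
have [cx cy] := cont _ pc.
have cphi : {for p, continuous phi} := has_grad_continuous (hphi _ (ltW pc)).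
have unif (g : plane R -> R) e : {for p, continuous g} -> 0 < e -> exists2 d, 0 < d &
    forall s t, 0 <= s <= 1 -> 0 <= t <= 1 -> `|s - S p| < d -> `|t - T p| < d ->
      `|g (X s, Y t) - g (X (S p), Y (T p))| <= e.
  move=> cg e0; rewrite XS YT -surjective_pairing.
  have /cvgrPdist_le/(_ _ e0)/nbhs_ballP[d /= d0 hd] := cg.
  exists (d / k); first by rewrite divr_gt0.
  move=> s t _ _ hs ht; rewrite distrC; apply: hd.
  apply/plane_ballP; rewrite plane_normE gt_max /=.
  have -> : X s - p.1 = k * (s - S p) by rewrite -[in LHS](XS p) /X; ring.
  have -> : Y t - p.2 = k * (t - T p) by rewrite -[in LHS](YT p) /Y; ring.
  have nk x : `|k * x| = `|x| * k by rewrite normrM gtr0_norm// mulrC.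
  by rewrite !nk -!ltr_pdivlMr// hs ht.
(* One convergence statement for the three sequences: each is a mean of a continuous function over
   nodes within one mesh of the grid. *)
have fin (g : plane R -> R) (u : nat -> R) (a b : nat -> nat) : {for p, continuous g} ->
    (forall q, `|q - c| <= rho -> `|g q| <= M) ->
    (forall n, (n <= a n)%N) -> (forall n, (n <= b n)%N) ->
    (forall n, exists th et, (forall i j, (i <= (a n).+1)%N -> (j <= (b n).+1)%N ->
     [/\ 0 <= th i j <= 1, 0 <= et i j <= 1,
       `|th i j - i%:R / (a n).+1%:R| <= (a n).+1%:R^-1 &
       `|et i j - j%:R / (b n).+1%:R| <= (b n).+1%:R^-1]) /\
       u n = binmean (a n).+1 (S p) (fun i => binmean (b n).+1 (T p) (fun j =>
         g (X (th i j), Y (et i j))))) ->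
    u @ \oo --> g p.
  move=> cg gM na nb hu; apply: cvg_of_bound => e e0.
  have [d d0 hd] := unif g e cg e0.
  have M0 : 0 <= M by apply: le_trans (gM p (ltW pc)).
  exists (2 * M / d ^+ 2 * 8) => n.
  have [th [et [hn ->]]] := hu n.
  have := @binmean_approx (fun s t => g (X s, Y t)) _ _ M d e (a n) (b n) th et sp tp d0 _ hd hn.
  rewrite XS YT -surjective_pairing => h; apply: le_trans (h _) _.
    by move=> s t s01 t01; apply: gM; exact: inS.
  rewrite lerD2l -!mulrA; apply: ler_wpM2l => //; apply: ler_wpM2l => //.
  apply: ler_wpM2l; first by rewrite invr_ge0 sqr_ge0.
  have inv m : (n <= m)%N -> 4 / m.+1%:R <= 4 / n.+1%:R :> R.
    by move=> nm; rewrite ler_pM2l// lef_pV2 ?posrE ?ltr0n// ler_nat ltnS.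
  apply: le_trans (lerD (inv _ (na n)) (inv _ (nb n))) _.
  by rewrite -mulrDl -natrD.
have ndn m n i : (m = n.+1)%N -> (i <= m.+1)%N ->
    0 <= nd n i <= 1 /\ `|nd n i - i%:R / m.+1%:R| <= m.+1%:R^-1.
  by move=> -> hi; split; [exact: nd01|rewrite /nd /N subrr normr0 invr_ge0].
split.
- apply: (fin phi _ (fun n => n.+1) (fun n => n.+1)) => // [q /bnd[]//|n].
  exists (fun i j => nd n i), (fun i j => nd n j); split=> // i j hi hj.
  by have [? ?] := ndn _ n i erefl hi; have [? ?] := ndn _ n j erefl hj.
- apply: (fin fx _ (fun n => n) (fun n => n.+1)) => // [q /bnd[]//|n].
  exists (th1 n), (fun i j => nd n j); split=> [i j hi hj|].
    have [? ?] := ndn _ n j erefl hj; have [hb _] := th1P _ _ _ hi hj.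
    by have [? ?] := between _ _ _ hi hb.
  rewrite /Px; apply/eqP; rewrite -subr_eq0 -binmeanB -normr_le0.
  rewrite -[leRHS](binmean_cst n.+1 (S p) 0); apply: binmean_norm_le => // i hi.
  rewrite -binmeanB -[leRHS](binmean_cst n.+2 (T p) 0); apply: binmean_norm_le => // j hj.
  by have [_ ->] := th1P _ _ _ hi hj; rewrite subrr normr0.
- apply: (fin fy _ (fun n => n.+1) (fun n => n)) => // [q /bnd[]//|n].
  exists (fun i j => nd n i), (th2 n); split=> [i j hi hj|].
    have [? ?] := ndn _ n i erefl hi; have [hb _] := th2P _ _ _ hi hj.
    by have [? ?] := between _ _ _ hj hb.
  rewrite /Py; apply/eqP; rewrite -subr_eq0 -binmeanB -normr_le0.
  rewrite -[leRHS](binmean_cst n.+2 (S p) 0); apply: binmean_norm_le => // i hi.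
  rewrite -binmeanB -[leRHS](binmean_cst n.+1 (T p) 0); apply: binmean_norm_le => // j hj.
  by have [_ ->] := th2P _ _ _ hi hj; rewrite subrr normr0.
Qed.

End bernstein.

(** * Iterated integrals and Stokes' formula on a square *)

Section plane_integration.
Variable R : realType.

Lemma compact_square (c : plane R) (rho : R) : compact [set p : plane R | `|p - c| <= rho].
Proof.
have -> : [set p : plane R | `|p - c| <= rho] =
    `[c.1 - rho, c.1 + rho]%classic `*` `[c.2 - rho, c.2 + rho]%classic.
  apply/seteqP; split=> -[x y] /=;
    rewrite plane_normE ge_max /= !ler_norml !in_itv/=.
    by move=> /andP[/andP[? ?] /andP[? ?]]; split; apply/andP; split; lra.
  by move=> [/andP[? ?] /andP[? ?]]; apply/andP; split; apply/andP; split; lra.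
by apply: compact_setX; exact: segment_compact.
Qed.

Lemma bounded_on_square (f : plane R -> R) (c : plane R) (rho : R) :
  (forall p, `|p - c| <= rho -> {for p, continuous f}) ->
  exists2 M, 0 < M & forall p, `|p - c| <= rho -> `|f p| <= M.
Proof.
move=> cf; set S := [set p : plane R | `|p - c| <= rho].
have cS : compact (f @` S).
  apply: continuous_compact; last exact: compact_square.
  by apply/subspace_continuousP => p Sp; apply: cvg_within_filter; exact: cf.
have [M [_ hM]] := compact_bounded cS.
exists (`|M| + 1); first by rewrite ltr_wpDl.
move=> p Sp; apply: (hM (`|M| + 1)); last by exists p.
by rewrite ltr_pwDr// ler_norm.
Qed.

Lemma measurable_indicM d (T : measurableType d) (D : set T) (f : T -> R) :
  measurable D -> measurable_fun D f ->
  measurable_fun setT (fun x => \1_D x * f x).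
Proof.
move=> mD mf; have := (measurable_restrictT f mD).1 mf.
congr (measurable_fun _ _); apply/funext => x.
by rewrite /patch indicE; case: ifP => _; rewrite ?mul1r ?mul0r.
Qed.

Lemma integrable_finite_support d (T : measurableType d)
    (mu : {measure set T -> \bar R}) (D : set T) (h : T -> R) (M : R) :
  measurable D -> (mu D < +oo)%E -> measurable_fun setT h ->
  (forall x, `|h x| <= M) -> (forall x, ~ D x -> h x = 0) ->
  mu.-integrable setT (EFin \o h).
Proof.
move=> mD Doo mh hM h0.
have iD : mu.-integrable D (EFin \o h).
  apply: measurable_bounded_integrable => //; first exact: measurable_funS mh.
  exists M; split; first exact: num_real.
  by move=> x Mx y _ /=; rewrite (le_trans (hM y))// ltW.
have := (integrable_mkcond (EFin \o h) mD).1 iD.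
congr (_.-integrable _ _); apply/funext => x; rewrite /patch.
by case: ifPn => //; rewrite notin_setE => /h0 /= ->.
Qed.

Lemma leb2_ball_lty (p : plane R) (r : R) : (leb2 R (ball p r) < +oo)%E.
Proof.
have [r0|r0] := leP 0 r.
  have := leb2_ball p r0; set x := leb2 R _ => ->; exact: ltry.
suff -> : ball p r = set0 by rewrite measure0.
by apply/seteqP; split=> // q /plane_ballP; rewrite ltNge (le_trans (ltW r0)).
Qed.

Lemma integrable_bounded_support (h : plane R -> R) (c : plane R) (rho M : R) :
  measurable_fun setT (h : mplane R -> R) ->
  (forall p, `|h p| <= M) -> (forall p, rho < `|p - c| -> h p = 0) ->
  (leb2 R).-integrable setT (EFin \o h : mplane R -> \bar R).
Proof.
move=> mh hM h0.
have mB : measurable (ball c (rho + 1) : set (mplane R)) := measurable_plane_ball c (rho + 1).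
apply: (integrable_finite_support mB (leb2_ball_lty c (rho + 1)) mh hM) => p.
move=> /plane_ballP pB; apply: h0.
by rewrite (lt_le_trans _ (_ : rho + 1 <= _)) ?ltrDl// leNgt; apply/negP.
Qed.

Lemma integrable_line_support (h : R -> R) (c rho M : R) :
  measurable_fun setT h ->
  (forall x, `|h x| <= M) -> (forall x, rho < `|x - c| -> h x = 0) ->
  (@lebesgue_measure R).-integrable setT (EFin \o h).
Proof.
move=> mh hM h0.
have mB : measurable (`[c - rho, c + rho]%classic : set R) by [].
apply: (@integrable_finite_support _ _ (@lebesgue_measure R) _ _ _ mB _ mh hM).
  have fin : (@lebesgue_measure R `[(c - rho)%R, (c + rho)%R]%classic < +oo)%E.
    by rewrite lebesgue_measure_itv/=; case: ifP => _ //=; rewrite -EFinD ltry.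
  exact: fin.
move=> x /=; rewrite in_itv/= => /negP hx; apply: h0; rewrite ltNge; apply/negP.
rewrite ler_norml => /andP[h1 h2]; move/negP: hx; apply.
by apply/andP; split; lra.
Qed.

Lemma Rintegral_leb2_iter (h : plane R -> R) (c : plane R) (rho M : R) :
  measurable_fun setT (h : mplane R -> R) ->
  (forall p, `|h p| <= M) -> (forall p, rho < `|p - c| -> h p = 0) ->
  (\int[leb2 R]_p h p) = (\int[@lebesgue_measure R]_x (\int[@lebesgue_measure R]_y h (x, y))) /\
  (\int[leb2 R]_p h p) = (\int[@lebesgue_measure R]_y (\int[@lebesgue_measure R]_x h (x, y))).
Proof.
move=> mh hM h0.
have ih := integrable_bounded_support mh hM h0.
have i1 x : (@lebesgue_measure R).-integrable setT (EFin \o (fun y => h (x, y))).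
  apply: (integrable_line_support (c := c.2) (rho := rho) _ (fun y => hM (x, y))).
    exact: (measurableT_comp mh (measurable_pair1 x)).
  by move=> y hy; apply: h0; rewrite plane_normE lt_max hy orbT.
have i2 y : (@lebesgue_measure R).-integrable setT (EFin \o (fun x => h (x, y))).
  apply: (integrable_line_support (c := c.1) (rho := rho) _ (fun x => hM (x, y))).
    exact: (measurableT_comp mh (measurable_pair2 y)).
  by move=> x hx; apply: h0; rewrite plane_normE lt_max hx.
rewrite /Rintegral; split; congr fine.
- rewrite -(integral12_prod_meas1 ih); apply: eq_integral => x _.
  by rewrite /fubini_F /= fineK//; exact: (integrable_fin_num measurableT (i1 x)).
- rewrite -(integral21_prod_meas1 ih); apply: eq_integral => y _.
  by rewrite /fubini_G /= fineK//; exact: (integrable_fin_num measurableT (i2 y)).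
Qed.

Lemma integration_by_parts0 (F G f g : R -> R) (a b : R) : a < b ->
  (forall x, a <= x <= b -> is_derive x 1 F (f x)) ->
  (forall x, a <= x <= b -> is_derive x 1 G (g x)) ->
  (forall x, a <= x <= b -> {for x, continuous f}) ->
  (forall x, a <= x <= b -> {for x, continuous g}) ->
  G a = 0 -> G b = 0 ->
  (\int[@lebesgue_measure R]_(x in `[a, b]) (F x * g x)) =
  - (\int[@lebesgue_measure R]_(x in `[a, b]) (f x * G x)).
Proof.
move=> ab dF dG cf cg Ga Gb.
have within h : (forall x, a <= x <= b -> {for x, continuous h}) ->
    {within `[a, b], continuous (h : R -> R)}.
  move=> ch; apply/subspace_continuousP => x /=; rewrite in_itv/= => xab.
  by apply: cvg_within_filter; exact: ch.
have LR (h dh : R -> R) : (forall x, a <= x <= b -> is_derive x 1 h (dh x)) ->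
    derivable_oo_LRcontinuous h a b /\ {in `]a, b[, derive1 h =1 dh}.
  move=> hh; have ch x : a <= x <= b -> {for x, continuous h}.
    move=> xab; apply: differentiable_continuous; apply/derivable1_diffP.
    by case: (hh _ xab).
  split; [split|].
  - move=> x; rewrite in_itv/= => /andP[h1 h2].
    by have [] := hh x _; rewrite ?(ltW h1) ?(ltW h2).
  - by apply: cvg_within_filter; apply: ch; rewrite lexx ltW.
  - by apply: cvg_within_filter; apply: ch; rewrite lexx ltW.
  move=> x; rewrite in_itv/= => /andP[h1 h2]; rewrite derive1E.
  by have [] := hh x _; rewrite ?(ltW h1) ?(ltW h2).
have [F1 F2] := LR _ _ dF; have [G1 G2] := LR _ _ dG.
have := integration_by_parts ab (within _ cf) F1 F2 (within _ cg) G1 G2.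
rewrite Ga Gb !mulr0 subrr sub0e => e.
by rewrite /Rintegral e fineN.
Qed.

Lemma has_grad_near0 (f : plane R -> R) (p : plane R) (a b : R) :
  (\forall q \near p, f q = 0) -> has_grad f p a b -> a = 0 /\ b = 0.
Proof.
move=> f0 /has_gradE[<- <-].
have [h1 h2] := has_gradE (has_grad_cst 0 p).
split; [rewrite -[RHS]h1|rewrite -[RHS]h2]; apply: near_eq_derive => //.
Qed.

Lemma near_square_gt (p c : plane R) (rho : R) : rho < `|p - c| ->
  \forall q \near p, rho < `|q - c|.
Proof.
move=> h; have d0 : 0 < `|p - c| - rho by rewrite subr_gt0.
apply/nbhs_ballP; exists (`|p - c| - rho) => // q /plane_ballP hq /=.
by have := ler_distD q p c; rewrite (distrC p q); lra.
Qed.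

Lemma smooth_expr_grad_continuous (f fx fy : plane R -> R) : smooth_expr f ->
  (forall p, has_grad f p (fx p) (fy p)) -> continuous fx /\ continuous fy.
Proof.
move=> /smooth_expr_grad[gx [gy [gxx [gxy [gyy [_ _ h h1 h2]]]]]] hf.
have -> : fx = gx.
  by apply/funext => p; have [<- _] := has_gradE (hf p); case: (has_gradE (h p)).
have -> : fy = gy.
  by apply/funext => p; have [_ <-] := has_gradE (hf p); case: (has_gradE (h p)).
by split=> p; [exact: has_grad_continuous (h1 p)|exact: has_grad_continuous (h2 p)].
Qed.

Lemma measurable_ballM (a : plane R -> R) (c : plane R) (r : R) :
  (forall p, `|p - c| < r -> {for p, continuous a}) ->
  measurable_fun setT (fun p : mplane R => \1_(ball c r) p * a p).
Proof.
move=> ca; apply: measurable_indicM; first exact: measurable_plane_ball.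
apply: continuous_measurable_plane; first exact: ball_open.
by move=> p /plane_ballP; exact: ca.
Qed.

Lemma continuous_pairl (x y : R) :
  {for x, continuous (fun x => (x, y) : plane R)}.
Proof.
move=> A /nbhs_ballP[e /= e0 eA]; apply/nbhs_ballP; exists e => // z hz.
by apply: eA; split=> //=; exact: ballxx.
Qed.

Lemma continuous_pairr (x y : R) :
  {for y, continuous (fun y => (x, y) : plane R)}.
Proof.
move=> A /nbhs_ballP[e /= e0 eA]; apply/nbhs_ballP; exists e => // z hz.
by apply: eA; split=> //=; exact: ballxx.
Qed.

(** The integral of [dX dphi] vanishes. As [X] is only C^1, each of the two terms is integrated by
    parts on lines, moving the derivative from [X] to [phi]; by the symmetry of second derivatives
    both become the integral of [- X * fxy]. *)
Lemma stokes_square (X a b phi phix phiy : plane R -> R)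
    (c : plane R) (r rho : R) : 0 < rho -> rho < r ->
  (forall p, `|p - c| < r -> has_grad X p (a p) (b p)) ->
  (forall p, `|p - c| < r -> {for p, continuous a}) ->
  (forall p, `|p - c| < r -> {for p, continuous b}) ->
  smooth_expr phi -> (forall p, has_grad phi p (phix p) (phiy p)) ->
  (forall p, rho <= `|p - c| -> phi p = 0) ->
  (\int[leb2 R]_p (\1_(ball c r) p * (a p * phiy p - b p * phix p))) = 0.
Proof.
move=> rho0 rhor hX ca cb sphi hphi phi0.
(* On the square of radius [r1] all functions are continuous up to the sides, and the derivatives of
   [phi] vanish on the sides: there are no boundary terms. *)
pose r1 := (rho + r) / 2.
have rr1 : rho < r1 by rewrite /r1; lra.
have r1r : r1 < r by rewrite /r1; lra.
have [fx [fy [fxx [fxy [fyy [sfx sfy hf hfx hfy]]]]]] := smooth_expr_grad sphi.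
have ex p : phix p = fx p by have [<- _] := has_gradE (hphi p); case: (has_gradE (hf p)).
have ey p : phiy p = fy p by have [_ <-] := has_gradE (hphi p); case: (has_gradE (hf p)).
have near0 p : rho < `|p - c| -> \forall q \near p, phi q = 0.
  move=> /near_square_gt; apply: filterS => q hq; apply: phi0; exact: ltW.
have fx0 p : rho < `|p - c| -> fx p = 0 /\ fy p = 0.
  by move=> hp; exact: (has_grad_near0 (near0 _ hp) (hf p)).
have fxy0 p : rho < `|p - c| -> fxy p = 0.
  move=> hp; have h : \forall q \near p, fx q = 0.
    by apply: filterS (near_square_gt hp) => q /fx0[].
  by have [] := has_grad_near0 h (hfx p).
have cfx : continuous fx by move=> p; exact: has_grad_continuous (hfx p).
have cfy : continuous fy by move=> p; exact: has_grad_continuous (hfy p).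
have cfxy : continuous fxy by case: (smooth_expr_grad_continuous sfx hfx).
have cX p : `|p - c| < r -> {for p, continuous X} by move=> /hX/has_grad_continuous.
have bnd (u v : plane R -> R) : (forall p, `|p - c| < r -> {for p, continuous u}) ->
    continuous v -> (forall p, rho < `|p - c| -> v p = 0) ->
    measurable_fun setT (fun p : mplane R => \1_(ball c r) p * (u p * v p)) /\
    exists M, forall p, `|\1_(ball c r) p * (u p * v p)| <= M.
  move=> cu cv v0.
  have cuv p : `|p - c| < r -> {for p, continuous (fun p => u p * v p)}.
    by move=> hp; apply: continuousM; [exact: cu|exact: cv].
  split; first exact: measurable_ballM.
  have [p hp|M M0 hM] := @bounded_on_square (fun p => u p * v p) c r1.
    by apply: cuv; exact: le_lt_trans r1r.
  exists M => p; have [hp|hp] := leP `|p - c| r1.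
    rewrite normrM -[leRHS]mul1r; apply: ler_pM => //; last exact: hM.
    by rewrite indicE; case: (_ \in _); rewrite ?normr1 ?normr0.
  by rewrite v0 ?(lt_trans rr1)// !mulr0 normr0 ltW.
have ind p : `|p - c| <= r1 -> \1_(ball c r) p = 1 :> R.
  move=> hp; rewrite indicE mem_set//; apply/plane_ballP; exact: le_lt_trans r1r.
have cC (u : plane R -> R) y : (forall p, `|p - c| < r -> {for p, continuous u}) ->
    `|y - c.2| <= r1 -> forall x, c.1 - r1 <= x <= c.1 + r1 ->
    {for x, continuous (fun x => u (x, y))}.
  move=> cu hy x hx; apply: (@continuous_comp _ _ _ (fun x => (x, y)) u).
    exact: continuous_pairl.
  apply: cu; apply: le_lt_trans r1r; rewrite plane_normE ge_max /= hy andbT ler_distl; exact: hx.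
have cR (u : plane R -> R) x : (forall p, `|p - c| < r -> {for p, continuous u}) ->
    `|x - c.1| <= r1 -> forall y, c.2 - r1 <= y <= c.2 + r1 ->
    {for y, continuous (fun y => u (x, y))}.
  move=> cu hy y hx; apply: (@continuous_comp _ _ _ (fun y => (x, y)) u).
    exact: continuous_pairr.
  apply: cu; apply: le_lt_trans r1r; rewrite plane_normE ge_max /= hy /= ler_distl; exact: hx.
have line (s s' t t' : R -> R) (z : R) : 
    (forall x, z - r1 <= x <= z + r1 -> is_derive x 1 s (s' x)) ->
    (forall x, z - r1 <= x <= z + r1 -> is_derive x 1 t (t' x)) ->
    (forall x, z - r1 <= x <= z + r1 -> {for x, continuous s'}) ->
    (forall x, z - r1 <= x <= z + r1 -> {for x, continuous t'}) ->
    (forall x, z - r1 <= x <= z + r1 -> {for x, continuous s}) ->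
    t (z - r1) = 0 -> t (z + r1) = 0 ->
    (\int[@lebesgue_measure R]_x ((fun x => s' x * t x) \_ `[(z - r1)%R, (z + r1)%R]) x) =
    (\int[@lebesgue_measure R]_x ((fun x => - (s x * t' x)) \_ `[(z - r1)%R, (z + r1)%R]) x).
  move=> hs ht cs' ct' cs t0 t1; rewrite -!Rintegral_mkcond.
  have zz : z - r1 < z + r1 by lra.
  have := integration_by_parts0 zz hs ht cs' ct' t0 t1.
  move=> /(congr1 (fun x => - x)); rewrite opprK => <-.
  rewrite -mulN1r -RintegralZl//.
    by apply: eq_Rintegral => x _; rewrite mulN1r.
  apply: continuous_compact_integrable; first exact: segment_compact.
  apply/subspace_continuousP => x /=; rewrite in_itv/= => hx.
  by apply: cvg_within_filter; apply: continuousM; [exact: cs|exact: ct'].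
have [m1 [M1 b1]] := bnd a fy ca cfy (fun p h => (fx0 p h).2).
have [m2 [M2 b2]] := bnd b fx cb cfx (fun p h => (fx0 p h).1).
have [m3 [M3 b3]] := bnd (fun p => - X p) fxy
   (fun p h => continuousN (cX p h)) cfxy fxy0.
have z1 p : rho < `|p - c| -> \1_(ball c r) p * (a p * fy p) = 0.
  by move=> /fx0[_ ->]; rewrite !mulr0.
have z2 p : rho < `|p - c| -> \1_(ball c r) p * (b p * fx p) = 0.
  by move=> /fx0[-> _]; rewrite !mulr0.
have z3 p : rho < `|p - c| -> \1_(ball c r) p * (- X p * fxy p) = 0.
  by move=> /fxy0->; rewrite !mulr0.
transitivity (\int[leb2 R]_p (\1_(ball c r) p * (a p * fy p)) -
              \int[leb2 R]_p (\1_(ball c r) p * (b p * fx p))).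
  rewrite -RintegralB//; last 2 first.
  - exact: integrable_bounded_support m1 b1 z1.
  - exact: integrable_bounded_support m2 b2 z2.
  by apply: eq_Rintegral => p _; rewrite ex ey mulrBr.
have [_ ->] := Rintegral_leb2_iter m1 b1 z1.
have [-> _] := Rintegral_leb2_iter m2 b2 z2.
have [I1 I2] := Rintegral_leb2_iter m3 b3 z3.
rewrite (_ : (\int[_]_y _) = \int[leb2 R]_p (\1_(ball c r) p * (- X p * fxy p))); last first.
  rewrite I2; apply: eq_Rintegral => y _.
  have [hy|hy] := leP `|y - c.2| r1; last first.
    apply: eq_Rintegral => x _.
    by rewrite z1 ?z3// plane_normE lt_max (lt_trans rr1 hy) orbT.
  transitivity (\int[@lebesgue_measure R]_x
     ((fun x => a (x, y) * fy (x, y)) \_ `[(c.1 - r1)%R, (c.1 + r1)%R]) x).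
    apply: eq_Rintegral => x _; rewrite /patch.
    case: ifPn => [|]; rewrite ?inE ?notin_setE /= in_itv/=.
      move=> hx; rewrite ind ?mul1r// plane_normE ge_max /= hy andbT ler_distl; exact: hx.
    move=> hx; rewrite z1// plane_normE lt_max /=; apply/orP; left.
    by rewrite ltNge; apply/negP => h; apply: hx; rewrite -ler_distl (le_trans h)// ltW.
  transitivity (\int[@lebesgue_measure R]_x
     ((fun x => - (X (x, y) * fxy (x, y))) \_ `[(c.1 - r1)%R, (c.1 + r1)%R]) x); last first.
    apply: eq_Rintegral => x _; rewrite /patch.
    case: ifPn => [|]; rewrite ?inE ?notin_setE /= in_itv/=.
      move=> hx; rewrite ind ?mul1r ?mulNr// plane_normE ge_max /= hy andbT ler_distl; exact: hx.
    move=> hx; rewrite z3// plane_normE lt_max /=; apply/orP; left.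
    by rewrite ltNge; apply/negP => h; apply: hx; rewrite -ler_distl (le_trans h)// ltW.
  have inr x : c.1 - r1 <= x <= c.1 + r1 -> `|(x, y) - c| < r.
    by move=> h; apply: le_lt_trans r1r; rewrite plane_normE ge_max /= hy andbT ler_distl.
  apply: line.
  + move=> x hx; have := has_grad_curve (is_derive_id x 1) (is_derive_cst y x 1) (hX _ (inr _ hx)).
    by move=> h; apply: is_derive_eq h _; rewrite mulr1 mulr0 addr0.
  + move=> x hx; have := has_grad_curve (is_derive_id x 1) (is_derive_cst y x 1) (hfy (x, y)).
    by move=> h; apply: is_derive_eq h _; rewrite mulr1 mulr0 addr0.
  + exact: cC.
  + exact: (cC fxy y (fun p _ => cfxy p)).
  + exact: cC.
  + apply: (fx0 _ _).2; rewrite plane_normE lt_max /=; apply/orP; left.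
    by rewrite ltr_normr; apply/orP; right; lra.
  + apply: (fx0 _ _).2; rewrite plane_normE lt_max /=; apply/orP; left.
    by rewrite ltr_normr; apply/orP; left; lra.
rewrite I1; apply/eqP; rewrite subr_eq0; apply/eqP/esym; apply: eq_Rintegral => x _.
have [hy|hy] := leP `|x - c.1| r1; last first.
  apply: eq_Rintegral => y _.
  by rewrite z2 ?z3// plane_normE lt_max (lt_trans rr1 hy).
transitivity (\int[@lebesgue_measure R]_y
   ((fun y => b (x, y) * fx (x, y)) \_ `[(c.2 - r1)%R, (c.2 + r1)%R]) y).
  apply: eq_Rintegral => y _; rewrite /patch.
  case: ifPn => [|]; rewrite ?inE ?notin_setE /= in_itv/=.
    move=> hx; rewrite ind ?mul1r// plane_normE ge_max /= hy /= ler_distl; exact: hx.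
  move=> hx; rewrite z2// plane_normE lt_max /=; apply/orP; right.
    by rewrite ltNge; apply/negP => h; apply: hx; rewrite -ler_distl (le_trans h)// ltW.
transitivity (\int[@lebesgue_measure R]_y
   ((fun y => - (X (x, y) * fxy (x, y))) \_ `[(c.2 - r1)%R, (c.2 + r1)%R]) y); last first.
  apply: eq_Rintegral => y _; rewrite /patch.
  case: ifPn => [|]; rewrite ?inE ?notin_setE /= in_itv/=.
    move=> hx; rewrite ind ?mul1r ?mulNr// plane_normE ge_max /= hy /= ler_distl; exact: hx.
  move=> hx; rewrite z3// plane_normE lt_max /=; apply/orP; right.
    by rewrite ltNge; apply/negP => h; apply: hx; rewrite -ler_distl (le_trans h)// ltW.
have inr y : c.2 - r1 <= y <= c.2 + r1 -> `|(x, y) - c| < r.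
  by move=> h; apply: le_lt_trans r1r; rewrite plane_normE ge_max /= hy /= ler_distl.
apply: line.
+ move=> y hx; have := has_grad_curve (is_derive_cst x y 1) (is_derive_id y 1) (hX _ (inr _ hx)).
  by move=> h; apply: is_derive_eq h _; rewrite mulr1 mulr0 add0r.
+ move=> y hx; have := has_grad_curve (is_derive_cst x y 1) (is_derive_id y 1) (hfx (x, y)).
  by move=> h; apply: is_derive_eq h _; rewrite mulr1 mulr0 add0r.
+ exact: cR.
+ exact: (cR fxy x (fun p _ => cfxy p)).
+ exact: cR.
+ apply: (fx0 _ _).1; rewrite plane_normE lt_max /=; apply/orP; right.
  by rewrite ltr_normr; apply/orP; right; lra.
+ apply: (fx0 _ _).1; rewrite plane_normE lt_max /=; apply/orP; right.
  by rewrite ltr_normr; apply/orP; left; lra.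
Qed.

End plane_integration.

(** * The weak equation with C^1 test functions *)

Section weak_equation.
Variable R : realType.
Local Notation C := R[i].

(** The Jacobian determinant of [Z] as a map between planes. *)
Definition jac (Zx Zy : plane R -> C) (p : plane R) : R :=
  complex.Re (Zx p) * complex.Im (Zy p) - complex.Re (Zy p) * complex.Im (Zx p).

(** [L] applied to a function whose partial derivatives are [a] and [b]. *)
Definition Lgrad (Zx Zy : plane R -> C) (a b : plane R -> C) (p : plane R) : C :=
  Zx p * b p - Zy p * a p.

(* [Z] is a first integral on the square of radius [r] about [c], with partial
   derivatives [Zx] and [Zy]; outside the square the three functions are only
   required to be measurable, and bounded for [Zx] and [Zy]. *)
Definition local_integral (c : plane R) (r M : R) (Z Zx Zy : plane R -> C) :=
  [/\ 0 < r, [/\ cmeasurable setT Z, cmeasurable setT Zx & cmeasurable setT Zy],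
    forall p, modc (Zx p) <= M /\ modc (Zy p) <= M,
    forall p, `|p - c| < r ->
      has_grad (Rec Z) p (complex.Re (Zx p)) (complex.Re (Zy p)) /\
      has_grad (Imc Z) p (complex.Im (Zx p)) (complex.Im (Zy p)) &
    forall p, `|p - c| < r ->
      [/\ {for p, continuous (Rec Zx)}, {for p, continuous (Imc Zx)},
        {for p, continuous (Rec Zy)} & {for p, continuous (Imc Zy)}]].

Definition cutoff (c : plane R) (r rho : R) (chi chix chiy : plane R -> R) :=
  [/\ 0 < rho, rho < r, smooth_expr chi,
    forall p, has_grad chi p (chix p) (chiy p) &
    forall p, rho <= `|p - c| -> chi p = 0].

(** Only real smooth cutoffs are tested; complex and less regular test functions follow by
    approximation and linearity. *)
Definition weak_on (c : plane R) (r : R) (Zx Zy w f : plane R -> C) :=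
  forall rho phi phix phiy, cutoff c r rho phi phix phiy ->
  - cintegral setT (fun p => w p *
      Lgrad Zx Zy (fun p => (phix p)%:C%C) (fun p => (phiy p)%:C%C) p) =
  cintegral setT (fun p => f p * (phi p)%:C%C).

Lemma cutoff_bound c r rho chi chix chiy : cutoff c r rho chi chix chiy ->
  exists2 K, 0 < K &
    forall p, [/\ `|chi p| <= K, `|chix p| <= K & `|chiy p| <= K].
Proof.
move=> [rho0 rhor schi hchi chi0].
have [cx cy] := smooth_expr_grad_continuous schi hchi.
have [|M1 M10 h1] := @bounded_on_square R chi c rho.
  by move=> p _; exact: has_grad_continuous (hchi p).
have [|M2 M20 h2] := @bounded_on_square R chix c rho; first by move=> p _; exact: cx.
have [|M3 M30 h3] := @bounded_on_square R chiy c rho; first by move=> p _; exact: cy.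
exists (M1 + M2 + M3); first by rewrite !addr_gt0.
move=> p; have [hp|hp] := leP `|p - c| rho.
  have := h1 p hp; have := h2 p hp; have := h3 p hp => a3 a2 a1.
  by split; lra.
have : \forall q \near p, chi q = 0.
  by apply: filterS (near_square_gt hp) => q hq; apply: chi0; exact: ltW.
move=> /has_grad_near0/(_ (hchi p))[-> ->]; rewrite (chi0 _ (ltW hp)) normr0.
by split; rewrite !addr_ge0// ltW.
Qed.

Lemma cutoff_grad0 c r rho chi chix chiy p : cutoff c r rho chi chix chiy ->
  rho < `|p - c| -> [/\ chi p = 0, chix p = 0 & chiy p = 0].
Proof.
move=> [rho0 rhor schi hchi chi0] hp.
have : \forall q \near p, chi q = 0.
  by apply: filterS (near_square_gt hp) => q hq; apply: chi0; exact: ltW.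
by move=> /has_grad_near0/(_ (hchi p))[-> ->]; rewrite chi0 ?ltW.
Qed.

Lemma continuous_measurable_fun_plane (f : plane R -> R) : continuous f ->
  measurable_fun setT (f : mplane R -> R).
Proof.
move=> cf; apply: (@continuous_measurable_plane R setT f); first exact: openT.
by move=> p _; exact: cf.
Qed.

Lemma smooth_expr_measurable (f : plane R -> R) : smooth_expr f ->
  measurable_fun setT (f : mplane R -> R).
Proof.
move=> /smooth_expr_grad[fx [fy [? [? [? [_ _ h _ _]]]]]].
by apply: continuous_measurable_fun_plane => p; exact: has_grad_continuous (h p).
Qed.

Lemma measurable_ball_support (f : plane R -> R) c r :
  (forall p, `|p - c| < r -> {for p, continuous f}) ->
  (forall p, r <= `|p - c| -> f p = 0) ->
  measurable_fun setT (f : mplane R -> R).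
Proof.
move=> cf f0; have := measurable_ballM cf; congr measurable_fun.
apply/funext => p; rewrite indicE; case: (boolP (p \in _)) => [_|].
  by rewrite mul1r.
rewrite notin_setE => /plane_ballP hp.
by rewrite mul0r f0// leNgt; apply/negP.
Qed.

Lemma ccvg_real (u : nat -> R) (l : R) : u @ \oo --> l ->
  ccvg (fun n => (u n)%:C%C) l%:C%C.
Proof. by move=> h; apply/ccvgP; split=> //=; exact: cvg_cst. Qed.

Lemma ae_all (P : mplane R -> Prop) : (forall x, P x) ->
  {ae leb2 R, forall x, P x}.
Proof. exact: aeW. Qed.

Section extension.
Variables (c : plane R) (r M rho : R) (Z Zx Zy w f : plane R -> C)
  (chi chix chiy : plane R -> R).
Hypotheses (hZ : local_integral c r M Z Zx Zy)
  (hchi : cutoff c r rho chi chix chiy)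
  (iw : cintegrable w) (if_ : cintegrable f)
  (wf : weak_on c r Zx Zy w f).

(** The kernel to be tested is a function of [Z], hence only C^1. With [P n] the Bernstein
    approximations of [psi], each [chi * P n] is an admissible cutoff, and dominated convergence
    passes to [chi * psi]. *)
Lemma weak_on_C1 (psi psix psiy : plane R -> R) :
  (forall p, `|p - c| < r -> has_grad psi p (psix p) (psiy p)) ->
  (forall p, `|p - c| < r -> {for p, continuous psix} /\ {for p, continuous psiy}) ->
  let I := fun p => w p * Lgrad Zx Zy
      (fun p => (chi p * psix p + chix p * psi p)%:C%C)
      (fun p => (chi p * psiy p + chiy p * psi p)%:C%C) p in
  [/\ cintegrable I, cintegrable (fun p => f p * (chi p * psi p)%:C%C) &
   - cintegral setT I = cintegral setT (fun p => f p * (chi p * psi p)%:C%C)].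
Proof.
move=> hpsi cpsi I.
have [r0 [mZ mZx mZy] bZ _ _] := hZ.
have [rho0 rhor schi gchi chi0] := hchi.
have [K K0 hK] := cutoff_bound hchi.
(* The approximants converge only inside their square, which is therefore taken larger than the
   support of [chi] and inside the domain of [psi]. *)
pose r1 := (rho + r) / 2.
have rr1 : rho < r1 by rewrite /r1; lra.
have r1r : r1 < r by rewrite /r1; lra.
have r10 : 0 < r1 by exact: lt_trans rr1.
have inr p : `|p - c| <= r1 -> `|p - c| < r by move=> h; exact: le_lt_trans r1r.
have [|M1 M10 h1] := @bounded_on_square R psi c r1.
  by move=> p /inr/hpsi/has_grad_continuous.
have [|M2 M20 h2] := @bounded_on_square R psix c r1; first by move=> p /inr/cpsi[].
have [|M3 M30 h3] := @bounded_on_square R psiy c r1; first by move=> p /inr/cpsi[].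
pose M' := M1 + M2 + M3.
have [|||P [Px [Py [sP gP bP cP]]]] := @C1_approx R psi psix psiy c r1 M' r10.
- by move=> p /inr; exact: hpsi.
- move=> p hp; have := h1 p hp; have := h2 p hp; have := h3 p hp => a3 a2 a1.
  by rewrite /M'; split; lra.
- by move=> p /ltW/inr; exact: cpsi.
have M'0 : 0 <= M' by rewrite /M' !addr_ge0// ltW.
have mchi := smooth_expr_measurable schi.
have [cchix cchiy] := smooth_expr_grad_continuous schi gchi.
have far p : r1 <= `|p - c| -> [/\ chi p = 0, chix p = 0 & chiy p = 0].
  by move=> h; apply: (cutoff_grad0 hchi); exact: lt_le_trans h.
have M0 : 0 <= M by apply: le_trans (bZ c).1; exact: modc_ge0.
pose In n p := w p * Lgrad Zx Zy
      (fun p => (chi p * Px n p + chix p * P n p)%:C%C)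
      (fun p => (chi p * Py n p + chiy p * P n p)%:C%C) p.
pose Jn n p := f p * (chi p * P n p)%:C%C.
have mL a b : measurable_fun setT (a : mplane R -> R) ->
    measurable_fun setT (b : mplane R -> R) ->
    cmeasurable setT (fun p => w p * Lgrad Zx Zy (fun p => (a p)%:C%C) (fun p => (b p)%:C%C) p).
  move=> ma mb; apply: cmeasurableM; first exact: cintegrable_measurable.
  apply: cmeasurableD; first by apply: cmeasurableM => //; exact: cmeasurable_real.
  by apply: cmeasurableN; apply: cmeasurableM => //; exact: cmeasurable_real.
have mR (u : plane R -> R) : (forall p, `|p - c| < r1 -> {for p, continuous u}) ->
    (forall p, r1 <= `|p - c| -> u p = 0) -> measurable_fun setT (u : mplane R -> R).
  exact: measurable_ball_support.
have inr' p : `|p - c| < r1 -> `|p - c| < r by move=> /ltW; exact: inr.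
have cchi : continuous chi by move=> p; exact: has_grad_continuous (gchi p).
have cpsi0 p : `|p - c| < r -> {for p, continuous psi}.
  by move=> /hpsi/has_grad_continuous.
have bL a b p : `|a| <= 2 * (K * M') -> `|b| <= 2 * (K * M') ->
    modc (w p * Lgrad Zx Zy (fun=> a%:C%C) (fun=> b%:C%C) p) <=
    (4 * M * K * M') * modc (w p).
  move=> ha hb; rewrite modcM mulrC ler_wpM2r ?modc_ge0// (le_trans (modcB _ _))//.
  rewrite !modcM !modcR.
  have [hx hy] := bZ p; have h4 : 0 <= 2 * (K * M') by exact: le_trans ha.
  have e1 := ler_pM (modc_ge0 _) (normr_ge0 b) hx hb.
  have e2 := ler_pM (modc_ge0 _) (normr_ge0 a) hy ha.
  by apply: le_trans (lerD e1 e2) _; rewrite le_eqVlt; apply/orP; left; apply/eqP; ring.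
have bterm (x y u v : R) : `|x| <= K -> `|y| <= M' -> `|u| <= K -> `|v| <= M' ->
    `|x * y + u * v| <= 2 * (K * M').
  move=> hx hy hu hv; rewrite (le_trans (ler_normD _ _))// !normrM.
  have := ler_pM (normr_ge0 x) (normr_ge0 y) hx hy.
  by have := ler_pM (normr_ge0 u) (normr_ge0 v) hu hv; lra.
have [iI cI] : cintegrable I /\ ccvg (fun n => cintegral setT (In n)) (cintegral setT I).
  apply: (@cintegral_dominated R In I (fun p => (4 * M * K * M') * modc (w p))).
  - move=> n; apply: mL.
      apply: measurable_funD; apply: measurable_funM => //.
      + by apply: continuous_measurable_fun_plane; case: (smooth_expr_grad_continuous (sP n) (gP n)).
      + exact: continuous_measurable_fun_plane.
      + exact: smooth_expr_measurable.
    apply: measurable_funD; apply: measurable_funM => //.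
    + by apply: continuous_measurable_fun_plane; case: (smooth_expr_grad_continuous (sP n) (gP n)).
    + exact: continuous_measurable_fun_plane.
    + exact: smooth_expr_measurable.
  - apply: mL; apply: mR.
    + move=> p hp; apply: continuousD; apply: continuousM.
      * exact: cchi.
      * by case: (cpsi p (inr' _ hp)).
      * exact: cchix.
      * exact: cpsi0 (inr' _ hp).
    + by move=> p /far[-> -> _]; rewrite !mul0r addr0.
    + move=> p hp; apply: continuousD; apply: continuousM.
      * exact: cchi.
      * by case: (cpsi p (inr' _ hp)).
      * exact: cchiy.
      * exact: cpsi0 (inr' _ hp).
    + by move=> p /far[-> _ ->]; rewrite !mul0r addr0.
  - exact: (integrableZl measurableT _ (integrable_modc iw)).
  - move=> n p; have [hp|hp] := leP `|p - c| r1.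
      have [k1 k2 k3] := hK p; have [b1 b2 b3] := bP n p hp.
      by apply: bL; apply: bterm.
    rewrite /In; have [e1 e2 e3] := far p (ltW hp).
    rewrite /Lgrad e1 e2 e3 !mul0r !addr0 !mulr0 subrr mulr0 modc0.
    by rewrite !mulr_ge0// ?modc_ge0// ltW.
  - apply: ae_all => p; have [hp|hp] := ltP `|p - c| r1; last first.
      have [e1 e2 e3] := far p hp.
      apply: (@ccvg_ext _ (fun=> I p)); last exact: ccvg_cst.
      by move=> n; rewrite /I /In /Lgrad e1 e2 e3 !mul0r.
    have [c1 c2 c3] := cP p hp.
    apply: ccvgM; first exact: ccvg_cst.
    apply: ccvgB; apply: ccvgM; try exact: ccvg_cst.
      by apply: ccvg_real; apply: cvgD; apply: cvgM => //; exact: cvg_cst.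
    by apply: ccvg_real; apply: cvgD; apply: cvgM => //; exact: cvg_cst.
have [iJ cJ] : cintegrable (fun p => f p * (chi p * psi p)%:C%C) /\
   ccvg (fun n => cintegral setT (Jn n)) (cintegral setT (fun p => f p * (chi p * psi p)%:C%C)).
  apply: (@cintegral_dominated R Jn _ (fun p => (K * M') * modc (f p))).
  - move=> n; apply: cmeasurableM; first exact: cintegrable_measurable.
    apply: cmeasurable_real; apply: measurable_funM => //.
    exact: smooth_expr_measurable.
  - apply: cmeasurableM; first exact: cintegrable_measurable.
    apply: cmeasurable_real; apply: mR.
      by move=> p hp; apply: continuousM; [exact: cchi|exact: cpsi0 (inr' _ hp)].
    by move=> p /far[-> _ _]; rewrite mul0r.
  - exact: (integrableZl measurableT _ (integrable_modc if_)).
  - move=> n p; rewrite /Jn modcM mulrC ler_wpM2r ?modc_ge0// modcR.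
    have [hp|hp] := leP `|p - c| r1.
      have [k1 k2 k3] := hK p; have [b1 b2 b3] := bP n p hp.
      by rewrite normrM ler_pM.
    by have [-> _ _] := far p (ltW hp); rewrite mul0r normr0 mulr_ge0// ltW.
  - apply: ae_all => p; have [hp|hp] := ltP `|p - c| r1; last first.
      have [e1 e2 e3] := far p hp.
      apply: (@ccvg_ext _ (fun=> f p * (chi p * psi p)%:C%C)); last exact: ccvg_cst.
      by move=> n; rewrite /Jn e1 !mul0r.
    have [c1 c2 c3] := cP p hp.
    apply: ccvgM; first exact: ccvg_cst.
    by apply: ccvg_real; apply: cvgM => //; exact: cvg_cst.
split=> //; apply: (ccvg_unique _ cJ).
have e n : cintegral setT (Jn n) = - 1 * cintegral setT (In n).
  rewrite mulN1r; symmetry; apply: (wf (rho := rho)); split=> //.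
  - exact: smooth_mul.
  - by move=> p; exact: has_gradM.
  - by move=> p /chi0 ->; rewrite mul0r.
rewrite -mulN1r; apply: (ccvg_ext (fun n => esym (e n))).
by apply: ccvgM => //; exact: ccvg_cst.
Qed.

Lemma weak_on_C1_complex (u v ux uy vx vy : plane R -> R) :
  (forall p, `|p - c| < r -> has_grad u p (ux p) (uy p)) ->
  (forall p, `|p - c| < r -> has_grad v p (vx p) (vy p)) ->
  (forall p, `|p - c| < r -> {for p, continuous ux} /\ {for p, continuous uy}) ->
  (forall p, `|p - c| < r -> {for p, continuous vx} /\ {for p, continuous vy}) ->
  let psi := fun p => Complex (u p) (v p) in
  let psix := fun p => Complex (ux p) (vx p) in
  let psiy := fun p => Complex (uy p) (vy p) in
  let I := fun p => w p * Lgrad Zx Zy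
      (fun p => (chi p)%:C%C * psix p + (chix p)%:C%C * psi p)
      (fun p => (chi p)%:C%C * psiy p + (chiy p)%:C%C * psi p) p in
  [/\ cintegrable I, cintegrable (fun p => f p * ((chi p)%:C%C * psi p)) &
   - cintegral setT I = cintegral setT (fun p => f p * ((chi p)%:C%C * psi p))].
Proof.
move=> hu hv cu cv psi psix psiy I.
have [i1 j1 e1] := weak_on_C1 hu cu; have [i2 j2 e2] := weak_on_C1 hv cv.
set I1 := (fun p => _) in i1 e1; set I2 := (fun p => _) in i2 e2.
have eps p : psi p = (u p)%:C%C + 'i%C * (v p)%:C%C by exact: complexE.
have epx p : psix p = (ux p)%:C%C + 'i%C * (vx p)%:C%C by exact: complexE.
have epy p : psiy p = (uy p)%:C%C + 'i%C * (vy p)%:C%C by exact: complexE.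
have EI : I = (fun p => I1 p + 'i%C * I2 p).
  apply/funext => p; rewrite /I /I1 /I2 /Lgrad eps epx epy.
  by rewrite !rmorphD !rmorphM /=; move: 'i%C => ii; ring.
have EJ : (fun p => f p * ((chi p)%:C%C * psi p)) =
    (fun p => f p * (chi p * u p)%:C%C + 'i%C * (f p * (chi p * v p)%:C%C)).
  by apply/funext => p; rewrite eps !rmorphM /=; move: 'i%C => ii; ring.
rewrite EI EJ; split.
- by apply: cintegrableD => //; exact: cintegrableZ.
- by apply: cintegrableD => //; exact: cintegrableZ.
rewrite !cintegralD// ?cintegralZ//; try exact: cintegrableZ.
by rewrite -e1 -e2; ring.
Qed.

End extension.
End weak_equation.

(** * The regularised Cauchy kernel as a test function *)

Section kernel_identity.
Variable R : realType.
Local Notation C := R[i].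

Lemma cintegral0 : cintegral setT (fun=> 0 : C) = 0.
Proof. by apply: complex_ext; rewrite /= Rintegral_cst// mul0r. Qed.

(** [L] is divergence free, so that it annihilates the constant 1 in the weak sense. As [Z] is only
    C^1, this is Stokes' formula for its real and imaginary parts. The function H arises from this
    solution. *)
Lemma weak_on_one (c : plane R) (r M : R) (Z Zx Zy : plane R -> C) :
  local_integral c r M Z Zx Zy ->
  weak_on c r Zx Zy (fun p => (\1_(ball c r) p)%:C%C) (fun=> 0).
Proof.
move=> [r0 mZ bZ gZ cZ] rho phi phix phiy [rho0 rhor sphi gphi phi0].
rewrite (_ : cintegral _ (fun p => 0 * _) = 0); last first.
  rewrite (_ : (fun p => _) = fun=> 0); last by apply/funext => p; rewrite mul0r.
  exact: cintegral0.
apply/eqP; rewrite oppr_eq0; apply/eqP; apply: complex_ext => /=.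
- rewrite -[RHS](@stokes_square R (Rec Z) (Rec Zx) (Rec Zy) phi phix phiy c r rho)//.
  + apply: eq_Rintegral => p _; rewrite /Lgrad ReM ReD ReN !ReM /=; ring.
  + by move=> p /gZ[].
  + by move=> p /cZ[].
  + by move=> p /cZ[].
- rewrite -[RHS](@stokes_square R (Imc Z) (Imc Zx) (Imc Zy) phi phix phiy c r rho)//.
  + apply: eq_Rintegral => p _; rewrite /Lgrad ImM ImD ImN !ImM /=; ring.
  + by move=> p /gZ[].
  + by move=> p /cZ[].
  + by move=> p /cZ[].
Qed.

(* A smooth approximation of the Cauchy kernel [1 / z], whose derivative
   [poisson d] in the direction of the conjugate of [z] is an approximate
   identity up to a constant. *)
Definition cauchy (d : R) (z : C) : C :=
  conjc z * ((modc z ^+ 2 + d ^+ 2)^-1)%:C%C.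

Definition poisson (d : R) (z : C) : R :=
  d ^+ 2 / (modc z ^+ 2 + d ^+ 2) ^+ 2.

Lemma poisson_ge0 d z : 0 <= poisson d z.
Proof. by rewrite /poisson divr_ge0 ?sqr_ge0. Qed.

Lemma modc_cauchy_le d z : 0 < d -> modc (cauchy d z) <= (modc z)^-1.
Proof.
move=> d0; have [->|z0] := eqVneq z 0.
  by rewrite /cauchy conjc0 mul0r modc0 invr0.
have m0 : 0 < modc z by rewrite modc_gt0.
have D0 : 0 < modc z ^+ 2 + d ^+ 2 by rewrite addr_gt0 ?exprn_gt0.
rewrite /cauchy modcM modcR gtr0_norm ?invr_gt0//.
have -> : modc (conjc z) = modc z by rewrite !modcE; case: z {z0 m0 D0} => a b /=; rewrite sqrrN.
rewrite ler_pdivrMr// mulrDr expr2 mulrA mulVf ?gt_eqF// mul1r lerDl.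
by rewrite mulr_ge0 ?invr_ge0 ?sqr_ge0// ltW.
Qed.

Lemma modc_cauchy_le_inv d z : 0 < d -> modc (cauchy d z) <= d^-1.
Proof.
move=> d0; have D0 : 0 < modc z ^+ 2 + d ^+ 2 by rewrite ltr_wpDl ?sqr_ge0 ?exprn_gt0.
rewrite /cauchy modcM modcR gtr0_norm ?invr_gt0//.
have -> : modc (conjc z) = modc z by rewrite !modcE; case: z {D0} => a b /=; rewrite sqrrN.
rewrite ler_pdivrMr// mulrC ler_pdivlMr//.
have := sqr_ge0 (modc z - d); have := modc_ge0 z; rewrite !expr2; nra.
Qed.

Lemma poisson_le d z : 0 < d -> poisson d z <= d ^- 2.
Proof.
move=> d0; have d2 : 0 < d ^+ 2 by rewrite exprn_gt0.
have D0 : 0 < modc z ^+ 2 + d ^+ 2 by rewrite ltr_wpDl ?sqr_ge0.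
rewrite /poisson ler_pdivrMr ?exprn_gt0// mulrC ler_pdivlMr// -expr2.
by rewrite lerXn2r ?nnegrE ?(ltW d2) ?(ltW D0)// lerDr sqr_ge0.
Qed.

Lemma poissonN d z : poisson d (- z) = poisson d z.
Proof. by rewrite /poisson modcN. Qed.

Lemma cauchyE d z : cauchy d z =
  Complex (complex.Re z * (complex.Re z ^+ 2 + complex.Im z ^+ 2 + d ^+ 2)^-1)
    (- complex.Im z * (complex.Re z ^+ 2 + complex.Im z ^+ 2 + d ^+ 2)^-1).
Proof.
by rewrite /cauchy sqr_modc; case: z => a b; apply: complex_ext;
  rewrite ?ReM ?ImM /=; ring.
Qed.

(** Since [L Z = 0], applying [L] to [cauchy d (Z - z0)] leaves the derivative in the conjugate
    variable, which is [poisson d], times [L (conj Z) = - 2 i J]. *)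
Lemma kernel_identity (c : plane R) (r M rho d : R) (Z Zx Zy w f : plane R -> C)
    (chi chix chiy : plane R -> R) (z0 : C) :
  local_integral c r M Z Zx Zy -> cutoff c r rho chi chix chiy ->
  cintegrable w -> cintegrable f -> weak_on c r Zx Zy w f -> 0 < d ->
  let I1 := fun p => w p * (chi p * jac Zx Zy p * poisson d (Z p - z0))%:C%C in
  let I2 := fun p => (f p * (chi p)%:C%C +
    w p * Lgrad Zx Zy (fun p => (chix p)%:C%C) (fun p => (chiy p)%:C%C) p) *
    cauchy d (Z p - z0) in
  [/\ cintegrable I1, cintegrable I2 &
    2 * 'i%C * cintegral setT I1 = cintegral setT I2].
Proof.
move=> hZ hchi iw if_ wf d0 I1 I2.
have [r0 [mZ mZx mZy] bZ gZ cZ] := hZ.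
pose X p := complex.Re (Z p) + - complex.Re z0.
pose Y p := complex.Im (Z p) + - complex.Im z0.
pose D p := X p * X p + Y p * Y p + d ^+ 2.
have D0 p : D p != 0.
  rewrite gt_eqF// /D ltr_wpDl ?exprn_gt0// -!expr2.
  by rewrite addr_ge0 ?sqr_ge0.
pose Xx p := complex.Re (Zx p); pose Xy p := complex.Re (Zy p).
pose Yx p := complex.Im (Zx p); pose Yy p := complex.Im (Zy p).
pose Dx p := X p * Xx p + Xx p * X p + (Y p * Yx p + Yx p * Y p).
pose Dy p := X p * Xy p + Xy p * X p + (Y p * Yy p + Yy p * Y p).
(* The real and the imaginary part of the kernel, with its denominator [D]; their derivatives
   follow. *)
pose u p := X p * (D p)^-1; pose v p := - 1 * Y p * (D p)^-1.
pose ux p := X p * (- Dx p * (D p)^-1 ^+ 2) + Xx p * (D p)^-1.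
pose uy p := X p * (- Dy p * (D p)^-1 ^+ 2) + Xy p * (D p)^-1.
pose vx p := - 1 * Y p * (- Dx p * (D p)^-1 ^+ 2) + - 1 * Yx p * (D p)^-1.
pose vy p := - 1 * Y p * (- Dy p * (D p)^-1 ^+ 2) + - 1 * Yy p * (D p)^-1.
have gX p : `|p - c| < r -> has_grad X p (Xx p) (Xy p).
  move=> /gZ[h _]; apply: has_grad_eq (has_gradD h (has_grad_cst _ p)) _ _;
    exact: addr0.
have gY p : `|p - c| < r -> has_grad Y p (Yx p) (Yy p).
  move=> /gZ[_ h]; apply: has_grad_eq (has_gradD h (has_grad_cst _ p)) _ _;
    exact: addr0.
have gD p : `|p - c| < r -> has_grad D p (Dx p) (Dy p).
  move=> hp; apply: has_grad_eq (has_gradD (has_gradD (has_gradM (gX p hp) (gX p hp))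
    (has_gradM (gY p hp) (gY p hp))) (has_grad_cst _ p)) _ _; exact: addr0.
have gI p : `|p - c| < r -> has_grad (fun p => (D p)^-1) p
    (- Dx p * (D p)^-1 ^+ 2) (- Dy p * (D p)^-1 ^+ 2).
  move=> hp; apply: has_grad_eq (has_gradV (D0 p) (gD p hp)) _ _; by rewrite exprVn.
have gu p : `|p - c| < r -> has_grad u p (ux p) (uy p).
  by move=> hp; exact: has_gradM (gX p hp) (gI p hp).
have gv p : `|p - c| < r -> has_grad v p (vx p) (vy p).
  move=> hp; have h := has_gradM (has_grad_cst (-1) p) (gY p hp).
  by apply: has_grad_eq (has_gradM h (gI p hp)) _ _; rewrite mul0r addr0.
have cX p : `|p - c| < r -> {for p, continuous X} by move=> /gX/has_grad_continuous.
have cY p : `|p - c| < r -> {for p, continuous Y} by move=> /gY/has_grad_continuous.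
have cI p : `|p - c| < r -> {for p, continuous (fun p => (D p)^-1)}.
  by move=> /gI/has_grad_continuous.
have cM (a b : plane R -> R) p : {for p, continuous a} -> {for p, continuous b} ->
  {for p, continuous (fun p => a p * b p)} by move=> ? ?; exact: continuousM.
have cD (a b : plane R -> R) p : {for p, continuous a} -> {for p, continuous b} ->
  {for p, continuous (fun p => a p + b p)} by move=> ? ?; exact: continuousD.
have cN (a : plane R -> R) p : {for p, continuous a} ->
  {for p, continuous (fun p => - a p)} by move=> ?; exact: continuousN.
have c2 p : `|p - c| < r -> {for p, continuous (fun p => (D p)^-1 ^+ 2)}.
  by move=> hp; exact: (cM _ _ _ (cI p hp) (cI p hp)).
have cDx p : `|p - c| < r -> {for p, continuous Dx} /\ {for p, continuous Dy}.
  move=> hp; have [h1 h2 h3 h4] := cZ p hp; have h5 := cX p hp; have h6 := cY p hp.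
  by split; apply: (cD); apply: (cD); exact: cM.
have c1 p (k : R) : {for p, continuous (fun _ : plane R => k)} by exact: cvg_cst.
have cu p : `|p - c| < r -> {for p, continuous ux} /\ {for p, continuous uy}.
  move=> hp; have [h1 h2 h3 h4] := cZ p hp; have h5 := cX p hp; have h6 := cY p hp.
  have [h7 h8] := cDx p hp; have h9 := c2 p hp; have h10 := cI p hp.
  have h11 := cN _ _ h7; have h12 := cN _ _ h8.
  split.
    exact: (cD _ _ _ (cM _ _ _ h5 (cM _ _ _ h11 h9)) (cM _ _ _ h1 h10)).
  exact: (cD _ _ _ (cM _ _ _ h5 (cM _ _ _ h12 h9)) (cM _ _ _ h3 h10)).
have cv p : `|p - c| < r -> {for p, continuous vx} /\ {for p, continuous vy}.
  move=> hp; have [h1 h2 h3 h4] := cZ p hp; have h5 := cX p hp; have h6 := cY p hp.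
  have [h7 h8] := cDx p hp; have h9 := c2 p hp; have h10 := cI p hp.
  have h11 := cN _ _ h7; have h12 := cN _ _ h8; have h13 := cM _ _ _ (c1 p (-1)) h6.
  split.
    exact: (cD _ _ _ (cM _ _ _ h13 (cM _ _ _ h11 h9)) (cM _ _ _ (cM _ _ _ (c1 p (-1)) h2) h10)).
  exact: (cD _ _ _ (cM _ _ _ h13 (cM _ _ _ h12 h9)) (cM _ _ _ (cM _ _ _ (c1 p (-1)) h4) h10)).
have [iA iB e] := weak_on_C1_complex hZ hchi iw if_ wf gu gv cu cv.
have Ecauchy p : cauchy d (Z p - z0) = Complex (u p) (v p).
  rewrite cauchyE /u /v /D /X /Y mulN1r !ReD !ReN !ImD !ImN.
  by congr Complex; rewrite !expr2.
have key p : Lgrad Zx Zy (fun p => Complex (ux p) (vx p)) (fun p => Complex (uy p) (vy p)) p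
    = - (2 * 'i%C * (jac Zx Zy p * poisson d (Z p - z0))%:C%C).
  have -> : poisson d (Z p - z0) = d ^+ 2 * (D p)^-1 ^+ 2.
    by rewrite /poisson sqr_modc exprVn /D /X /Y !ReD !ReN !ImD !ImN !expr2.
  have := D0 p; rewrite /Lgrad /jac /ux /uy /vx /vy /Dx /Dy /Xx /Xy /Yx /Yy.
  rewrite /D; move: (X p) (Y p) => x y.
  case: (Zx p) => a1 a2; case: (Zy p) => b1 b2 /= h.
  by apply: complex_ext; rewrite ?(ReD, ReN, ImD, ImN, ReM, ImM) /=; field.
pose I3 p := w p * Lgrad Zx Zy (fun p => (chix p)%:C%C) (fun p => (chiy p)%:C%C) p *
    cauchy d (Z p - z0).
set A := (fun p => _) in iA e; set B := (fun p => _) in iB e.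
have Lchi_bound : exists2 K, 0 <= K & forall p,
    modc (Lgrad Zx Zy (fun p => (chix p)%:C%C) (fun p => (chiy p)%:C%C) p) <= K.
  have [K K0 hK] := cutoff_bound hchi.
  exists (M * K + M * K).
    have M0 : 0 <= M by apply: le_trans (bZ c).1; exact: modc_ge0.
    by rewrite addr_ge0// mulr_ge0// ltW.
  move=> p; have [_ h1 h2] := hK p; have [h3 h4] := bZ p.
  rewrite (le_trans (modcB _ _))// !modcM !modcR.
  by apply: lerD; apply: ler_pM => //; exact: modc_ge0.
have [K K0 hK] := Lchi_bound.
have mZ0 : cmeasurable setT (fun p => Z p - z0).
  by apply: cmeasurableD => //; exact: cmeasurable_cst.
have mcau : cmeasurable setT (fun p => cauchy d (Z p - z0)).
  apply: cmeasurableM.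
    case: mZ0 => h1 h2; split.
      by rewrite (_ : (fun q => _) = (fun p => complex.Re (Z p - z0)))//; apply/funext => p; case: (_ - _).
    rewrite (_ : (fun q => _) = (fun p => - complex.Im (Z p - z0))); first exact: measurableT_comp.
    by apply/funext => p; case: (_ - _).
  apply: cmeasurable_real.
  under eq_fun do rewrite -powR_inv1 ?addr_ge0 ?sqr_ge0//.
  apply: (measurableT_comp (measurable_powR _)).
  apply: measurable_funD; last exact: measurable_cst.
  by apply: measurable_funX; exact: measurable_modc.
have [_ _ schi gchi _] := hchi.
have [cchix cchiy] := smooth_expr_grad_continuous schi gchi.
have mL : cmeasurable setT (Lgrad Zx Zy (fun p => (chix p)%:C%C) (fun p => (chiy p)%:C%C)).
  apply: cmeasurableD; first apply: cmeasurableM => //.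
    by apply: cmeasurable_real; exact: continuous_measurable_fun_plane.
  apply: cmeasurableN; apply: cmeasurableM => //.
  by apply: cmeasurable_real; exact: continuous_measurable_fun_plane.
have i3 : cintegrable I3.
  apply: (@cintegrable_le R _ (fun p => (K * d^-1) * modc (w p))).
  - apply: cmeasurableM => //; apply: cmeasurableM => //.
    exact: cintegrable_measurable.
  - exact: (integrableZl measurableT _ (integrable_modc iw)).
  - move=> p; rewrite /I3 -mulrA modcM mulrC ler_wpM2r ?modc_ge0// modcM.
    by apply: ler_pM; rewrite ?modc_ge0// modc_cauchy_le_inv.
have EA p : A p = - (2 * 'i%C) * I1 p + I3 p.
  have EL : Lgrad Zx Zy
      (fun p => (chi p)%:C%C * Complex (ux p) (vx p) + (chix p)%:C%C * Complex (u p) (v p))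
      (fun p => (chi p)%:C%C * Complex (uy p) (vy p) + (chiy p)%:C%C * Complex (u p) (v p)) p =
    (chi p)%:C%C *
      Lgrad Zx Zy (fun p => Complex (ux p) (vx p)) (fun p => Complex (uy p) (vy p)) p +
    cauchy d (Z p - z0) * Lgrad Zx Zy (fun p => (chix p)%:C%C) (fun p => (chiy p)%:C%C) p.
    by rewrite Ecauchy /Lgrad; ring.
  rewrite /A EL key /I1 /I3 !rmorphM /=.
  by move: 'i%C => ii; ring.
have E2 p : I2 p = B p + I3 p by rewrite /I2 /B /I3 -Ecauchy; ring.
have two0 : (2 * 'i%C : C) != 0.
  by rewrite mulf_neq0 ?pnatr_eq0//; apply/eqP => -[] /eqP; rewrite oner_eq0.
(* The integrability of [I1] is read off from the other two terms, after division by [2 i]. *)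
have E1 : I1 = (fun p => (2 * 'i%C)^-1 * (I3 p - A p)).
  apply/funext => p; rewrite EA; move: two0; move: (2 * 'i%C) => t t0.
  by rewrite (_ : I3 p - (- t * I1 p + I3 p) = t * I1 p) ?mulKf//; ring.
have i1 : cintegrable I1.
  rewrite E1; apply: cintegrableZ; apply: cintegrableD => //; exact: cintegrableN.
split=> //.
  by rewrite (funext E2); exact: cintegrableD.
have -> : cintegral setT I1 = (2 * 'i%C)^-1 * (cintegral setT I3 - cintegral setT A).
  by rewrite {1}E1 cintegralZ ?cintegralB//; apply: cintegrableD => //; exact: cintegrableN.
by rewrite (funext E2) cintegralD// mulrA mulfV// mul1r e addrC.
Qed.

End kernel_identity.

(** * Integrals of a function [D] whose sublevel sets have area O(s^m) *)

Section singular_integrals.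
Variable R : realType.
Local Notation mu := (leb2 R).
Local Notation C := R[i].

(** Comparison of [h] with the sum of the [a k] on [E k], integrated as a geometric series. The
    layers may overlap, and only the points where [h] is nonzero need one. *)
Lemma layer_bound (h : plane R -> R) (E : nat -> set (plane R)) (a : nat -> R) (A x : R) :
  measurable_fun setT (h : mplane R -> R) -> (forall p, 0 <= h p) ->
  (forall k, measurable (E k : set (mplane R))) -> (forall k, 0 <= a k) ->
  0 <= A -> 0 <= x -> x < 1 ->
  (forall p, h p != 0 -> exists2 k, E k p & h p <= a k) ->
  (forall k, ((a k)%:E * mu (E k) <= (A * x ^+ k)%:E)%E) ->
  (\int[mu]_p (h p)%:E <= (A / (1 - x))%:E)%E.
Proof.
move=> mh h0 mE a0 A0 x0 x1 cover vol.
have term0 k p : (0 <= (a k * \1_(E k) p)%:E)%E by rewrite lee_fin mulr_ge0.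
have mterm k : measurable_fun setT (fun p : mplane R => (a k * \1_(E k) p)%:E).
  apply/measurable_EFinP; apply: measurable_funM => //.
apply: (@le_trans _ _ (\int[mu]_p \sum_(k <oo) (a k * \1_(E k) p)%:E)%E).
  apply: ge0_le_integral => //.
  - by move=> p _; rewrite lee_fin.
  - exact/measurable_EFinP.
  - by apply: ge0_emeasurable_sum => k; [move=> p _ _; exact: term0|move=> _; exact: mterm].
  move=> p _; have [h0'|hp] := eqVneq (h p) 0.
    by rewrite h0'; apply: nneseries_ge0 => k _ _; exact: term0.
  have [k Ek hk] := cover p hp.
  apply: (@le_trans _ _ (\sum_(0 <= j < k.+1) (a j * \1_(E j) p)%:E)%E); last first.
    by apply: nneseries_lim_ge => j _ _; exact: term0.
  rewrite big_nat_recr//=; apply: (@le_trans _ _ (a k * \1_(E k) p)%:E).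
    by rewrite lee_fin indicE mem_set// mulr1.
  by apply: leeDr; apply: sume_ge0 => j _; exact: term0.
rewrite integral_nneseries//.
have step k : (\int[mu]_p (a k * \1_(E k) p)%:E <= (A * x ^+ k)%:E)%E.
  apply: le_trans (vol k).
  under eq_integral do rewrite EFinM.
  rewrite ge0_integralZl//.
  - by rewrite integral_indic// setIT.
  - by apply/measurable_EFinP; exact: (@measurable_indic _ (mplane R) R setT (E k) (mE k)).
  - by rewrite lee_fin.
have nneg k : (0 <= \int[mu]_p (a k * \1_(E k) p)%:E)%E.
  by apply: integral_ge0 => p _; exact: term0.
apply: lime_le; first by apply: is_cvg_nneseries => k _ _; exact: nneg.
apply: nearW => n.
apply: (@le_trans _ _ (\sum_(0 <= k < n) (A * x ^+ k)%:E)%E).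
  by apply: lee_sum => k _; exact: step.
rewrite sumEFin lee_fin -mulr_sumr; apply: ler_wpM2l => //.
rewrite -[leRHS]mul1r ler_pdivlMr ?subr_gt0// big_mkord mulrC.
have e := subrX1 x n.
have -> : (1 - x) * \sum_(i < n) x ^+ i = 1 - x ^+ n by rewrite -[1 - x]opprB mulNr -e opprB.
by rewrite lerBlDr lerDl exprn_ge0.
Qed.

Lemma powR_half_lt1 (e : R) : 0 < e -> 0 <= (2^-1 : R) `^ e < 1.
Proof.
move=> e0; rewrite powR_ge0/=.
have h : 2^-1 < 1 :> R by rewrite invf_lt1// ltr1n.
by have := gt0_ltr_powR e0 (x := 2^-1) (y := 1); rewrite powR1; apply; rewrite ?nnegrE.
Qed.

Lemma powRX (a e : R) n : 0 <= a -> (a ^+ n) `^ e = (a `^ e) ^+ n.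
Proof. by move=> a0; rewrite -powR_mulrn// -powRrM mulrC powRrM powR_mulrn ?powR_ge0. Qed.

Section distribution.
Variables (B : set (plane R)) (D : plane R -> R) (C0 m : R).
Hypotheses (mB : measurable (B : set (mplane R)))
  (mD : measurable_fun setT (D : mplane R -> R)) (D0 : forall p, 0 <= D p)
  (C00 : 0 <= C0)
  (vol : forall s, 0 < s -> (mu (B `&` [set p | (D p < s)%R]) <= (C0 * s `^ m)%:E)%E).

Let mlt s : measurable (B `&` [set p | D p < s] : set (mplane R)).
Proof.
apply: measurableI => //; rewrite -[X in measurable X]setTI.
have -> : [set: plane R] `&` [set p | D p < s] = [set: mplane R] `&` D @^-1` `]-oo, s[%classic.
  by apply/seteqP; split=> p [_ h]; split=> //=; move: h; rewrite /= in_itv.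
by apply: mD => //.
Qed.

(** Layers [D < d / 2 ^ k], each used where [D] is at least half of this bound. The series has the
    ratio [2 ^ (e - m)], less than 1 as [e < m]. *)
Lemma small_layer_bound e d : 0 < e -> e < m -> 0 < d ->
  (\int[mu]_p (\1_B p * (if D p < d then (D p `^ e)^-1 else 0))%:E <=
   (C0 * 2 `^ e * d `^ (m - e) / (1 - 2^-1 `^ (m - e)))%:E)%E.
Proof.
move=> e0 em d0.
have x01 := powR_half_lt1 (e := m - e).
have /andP[x0 x1] : 0 <= (2^-1 : R) `^ (m - e) < 1 by apply: x01; rewrite subr_gt0.
pose s k : R := d * 2^-1 ^+ k.
have s0 k : 0 < s k by rewrite mulr_gt0 ?exprn_gt0 ?invr_gt0.
apply: (@layer_bound _ (fun k => B `&` [set p | D p < s k])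
  (fun k => (s k.+1 `^ e)^-1)) => //.
- apply: measurable_indicM => //; apply: measurable_funTS.
  apply: measurable_fun_ifT => //.
    exact: measurable_fun_ltr.
  under eq_fun do rewrite -powRN.
  by apply: (measurableT_comp (measurable_powR _)).
- by move=> p; rewrite mulr_ge0//; case: ifP => // _; rewrite invr_ge0 powR_ge0.
- by move=> k; rewrite invr_ge0 powR_ge0.
- by rewrite !mulr_ge0 ?powR_ge0.
- move=> p; rewrite indicE; case: (boolP (p \in B)) => [pB|]; last by rewrite mul0r eqxx.
  rewrite mul1r; case: ifP => [Dd|_]; last by rewrite eqxx.
  (* Where [D] vanishes the integrand has the default value 0 of an inverse, so that no layer has to
     cover it. *)
  move=> hn; have Dp : 0 < D p.
    rewrite lt_neqAle D0 andbT eq_sym; apply: contraNneq hn => ->.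
    by rewrite powR0 ?invr0// gt_eqF.
  have ex : exists k, s k.+1 <= D p.
    have h := near_infty_natSinv_lt (PosNum (divr_gt0 Dp d0)).
    have [k _ /(_ k (leqnn _)) /=] := h.
    rewrite ltr_pdivlMr// => hk; exists k; rewrite (le_trans _ (ltW hk))//.
    rewrite /s mulrC ler_wpM2r ?(ltW d0)// exprVn lef_pV2 ?posrE ?exprn_gt0 ?ltr0n//.
    by rewrite -natrX ler_nat (leq_trans _ (ltn_expl k.+1 (leqnn 2)))//.
  case: (ex_minnP ex) => k hk kmin; exists k.
    split; first by rewrite inE in pB.
    case: k hk kmin => [|k] hk kmin /=; first by rewrite /s expr0 mulr1.
    by rewrite ltNge; apply/negP => h; have := kmin _ h; rewrite ltnn.
  rewrite lef_pV2 ?posrE ?powR_gt0//.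
  by apply: ge0_ler_powR; rewrite ?nnegrE ?(ltW e0) ?(ltW (s0 _)) ?(ltW Dp).
- move=> k; apply: (@le_trans _ _ ((s k.+1 `^ e)^-1%:E * (C0 * s k `^ m)%:E)%E).
    by apply: lee_wpmul2l; [rewrite lee_fin invr_ge0 powR_ge0|exact: vol].
  rewrite -EFinM lee_fin le_eqVlt; apply/orP; left; apply/eqP.
  have h0 : 0 <= 2^-1 :> R by rewrite invr_ge0.
  have -> : s k.+1 = s k * 2^-1 by rewrite /s exprSr mulrA.
  rewrite powRM ?(ltW (s0 k))// invfM -(powRN 2^-1) -(powR_inv1 (a := 2))// -powRrM mulN1r opprK.
  have -> : C0 * 2 `^ e * d `^ (m - e) * (2 `^ (-1)) `^ (m - e) ^+ k =
      C0 * 2 `^ e * (s k `^ m / s k `^ e).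
    rewrite -mulrA -powRX ?powR_ge0// -powRM ?exprn_ge0 ?powR_ge0 ?(ltW d0)// powR_inv1//.
    by rewrite -[d * _]/(s k) powRB// (gt_eqF (s0 k)) implybT.
  by ring.
Qed.

(** The outer counterpart, with layers growing by factors of 2: the ratio is now [2 ^ (m - e)], and
    convergence requires [m < e]. *)
Lemma large_layer_bound e d : 0 < e -> m < e -> 0 <= m -> 0 < d ->
  (\int[mu]_p (\1_B p * (if D p < d then 0 else (D p `^ e)^-1))%:E <=
   (C0 * 2 `^ m * d `^ (m - e) / (1 - 2^-1 `^ (e - m)))%:E)%E.
Proof.
move=> e0 em m0 d0.
have /andP[x0 x1] : 0 <= (2^-1 : R) `^ (e - m) < 1 by apply: powR_half_lt1; rewrite subr_gt0.
pose s k : R := d * 2 ^+ k.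
have s0 k : 0 < s k by rewrite mulr_gt0 ?exprn_gt0.
apply: (@layer_bound _ (fun k => B `&` [set p | D p < s k.+1])
  (fun k => (s k `^ e)^-1)) => //.
- apply: measurable_indicM => //; apply: measurable_funTS.
  apply: measurable_fun_ifT => //.
    exact: measurable_fun_ltr.
  under eq_fun do rewrite -powRN.
  by apply: (measurableT_comp (measurable_powR _)).
- by move=> p; rewrite mulr_ge0//; case: ifP => // _; rewrite invr_ge0 powR_ge0.
- by move=> k; rewrite invr_ge0 powR_ge0.
- by rewrite !mulr_ge0 ?powR_ge0.
- move=> p; rewrite indicE; case: (boolP (p \in B)) => [pB|]; last by rewrite mul0r eqxx.
  rewrite mul1r; case: ltP => [|Dd _]; first by rewrite eqxx.
  have ex : exists k, D p < s k.+1.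
    exists (Num.truncn (D p / d)); rewrite /s mulrC -ltr_pdivrMr//.
    rewrite (lt_trans (truncnS_gt _))// -natrX ltr_nat.
    exact: ltn_expl.
  case: (ex_minnP ex) => k hk kmin; exists k.
    by split; first by rewrite inE in pB.
  have skD : s k <= D p.
    case: k hk kmin => [|k] hk kmin; first by rewrite /s expr0 mulr1.
    by rewrite leNgt; apply/negP => h; have := kmin _ h; rewrite ltnn.
  rewrite lef_pV2 ?posrE ?powR_gt0//; last exact: lt_le_trans d0 Dd.
  by apply: ge0_ler_powR; rewrite ?nnegrE ?(ltW e0) ?(ltW (s0 _)) ?D0.
- move=> k; apply: (@le_trans _ _ ((s k `^ e)^-1%:E * (C0 * s k.+1 `^ m)%:E)%E).
    by apply: lee_wpmul2l; [rewrite lee_fin invr_ge0 powR_ge0|exact: vol].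
  rewrite -EFinM lee_fin le_eqVlt; apply/orP; left; apply/eqP.
  have -> : s k.+1 = s k * 2 by rewrite /s exprSr mulrA.
  rewrite powRM ?(ltW (s0 k))//.
  have -> : (2^-1 : R) `^ (e - m) = 2 `^ (m - e).
    by rewrite -(powR_inv1 (a := 2))// -powRrM mulN1r opprB.
  have -> : C0 * 2 `^ m * d `^ (m - e) * 2 `^ (m - e) ^+ k = C0 * 2 `^ m * (s k `^ m / s k `^ e).
    rewrite -mulrA -powRX// -powRM ?exprn_ge0 ?(ltW d0)//.
    by rewrite -[d * _]/(s k) powRB// (gt_eqF (s0 k)) implybT.
  by ring.
Qed.

(* The larger of the two factors in [d / (|a| |b|)], [d <= |a| + |b|],
   estimated in terms of the other one. *)
Definition kernel_profile (d s : R) : R := if s < d then 2 / s else d / s ^+ 2.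

Lemma kernel_profile_ge0 d s : 0 < d -> 0 <= s -> 0 <= kernel_profile d s.
Proof.
by move=> d0 s0; rewrite /kernel_profile; case: ifP => _;
  rewrite divr_ge0 ?exprn_ge0 ?(ltW d0).
Qed.

Lemma kernel_profile_powR q d s : 0 < q -> 0 < d -> 0 <= s ->
  kernel_profile d s `^ q =
  2 `^ q * (if s < d then (s `^ q)^-1 else 0) +
  d `^ q * (if s < d then 0 else (s `^ (2 * q))^-1).
Proof.
move=> q0 d0 s0; rewrite /kernel_profile; case: ifP => _.
  rewrite mulr0 addr0 powRM ?invr_ge0//.
  by rewrite -(powR_inv1 s0) -powRrM mulN1r powRN.
rewrite mulr0 add0r powRM ?invr_ge0 ?exprn_ge0 ?(ltW d0)//; congr (_ * _).
rewrite -powR_inv1 ?exprn_ge0// -powRrM mulN1r powRN; congr (_^-1).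
by rewrite -powR_mulrn// -powRrM.
Qed.

(** The first term comes from the inner layers with exponent [q], the second from the outer layers
    with exponent [2 q], once the powers of [d] are factored out. *)
Definition kernel_const q := 2 `^ q * (C0 * 2 `^ q / (1 - 2^-1 `^ (m - q))) +
  C0 * 2 `^ m / (1 - 2^-1 `^ (2 * q - m)).

(** Up to constants, the [q]-th power of the profile is [s ^ (- q)] for [s < d] and
    [d ^ q * s ^ (- 2 q)] beyond. The condition [q < m < 2 q] makes both parts converge, and both
    scale as [d ^ (m - q)]. *)
Lemma kernel_profile_bound q d : 0 < q -> q < m -> m < 2 * q -> 0 < d ->
  (\int[mu]_p (\1_B p * kernel_profile d (D p) `^ q)%:E <=
   (kernel_const q * d `^ (m - q))%:E)%E.
Proof.
move=> q0 qm mq d0.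
have m0 : 0 <= m by rewrite ltW// (lt_trans q0).
pose K1 := C0 * 2 `^ q / (1 - 2^-1 `^ (m - q)).
pose K2 := C0 * 2 `^ m / (1 - 2^-1 `^ (2 * q - m)).
rewrite /kernel_const -/K1 -/K2.
pose g1 p := \1_B p * (if D p < d then (D p `^ q)^-1 else 0).
pose g2 p := \1_B p * (if D p < d then 0 else (D p `^ (2 * q))^-1).
have mif (u v : mplane R -> R) : measurable_fun setT u -> measurable_fun setT v ->
    measurable_fun setT (fun p => \1_B p * (if D p < d then u p else v p)).
  move=> hu hv; apply: measurable_indicM => //; apply: measurable_funTS.
  by apply: measurable_fun_ifT => //; exact: measurable_fun_ltr.
have mpow e : measurable_fun setT (fun p : mplane R => (D p `^ e)^-1).
  under eq_fun do rewrite -powRN.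
  by apply: (measurableT_comp (measurable_powR _)).
have mg1 : measurable_fun setT (g1 : mplane R -> R) by apply: mif.
have mg2 : measurable_fun setT (g2 : mplane R -> R) by apply: mif.
have g10 p : 0 <= g1 p.
  by rewrite mulr_ge0//; case: ifP => // _; rewrite invr_ge0 powR_ge0.
have g20 p : 0 <= g2 p.
  by rewrite mulr_ge0//; case: ifP => // _; rewrite invr_ge0 powR_ge0.
rewrite (_ : (\int[mu]_p _)%E = ((2 `^ q)%:E * \int[mu]_p (g1 p)%:E +
    (d `^ q)%:E * \int[mu]_p (g2 p)%:E)%E); last first.
  rewrite -!ge0_integralZl//; try exact/measurable_EFinP; try by rewrite lee_fin powR_ge0.
  - rewrite -ge0_integralD//.
    + apply: eq_integral => p _; rewrite -!EFinM -EFinD kernel_profile_powR//.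
      by congr EFin; rewrite /g1 /g2; case: ifP => _; ring.
    + by move=> p _; rewrite -EFinM lee_fin mulr_ge0 ?powR_ge0.
    + by apply/measurable_EFinP; apply: measurable_funM.
    + by move=> p _; rewrite -EFinM lee_fin mulr_ge0 ?powR_ge0.
    + by apply/measurable_EFinP; apply: measurable_funM.
  - by move=> p _; rewrite lee_fin.
  - by move=> p _; rewrite lee_fin.
have b1 := small_layer_bound q0 qm d0.
have b2 := large_layer_bound (mulr_gt0 (ltr0n _ 2) q0) mq m0 d0.
apply: (@le_trans _ _ ((2 `^ q * (K1 * d `^ (m - q)) +
   d `^ q * (K2 * d `^ (m - 2 * q)))%:E)).
  rewrite EFinD !EFinM; apply: leeD; apply: lee_wpmul2l; rewrite ?lee_fin ?powR_ge0//.
    apply: le_trans b1 _; rewrite -EFinM lee_fin le_eqVlt; apply/orP; left; apply/eqP.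
    by rewrite /K1; ring.
  apply: le_trans b2 _; rewrite -EFinM lee_fin le_eqVlt; apply/orP; left; apply/eqP.
  by rewrite /K2; ring.
rewrite lee_fin le_eqVlt; apply/orP; left; apply/eqP.
rewrite (_ : m - q = q + (m - 2 * q)); last by ring.
rewrite [d `^ (q + _)]powRD; last by rewrite (gt_eqF d0) implybT.
by ring.
Qed.

(* Young's inequality with the weight [d `^ (alpha / p)], which makes both of
   its terms of order [d `^ alpha]. *)
Lemma weighted_kernel_bound (p q : R) (f : plane R -> R) (F d : R) : 1 < q -> q < m -> m < 2 * q ->
  0 < p -> p^-1 + q^-1 = 1 ->
  measurable_fun setT (f : mplane R -> R) -> (forall x, 0 <= f x) ->
  (\int[mu]_x (\1_B x * f x `^ p)%:E <= F%:E)%E -> 0 < d ->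
  (\int[mu]_x (\1_B x * (f x * kernel_profile d (D x)))%:E <=
   ((F / p + kernel_const q / q) * d `^ ((m - q) / q))%:E)%E.
Proof.
move=> q1 qm mq p0 pq mf f0 fp d0.
have q0 : 0 < q by exact: lt_trans q1.
have hK := kernel_profile_bound q0 qm mq d0.
pose al := (m - q) / q.
pose l := d `^ (al / p).
have l0 : 0 < l by rewrite powR_gt0.
have lp : l `^ p = d `^ al by rewrite /l -powRrM divfK// gt_eqF.
(* Exponents: [m - q = q * al] and [1 - p^-1 = q^-1]. *)
have lq : l^-1 `^ q * d `^ (m - q) = d `^ al.
  rewrite -powR_inv1 ?(ltW l0)// -powRrM /l -powRrM -powRD; last by rewrite (gt_eqF d0) implybT.
  congr (_ `^ _); rewrite /al.
  have -> : p^-1 = 1 - q^-1 by rewrite -pq addrK.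
  by field; rewrite gt_eqF.
have mk : measurable_fun setT (fun x : mplane R => kernel_profile d (D x)).
  apply: measurable_fun_ifT.
  - exact: measurable_fun_ltr.
  - apply: measurable_funM => //; under eq_fun do rewrite -powR_inv1//.
    by apply: (measurableT_comp (measurable_powR _)).
  - apply: measurable_funM => //; under eq_fun do rewrite -exprVn -powR_inv1//.
    apply: measurable_funX.
    by apply: (measurableT_comp (measurable_powR _)).
have mind : measurable_fun setT (fun x : mplane R => \1_B x : R).
  exact: (@measurable_indic _ (mplane R) R setT B mB).
have mfp : measurable_fun setT (fun x : mplane R => \1_B x * f x `^ p).
  by apply: measurable_funM => //; apply: (measurableT_comp (measurable_powR _)).
have mkq : measurable_fun setT (fun x : mplane R => \1_B x * kernel_profile d (D x) `^ q).
  by apply: measurable_funM => //; apply: (measurableT_comp (measurable_powR _)).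
apply: (@le_trans _ _ (\int[mu]_x ((d `^ al / p)%:E * (\1_B x * f x `^ p)%:E +
    (l^-1 `^ q / q)%:E * (\1_B x * kernel_profile d (D x) `^ q)%:E)%E)%E).
  apply: ge0_le_integral => //.
  - move=> x _; rewrite lee_fin mulr_ge0// mulr_ge0//.
    exact: kernel_profile_ge0.
  - by apply/measurable_EFinP; do 2 apply: measurable_funM => //.
  - by apply/measurable_EFinP; apply: measurable_funD; apply: measurable_funM.
  move=> x _; rewrite -!EFinM -EFinD lee_fin.
  have k0 := kernel_profile_ge0 d0 (D0 x).
  have y := @conjugate_powR R (l * f x) (l^-1 * kernel_profile d (D x)) p q
    (mulr_ge0 (ltW l0) (f0 x)) (mulr_ge0 (ltW (etrans (invr_gt0 l) l0)) k0) p0 q0 pq.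
  rewrite (_ : l * f x * (l^-1 * kernel_profile d (D x)) = f x * kernel_profile d (D x)) in y; last first.
    by field; rewrite gt_eqF.
  rewrite !powRM ?invr_ge0 ?(ltW l0)// lp in y.
  rewrite indicE; case: (_ \in _); rewrite ?mul0r ?mulr0 ?addr0// !mul1r.
  by apply: le_trans y _; rewrite le_eqVlt; apply/orP; left; apply/eqP; ring.
rewrite ge0_integralD//.
- rewrite !ge0_integralZl//.
  + apply: (@le_trans _ _ (d `^ al / p * F + l^-1 `^ q / q * (kernel_const q * d `^ (m - q)))%:E).
      rewrite EFinD !EFinM; apply: leeD; apply: lee_wpmul2l => //.
        by rewrite -EFinM lee_fin divr_ge0 ?powR_ge0 ?(ltW p0).
      by rewrite -EFinM lee_fin divr_ge0 ?powR_ge0 ?(ltW q0).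
    rewrite lee_fin le_eqVlt; apply/orP; left; apply/eqP.
    rewrite (_ : (F / p + _) * _ = F / p * d `^ al + kernel_const q / q * (l^-1 `^ q * d `^ (m - q))); first by ring.
    by rewrite lq mulrDl.
  + exact/measurable_EFinP.
  + by move=> x _; rewrite lee_fin mulr_ge0 ?powR_ge0.
  + by rewrite lee_fin divr_ge0 ?powR_ge0 ?(ltW q0).
  + exact/measurable_EFinP.
  + by move=> x _; rewrite lee_fin mulr_ge0 ?powR_ge0.
  + by rewrite lee_fin divr_ge0 ?powR_ge0 ?(ltW p0).
- move=> x _; rewrite -EFinM lee_fin; apply: mulr_ge0.
    by apply: divr_ge0; [exact: powR_ge0|exact: (ltW p0)].
  by apply: mulr_ge0 => //; exact: powR_ge0.
- by apply/measurable_EFinP; apply: measurable_funM.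
- move=> x _; rewrite -EFinM lee_fin; apply: mulr_ge0.
    by apply: divr_ge0; [exact: powR_ge0|exact: (ltW q0)].
  by apply: mulr_ge0 => //; exact: powR_ge0.
- by apply/measurable_EFinP; apply: measurable_funM.
Qed.

Lemma inverse_bound : 1 < m -> (mu B < +oo)%E ->
  (\int[mu]_p (\1_B p * (D p)^-1)%:E <=
   (C0 * 2 `^ 1 * 1 `^ (m - 1) / (1 - 2^-1 `^ (m - 1)))%:E + mu B)%E.
Proof.
move=> m1 Boo.
have b := small_layer_bound ltr01 m1 ltr01.
have mg : measurable_fun setT (fun p : mplane R =>
    \1_B p * (if D p < 1 then (D p `^ 1)^-1 else 0)).
  apply: measurable_indicM => //; apply: measurable_funTS.
  apply: measurable_fun_ifT => //; first exact: measurable_fun_ltr.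
  under eq_fun do rewrite -powRN.
  by apply: (measurableT_comp (measurable_powR _)).
have mind : measurable_fun setT (fun x : mplane R => \1_B x : R).
  exact: (@measurable_indic _ (mplane R) R setT B mB).
apply: (@le_trans _ _ (\int[mu]_p ((\1_B p * (if D p < 1 then (D p `^ 1)^-1 else 0))%:E + (\1_B p)%:E))%E).
  apply: ge0_le_integral => //.
  - by move=> x _; rewrite lee_fin mulr_ge0// invr_ge0.
  - apply/measurable_EFinP; apply: measurable_funM => //.
    under eq_fun do rewrite -powR_inv1//.
    by apply: (measurableT_comp (measurable_powR _)).
  - by apply/measurable_EFinP; apply: measurable_funD.
  move=> x _; rewrite -EFinD lee_fin indicE.
  case: (x \in B); rewrite ?mul0r ?addr0// !mul1r.
  case: ltP => [_|D1]; first by rewrite powRr1// lerDl.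
  by rewrite add0r invf_le1// (lt_le_trans ltr01).
rewrite ge0_integralD//.
- by rewrite integral_indic// setIT; apply: leeD.
- move=> x _; rewrite lee_fin mulr_ge0//; case: ifP => // _.
  by rewrite invr_ge0 powR_ge0.
- exact/measurable_EFinP.
- exact/measurable_EFinP.
Qed.

End distribution.
End singular_integrals.

(** * Functions with vanishing integrals over rectangles *)

Section rectangles.
Variable R : realType.
Local Notation mu := (leb2 R).
Local Notation C := R[i].

Lemma setI_closed_opens : setI_closed (@RGenOpens.G R).
Proof.
move=> _ _ [a [b ->]] [c [d ->]]; exists (Num.max a c), (Num.min b d).
apply/seteqP; split=> x /=; rewrite !in_itv/= gt_max lt_min.
  by move=> [/andP[-> ->] /andP[-> ->]].
by move=> /andP[/andP[-> ->] /andP[-> ->]].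
Qed.

Let sym (n : nat) : set R := `]- n%:R, n%:R[%classic.

Let sym_nd (m n : nat) : (m <= n)%N -> sym m `<=` sym n.
Proof.
move=> mn x; rewrite /sym /= !in_itv/= => /andP[h1 h2].
have : m%:R <= n%:R :> R by rewrite ler_nat.
by move=> h; apply/andP; split; lra.
Qed.

Let sym_cover : \bigcup_n sym n = setT.
Proof.
apply/seteqP; split=> // x _; exists (Num.truncn `|x|).+1 => //=.
by rewrite /sym /= in_itv/= -ltr_norml truncnS_gt.
Qed.

(** Dynkin's theorem on lambda-systems: bounded open intervals are stable under intersection,
    generate the Borel sets and increase to the line. *)
Lemma interval_induction (H : set (set R)) : setSD_closed H -> ndseq_closed H ->
  (forall a b : R, H `]a, b[%classic) ->
  forall A, measurable (A : set (measurableTypeR R)) -> H A.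
Proof.
move=> HD Hn H0 A mA.
have HT : H setT.
  rewrite -sym_cover; apply: Hn => [m n mn|n]; last exact: H0.
  by apply/subsetPset; exact: sym_nd.
suff : <<s @RGenOpens.G R >> `<=` H by apply; move: mA; rewrite RGenOpens.measurableE.
apply: lambda_system_subset; first exact: setI_closed_opens.
- by split.
- by move=> _ [a [b ->]].
- by [].
Qed.

(** The interval case is applied to one factor at a time; a last lambda-system argument passes from
    products of Borel sets to the product sigma-algebra. *)
Lemma rectangle_induction (H : set (set (plane R))) :
  setSD_closed H -> ndseq_closed H ->
  (forall a b c d : R, H (`]a, b[%classic `*` `]c, d[%classic)) ->
  forall A, measurable (A : set (mplane R)) -> H A.
Proof.
move=> HD Hn H0 A mA.
have H1 c d B : measurable (B : set (measurableTypeR R)) -> H (B `*` `]c, d[%classic).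
  apply: (@interval_induction [set B | H (B `*` `]c, d[%classic)]) => /=.
  - move=> B1 B2 B21 /= h1 h2.
    rewrite (_ : _ `*` _ = (B1 `*` `]c, d[) `\` (B2 `*` `]c, d[)).
      by apply: HD => // -[x y] [/= /B21 ? ?].
    apply/seteqP; split=> -[x y] /=; first by move=> [[h3 h4] h5]; split=> // -[].
    by move=> [[h3 h4] h5]; split=> //; split=> // h6; exact: h5.
  - move=> F ndF hF /=; rewrite setX_bigcupl; apply: Hn => // m n mn.
    by apply/subsetPset => -[x y] [/= hx ?]; split=> //; move/subsetPset: (ndF _ _ mn); apply.
  - by move=> a b; exact: H0.
have H2 B D : measurable (B : set (measurableTypeR R)) ->
    measurable (D : set (measurableTypeR R)) -> H (B `*` D).
  move=> mB; apply: (@interval_induction [set D | H (B `*` D)]) => /=.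
  - move=> B1 B2 B21 /= h1 h2.
    rewrite (_ : _ `*` _ = (B `*` B1) `\` (B `*` B2)).
      by apply: HD => // -[x y] [/= ? /B21 ?].
    apply/seteqP; split=> -[x y] /=; first by move=> [h3 [h4 h5]]; split=> // -[].
    by move=> [[h3 h4] h5]; split=> //; split=> // h6; exact: h5.
  - move=> F ndF hF /=; rewrite setX_bigcupr; apply: Hn => // m n mn.
    by apply/subsetPset => -[x y] [/= ? hy]; split=> //; move/subsetPset: (ndF _ _ mn); apply.
  - by move=> a b; exact: H1.
move: mA; rewrite measurable_prod_measurableType; move: A.
apply: lambda_system_subset.
- move=> _ _ [A1 mA1 [A2 mA2 <-]] [B1 mB1 [B2 mB2 <-]].
  exists (A1 `&` B1); first exact: measurableI.
  by exists (A2 `&` B2); [exact: measurableI|rewrite setXI].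
- by split=> //; rewrite -setXTT; apply: H2.
- by move=> _ [A1 mA1 [A2 mA2 <-]]; exact: H2.
- by [].
Qed.

Lemma cintegrable_indicM (A : set (plane R)) (g : plane R -> C) :
  measurable (A : set (mplane R)) -> cintegrable g ->
  cintegrable (fun x => (\1_A x)%:C%C * g x).
Proof.
move=> mA ig; have [m1 m2] := cintegrable_measurable ig.
apply: (@cintegrable_le _ _ (fun x => modc (g x))); last 1 first.
- move=> x; rewrite modcM modcR indicE; case: (_ \in _).
    by rewrite normr1 mul1r.
  by rewrite normr0 mul0r modc_ge0.
- apply: cmeasurableM => //.
  by apply: cmeasurable_real; exact: (@measurable_indic _ (mplane R) R setT A mA).
- exact: integrable_modc.
Qed.

(** The measurable sets over which [g] integrates to 0 form a lambda-system, by linearity for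
    differences and by dominated convergence for increasing unions. *)
Lemma ae_eq0_rectangles (g : plane R -> C) : cintegrable g ->
  (forall a b c d : R, cintegral setT (fun x =>
     (\1_(`]a, b[%classic `*` `]c, d[%classic) x)%:C%C * g x) = 0) ->
  {ae mu, forall x, g x = 0}.
Proof.
move=> ig g0.
have g0' A : measurable (A : set (mplane R)) ->
    measurable (A : set (mplane R)) /\
    cintegral setT (fun x => (\1_A x)%:C%C * g x) = 0.
  move: A; apply: rectangle_induction.
  - move=> A B BA [mA hA] [mB hB]; split; first exact: measurableD.
    rewrite -[RHS](subrr 0) -{1}hA -hB -cintegralB; try exact: cintegrable_indicM.
    congr cintegral; apply/funext => x; rewrite -mulrBl -rmorphB/=.
    congr (_%:C%C * _); rewrite !indicE; have [xB|xB] := boolP (x \in B).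
      have xA : x \in A by apply/mem_set; apply: BA; exact: set_mem.
      rewrite xA subrr memNset// => -[_]; apply; exact: set_mem.
    rewrite subr0; have [xA|xA] := boolP (x \in A).
      rewrite mem_set//; split; first exact: set_mem.
      by move=> /mem_set; rewrite (negbTE xB).
    by rewrite memNset// => -[/mem_set]; rewrite (negbTE xA).
  - move=> F ndF hF; have mF k := (hF k).1; split; first exact: bigcupT_measurable.
    have [] := @cintegral_dominated R (fun k x => (\1_(F k) x)%:C%C * g x)
      (fun x => (\1_(\bigcup_k F k) x)%:C%C * g x) (fun x => modc (g x)).
    + by move=> k; apply: cintegrable_measurable; exact: cintegrable_indicM.
    + apply: cintegrable_measurable; apply: cintegrable_indicM => //.
      exact: bigcupT_measurable.
    + exact: integrable_modc.
    + move=> k x; rewrite modcM modcR indicE; case: (_ \in _).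
        by rewrite normr1 mul1r.
      by rewrite normr0 mul0r modc_ge0.
    + apply: ae_all => x; apply: ccvgM; last exact: ccvg_cst.
      apply: ccvg_real; apply: cvg_near_cst.
      rewrite indicE; have [/set_mem[k _ Fk]|h] := boolP (x \in \bigcup_k F k).
        exists k => // j /= kj; rewrite indicE mem_set//.
        by move/subsetPset: (ndF _ _ kj); apply.
      exists 0%N => // j _ /=; rewrite indicE; case: (boolP (x \in F j)) => // /set_mem Fj.
      by case/negP: h; apply/mem_set; exists j.
    move=> _ cv; apply: ccvg_unique cv _.
    by apply: (ccvg_ext _ (ccvg_cst 0)) => k; rewrite (hF k).2.
  - move=> a b c d; split; last exact: g0.
    by apply: measurableX.
have key (h : mplane R -> R) : mu.-integrable setT (EFin \o h) ->
    (forall A, measurable A -> \int[mu]_(x in A) h x = 0) ->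
    {ae mu, forall x, h x = 0}.
  move=> ih h0.
  have : ae_eq mu setT (EFin \o h) (cst 0%E).
    apply: integral_ae_eq => // E _ mE; rewrite integral0.
    have ihE : mu.-integrable E (EFin \o h) by exact: (integrableS measurableT).
    have hE := congr1 EFin (h0 E mE); move: hE; rewrite /Rintegral fineK//.
    exact: integrable_fin_num.
  by apply: ae_leb2_impl => x /(_ I)[].
have [i1 i2] := ig.
have h1 : {ae mu, forall x, complex.Re (g x) = 0}.
  apply: key => // A mA; have [_ /(congr1 (@complex.Re R))] := g0' A mA.
  by rewrite -cintegral_mkcond.
have h2 : {ae mu, forall x, complex.Im (g x) = 0}.
  apply: key => // A mA; have [_ /(congr1 (@complex.Im R))] := g0' A mA.
  by rewrite -cintegral_mkcond.
have := @filterI (mplane R) _ (ae_filter_ringOfSetsType mu) _ _ h1 h2.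
by apply: ae_leb2_impl => x [? ?]; exact: complex_ext.
Qed.

End rectangles.

(** * Mean value estimates, kernel differences and Cauchy transforms *)

Section cauchy_transform.
Variable R : realType.
Local Notation mu := (leb2 R).
Local Notation C := R[i].

Lemma ball_convex (c p q : plane R) (r t : R) : `|p - c| < r -> `|q - c| < r ->
  0 <= t <= 1 -> `|(q.1 + t * (p.1 - q.1), q.2 + t * (p.2 - q.2)) - c| < r.
Proof.
move=> hp hq /andP[t0 t1].
have key (a b : R) : `|a| < r -> `|b| < r -> `|b + t * (a - b)| < r.
  move=> ha hb; have -> : b + t * (a - b) = t * a + (1 - t) * b by ring.
  rewrite (le_lt_trans (ler_normD _ _))// !normrM (ger0_norm t0) [`|1 - t|]ger0_norm ?subr_ge0//.
  have [->|tn0] := eqVneq t 0; first by rewrite mul0r add0r subr0 mul1r.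
  have t0' : 0 < t by rewrite lt_neqAle eq_sym tn0.
  have h1 : 0 < t * (r - `|a|) by rewrite mulr_gt0 ?subr_gt0.
  have h2 : 0 <= (1 - t) * (r - `|b|) by apply: mulr_ge0; rewrite subr_ge0// ltW.
  by lra.
move: hp hq; rewrite !plane_normE !gt_max /= => /andP[h1 h2] /andP[h3 h4].
have e (x y z : R) : y + t * (x - y) - z = (y - z) + t * ((x - z) - (y - z)) by ring.
by rewrite !e !key.
Qed.

(** The distance from the intermediate point to [q] is recorded, so that continuity of the
    derivatives at [q] can be used afterwards. *)
Lemma mean_value_ball (f : plane R -> R) (a b : plane R -> R) (c : plane R) (r : R) :
  (forall p, `|p - c| < r -> has_grad f p (a p) (b p)) ->
  forall p q, `|p - c| < r -> `|q - c| < r -> exists z,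
    [/\ `|z - c| < r, `|z - q| <= `|p - q| &
        f p - f q = a z * (p.1 - q.1) + b z * (p.2 - q.2)].
Proof.
move=> hf p q hp hq.
pose x (t : R) := q.1 + t * (p.1 - q.1); pose y (t : R) := q.2 + t * (p.2 - q.2).
have dl (u v t : R) : is_derive t 1 (fun s : R => u + s * v) v.
  have h := is_deriveD (is_derive_cst u t 1) (is_deriveM (is_derive_id t 1) (is_derive_cst v t 1)).
  by apply: (is_derive_eq h); rewrite /GRing.scale/= mulr0 !add0r mulr1.
have inb t : 0 <= t <= 1 -> `|(x t, y t) - c| < r by exact: ball_convex.
pose F t := f (x t, y t).
pose F' t := a (x t, y t) * (p.1 - q.1) + b (x t, y t) * (p.2 - q.2).
have dF (t : R) : 0 <= t <= 1 -> is_derive t 1 F (F' t).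
  by move=> ht; exact: (has_grad_curve (dl _ _ _) (dl _ _ _) (hf _ (inb _ ht))).
have [t] : exists2 t, t \in `]0, 1[%R & F 1 - F 0 = F' t * (1 - 0).
  apply: MVT; first exact: ltr01.
  - by move=> t; rewrite in_itv/= => /andP[t0 t1]; apply: dF; rewrite !ltW.
  - apply: derivable_within_continuous => t; rewrite in_itv/= => ht.
    by case: (dF t ht).
rewrite in_itv/= => /andP[t0 t1].
rewrite /F /x /y !mul1r !mul0r !addr0 subr0 mulr1 ![_ + (_ - _)]addrC !subrK -!surjective_pairing => e.
exists (x t, y t); split=> //; first by apply: inb; rewrite !ltW.
rewrite !plane_normE /= /x /y ![_ + _ * _ - _]addrAC !subrr !add0r !normrM (gtr0_norm t0).
rewrite ge_max !le_max; apply/andP; split; apply/orP; [left|right]; by rewrite ler_piMl// ltW.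
Qed.

Lemma lipschitz_grad (f : plane R -> R) (a b : plane R -> R) (c : plane R) (r M : R) :
  (forall p, `|p - c| < r -> has_grad f p (a p) (b p)) ->
  (forall p, `|p - c| < r -> `|a p| <= M /\ `|b p| <= M) ->
  forall p q, `|p - c| < r -> `|q - c| < r -> `|f p - f q| <= 2 * M * `|p - q|.
Proof.
move=> hf hM p q hp hq; have [z [hz _ ->]] := mean_value_ball hf hp hq.
have [h1 h2] := hM z hz.
have hpq1 : `|p.1 - q.1| <= `|p - q| by rewrite plane_normE le_max lexx.
have hpq2 : `|p.2 - q.2| <= `|p - q| by rewrite plane_normE le_max lexx orbT.
rewrite (le_trans (ler_normD _ _))// !normrM.
have -> : 2 * M * `|p - q| = M * `|p - q| + M * `|p - q| by ring.
by apply: lerD; apply: ler_pM.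
Qed.

(* Cutting a segment into [n] equal parts divides a quadratic bound by [n]. *)
Lemma quadratic_constant (h : plane R -> C) (c : plane R) (r K : R) :
  (forall p q, `|p - c| < r -> `|q - c| < r -> modc (h p - h q) <= K * `|p - q| ^+ 2) ->
  forall p q, `|p - c| < r -> `|q - c| < r -> h p = h q.
Proof.
move=> hK p q hp hq; apply/eqP; rewrite -subr_eq0 -modc_eq0 eq_le modc_ge0 andbT.
apply/ler_addgt0Pr => e e0; rewrite add0r.
have K0 : 0 <= `|K| * `|p - q| ^+ 2 by rewrite mulr_ge0// exprn_ge0.
pose n := (Num.truncn (`|K| * `|p - q| ^+ 2 / e)).+1.
have n0 : 0 < n%:R :> R by rewrite ltr0n.
have hn : `|K| * `|p - q| ^+ 2 <= e * n%:R.
  rewrite [e * _]mulrC -ler_pdivrMr//; apply: ltW; exact: truncnS_gt.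
pose z (k : nat) : plane R := q + (k%:R / n%:R) *: (p - q).
have hz k : (k <= n)%N -> `|z k - c| < r.
  move=> kn; apply: ball_convex => //.
  by rewrite divr_ge0//= ler_pdivrMr// mul1r ler_nat.
have hs k : (k < n)%N -> modc (h (z k.+1) - h (z k)) <= K * (`|p - q| / n%:R) ^+ 2.
  move=> kn; have := hK _ _ (hz _ kn) (hz _ (ltnW kn)).
  have -> : z k.+1 - z k = n%:R^-1 *: (p - q).
    rewrite /z opprD addrACA subrr add0r -scalerBl; congr (_ *: _).
    by rewrite -mulrBl -natr1 [_ + 1]addrC addrK mul1r.
  by rewrite normrZ ger0_norm ?invr_ge0// [_ * `|p - q|]mulrC.
have tel k : (k <= n)%N -> modc (h (z k) - h (z 0%N)) <= k%:R * (K * (`|p - q| / n%:R) ^+ 2).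
  elim: k => [|k IH] kn; first by rewrite subrr modc0 mul0r.
  have -> : h (z k.+1) - h (z 0%N) = (h (z k.+1) - h (z k)) + (h (z k) - h (z 0%N)) by rewrite addrA subrK.
  rewrite -natr1 mulrDl mul1r [leRHS]addrC (le_trans (modcD _ _))// lerD//; first exact: hs.
  by apply: IH; exact: ltnW.
have := tel n (leqnn n).
have -> : z n = p by rewrite /z divff ?gt_eqF// scale1r addrC subrK.
have -> : z 0%N = q by rewrite /z mul0r scale0r addr0.
move=> /le_trans; apply.
have -> : n%:R * (K * (`|p - q| / n%:R) ^+ 2) = K * `|p - q| ^+ 2 / n%:R.
  by move: n0; move: (n%:R : R) => N N0; field; rewrite gt_eqF.
rewrite ler_pdivrMr// (le_trans _ hn)// ler_wpM2r ?sqr_ge0//; exact: ler_norm.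
Qed.

Lemma has_grad_quadratic (f : plane R -> R) (p : plane R) (a b d K : R) : 0 < d ->
  has_grad f p a b -> (forall q, `|q - p| < d -> `|f q| <= K * `|q - p| ^+ 2) ->
  a = 0 /\ b = 0.
Proof.
move=> d0 hf hK.
have K0 : 0 <= `|K| by [].
have fp0 : f p = 0.
  apply/eqP; rewrite -normr_eq0 eq_le normr_ge0 andbT.
  by have := hK p; rewrite subrr normr0 expr0n/= mulr0; apply.
have D0 v : 'D_v f p = 0.
  apply: cvg_lim => //; apply/cvgr0Pnorm_lt => e e0.
  have v1 : 0 < `|v| + 1 by rewrite ltr_wpDl.
  near=> h => /=.
  have h0 : h != 0 by near: h; exact: nbhs_dnbhs_neq.
  have nh : 0 < `|h| by rewrite normr_gt0.
  have hd : `|h| * (`|v| + 1) < d.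
    rewrite -ltr_pdivlMr//; near: h; apply: dnbhs0_lt; exact: divr_gt0.
  have he' : `|h| * (`|K| * (`|v| + 1) ^+ 2) < e.
    apply: (@le_lt_trans _ _ (`|h| * (`|K| * (`|v| + 1) ^+ 2 + 1))).
      by apply: ler_wpM2l => //; rewrite lerDl.
    rewrite -ltr_pdivlMr ?ltr_wpDl ?mulr_ge0 ?sqr_ge0//.
    by near: h; apply: dnbhs0_lt; rewrite divr_gt0// ltr_wpDl ?mulr_ge0 ?sqr_ge0.
  rewrite fp0 subr0 normrZ normfV ltr_pdivrMl//.
  have e1 : h *: v + p - p = h *: v by rewrite addrK.
  have hvd : `|h *: v| <= `|h| * (`|v| + 1) by rewrite normrZ ler_wpM2l// lerDl.
  have := hK (h *: v + p); rewrite e1 => /(_ (le_lt_trans hvd hd)) /le_lt_trans; apply.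
  apply: (@le_lt_trans _ _ (`|K| * (`|h| * (`|v| + 1)) ^+ 2)).
    apply: (@le_trans _ _ (`|K| * `|h *: v| ^+ 2)); first by rewrite ler_wpM2r ?sqr_ge0 ?ler_norm.
    by rewrite ler_wpM2l// lerXn2r ?nnegrE ?mulr_ge0 ?addr_ge0.
  have -> : `|K| * (`|h| * (`|v| + 1)) ^+ 2 = `|h| * (`|h| * (`|K| * (`|v| + 1) ^+ 2)) by ring.
  by rewrite ltr_pM2l.
by have [<- <-] := has_gradE hf.
Unshelve. all: by end_near. Qed.

(** With [d = |a - b|] the left side is [d / (|a| |b|)]. If both moduli are at least [d], the
    product of the inverses is bounded by the sum of their squares. Otherwise it is at most
    [1 / |a| + 1 / |b|], and the smaller modulus is below [d]. *)
Lemma invr_sub_le (a b : C) : 0 < modc (a - b) ->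
  modc (a^-1 - b^-1) <= kernel_profile (modc (a - b)) (modc a) +
                        kernel_profile (modc (a - b)) (modc b).
Proof.
move=> d0.
have tri1 : modc a <= modc (a - b) + modc b by have := modcD (a - b) b; rewrite subrK.
have tri2 : modc b <= modc (a - b) + modc a.
  by have := modcD (b - a) a; rewrite subrK modc_distC.
(* As [0^-1 = 0], only the other point contributes. Its modulus is exactly [d], where the profile is
   [d / d ^ 2]. *)
have [a0|an0] := eqVneq a 0.
  move: d0 tri1 tri2; rewrite a0 invr0 !sub0r !modcN modc0 modcV addr0 => d0 _ _.
  rewrite /kernel_profile d0 ltxx invr0 mulr0 add0r expr2 invfM mulrA mulfV ?mul1r//.
  by rewrite gt_eqF.
have [b0|bn0] := eqVneq b 0.
  move: d0 tri1 tri2; rewrite b0 invr0 !subr0 modc0 modcV => d0 _ _.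
  rewrite /kernel_profile d0 ltxx invr0 mulr0 addr0 expr2 invfM mulrA mulfV ?mul1r//.
  by rewrite gt_eqF.
have a0 : 0 < modc a by rewrite modc_gt0.
have b0 : 0 < modc b by rewrite modc_gt0.
have ab : modc (a^-1 - b^-1) = modc (a - b) / (modc a * modc b).
  rewrite -modcM -modcV -modcM; rewrite -[LHS]modcN; congr modc.
  by field; rewrite an0 bn0.
have ab2 : modc (a^-1 - b^-1) <= (modc a)^-1 + (modc b)^-1.
  by rewrite -!modcV; exact: modcB.
rewrite /kernel_profile; move: ab ab2.
move: (modc (a - b)) (modc a) (modc b) (modc (_^-1 - _)) d0 a0 b0 tri1 tri2 => d x y w d0 x0 y0 t1 t2 ab ab2.
case: ltP => xd; case: ltP => yd.
- rewrite (le_trans ab2)//; apply: lerD; rewrite ler_peMl ?invr_ge0 ?(ltW x0) ?(ltW y0)//; lra.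
- have yx : y^-1 <= x^-1 by rewrite lef_pV2 ?posrE// ltW// (lt_le_trans xd).
  have : 0 <= d / y ^+ 2 by rewrite divr_ge0 ?sqr_ge0// ltW.
  lra.
- have yx : x^-1 <= y^-1 by rewrite lef_pV2 ?posrE// ltW// (lt_le_trans yd).
  have : 0 <= d / x ^+ 2 by rewrite divr_ge0 ?sqr_ge0// ltW.
  lra.
- rewrite ab -mulrDr ler_wpM2l ?(ltW d0)// -!exprVn invfM.
  have := sqr_ge0 (x^-1 - y^-1); have : 0 < x^-1 * y^-1 by rewrite mulr_gt0 ?invr_gt0.
  rewrite !expr2; nra.
Qed.

(** At 0 both sides have the value 0, by the convention [0^-1 = 0]; thus no exceptional set
    arises. *)
Lemma cauchy_cvg (z : C) : ccvg (fun n => cauchy n.+1%:R^-1 z) z^-1.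
Proof.
have [->|z0] := eqVneq z 0.
  rewrite invr0; apply: (ccvg_ext _ (ccvg_cst 0)) => n.
  by rewrite /cauchy conjc0 mul0r.
have m0 : 0 < modc z by rewrite modc_gt0.
have -> : z^-1 = conjc z * ((modc z ^+ 2 + 0 ^+ 2)^-1)%:C%C.
  rewrite expr0n/= addr0 sqr_modc; apply: complex_ext.
    by rewrite ReV ReM; case: z {z0 m0} => a b /=; rewrite mulr0 subr0.
  by rewrite ImV ImM; case: z {z0 m0} => a b /=; rewrite mulr0 add0r.
apply: ccvgM; first exact: ccvg_cst.
apply: ccvg_real; apply: cvgV; first by rewrite expr0n/= addr0 expf_neq0// gt_eqF.
apply: cvgD; first exact: cvg_cst.
by rewrite expr2; under eq_fun do rewrite expr2; apply: cvgM; exact: cvg_harmonic.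
Qed.

Lemma poisson_cvg0 (z : C) : z != 0 ->
  ccvg (fun n => (poisson n.+1%:R^-1 z)%:C%C) 0.
Proof.
move=> z0; have m0 : 0 < modc z by rewrite modc_gt0.
rewrite -[0 : C]/((0 : R)%:C%C); apply: ccvg_real.
have -> : 0 = 0 * 0 / (modc z ^+ 2 + 0 * 0) ^+ 2 :> R by rewrite !mul0r.
have sq : (fun n : nat => (n.+1%:R^-1 : R) ^+ 2) @ \oo --> (0 * 0 : R).
  by under eq_fun do rewrite expr2; apply: cvgM; exact: cvg_harmonic.
apply: cvgM => //; apply: cvgV.
  by rewrite mulr0 addr0 !expf_neq0// gt_eqF.
rewrite [X in _ --> X]expr2; under eq_fun do rewrite expr2.
by apply: cvgM; (apply: cvgD; [exact: cvg_cst|exact: sq]).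
Qed.

Lemma ge0_Rintegral_le (h : plane R -> R) (K : R) : measurable_fun setT (h : mplane R -> R) ->
  (forall p, 0 <= h p) -> (\int[mu]_p (h p)%:E <= K%:E)%E ->
  mu.-integrable setT (EFin \o h : mplane R -> \bar R) /\ \int[mu]_p h p <= K.
Proof.
move=> mh h0 hK.
have p0 : (0 <= \int[mu]_p (h p)%:E)%E by apply: integral_ge0 => p _; rewrite lee_fin.
have lty : (\int[mu]_p (h p)%:E < +oo)%E by rewrite (le_lt_trans hK)// ltry.
split; last by rewrite -lee_fin /Rintegral fineK ?ge0_fin_numE.
apply/integrableP; split; first exact/measurable_EFinP.
rewrite (_ : (\int[mu]_p _)%E = (\int[mu]_p (h p)%:E)%E)//.
by apply: eq_integral => p _; rewrite /= ger0_norm.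
Qed.

Lemma holder_continuous (h : plane R -> R) (c p : plane R) (r K e : R) : 0 < e ->
  (forall q, `|q - c| < r -> `|h q - h p| <= K * `|q - p| `^ e) -> `|p - c| < r ->
  {for p, continuous h}.
Proof.
move=> e0 hK hp; apply/cvgrPdist_lt => d d0.
have K1 : 0 < `|K| + 1 by rewrite ltr_wpDl.
pose s := Num.min (r - `|p - c|) ((d / (`|K| + 1)) `^ e^-1).
have dK : 0 < d / (`|K| + 1) by rewrite divr_gt0.
have s0 : 0 < s by rewrite lt_min subr_gt0 hp powR_gt0.
change (nbhs p [set q | `|h p - h q| < d]).
apply/nbhs_ballP; exists s => // q /plane_ballP.
rewrite lt_min => /andP[q1 q2] /=; rewrite distrC.
have qc : `|q - c| < r by have := ler_distD p q c; lra.
apply: (le_lt_trans (hK q qc)).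
apply: (@le_lt_trans _ _ (`|K| * `|q - p| `^ e)); first by rewrite ler_wpM2r ?powR_ge0 ?ler_norm.
have : `|q - p| `^ e < d / (`|K| + 1).
  have -> : d / (`|K| + 1) = ((d / (`|K| + 1)) `^ e^-1) `^ e.
    by rewrite -powRrM mulVf ?gt_eqF// powRr1// ltW.
  by apply: gt0_ltr_powR => //; rewrite nnegrE// powR_ge0.
rewrite ltr_pdivlMr// => h1; apply: le_lt_trans h1.
by rewrite mulrC ler_wpM2l ?powR_ge0// lerDl.
Qed.

(** The exceptional points lie on the four lines that carry the sides, and lines are null. *)
Lemma rectangle_ae (a b a' b' : R) : let Q := `]a, b[%classic `*` `]a', b'[%classic in
  {ae mu, forall xi : plane R, (exists2 delta, 0 < delta & ball xi delta `<=` Q) \/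
    (exists2 delta, 0 < delta & forall p, Q p -> delta <= `|p - xi|)}.
Proof.
move=> Q.
have l1 x : mu.-negligible ([set x] `*` setT : set (plane R)).
  apply/negligibleP; first exact: measurableX.
  have e0 := lebesgue_measure_set1 x.
  transitivity (0 * @lebesgue_measure R setT)%E; last exact: mul0e.
  by rewrite -e0; exact: product_measure1E.
have l2 x : mu.-negligible (setT `*` [set x] : set (plane R)).
  apply/negligibleP; first exact: measurableX.
  have e0 := lebesgue_measure_set1 x.
  transitivity (@lebesgue_measure R setT * 0)%E; last exact: mule0.
  by rewrite -e0; exact: product_measure1E.
have nU A A' : mu.-negligible A -> mu.-negligible A' -> mu.-negligible (A `|` A').
  exact: negligibleU.
have nn := nU _ _ (nU _ _ (l1 a) (l1 b)) (nU _ _ (l2 a') (l2 b')).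
apply: (@negligibleS _ (mplane R) R mu _ _ _ nn) => -[x y] /= hn.
apply: contrapT => hxy; apply: hn.
have xa : x != a by apply/eqP => e; apply: hxy; left; left; rewrite e.
have xb : x != b by apply/eqP => e; apply: hxy; left; right; rewrite e.
have ya : y != a' by apply/eqP => e; apply: hxy; right; left; rewrite e.
have yb : y != b' by apply/eqP => e; apply: hxy; right; right; rewrite e.
have far (d : R) : 0 < d -> (forall p, Q p -> d <= `|p.1 - x| \/ d <= `|p.2 - y|) ->
    exists2 delta, 0 < delta & forall p, Q p -> delta <= `|p - (x, y)|.
  move=> d0 hd; exists d => // p /hd; rewrite plane_normE le_max /=.
  by case=> ->; rewrite ?orbT.
have [xa'|xa'|/eqP] := ltgtP x a; last by rewrite (negbTE xa).
  right; apply: (far (a - x)); first by rewrite subr_gt0.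
  move=> p [/= + _]; rewrite in_itv/= => /andP[h _]; left.
  by rewrite ger0_norm; lra.
have [xb'|xb'|/eqP] := ltgtP x b; last by rewrite (negbTE xb).
  have [ya'|ya'|/eqP] := ltgtP y a'; last by rewrite (negbTE ya).
    right; apply: (far (a' - y)); first by rewrite subr_gt0.
    move=> p [/= _]; rewrite in_itv/= => /andP[h _]; right.
    by rewrite ger0_norm; lra.
  have [yb'|yb'|/eqP] := ltgtP y b'; last by rewrite (negbTE yb).
    left; exists (Num.min (Num.min (x - a) (b - x)) (Num.min (y - a') (b' - y))).
      by rewrite !lt_min !subr_gt0 xa' xb' ya'.
    move=> p /plane_ballP; rewrite plane_normE gt_max !lt_min /= !ltr_norml.
    move=> /andP[/andP[/andP[h1 h2] _] /andP[_ /andP[h3 h4]]].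
    by split; rewrite /= in_itv/=; apply/andP; split; lra.
  right; apply: (far (y - b')); first by rewrite subr_gt0.
  move=> p [/= _]; rewrite in_itv/= => /andP[_ h]; right.
  by rewrite ler0_norm; lra.
right; apply: (far (x - b)); first by rewrite subr_gt0.
move=> p [/= + _]; rewrite in_itv/= => /andP[_ h]; left.
by rewrite ler0_norm; lra.
Qed.

Definition cauchy_transform (Z g : plane R -> C) (z : C) : C :=
  cintegral setT (fun p => g p * (Z p - z)^-1).

Lemma cmeasurable_cauchy (h : plane R -> C) (d : R) : cmeasurable setT h ->
  cmeasurable setT (fun p => cauchy d (h p)).
Proof.
move=> mh; have [h1 h2] := mh; have m := measurable_modc mh.
apply: cmeasurableM.
  split=> /=.
    by rewrite (_ : (fun _ => _) = (fun p => complex.Re (h p)))//; apply/funext => p; case: (h p).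
  rewrite (_ : (fun _ => _) = (fun p => - complex.Im (h p))); last by apply/funext => p; case: (h p).
  exact: measurableT_comp.
apply: cmeasurable_real; under eq_fun do rewrite -powR_inv1 ?addr_ge0 ?sqr_ge0//.
apply: (measurableT_comp (measurable_powR _)).
by apply: measurable_funD => //; exact: measurable_funX.
Qed.

Lemma measurable_poisson d' (T : measurableType d') (h : T -> C) (d : R) :
  measurable_fun setT (fun p => complex.Re (h p)) ->
  measurable_fun setT (fun p => complex.Im (h p)) ->
  measurable_fun setT (fun p => poisson d (h p)).
Proof.
move=> h1 h2; rewrite /poisson; apply: measurable_funM => //.
under eq_fun do rewrite -powR_inv1 ?sqr_ge0//.
apply: (measurableT_comp (measurable_powR _)); apply: measurable_funX.
apply: measurable_funD => //; under eq_fun do rewrite sqr_modc.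
by apply: measurable_funD; exact: measurable_funX.
Qed.

Lemma cauchy_transform_cvg (Z g : plane R -> C) (G : plane R -> R) (z : C) :
  cmeasurable setT Z -> cmeasurable setT g ->
  mu.-integrable setT (EFin \o G : mplane R -> \bar R) ->
  (forall p, modc (g p) * (modc (Z p - z))^-1 <= G p) ->
  cintegrable (fun p => g p * (Z p - z)^-1) /\
  ccvg (fun n => cintegral setT (fun p => g p * cauchy n.+1%:R^-1 (Z p - z)))
    (cauchy_transform Z g z).
Proof.
move=> mZ mg iG gG.
have mz : cmeasurable setT (fun p => Z p - z).
  by apply: cmeasurableD => //; exact: (cmeasurable_cst _ (- z)).
apply: (@cintegral_dominated R _ _ G) => //.
- by move=> n; apply: cmeasurableM => //; exact: cmeasurable_cauchy.
- by apply: cmeasurableM => //; exact: cmeasurableV.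
- move=> n p; rewrite modcM (le_trans _ (gG p))// ler_wpM2l ?modc_ge0//.
  by apply: modc_cauchy_le; rewrite invr_gt0.
- by apply: ae_all => p; apply: ccvgM; [exact: ccvg_cst|exact: cauchy_cvg].
Qed.

Section separated.
Variables (Z g : plane R -> C) (e : R).
Hypotheses (mZ : cmeasurable setT Z) (ig : cintegrable g) (e0 : 0 < e).

(** The distance [e] is kept from the values of [Z] where [g] is nonzero. The transform is
    holomorphic near such [z], which is used only through the Lipschitz bound and the expansion of
    first order below. *)
Definition separated_from (z : C) := forall p, g p != 0 -> e <= modc (Z p - z).

Let N := \int[mu]_p (modc (g p) : R).

Let N0 : 0 <= N.
Proof. by apply: Rintegral_ge0 => p _; exact: modc_ge0. Qed.

Let bounded_factor (k : plane R -> C) (K : R) : 0 <= K -> cmeasurable setT k ->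
  (forall p, g p != 0 -> modc (k p) <= K) ->
  cintegrable (fun p => g p * k p) /\ modc (cintegral setT (fun p => g p * k p)) <= N * K.
Proof.
move=> K0 mk hk.
have b p : modc (g p * k p) <= modc (g p) * K.
  have [->|gp] := eqVneq (g p) 0; first by rewrite mul0r !modc0 mul0r.
  by rewrite modcM ler_wpM2l ?modc_ge0 ?hk.
have iK : mu.-integrable setT (EFin \o (fun p => modc (g p) * K) : mplane R -> \bar R).
  exact: (integrableZr measurableT _ (integrable_modc ig)).
have ik : cintegrable (fun p => g p * k p).
  apply: (cintegrable_le _ iK) => //.
  by apply: cmeasurableM => //; exact: cintegrable_measurable.
split=> //; rewrite (le_trans (modc_cintegral_le ik))//.
rewrite /N -RintegralZr//; last exact: integrable_modc.
apply: le_Rintegral => //; exact: integrable_modc.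
Qed.

Let mz (z : C) : cmeasurable setT (fun p => Z p - z).
Proof. by apply: cmeasurableD => //; exact: (cmeasurable_cst _ (- z)). Qed.

Let mVz (z : C) : cmeasurable setT (fun p => (Z p - z)^-1).
Proof. exact: cmeasurableV. Qed.

Let inv_le z p : separated_from z -> g p != 0 -> modc (Z p - z)^-1 <= e^-1 /\ Z p - z != 0.
Proof.
move=> sz /sz ez; split; last by rewrite -modc_gt0 (lt_le_trans e0).
by rewrite modcV lef_pV2 ?posrE// (lt_le_trans e0).
Qed.

Let inv_ge0 : 0 <= e^-1. Proof. by rewrite invr_ge0 ltW. Qed.

Definition cauchy_transform_deriv (z : C) :=
  cintegral setT (fun p => g p * ((Z p - z)^-1 * (Z p - z)^-1)).

Lemma cauchy_transform_separated z : separated_from z ->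
  cintegrable (fun p => g p * (Z p - z)^-1).
Proof.
move=> sz; apply: (proj1 (@bounded_factor _ e^-1 _ _ _)) => // p gp.
by have [] := inv_le sz gp.
Qed.

Lemma cauchy_transform_lipschitz z z' : separated_from z -> separated_from z' ->
  modc (cauchy_transform Z g z - cauchy_transform Z g z') <=
    N * (e^-1 * e^-1) * modc (z - z').
Proof.
move=> sz sz'; rewrite -cintegralB; try exact: cauchy_transform_separated.
rewrite (_ : (fun p => _) = fun p => g p * ((z - z') * ((Z p - z)^-1 * (Z p - z')^-1))); last first.
  apply/funext => p; have [->|gp] := eqVneq (g p) 0; first by rewrite !mul0r subrr.
  have [_ n1] := inv_le sz gp; have [_ n2] := inv_le sz' gp.
  by field; rewrite n1 n2.
rewrite -mulrA [_ * modc _]mulrC.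
apply: (proj2 (@bounded_factor _ (modc (z - z') * (e^-1 * e^-1)) _ _ _)).
- by rewrite !mulr_ge0 ?modc_ge0.
- apply: cmeasurableM; first exact: cmeasurable_cst.
  exact: cmeasurableM.
move=> p gp; have [n1 _] := inv_le sz gp; have [n2 _] := inv_le sz' gp.
by rewrite modcM ler_wpM2l ?modc_ge0// modcM ler_pM ?modc_ge0.
Qed.

(** With [a = 1 / (Z - z)] and [b = 1 / (Z - z')] one has exactly [b - a - (z' - z) a ^ 2 = (z' - z)
    ^ 2 a ^ 2 b], and both [a] and [b] are bounded by [1 / e]. *)
Lemma cauchy_transform_expansion z z' : separated_from z -> separated_from z' ->
  modc (cauchy_transform Z g z' - cauchy_transform Z g z -
    (z' - z) * cauchy_transform_deriv z) <=
    N * (e^-1 * e^-1 * e^-1) * modc (z' - z) ^+ 2.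
Proof.
move=> sz sz'.
have i2 : cintegrable (fun p => g p * ((Z p - z)^-1 * (Z p - z)^-1)).
  apply: (proj1 (@bounded_factor _ (e^-1 * e^-1) _ _ _)) => //.
  - by rewrite mulr_ge0.
  - exact: cmeasurableM.
  by move=> p gp; have [n1 _] := inv_le sz gp; rewrite modcM ler_pM ?modc_ge0.
rewrite -cintegralB; try exact: cauchy_transform_separated.
rewrite /cauchy_transform_deriv -cintegralZ// -cintegralB; last 2 first.
- rewrite (_ : (fun p => _) = fun p => g p * (Z p - z')^-1 + - (g p * (Z p - z)^-1))//.
  by apply: cintegrableD; last apply: cintegrableN; exact: cauchy_transform_separated.
- exact: cintegrableZ.
rewrite (_ : (fun p => _) = fun p => g p * ((z' - z) * (z' - z) *
    ((Z p - z)^-1 * (Z p - z)^-1 * (Z p - z')^-1))); last first.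
  apply/funext => p; have [->|gp] := eqVneq (g p) 0.
    by rewrite !mul0r mulr0 !subrr.
  have [_ n1] := inv_le sz gp; have [_ n2] := inv_le sz' gp.
  by field; rewrite n1 n2.
rewrite -mulrA [_ * modc _ ^+ 2]mulrC.
apply: (proj2 (@bounded_factor _ (modc (z' - z) ^+ 2 * (e^-1 * e^-1 * e^-1)) _ _ _)).
- by rewrite !mulr_ge0 ?sqr_ge0 ?modc_ge0.
- apply: cmeasurableM; first exact: cmeasurable_cst.
  by apply: cmeasurableM => //; exact: cmeasurableM.
move=> p gp; have [n1 _] := inv_le sz gp; have [n2 _] := inv_le sz' gp.
rewrite modcM [modc (_ * (z' - z))]modcM -expr2 ler_wpM2l ?sqr_ge0//.
by rewrite !modcM !ler_pM ?mulr_ge0 ?modc_ge0.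
Qed.

End separated.
End cauchy_transform.

(** * Representation of a solution by Cauchy transforms *)

Section representation.
Variable R : realType.
Local Notation mu := (leb2 R).
Local Notation C := R[i].
Variables (c : plane R) (r M C0 m eps : R) (Z Zx Zy : plane R -> C).
Local Notation J := (jac Zx Zy).
Hypotheses (hZ : local_integral c r M Z Zx Zy)
  (sep : forall d, 0 < d -> exists2 e, 0 < e & forall p q, `|p - c| < r ->
     `|q - c| < r -> d <= `|p - q| -> e <= modc (Z p - Z q))
  (C00 : 0 <= C0)
  (vol : forall z s, 0 < s -> (mu (ball c r `&` [set p | (modc (Z p - z) < s)%R]) <=
     (C0 * s `^ m)%:E)%E)
  (m1 : 1 < m) (eps1 : `|eps| = 1)
  (jsgn : forall p, `|p - c| < r -> 0 <= eps * J p)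
  (jnull : mu.-negligible (ball c r `&` [set p | J p = 0])).
Variables (rho r2 : R) (chi chix chiy : plane R -> R).
Hypotheses (hchi : cutoff c r rho chi chix chiy) (chi01 : forall p, 0 <= chi p <= 1)
  (r2rho : r2 < rho) (chi1 : forall p, `|p - c| <= r2 -> chi p = 1).

Let mZ : cmeasurable setT Z. Proof. by case: hZ => _ []. Qed.

Let mZz z : cmeasurable setT (fun p => Z p - z).
Proof. by apply: cmeasurableD => //; exact: (cmeasurable_cst _ (- z)). Qed.

Let mJ : measurable_fun setT (J : mplane R -> R).
Proof.
have [_ [_ [a1 a2] [b1 b2]] _ _ _] := hZ.
by apply: measurable_funB; exact: measurable_funM.
Qed.

Let M0 : 0 <= M.
Proof. by have [_ _ /(_ c)[h _] _ _] := hZ; exact: le_trans (modc_ge0 _) h. Qed.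

Let J_le p : `|J p| <= 2 * M ^+ 2.
Proof.
have [_ _ /(_ p)[h1 h2] _ _] := hZ.
have k (x y : C) : modc x <= M -> modc y <= M -> `|complex.Re x * complex.Im y| <= M ^+ 2.
  move=> hx hy; rewrite normrM expr2; apply: ler_pM => //.
    exact: le_trans (normr_Re_le _) hx.
  exact: le_trans (normr_Im_le _) hy.
rewrite /jac (le_trans (ler_normB _ _))// mulr_natl mulr2n.
by apply: lerD; exact: k.
Qed.

Let rho_r : rho < r. Proof. by case: hchi. Qed.

Let chi_off p : r <= `|p - c| -> chi p = 0.
Proof. by have [_ _ _ _ h] := hchi => hp; apply: h; exact: le_trans (ltW rho_r) hp. Qed.

Let mchi : measurable_fun setT (chi : mplane R -> R).
Proof. by have [_ _ h _ _] := hchi; exact: smooth_expr_measurable. Qed.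

Definition Lchi p := Lgrad Zx Zy (fun p => (chix p)%:C%C) (fun p => (chiy p)%:C%C) p.

(** [L chi] lives where the cutoff varies. It is thus kept away from smaller concentric squares, on
    which its transform will be holomorphic along [Z]. *)
Lemma Lchi_support p : Lchi p != 0 -> r2 <= `|p - c| < r.
Proof.
move=> h; apply/andP; split; last first.
  rewrite ltNge; apply: contraNN h => hp; have := cutoff_grad0 hchi (lt_le_trans rho_r hp).
  by case=> _ x0 y0; rewrite /Lchi /Lgrad x0 y0 !mulr0 subrr.
rewrite leNgt; apply: contraNN h => hp.
have [_ _ _ gchi _] := hchi.
have : \forall q \near p, chi q - 1 = 0.
  apply/nbhs_ballP; exists (r2 - `|p - c|) => /=; first by rewrite subr_gt0.
  move=> q /plane_ballP hq; rewrite chi1 ?subrr//.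
  by have := ler_distD p q c; lra.
move=> /has_grad_near0/(_ (has_gradD (gchi p) (has_grad_cst (-1) p)))[].
by rewrite !addr0 => x0 y0; rewrite /Lchi /Lgrad x0 y0 !mulr0 subrr.
Qed.

Let mLchi : cmeasurable setT Lchi.
Proof.
have [_ _ schi gchi _] := hchi.
have [cx cy] := smooth_expr_grad_continuous schi gchi.
have [_ [_ a b] _ _ _] := hZ.
apply: cmeasurableD; last apply: cmeasurableN; apply: cmeasurableM => //;
  by apply: cmeasurable_real; exact: continuous_measurable_fun_plane.
Qed.

Lemma Lchi_bound : exists2 K, 0 < K & forall p, modc (Lchi p) <= K.
Proof.
have [K K0 hK] := cutoff_bound hchi.
exists (2 * (M * K) + 1) => [|p]; first by rewrite ltr_wpDl ?mulr_ge0 ?(ltW K0).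
have [_ _ /(_ p)[h1 h2] _ _] := hZ; have [_ k1 k2] := hK p.
rewrite /Lchi /Lgrad (le_trans (modcB _ _))// !modcM !modcR.
have : modc (Zx p) * `|chiy p| <= M * K by apply: ler_pM => //; exact: modc_ge0.
have : modc (Zy p) * `|chix p| <= M * K by apply: ler_pM => //; exact: modc_ge0.
lra.
Qed.

Let iB (K : R) : mu.-integrable setT (EFin \o (fun p => K * \1_(ball c r) p) : mplane R -> \bar R).
Proof.
apply: (@integrable_bounded_support R _ c r `|K|).
- apply: measurable_funM => //.
  by apply: (@measurable_indic _ (mplane R) R setT (ball c r)); exact: measurable_plane_ball.
- move=> p; rewrite normrM indicE; case: (_ \in _); first by rewrite normr1 mulr1.
  by rewrite normr0 mulr0.
- move=> p hp; rewrite indicE memNset ?mulr0// => /plane_ballP.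
  by rewrite ltNge (ltW hp).
Qed.

Let cut_le (g : plane R -> C) (K : R) : (forall p, modc (g p) <= K) ->
  (forall p, g p != 0 -> `|p - c| < r) -> forall p, modc (g p) <= K * \1_(ball c r) p.
Proof.
move=> gK g0 p; rewrite indicE; have [gp|gp] := eqVneq (g p) 0.
  by rewrite gp modc0 mulr_ge0// (le_trans (modc_ge0 (g p))).
by rewrite mem_set ?mulr1//; apply/plane_ballP; exact: g0.
Qed.

Lemma Lchi_integrable : cintegrable Lchi.
Proof.
have [K _ hK] := Lchi_bound.
apply: (cintegrable_le mLchi (iB K)); apply: cut_le => // p /Lchi_support/andP[].
by [].
Qed.

Lemma separated_support (r3 : R) : r3 < r2 -> exists2 e, 0 < e &
  forall (g : plane R -> C), (forall p, g p != 0 -> r2 <= `|p - c| < r) ->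
  forall p, `|p - c| < r3 -> separated_from Z g e (Z p).
Proof.
move=> r32; have d0 : 0 < r2 - r3 by rewrite subr_gt0.
have [e e0 he] := sep d0; exists e => // g hg p hp q /hg/andP[q2 qr].
apply: he => //; first by rewrite (lt_trans hp)// (lt_trans r32)// (lt_trans r2rho).
by have := ler_distD p q c; lra.
Qed.

(** Uniform in [z] because the area bound [vol] is; [1 < m] makes the inverse integrable. These
    integrals dominate the regularised kernels. *)
Lemma inverse_integral : exists2 M1, 0 <= M1 & forall z,
  mu.-integrable setT (EFin \o (fun p => \1_(ball c r) p * (modc (Z p - z))^-1) : mplane R -> \bar R) /\
  (\int[mu]_p (\1_(ball c r) p * (modc (Z p - z))^-1)) <= M1.
Proof.
have mB : measurable (ball c r : set (mplane R)) := measurable_plane_ball c r.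
have Boo := leb2_ball_lty c r.
set K := C0 * 2 `^ 1 * 1 `^ (m - 1) / (1 - 2^-1 `^ (m - 1)).
have b z : (\int[mu]_p (\1_(ball c r) p * (modc (Z p - z))^-1)%:E <= K%:E + mu (ball c r))%E.
  apply: (@inverse_bound R (ball c r) (fun p => modc (Z p - z)) C0 m) => //.
  - exact: measurable_modc.
  - by move=> p; exact: modc_ge0.
  - exact: vol.
have fB : mu (ball c r) \is a fin_num by rewrite ge0_fin_numE.
have e : (K%:E + mu (ball c r) = (K + fine (mu (ball c r)))%:E)%E by rewrite EFinD fineK.
have K0 z : 0 <= (\1_(ball c r) z : R) by rewrite indicE.
exists (`|K + fine (mu (ball c r))|) => // z; apply: ge0_Rintegral_le.
- apply: measurable_indicM => //; apply: measurable_funTS.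
  under eq_fun do rewrite -modcV; apply: measurable_modc; exact: cmeasurableV.
- by move=> p; rewrite mulr_ge0// invr_ge0 modc_ge0.
by rewrite (le_trans (b z))// e lee_fin ler_norm.
Qed.

(** The density [J] makes this, formally, an integral of the kernel over the image of [Z]. *)
Definition poisson_mean (d : R) (z : C) (a : plane R -> R) : C :=
  cintegral setT (fun p => (a p * J p * poisson d (Z p - z))%:C%C).

Let mpoi d z (a : plane R -> R) : measurable_fun setT (a : mplane R -> R) ->
  measurable_fun setT (fun p : mplane R => a p * J p * poisson d (Z p - z)).
Proof.
move=> ma; apply: measurable_funM; first exact: measurable_funM.
by case: (mZz z) => h1 h2; exact: measurable_poisson.
Qed.

Let poi_bound d z (a : plane R -> R) K : 0 < d -> (forall p, `|a p| <= K) ->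
  (forall p, r <= `|p - c| -> a p = 0) ->
  forall p, `|a p * J p * poisson d (Z p - z)| <= K * (2 * M ^+ 2) * d ^- 2 * \1_(ball c r) p.
Proof.
move=> d0 aK a0 p.
have := @cut_le (fun p => (a p * J p * poisson d (Z p - z))%:C%C) (K * (2 * M ^+ 2) * d ^- 2).
move=> /(_ _ _ p); rewrite modcR; apply=> {}p.
  rewrite modcR normrM [`|a p * _|]normrM; apply: ler_pM => //.
    by apply: ler_pM.
  by rewrite ger0_norm ?poisson_ge0// poisson_le.
by rewrite ltNge; apply: contraNN => /a0 ->; rewrite !mul0r.
Qed.

Lemma poisson_mean_integrable d z a K : 0 < d ->
  measurable_fun setT (a : mplane R -> R) -> (forall p, `|a p| <= K) ->
  (forall p, r <= `|p - c| -> a p = 0) ->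
  cintegrable (fun p => (a p * J p * poisson d (Z p - z))%:C%C).
Proof.
move=> d0 ma aK a0; apply: (cintegrable_le _ (iB (K * (2 * M ^+ 2) * d ^- 2))).
  by apply: cmeasurable_real; exact: mpoi.
by move=> p; rewrite modcR; exact: poi_bound.
Qed.

Let chi_norm p : `|chi p| <= 1.
Proof. by have /andP[h1 h2] := chi01 p; rewrite ger0_norm. Qed.

(** The kernel identity for the solution 1 with right side 0. *)
Lemma poisson_mean_cauchy d z : 0 < d ->
  2 * 'i%C * poisson_mean d z chi = cintegral setT (fun p => Lchi p * cauchy d (Z p - z)).
Proof.
move=> d0.
have iw : cintegrable (fun p => (\1_(ball c r) p)%:C%C : C).
  apply: (cintegrable_le _ (iB 1)).
    apply: cmeasurable_real.
    by apply: (@measurable_indic _ (mplane R) R setT (ball c r)); exact: measurable_plane_ball.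
  by move=> p; rewrite modcR mul1r ger0_norm.
have i0 : cintegrable (fun=> 0 : C).
  apply: (cintegrable_le _ (iB 0)); first exact: cmeasurable_cst.
  by move=> p; rewrite modc0 mul0r.
have [_ _ e] := kernel_identity z hZ hchi iw i0 (weak_on_one hZ) d0.
rewrite /poisson_mean (_ : (fun p => (chi p * _ * _)%:C%C) = (fun p => (\1_(ball c r) p)%:C%C *
    (chi p * J p * poisson d (Z p - z))%:C%C)) ?e.
  congr cintegral; apply/funext => p; rewrite mul0r add0r -/(Lchi p).
  have [->|/Lchi_support/andP[_ h]] := eqVneq (Lchi p) 0; first by rewrite mulr0 mul0r.
  by rewrite indicE mem_set ?mul1r//; exact/plane_ballP.
apply/funext => p; rewrite indicE; case: (boolP (p \in _)) => [_|h]; first by rewrite mul1r.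
rewrite chi_off ?mul0r ?mulr0//.
by rewrite leNgt; apply: contraNN h => h; rewrite inE; exact/plane_ballP.
Qed.

Let Lchi_dom z : exists K, [/\ 0 <= K, mu.-integrable setT
    (EFin \o (fun p => K * (\1_(ball c r) p * (modc (Z p - z))^-1)) : mplane R -> \bar R) &
  forall p, modc (Lchi p) * (modc (Z p - z))^-1 <= K * (\1_(ball c r) p * (modc (Z p - z))^-1)].
Proof.
have [M1 _ /(_ z)[hi _]] := inverse_integral; have [K K0 hK] := Lchi_bound.
exists K; split; first exact: ltW.
  exact: (integrableZl measurableT _ hi).
move=> p; rewrite mulrA ler_wpM2r ?invr_ge0 ?modc_ge0//.
by apply: cut_le => // q /Lchi_support/andP[].
Qed.

(** The kernel [poisson d] itself reaches [d ^ (- 2)]. The identity trades it for [cauchy d], which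
    is dominated by [1 / |Z - z|] uniformly in [d]. *)
Lemma poisson_mean_bound : exists2 M2, 0 <= M2 &
  forall d z, 0 < d -> modc (poisson_mean d z chi) <= M2.
Proof.
have [M1 M10 hM1] := inverse_integral; have [K K0 hK] := Lchi_bound.
have K0' := ltW K0.
exists (K * M1); first exact: mulr_ge0.
move=> d z d0; have [i1 b1] := hM1 z.
have dom p : modc (Lchi p * cauchy d (Z p - z)) <= K * (\1_(ball c r) p * (modc (Z p - z))^-1).
  rewrite modcM mulrA; apply: ler_pM; rewrite ?modc_ge0//; last exact: modc_cauchy_le.
  by apply: cut_le => // q /Lchi_support/andP[].
have iK := integrableZl measurableT K i1.
have il : cintegrable (fun p => Lchi p * cauchy d (Z p - z)).
  by apply: (cintegrable_le _ iK) => //; apply: cmeasurableM => //; exact: cmeasurable_cauchy.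
have : modc (2 * 'i%C * poisson_mean d z chi) <= K * M1.
  rewrite poisson_mean_cauchy// (le_trans (modc_cintegral_le il))//.
  apply: (@le_trans _ _ (\int[mu]_p (K * (\1_(ball c r) p * (modc (Z p - z))^-1)))).
    by apply: le_Rintegral => //; exact: integrable_modc.
  by rewrite RintegralZl// ler_wpM2l.
rewrite modcM; have -> : modc (2 * 'i%C : C) = 2.
  rewrite modcM [X in _ * X]modcE /= expr0n/= add0r expr1n sqrtr1 mulr1.
  have -> : (2 : C) = (2 : R)%:C%C by rewrite rmorph_nat.
  by rewrite modcR ger0_norm.
by have := modc_ge0 (poisson_mean d z chi); lra.
Qed.

(** The function H, which is the limit of [2 i] times the means of the cutoff. *)
Definition chi_transform z := cauchy_transform Z Lchi z.

Lemma chi_transform_cvg z :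
  ccvg (fun n => 2 * 'i%C * poisson_mean n.+1%:R^-1 z chi) (chi_transform z).
Proof.
have [K [K0 iK hK]] := Lchi_dom z.
have [_] := cauchy_transform_cvg mZ mLchi iK hK.
by apply: ccvg_ext => n; rewrite poisson_mean_cauchy// invr_gt0.
Qed.

(** A limit of numbers [2 i x] with [x] real. *)
Lemma Re_chi_transform z : complex.Re (chi_transform z) = 0.
Proof.
have /ccvgP[h _] := chi_transform_cvg z.
apply: (cvg_unique _ h) => //; rewrite (_ : (fun n => _) = fun=> 0); first exact: cvg_cst.
apply/funext => n; set w := poisson_mean _ _ _.
have -> : w = (complex.Re w)%:C%C.
  by apply: complex_ext => //=; rewrite /w /= Rintegral_cst// mul0r.
have -> : (2 : C) = (2 : R)%:C%C by rewrite rmorph_nat.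
by rewrite !(ReM, ImM) /=; ring.
Qed.

(** The constant sign of [J] enters here: nothing cancels in the mean of [chi], which therefore
    bounds the mean of every function between 0 and [chi]. *)
Lemma poisson_mean_monotone d z a : 0 < d -> measurable_fun setT (a : mplane R -> R) ->
  (forall p, 0 <= a p <= chi p) ->
  (\int[mu]_p (a p * `|J p| * poisson d (Z p - z))) <= modc (poisson_mean d z chi) /\
  modc (poisson_mean d z a) <= modc (poisson_mean d z chi).
Proof.
move=> d0 ma ha.
have a0 p : 0 <= a p by case/andP: (ha p).
have ac p : a p <= chi p by case/andP: (ha p).
have aoff p : r <= `|p - c| -> a p = 0.
  by move=> /chi_off c0; apply/eqP; rewrite eq_le a0 andbT -c0.
have an p : `|a p| <= 1.
  by rewrite ger0_norm// (le_trans (ac p))//; case/andP: (chi01 p).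
have eJ b p : b p = 0 \/ `|p - c| < r -> b p * `|J p| = eps * (b p * J p) :> R.
  case=> [->|h]; first by rewrite !mul0r mulr0.
  rewrite -[`|J p|]mul1r -eps1 -normrM ger0_norm ?jsgn//; ring.
have off (b : plane R -> R) p : (forall p, r <= `|p - c| -> b p = 0) -> b p = 0 \/ `|p - c| < r.
  by move=> b0; have [/b0|] := leP r `|p - c|; [left|right].
have ia := poisson_mean_integrable z d0 ma an aoff.
have ic := poisson_mean_integrable z d0 mchi chi_norm chi_off.
have ia' := integrable_modc ia; have [ic1 _] := ic.
have ea p : modc (a p * J p * poisson d (Z p - z))%:C%C = a p * `|J p| * poisson d (Z p - z).
  by rewrite modcR normrM [X in X * _]normrM (ger0_norm (poisson_ge0 _ _)) (ger0_norm (a0 p)).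
have hle : \int[mu]_p (a p * `|J p| * poisson d (Z p - z)) <= modc (poisson_mean d z chi).
  apply: (@le_trans _ _ (eps * (\int[mu]_p (chi p * J p * poisson d (Z p - z))))).
    rewrite -RintegralZl//.
    apply: le_Rintegral => //.
    - by under eq_fun do rewrite -ea.
    - exact: (integrableZl measurableT eps ic1).
    move=> p _; rewrite mulrA; rewrite -(@eJ chi); last exact: off.
    by rewrite ler_wpM2r ?poisson_ge0// ler_wpM2r.
  rewrite (le_trans (ler_norm _))// normrM eps1 mul1r.
  exact: (normr_Re_le (poisson_mean d z chi)).
split=> //; apply: le_trans hle.
rewrite (le_trans (modc_cintegral_le ia))//.
by under eq_Rintegral do rewrite ea.
Qed.

(** By separation [|Z - Z xi|] stays above some [e] where [a] is nonzero, and there [poisson d] is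
    at most [d ^ 2 / e ^ 4]. *)
Lemma poisson_mean_off a K xi delta : measurable_fun setT (a : mplane R -> R) ->
  (forall p, `|a p| <= K) -> (forall p, r <= `|p - c| -> a p = 0) ->
  `|xi - c| < r -> 0 < delta -> (forall p, `|p - xi| < delta -> a p = 0) ->
  ccvg (fun n => poisson_mean n.+1%:R^-1 (Z xi) a) 0.
Proof.
move=> ma aK a0 hxi d0 ad.
have [e e0 he] := sep d0.
have K0 : 0 <= K by exact: le_trans (normr_ge0 _) (aK c).
have ez p : a p != 0 -> e <= modc (Z p - Z xi).
  move=> ap; apply: he => //.
    by rewrite ltNge; apply: contraNN ap => /a0 ->.
  by rewrite leNgt; apply: contraNN ap => /ad ->.
have n0 n : 0 < n.+1%:R^-1 :> R by rewrite invr_gt0.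
have n1 n : n.+1%:R^-1 <= 1 :> R by rewrite invf_le1// ler1n.
have bd n p : modc (a p * J p * poisson n.+1%:R^-1 (Z p - Z xi))%:C%C <=
    K * (2 * M ^+ 2) * (e ^+ 2) ^- 2 * \1_(ball c r) p.
  move: p; apply: (@cut_le (fun p => (a p * J p * poisson n.+1%:R^-1 (Z p - Z xi))%:C%C)) => p; last first.
    by rewrite ltNge; apply: contraNN => /a0 ->; rewrite !mul0r.
  have [->|ap] := eqVneq (a p) 0.
    by rewrite !mul0r modc0 !mulr_ge0 ?invr_ge0 ?sqr_ge0.
  rewrite modcR normrM [`|a p * _|]normrM; apply: ler_pM => //; first exact: ler_pM.
  rewrite ger0_norm ?poisson_ge0// /poisson.
  have e2 : 0 < e ^+ 2 by rewrite exprn_gt0.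
  have ez2 : e ^+ 2 <= modc (Z p - Z xi) ^+ 2 + n.+1%:R^-1 ^+ 2.
    apply: (@le_trans _ _ (modc (Z p - Z xi) ^+ 2)); last by rewrite lerDl sqr_ge0.
    by rewrite lerXn2r ?nnegrE ?(ltW e0) ?modc_ge0//; exact: ez.
  rewrite ler_pdivrMr; last by rewrite exprn_gt0// (lt_le_trans e2).
  apply: (@le_trans _ _ 1); first by rewrite exprn_ile1// ltW.
  rewrite mulrC ler_pdivlMr ?exprn_gt0// mul1r lerXn2r ?nnegrE ?(ltW e2)//.
  exact: le_trans (ltW e2) ez2.
have [] := @cintegral_dominated R (fun n p => (a p * J p * poisson n.+1%:R^-1 (Z p - Z xi))%:C%C)
  (fun=> 0) _ _ _ (iB (K * (2 * M ^+ 2) * (e ^+ 2) ^- 2)) bd.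
- by move=> n; apply: cmeasurable_real; exact: mpoi.
- exact: cmeasurable_cst.
- apply: ae_all => p; have [ap|ap] := eqVneq (a p) 0.
    by apply: (ccvg_ext _ (ccvg_cst 0)) => n; rewrite ap !mul0r.
  have zp : Z p - Z xi != 0 by rewrite -modc_gt0 (lt_le_trans e0)//; exact: ez.
  have := ccvgM (ccvg_cst (a p * J p)%:C%C) (poisson_cvg0 zp); rewrite mulr0.
  by apply: ccvg_ext => n; rewrite -rmorphM.
by rewrite cintegral0.
Qed.

(** Inside [Q] the indicator differs from [chi] by a function that vanishes near [xi]; at positive
    distance from [Q] the indicator itself vanishes near [xi]. The means of such functions tend to
    0. The uniform bound prepares dominated convergence. *)
Lemma poisson_mean_indic (Q : set (plane R)) : measurable (Q : set (mplane R)) ->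
  (forall p, Q p -> `|p - c| <= r2) ->
  [/\ exists2 K, 0 <= K & forall d z, 0 < d -> modc (2 * 'i%C * poisson_mean d z \1_Q) <= K,
    forall xi delta, 0 < delta -> ball xi delta `<=` Q -> ccvg (fun n =>
      2 * 'i%C * poisson_mean n.+1%:R^-1 (Z xi) \1_Q) (chi_transform (Z xi)) &
    forall xi delta, `|xi - c| < r -> 0 < delta -> (forall p, Q p -> delta <= `|p - xi|) ->
      ccvg (fun n => 2 * 'i%C * poisson_mean n.+1%:R^-1 (Z xi) \1_Q) 0].
Proof.
move=> mQ Qr2.
have m1Q : measurable_fun setT (\1_Q : mplane R -> R).
  exact: (@measurable_indic _ (mplane R) R setT Q mQ).
have Qchi p : 0 <= (\1_Q p : R) <= chi p.
  rewrite indicE; case: (boolP (p \in Q)) => [/set_mem Qp|_]; last first.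
    by rewrite lexx /=; case/andP: (chi01 p).
  by rewrite chi1 ?Qr2// lexx ler01.
have Q1 p : `|\1_Q p : R| <= 1.
  by have /andP[h1 h2] := Qchi p; rewrite ger0_norm// (le_trans h2)//; case/andP: (chi01 p).
have Qoff p : r <= `|p - c| -> \1_Q p = 0 :> R.
  by move=> /chi_off c0; have := Qchi p; rewrite c0 -eq_le => /eqP.
split.
- have [K K0 hK] := poisson_mean_bound.
  exists (modc (2 * 'i%C : C) * K); first by rewrite mulr_ge0 ?modc_ge0.
  move=> d z d0; rewrite modcM ler_wpM2l ?modc_ge0//; apply: le_trans (hK d z d0).
  by have [] := poisson_mean_monotone z d0 m1Q Qchi.
- move=> xi delta d0 hQ.
  have xiQ : Q xi by apply: hQ; exact: ballxx.
  have xir : `|xi - c| < r by rewrite (le_lt_trans (Qr2 _ xiQ))// (lt_trans r2rho).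
  have h1 : ccvg (fun n => poisson_mean n.+1%:R^-1 (Z xi) (fun p => chi p - \1_Q p)) 0.
    apply: (@poisson_mean_off _ 1 xi delta) => //.
    + exact: measurable_funB.
    + move=> p; have /andP[q0 q1] := Qchi p; have /andP[c0 c1] := chi01 p.
      by rewrite ger0_norm ?subr_ge0// lerBlDr (le_trans c1)// lerDl.
    + by move=> p hp; rewrite chi_off// Qoff// subrr.
    + move=> p hp; have pQ : Q p by apply: hQ; exact/plane_ballP.
      by rewrite chi1 ?Qr2// indicE mem_set// subrr.
  have := ccvgB (chi_transform_cvg (Z xi)) (ccvgM (ccvg_cst (2 * 'i%C)) h1).
  rewrite mulr0 subr0; apply: ccvg_ext => n; rewrite -mulrBr; congr (_ * _).
  have n0 : 0 < n.+1%:R^-1 :> R by rewrite invr_gt0.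
  rewrite /poisson_mean -cintegralB; last 2 first.
  + exact: poisson_mean_integrable n0 mchi chi_norm chi_off.
  + apply: (@poisson_mean_integrable _ _ _ 1 n0).
    * exact: measurable_funB.
    * move=> p; have /andP[q0 q1] := Qchi p; have /andP[c0 c1] := chi01 p.
      by rewrite ger0_norm ?subr_ge0// lerBlDr (le_trans c1)// lerDl.
    * by move=> p hp; rewrite chi_off// Qoff// subrr.
  congr cintegral; apply/funext => p; rewrite -rmorphB/=; congr (_%:C%C); ring.
- move=> xi delta xir d0 hQ.
  rewrite -[0 : C](mulr0 (2 * 'i%C)); apply: ccvgM; first exact: ccvg_cst.
  apply: (@poisson_mean_off _ 1 xi delta) => // p hp.
  rewrite indicE memNset// => /hQ; by rewrite leNgt hp.
Qed.

Lemma Z_lipschitz p q : `|p - c| < r -> `|q - c| < r ->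
  modc (Z p - Z q) <= 4 * M * `|p - q|.
Proof.
have [_ _ hM hg _] := hZ; move=> hp hq.
have h1 := @lipschitz_grad R (Rec Z) (fun p => complex.Re (Zx p)) (fun p => complex.Re (Zy p)) c r M.
have h2 := @lipschitz_grad R (Imc Z) (fun p => complex.Im (Zx p)) (fun p => complex.Im (Zy p)) c r M.
have {}h1 := h1 (fun p hp => (hg p hp).1) _ p q hp hq.
have {}h2 := h2 (fun p hp => (hg p hp).2) _ p q hp hq.
have -> : 4 * M * `|p - q| = 2 * M * `|p - q| + 2 * M * `|p - q| by ring.
rewrite (le_trans (modc_le_ReIm _))// !ReD !ImD !ReN !ImN lerD//.
- apply: h1 => s _; have [k1 k2] := hM s.
  by split; rewrite (le_trans (normr_Re_le _)).
- apply: h2 => s _; have [k1 k2] := hM s.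
  by split; rewrite (le_trans (normr_Im_le _)).
Qed.

Lemma jac_dense p delta : `|p - c| < r -> 0 < delta ->
  exists q, [/\ `|q - p| < delta, `|q - c| < r & J q != 0].
Proof.
move=> hp d0; apply: contrapT => /forallNP hn.
pose e := Num.min delta (r - `|p - c|).
have e0 : 0 < e by rewrite lt_min d0 subr_gt0.
have sub : ball p e `<=` ball c r `&` [set p | J p = 0].
  move=> q /plane_ballP; rewrite lt_min => /andP[q1 q2].
  have qc : `|q - c| < r by have := ler_distD p q c; lra.
  split; first exact/plane_ballP.
  by apply/eqP/negPn/negP => Jq; apply: (hn q).
have /(measure_negligible (measurable_plane_ball p e)) := (@negligibleS _ (mplane R) R mu _ _ sub jnull).
move=> h; have := etrans (esym h) (leb2_ball p (ltW e0)) => /esym/eqP; rewrite eqe.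
by rewrite expf_eq0/= mulrn_eq0/= gt_eqF.
Qed.

Let jac_cont p : `|p - c| < r -> {for p, continuous J}.
Proof.
move=> hp; have [_ _ _ _ /(_ p hp)[c1 c2 c3 c4]] := hZ.
by apply: cvgB; apply: cvgM.
Qed.

(* On a square of side comparable to [d] about a point where [J] does not vanish,
   [poisson d (Z - z)] is at least of order [d ^- 2]. *)
Lemma chi_transform_neq0 p : `|p - c| < r2 -> J p != 0 -> chi_transform (Z p) != 0.
Proof.
move=> hp Jp; have hpr : `|p - c| < r by rewrite (lt_trans hp)// (lt_trans r2rho).
have aJ : 0 < `|J p| by rewrite normr_gt0.
have [delta d0 hd] : exists2 delta, 0 < delta & forall q, `|q - p| < delta ->
    `|q - c| <= r2 /\ `|J p| / 2 <= `|J q|.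
  have : \forall q \near p, `|J p - J q| < `|J p| / 2.
    by have /cvgrPdist_lt := jac_cont hpr; apply; rewrite divr_gt0.
  move=> /nbhs_ballP[e /= e0 he]; exists (Num.min e (r2 - `|p - c|)).
    by rewrite lt_min e0 subr_gt0.
  move=> q; rewrite lt_min => /andP[q1 q2]; split.
    by have := ler_distD p q c; lra.
  have /= := he q; move=> /(_ _)/ltW h.
  have := h (iffRL (plane_ballP p q e) q1).
  have := ler_distD (J q) (J p) 0; rewrite !subr0; lra.
(* As [Z] is [L]-Lipschitz, [poisson d] is at least [k0 / d ^ 2] on the square of radius [d]. The
   area [4 d ^ 2] of the square and [|J| >= |J p| / 2] leave [2 |J p| k0]. *)
pose L := 4 * M; pose k0 := (L ^+ 2 + 1) ^- 2.
have L1 : 0 < L ^+ 2 + 1 by rewrite ltr_wpDl ?sqr_ge0.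
have k00 : 0 < k0 by rewrite invr_gt0 exprn_gt0.
have low d : 0 < d -> d < delta -> 2 * `|J p| * k0 <= modc (poisson_mean d (Z p) chi).
  move=> dp dd; have mB := measurable_plane_ball p d.
  have ma : measurable_fun setT (\1_(ball p d) : mplane R -> R).
    exact: (@measurable_indic _ (mplane R) R setT _ mB).
  have ha q : 0 <= (\1_(ball p d) q : R) <= chi q.
    rewrite indicE; case: (boolP (q \in _)) => [/set_mem/plane_ballP hq|_].
      by rewrite chi1 ?lexx ?ler01//; case: (hd q (lt_trans hq dd)).
    by rewrite lexx /=; case/andP: (chi01 q).
  have [h _] := poisson_mean_monotone (Z p) dp ma ha; apply: le_trans h.
  have d20 : 0 < d ^+ 2 by rewrite exprn_gt0.
  pose K := `|J p| / 2 * (d ^- 2 * k0).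
  have i1 : mu.-integrable setT (EFin \o (\1_(ball p d) : plane R -> R) : mplane R -> \bar R).
    apply: (@integrable_bounded_support R _ p d 1) => // [q|q hq].
      by have /andP[h _] := ha q; rewrite ger0_norm// indicE; case: (_ \in _).
    by rewrite indicE memNset// => /plane_ballP; rewrite ltNge (ltW hq).
  have -> : 2 * `|J p| * k0 = \int[mu]_q (K * \1_(ball p d) q).
    rewrite RintegralZl//.
    have -> : \int[mu]_q (\1_(ball p d) q : R) = (d *+ 2) ^+ 2.
      rewrite /Rintegral integral_indic// setIT.
      by have := leb2_ball p (ltW dp); set x := leb2 R _ => ->.
    by rewrite /K -mulr_natr; field; rewrite gt_eqF.
  apply: le_Rintegral => //.
  - exact: (integrableZl measurableT K i1).
  - have i2 := @poisson_mean_integrable d (Z p) \1_(ball p d) 1 dp ma.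
    have {}i2 : cintegrable (fun q => (\1_(ball p d) q * J q * poisson d (Z q - Z p))%:C%C).
      apply: i2 => q; last first.
        by move=> /chi_off c0; have := ha q; rewrite c0 -eq_le => /eqP.
      by have /andP[h _] := ha q; rewrite ger0_norm// indicE; case: (_ \in _).
    have := integrable_modc i2; congr (integrable _ _ _); apply/funext => q /=.
    rewrite modcR normrM [X in X * _]normrM (ger0_norm (poisson_ge0 _ _)).
    by have /andP[h _] := ha q; rewrite (ger0_norm h).
  move=> q _; rewrite indicE; case: (boolP (q \in _)) => [/set_mem/plane_ballP hq|_]; last first.
    by rewrite mulr0 !mul0r.
  have [qr2 Jq] := hd q (lt_trans hq dd).
  have qr : `|q - c| < r by rewrite (le_lt_trans qr2)// (lt_trans r2rho).
  rewrite mulr1 mul1r /K; apply: ler_pM => //.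
    by rewrite mulr_ge0 ?invr_ge0 ?sqr_ge0// ltW.
  have zq : modc (Z q - Z p) <= L * d.
    by rewrite (le_trans (Z_lipschitz qr hpr))// ler_wpM2l ?mulr_ge0// ltW.
  have z2 : modc (Z q - Z p) ^+ 2 + d ^+ 2 <= (L ^+ 2 + 1) * d ^+ 2.
    rewrite mulrDl mul1r lerD2r -exprMn lerXn2r ?nnegrE ?modc_ge0//.
    by rewrite !mulr_ge0 ?(ltW dp).
  rewrite /poisson /k0 -[d ^- 2 * _]invfM.
  have zz0 : 0 < modc (Z q - Z p) ^+ 2 + d ^+ 2 by rewrite ltr_wpDl ?sqr_ge0.
  rewrite ler_pdivlMr ?exprn_gt0// mulrC ler_pdivrMr; last by rewrite mulr_gt0// exprn_gt0.
  rewrite mulrA -expr2 -exprMn mulrC lerXn2r ?nnegrE ?(ltW zz0)//.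
  by rewrite mulr_ge0 ?(ltW L1) ?(ltW d20).
apply/eqP => H0; have := chi_transform_cvg (Z p); rewrite H0 => hc.
have c0 : 0 < 2 * `|J p| * k0 by rewrite !mulr_gt0.
have h1 := @near_infty_natSinv_lt R (PosNum d0).
move: (hc); rewrite /ccvg => /cvgrPdist_lt/(_ _ c0) h2.
 have [n [/= n1 n2]] : exists n, n.+1%:R^-1 < delta /\
    modc (2 * 'i%C * poisson_mean n.+1%:R^-1 (Z p) chi - 0) < 2 * `|J p| * k0.
  have [n [? h3]] := filter_ex (filterI h1 h2); exists n; split=> //.
  by move: h3; rewrite sub0r normrN ger0_norm ?modc_ge0.
have := low n.+1%:R^-1; rewrite invr_gt0 ltr0n => /(_ isT n1).
move: n2; rewrite subr0 !modcM.
have -> : modc (2 : C) = 2.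
  have -> : (2 : C) = (2 : R)%:C%C by rewrite rmorph_nat.
  by rewrite modcR ger0_norm.
rewrite [modc 'i%C]modcE /= expr0n/= add0r expr1n sqrtr1 mulr1.
by have := modc_ge0 (poisson_mean n.+1%:R^-1 (Z p) chi); lra.
Qed.

(* [H := chi_transform] takes imaginary values on [Z], so that the differential of
   [Re ((Z - Z p) H' (Z p))] vanishes at [p]; as the differentials of the real and
   the imaginary part of [Z] are independent where [J != 0], so does [H']. *)
Lemma chi_transform_constant r3 : r3 < r2 -> forall p q, `|p - c| < r3 -> `|q - c| < r3 ->
  chi_transform (Z p) = chi_transform (Z q).
Proof.
move=> r32; have r3r : r3 < r by rewrite (lt_trans r32)// (lt_trans r2rho).
have [e e0 /(_ Lchi Lchi_support) hsep] := separated_support r32.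
set N := \int[mu]_p (modc (Lchi p) : R).
have N0 : 0 <= N by apply: Rintegral_ge0 => p _; exact: modc_ge0.
have [L0 V0] : 0 <= 4 * M /\ 0 <= e^-1 by rewrite mulr_ge0// invr_ge0 ltW.
have lip p q : `|p - c| < r3 -> `|q - c| < r3 ->
    modc (chi_transform (Z p) - chi_transform (Z q)) <=
    N * (e^-1 * e^-1) * (4 * M) * `|p - q|.
  move=> hp hq; have := cauchy_transform_lipschitz mZ Lchi_integrable e0 (hsep p hp) (hsep q hq).
  move=> /le_trans; apply; rewrite -/N -[leRHS]mulrA ler_wpM2l ?mulr_ge0//.
  by apply: Z_lipschitz; exact: lt_trans r3r.
pose K := N * (e^-1 * e^-1 * e^-1) * (4 * M) ^+ 2.
have K0 : 0 <= K by rewrite !mulr_ge0 ?sqr_ge0.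
have quad p : `|p - c| < r3 -> J p != 0 -> forall q, `|q - c| < r3 ->
    modc (chi_transform (Z q) - chi_transform (Z p)) <= K * `|q - p| ^+ 2.
  move=> hp Jp.
  have ex q : `|q - c| < r3 -> modc (chi_transform (Z q) - chi_transform (Z p) -
      (Z q - Z p) * cauchy_transform_deriv Z Lchi (Z p)) <= K * `|q - p| ^+ 2.
    move=> hq; have := cauchy_transform_expansion mZ Lchi_integrable e0 (hsep p hp) (hsep q hq).
    move=> /le_trans; apply; rewrite -/N /K -[leRHS]mulrA ler_wpM2l ?mulr_ge0// -exprMn.
    rewrite lerXn2r ?nnegrE ?modc_ge0 ?mulr_ge0//.
    by apply: Z_lipschitz; exact: lt_trans r3r.
  suff G0 : cauchy_transform_deriv Z Lchi (Z p) = 0.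
    by move=> q /ex; rewrite G0 mulr0 subr0.
  move: (cauchy_transform_deriv Z Lchi (Z p)) ex => G ex.
  have [_ _ _ /(_ p (lt_trans hp r3r))[g1 g2] _] := hZ.
  have := has_gradD (has_gradM (has_gradD g1 (has_grad_cst (- complex.Re (Z p)) p))
      (has_grad_cst (complex.Re G) p))
    (has_gradM (has_gradD g2 (has_grad_cst (- complex.Im (Z p)) p))
      (has_grad_cst (- complex.Im G) p)).
  have d0 : 0 < r3 - `|p - c| by rewrite subr_gt0.
  move=> /(@has_grad_quadratic R _ _ _ _ _ K d0)[|].
    move=> q hq; have hq3 : `|q - c| < r3 by have := ler_distD p q c; lra.
    have := le_trans (normr_Re_le _) (ex q hq3).
    rewrite !(ReD, ReN, ReM, ImD, ImN) !Re_chi_transform subrr sub0r normrN => /(le_trans _); apply.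
    by rewrite le_eqVlt; apply/orP; left; apply/eqP; congr `|_|; ring.
  rewrite !subrr !mul0r !addr0 !add0r => e1 e2; apply: complex_ext => /=.
    apply: (mulfI Jp); rewrite mulr0 /jac.
    rewrite [LHS](_ : _ = complex.Im (Zy p) * (complex.Re (Zx p) * complex.Re G + complex.Im (Zx p) * - complex.Im G)
      - complex.Im (Zx p) * (complex.Re (Zy p) * complex.Re G + complex.Im (Zy p) * - complex.Im G)); last by ring.
    by rewrite e1 e2 !mulr0 subrr.
  apply: (mulfI Jp); rewrite mulr0 /jac.
  rewrite [LHS](_ : _ = complex.Re (Zy p) * (complex.Re (Zx p) * complex.Re G + complex.Im (Zx p) * - complex.Im G)
    - complex.Re (Zx p) * (complex.Re (Zy p) * complex.Re G + complex.Im (Zy p) * - complex.Im G)); last by ring.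
  by rewrite e1 e2 !mulr0 subrr.
(* The quadratic bound is available only from points where [J] is nonzero. These are dense, and the
   Lipschitz bound extends it to all points. *)
apply: (@quadratic_constant R _ c r3 K) => p q hp hq.
apply/ler_addgt0Pr => t t0.
set L := N * (e^-1 * e^-1) * (4 * M) in lip.
have LL : 0 <= L by rewrite !mulr_ge0.
pose a := `|p - q|.
have a0 : 0 <= a by exact: normr_ge0.
have S0 : 0 < K * (2 * a + 1) + L + 1 
  by apply: ltr_wpDl => //; apply: addr_ge0 => //; apply: mulr_ge0 => //;
    apply: addr_ge0 => //; apply: mulr_ge0.
(* With [s = |q' - q| <= d <= 1], replacing [q] by [q'] costs at most [K (2 a + 1) s + L s], which
   this choice keeps below [t]. *)
pose d := Num.min (Num.min 1 (r3 - `|q - c|)) (t / (K * (2 * a + 1) + L + 1)).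
have d0 : 0 < d by rewrite !lt_min ltr01 subr_gt0 hq divr_gt0.
have [q' [q1 _ Jq']] := jac_dense (lt_trans hq r3r) d0.
have : `|q' - q| <= d by exact: ltW.
rewrite !le_min => /andP[/andP[d1 d2] d3].
have hq' : `|q' - c| < r3.
  by move: q1; rewrite !lt_min => /andP[/andP[_ h] _]; have := ler_distD q q' c; lra.
have b1 := quad q' hq' Jq' p hp.
have b2 := lip q' q hq' hq.
have tri : modc (chi_transform (Z p) - chi_transform (Z q)) <=
    modc (chi_transform (Z p) - chi_transform (Z q')) + modc (chi_transform (Z q') - chi_transform (Z q)).
  by apply: le_trans (modcD _ _); rewrite addrA subrK.
have b3 : `|p - q'| <= a + `|q' - q| by have := ler_distD q p q'; rewrite (distrC q q').
move: d3; rewrite ler_pdivlMr//.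
have b4 : K * `|p - q'| ^+ 2 <= K * (a + `|q' - q|) ^+ 2.
  by rewrite ler_wpM2l// lerXn2r ?nnegrE ?addr_ge0.
rewrite -/a; move: b1 b2 tri b4 d1; move: (`|q' - q|) (normr_ge0 (q' - q)) => s s0 b1 b2 tri b4 d1 d3.
have b5 : K * (a + s) ^+ 2 <= K * a ^+ 2 + K * (2 * a + 1) * s.
  rewrite -mulrA -mulrDr ler_wpM2l//.
  have : s ^+ 2 <= s by rewrite expr2 ler_piMl.
  by rewrite !expr2; lra.
have b6 : s * (K * (2 * a + 1) + L + 1) = K * (2 * a + 1) * s + L * s + s by ring.
lra.
Qed.

Section hoelder.
Variables (w f : plane R -> C) (p q F0 r3 : R).
Hypotheses (iw : cintegrable w) (if_ : cintegrable f) (hw : weak_on c r Zx Zy w f)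
  (q1 : 1 < q) (qm : q < m) (mq : m < 2 * q) (p0 : 0 < p) (pq : p^-1 + q^-1 = 1)
  (fp : (\int[mu]_x (\1_(ball c r) x * modc (f x) `^ p)%:E <= F0%:E)%E)
  (r30 : 0 < r3) (r32 : r3 < r2).

Local Notation alpha := ((m - q) / q).
Local Notation F := (fun x => f x * (chi x)%:C%C + w x * Lchi x).
Local Notation T := (cauchy_transform Z F).

Let alpha0 : 0 < alpha. Proof. by rewrite divr_gt0 ?subr_gt0// (lt_trans ltr01). Qed.

Let q0 : 0 < q. Proof. exact: lt_trans q1. Qed.

Let alpha1 : alpha <= 1.
Proof. by rewrite ler_pdivrMr// mul1r lerBlDr ltW// -mulr2n -mulr_natl. Qed.

Let r3r : r3 < r. Proof. by rewrite (lt_trans r32)// (lt_trans r2rho). Qed.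

Let if1 : cintegrable (fun x => f x * (chi x)%:C%C).
Proof.
apply: (cintegrable_le _ (integrable_modc if_)).
  by apply: cmeasurableM; [exact: cintegrable_measurable|exact: cmeasurable_real].
by move=> x; rewrite modcM modcR ler_piMr ?modc_ge0.
Qed.

Let if2 : cintegrable (fun x => w x * Lchi x).
Proof.
have [K K0 hK] := Lchi_bound.
apply: (cintegrable_le _ (integrableZr measurableT K (integrable_modc iw))).
  by apply: cmeasurableM => //; exact: cintegrable_measurable.
by move=> x; rewrite modcM ler_wpM2l ?modc_ge0.
Qed.

Let iF : cintegrable F. Proof. exact: cintegrableD. Qed.

Let f2_support x : w x * Lchi x != 0 -> r2 <= `|x - c| < r.
Proof. by rewrite mulf_eq0 negb_or => /andP[_]; exact: Lchi_support. Qed.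

Let kprofile d z x := \1_(ball c r) x * (modc (f x) * kernel_profile d (modc (Z x - z))).

Let kprofile_ge0 d z x : 0 < d -> 0 <= kprofile d z x.
Proof.
move=> d0; rewrite mulr_ge0// mulr_ge0 ?modc_ge0//.
by apply: kernel_profile_ge0 => //; exact: modc_ge0.
Qed.

Let Kf := F0 / p + kernel_const C0 m q / q.

Let kprofile_bound d z : 0 < d ->
  mu.-integrable setT (EFin \o kprofile d z : mplane R -> \bar R) /\
  \int[mu]_x kprofile d z x <= Kf * d `^ alpha.
Proof.
move=> d0; have mB : measurable (ball c r : set (mplane R)) := measurable_plane_ball c r.
have mD := measurable_modc (mZz z).
have [mf _] := (measurable_modc (cintegrable_measurable if_), tt).
apply: ge0_Rintegral_le.
- apply: measurable_indicM => //; apply: measurable_funTS.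
  apply: measurable_funM => //; apply: measurable_fun_ifT.
  + exact: measurable_fun_ltr.
  + apply: measurable_funM => //; under eq_fun do rewrite -modcV.
    by apply: measurable_modc; exact: cmeasurableV.
  + apply: measurable_funM => //; under eq_fun do rewrite -exprVn -modcV.
    by apply: measurable_funX; apply: measurable_modc; exact: cmeasurableV.
- by move=> x; exact: kprofile_ge0.
apply: (@weighted_kernel_bound R (ball c r) (fun x => modc (Z x - z)) C0 m) => //.
- by move=> x; exact: modc_ge0.
- exact: vol.
- by move=> x; exact: modc_ge0.
Qed.

Let f1_le x : modc (f x * (chi x)%:C%C) <= \1_(ball c r) x * modc (f x).
Proof.
rewrite modcM modcR mulrC indicE; case: (boolP (x \in _)) => [_|h].
  by rewrite mul1r ler_piMl ?modc_ge0.
rewrite chi_off ?normr0 ?mul0r// leNgt; apply: contraNN h => h.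
by rewrite inE; exact/plane_ballP.
Qed.

Let Z_diam x y : `|x - c| < r -> `|y - c| < r -> modc (Z x - Z y) <= 8 * M * r.
Proof.
move=> hx hy; rewrite (le_trans (Z_lipschitz hx hy))//.
have -> : 8 * M * r = 4 * M * (2 * r) by ring.
rewrite ler_wpM2l ?mulr_ge0//.
by have := ler_distD c x y; rewrite (distrC c y); lra.
Qed.

Let F_dominated : exists2 K, 0 <= K & forall y, `|y - c| < r3 ->
  exists G, [/\ mu.-integrable setT (EFin \o G : mplane R -> \bar R),
    forall x, modc (F x) * (modc (Z x - Z y))^-1 <= G x & \int[mu]_x G x <= K].
Proof.
have [e e0 /(_ _ f2_support) hsep] := separated_support r32.
(* [d] exceeds the diameter of the image of the square, so that the profile equals [2 / |Z - Z y|]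
   throughout and majorises the kernel. *)
pose d := 8 * M * r + 1.
have r0 : 0 < r by case: hZ.
have d0 : 0 < d by rewrite ltr_wpDl// !mulr_ge0// ltW.
pose N2 := \int[mu]_x (modc (w x * Lchi x) : R).
exists (`|Kf * d `^ alpha + e^-1 * N2|) => // y hy.
have [i1 b1] := kprofile_bound (Z y) d0.
have i2 := integrableZl measurableT e^-1 (integrable_modc if2).
exists (fun x => kprofile d (Z y) x + e^-1 * modc (w x * Lchi x)); split.
- exact: (integrableD measurableT i1 i2).
- move=> x; rewrite (le_trans (ler_wpM2r _ (modcD _ _))) ?invr_ge0 ?modc_ge0//.
  rewrite mulrDl; apply: lerD.
    rewrite (le_trans (ler_wpM2r _ (f1_le x))) ?invr_ge0 ?modc_ge0//.
    rewrite /kprofile indicE; case: (boolP (x \in _)) => [/set_mem/plane_ballP hx|]; last by rewrite !mul0r.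
    rewrite !mul1r ler_wpM2l ?modc_ge0// /kernel_profile.
    rewrite ifT; last by rewrite (le_lt_trans (Z_diam hx _)) ?(lt_trans hy)// ltrDl.
    by rewrite ler_peMl ?invr_ge0 ?modc_ge0// ler1n.
  have [->|fx] := eqVneq (w x * Lchi x) 0; first by rewrite modc0 !mul0r mulr0.
  rewrite mulrC ler_wpM2r ?modc_ge0// lef_pV2 ?posrE//; first exact: hsep.
  by rewrite (lt_le_trans e0)//; exact: hsep.
rewrite RintegralD//.
rewrite (le_trans _ (ler_norm _))// lerD// RintegralZl//.
exact: integrable_modc.
Qed.

Let T_integrable y : `|y - c| < r3 -> cintegrable (fun x => F x * (Z x - Z y)^-1).
Proof.
have [K K0 hK] := F_dominated; move=> /hK[G [iG FG _]].
by have [] := cauchy_transform_cvg mZ (cintegrable_measurable iF) iG FG.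
Qed.

(** The part [f chi] is estimated by the profiles at the two points, with [d = |Z x - Z y|]. The
    part [w L chi] is separated from both points, hence gives a Lipschitz term, and
    [d <= D ^ (1 - alpha) * d ^ alpha] lowers its exponent. *)
Let T_holder : exists2 K, 0 <= K & forall x y, `|x - c| < r3 -> `|y - c| < r3 ->
  modc (T (Z x) - T (Z y)) <= K * `|x - y| `^ alpha.
Proof.
have [e e0 /(_ _ f2_support) hsep] := separated_support r32.
pose N2 := \int[mu]_x (modc (w x * Lchi x) : R).
have N20 : 0 <= N2 by apply: Rintegral_ge0 => x _; exact: modc_ge0.
have V0 : 0 <= e^-1 by rewrite invr_ge0 ltW.
have Kf0 : 0 <= Kf.
  have [_] := kprofile_bound 0 ltr01; rewrite powR1 mulr1; apply: le_trans.
  by apply: Rintegral_ge0 => x _; exact: kprofile_ge0.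
have r0 : 0 < r by case: hZ.
pose D := 8 * M * r.
have D0 : 0 <= D by rewrite !mulr_ge0// ltW.
pose K' := 2 * Kf + N2 * (e^-1 * e^-1) * D `^ (1 - alpha).
have K'0 : 0 <= K' by rewrite addr_ge0 ?mulr_ge0 ?powR_ge0.
exists (K' * (4 * M) `^ alpha); first by rewrite mulr_ge0 ?powR_ge0.
move=> x y hx hy.
have hxr := lt_trans hx r3r; have hyr := lt_trans hy r3r.
have [exy|nxy] := eqVneq (Z x) (Z y).
  by rewrite exy subrr modc0 !mulr_ge0 ?powR_ge0.
pose d := modc (Z x - Z y).
have d0 : 0 < d by rewrite modc_gt0 subr_eq0.
have [i1 b1] := kprofile_bound (Z x) d0; have [i2 b2] := kprofile_bound (Z y) d0.
have i3 := integrableZl measurableT (e^-1 * e^-1 * d) (integrable_modc if2).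
have i12 := integrableD measurableT i1 i2.
have i123 := integrableD measurableT i12 i3.
suff : modc (T (Z x) - T (Z y)) <= K' * d `^ alpha.
  move=> /le_trans; apply; rewrite -mulrA ler_wpM2l// -powRM ?mulr_ge0//.
  apply: ge0_ler_powR; rewrite ?nnegrE ?(ltW alpha0) ?(ltW d0) ?mulr_ge0//.
  exact: Z_lipschitz.
rewrite -cintegralB; try exact: T_integrable.
have iD : cintegrable (fun z => F z * (Z z - Z x)^-1 - F z * (Z z - Z y)^-1).
  by apply: cintegrableD; last apply: cintegrableN; exact: T_integrable.
rewrite (le_trans (modc_cintegral_le iD))//.
apply: (@le_trans _ _ (\int[mu]_z (kprofile d (Z x) z + kprofile d (Z y) z +
    e^-1 * e^-1 * d * modc (w z * Lchi z)))).
  apply: le_Rintegral => //; first exact: integrable_modc.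
  move=> z _.
  rewrite -mulrBr [leLHS]modcM; apply: (le_trans (ler_wpM2r (modc_ge0 _) (modcD _ _))).
  have dE : modc ((Z z - Z x) - (Z z - Z y)) = d.
    by rewrite /d [RHS]modc_distC; congr modc; ring.
  rewrite mulrDl; apply: lerD.
    rewrite (le_trans (ler_wpM2r _ (f1_le z))) ?modc_ge0//.
    rewrite /kprofile -mulrDr -mulrDr -mulrA ler_wpM2l// ler_wpM2l ?modc_ge0//.
    by rewrite -dE; apply: invr_sub_le; rewrite dE.
  have [->|fz] := eqVneq (w z * Lchi z) 0; first by rewrite modc0 mul0r mulr0.
  rewrite mulrC ler_wpM2r ?modc_ge0//.
  have s1 := hsep x hx z fz; have s2 := hsep y hy z fz.
  have a1 : 0 < modc (Z z - Z x) by rewrite (lt_le_trans e0).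
  have a2 : 0 < modc (Z z - Z y) by rewrite (lt_le_trans e0).
  have -> : (Z z - Z x)^-1 - (Z z - Z y)^-1 =
      - ((Z z - Z x) - (Z z - Z y)) * ((Z z - Z x)^-1 * (Z z - Z y)^-1).
    have n1 : Z z - Z x != 0 by rewrite -modc_gt0.
    have n2 : Z z - Z y != 0 by rewrite -modc_gt0.
    by move: n1 n2; move: (Z z - Z x) (Z z - Z y) => s t n1 n2; field; rewrite ?n1 ?n2.
  rewrite modcM modcN dE mulrC ler_wpM2r ?(ltW d0)// modcM !modcV.
  by rewrite ler_pM ?invr_ge0 ?modc_ge0// lef_pV2 ?posrE.
rewrite RintegralD// RintegralD// RintegralZl//; last exact: integrable_modc.
rewrite -/N2.
have dd : d <= D `^ (1 - alpha) * d `^ alpha.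
  rewrite -[leLHS]powRr1 ?(ltW d0)// -[X in d `^ X](subrK alpha 1) powRD; last by rewrite (gt_eqF d0) implybT.
  rewrite ler_wpM2r ?powR_ge0//; apply: ge0_ler_powR; rewrite ?nnegrE ?subr_ge0 ?(ltW d0)//.
  exact: Z_diam.
rewrite /K' mulrDl; apply: lerD; first lra.
rewrite -mulrA [N2 * _]mulrC -!mulrA.
have -> : e^-1 * (e^-1 * (d * N2)) = N2 * (e^-1 * e^-1) * d by ring.
have -> : e^-1 * (e^-1 * (N2 * (D `^ (1 - alpha) * d `^ alpha))) =
   N2 * (e^-1 * e^-1) * (D `^ (1 - alpha) * d `^ alpha) by ring.
by rewrite ler_wpM2l// !mulr_ge0.
Qed.

Let mT : cmeasurable setT (fun x => (\1_(ball c r3) x)%:C%C * T (Z x)).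
Proof.
have [K K0 hK] := T_holder.
split.
- have h : measurable_fun setT (fun x : mplane R => \1_(ball c r3) x * complex.Re (T (Z x))).
    apply: measurable_ballM => x hx; apply: (@holder_continuous R _ c x r3 K alpha) => // y hy.
    by rewrite -ReN -ReD (le_trans (normr_Re_le _))// hK.
  by move: h; congr (measurable_fun _ _); apply/funext => x; rewrite ReM /= mul0r subr0.
- have h : measurable_fun setT (fun x : mplane R => \1_(ball c r3) x * complex.Im (T (Z x))).
    apply: measurable_ballM => x hx; apply: (@holder_continuous R _ c x r3 K alpha) => // y hy.
    by rewrite -ImN -ImD (le_trans (normr_Im_le _))// hK.
  by move: h; congr (measurable_fun _ _); apply/funext => x; rewrite ImM /= mul0r addr0.
Qed.

(** The relation [w H = T] along [Z], weighted by [J] and integrated over [Q]. The double integral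
    of [h n] is computed in both orders; each order has a dominated limit, and only the points on
    the sides of the rectangle are excepted. *)
Let rectangle_identity (Q : set (plane R)) : measurable (Q : set (mplane R)) ->
  Q `<=` ball c r3 ->
  {ae mu, forall xi : plane R, (exists2 delta, 0 < delta & ball xi delta `<=` Q) \/
    (exists2 delta, 0 < delta & forall p, Q p -> delta <= `|p - xi|)} ->
  cintegral setT (fun x => (\1_Q x)%:C%C * ((J x)%:C%C * (w x * chi_transform (Z c)))) =
  cintegral setT (fun x => (\1_Q x)%:C%C * ((J x)%:C%C * T (Z x))).
Proof.
move=> mQ Q3 Qae.
have m1Q : measurable_fun setT (\1_Q : mplane R -> R).
  exact: (@measurable_indic _ (mplane R) R setT Q mQ).
have Qin x : Q x -> `|x - c| < r3 by move=> /Q3/plane_ballP.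
have Qr2 x : Q x -> `|x - c| <= r2 by move=> /Qin h; rewrite ltW// (lt_trans h).
have Qoff x : r <= `|x - c| -> \1_Q x = 0 :> R.
  by move=> hx; rewrite indicE memNset// => /Qin; rewrite ltNge (le_trans (ltW r3r)).
have Q1 x : `|\1_Q x : R| <= 1 by rewrite indicE; case: (_ \in _); rewrite ?normr1 ?normr0.
have [[Kp Kp0 hKp] Qcvg_in Qcvg_out] := poisson_mean_indic mQ Qr2.
have [KF KF0 hKF] := F_dominated.
have n0 n : 0 < n.+1%:R^-1 :> R by rewrite invr_gt0.
(* The kernel identity at [z = Z x] is multiplied by [J x] and integrated over [x] in [Q]. *)
pose k n (x y : plane R) : R := \1_Q x * J x * (chi y * J y * poisson n.+1%:R^-1 (Z y - Z x)).
pose h n (x y : plane R) : C := w y * (k n x y)%:C%C.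
have mk n : measurable_fun setT (fun z : mplane R * mplane R => k n z.1 z.2).
  have mfst (g : mplane R -> R) : measurable_fun setT g ->
    measurable_fun setT (fun z : mplane R * mplane R => g z.1) by move=> mg; exact: measurableT_comp.
  have msnd (g : mplane R -> R) : measurable_fun setT g ->
    measurable_fun setT (fun z : mplane R * mplane R => g z.2) by move=> mg; exact: measurableT_comp.
  have [z1 z2] := mZ.
  apply: measurable_funM; first by apply: measurable_funM; exact: mfst.
  apply: measurable_funM; first by apply: measurable_funM; exact: msnd.
  apply: measurable_poisson.
    have h' := measurable_funB (msnd _ z1) (mfst _ z1); move: h'.
    by congr (measurable_fun _ _); apply/funext => z; rewrite ReD ReN.
  have h' := measurable_funB (msnd _ z2) (mfst _ z2); move: h'.
  by congr (measurable_fun _ _); apply/funext => z; rewrite ImD ImN.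
have [mw1 mw2] := cintegrable_measurable iw.
have mh1 n : measurable_fun setT (fun z : mplane R * mplane R => complex.Re (h n z.1 z.2)).
  under eq_fun do rewrite ReM /= mulr0 subr0.
  by apply: measurable_funM => //; exact: (measurableT_comp mw1).
have mh2 n : measurable_fun setT (fun z : mplane R * mplane R => complex.Im (h n z.1 z.2)).
  under eq_fun do rewrite ImM /= mulr0 add0r.
  by apply: measurable_funM => //; exact: (measurableT_comp mw2).
have ms1 n : measurable_fun setT (fun z : mplane R * mplane R => complex.Re (h n z.2 z.1)).
  exact: (measurableT_comp (mh1 n) (measurable_fun_pair measurable_snd measurable_fst)).
have ms2 n : measurable_fun setT (fun z : mplane R * mplane R => complex.Im (h n z.2 z.1)).
  exact: (measurableT_comp (mh2 n) (measurable_fun_pair measurable_snd measurable_fst)).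
pose M2 := 2 * M ^+ 2.
have M20 : 0 <= M2 by rewrite mulr_ge0// sqr_ge0.
have indB x : \1_Q x <= \1_(ball c r) x :> R.
  rewrite !indicE; case: (boolP (x \in Q)) => // /set_mem/Qin hx.
  by rewrite mem_set//; apply/plane_ballP; exact: lt_trans r3r.
have h_le n x y : modc (h n x y) <= (n.+1%:R^-1 ^- 2 * M2 * \1_(ball c r) x) * (M2 * modc (w y)).
  rewrite modcM modcR /k [leRHS]mulrA mulrC; apply: ler_pM; rewrite ?modc_ge0//.
  rewrite normrM [`|_ * J x|]normrM [`|chi y * _ * _|]normrM [`|chi y * _|]normrM.
  rewrite (ger0_norm (poisson_ge0 _ _)) [`|\1_Q x : R|]ger0_norm; last by rewrite indicE.
  have := poisson_le (Z y - Z x) (n0 n).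
  have := indB x.
  set b := \1_(ball c r) x; set D := _ ^- 2 => hb hD.
  have q0x : 0 <= (\1_Q x : R) by rewrite indicE.
  rewrite (_ : D * M2 * b * M2 = b * M2 * (1 * M2 * D)); last by ring.
  have := poisson_ge0 n.+1%:R^-1 (Z y - Z x); move: hD; move: (poisson _ _) => P hD P0.
  apply: ler_pM; rewrite ?mulr_ge0//; first exact: ler_pM.
  by apply: ler_pM; rewrite ?mulr_ge0//; apply: ler_pM.
have iw' := integrableZl measurableT M2 (integrable_modc iw).
have Fub n := cintegral_Fubini_dominated (mh1 n) (mh2 n) (iB (n.+1%:R^-1 ^- 2 * M2)) iw' (h_le n).
have Fub' n : cintegrable (fun y => cintegral setT ((h n)^~ y)).
  have := @cintegral_Fubini_dominated R (fun y x => h n x y) _ _ (ms1 n) (ms2 n) iw'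
    (iB (n.+1%:R^-1 ^- 2 * M2)).
  by case=> // y x; rewrite mulrC; exact: h_le.
have ker n x := kernel_identity (Z x) hZ hchi iw if_ hw (n0 n).
(* Integration in [y] first: by the kernel identity, a regularised [T (Z x)] appears. *)
have eL n x : 2 * 'i%C * cintegral setT (h n x) = (\1_Q x * J x)%:C%C *
    cintegral setT (fun y => F y * cauchy n.+1%:R^-1 (Z y - Z x)).
  have [i1 _ <-] := ker n x.
  rewrite [RHS]mulrCA; congr (_ * _); rewrite -cintegralZ//; congr cintegral; apply/funext => y.
  by rewrite mulrCA -rmorphM.
(* Integration in [x] first: as [poisson] is even, this is a mean of the indicator of [Q] at
   [Z y]. *)
have eR n y : 2 * 'i%C * cintegral setT ((h n)^~ y) = (w y * (chi y * J y)%:C%C) *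
    (2 * 'i%C * poisson_mean n.+1%:R^-1 (Z y) \1_Q).
  rewrite [RHS]mulrCA; congr (_ * _).
  rewrite -cintegralZ; last exact: (poisson_mean_integrable _ (n0 n) m1Q Q1 Qoff).
  congr cintegral; apply/funext => x.
  rewrite -[RHS]mulrA -rmorphM/=; congr (_ * _%:C%C); rewrite /k.
  by rewrite -(opprB (Z x) (Z y)) poissonN; ring.
have iL n : cintegrable (fun x => 2 * 'i%C * cintegral setT (h n x)).
  by apply: cintegrableZ; case: (Fub n).
have iR n : cintegrable (fun y => 2 * 'i%C * cintegral setT ((h n)^~ y)).
  exact: cintegrableZ.
have eLR n : cintegral setT (fun x => 2 * 'i%C * cintegral setT (h n x)) =
    cintegral setT (fun y => 2 * 'i%C * cintegral setT ((h n)^~ y)).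
  have [f1 f2] := Fub n.
  have e1 := cintegralZ (2 * 'i%C) f1; have e2 := cintegralZ (2 * 'i%C) (Fub' n).
  exact: (etrans e1 (etrans (congr1 (fun z => 2 * 'i%C * z) f2) (esym e2))).
have mJ' : cmeasurable setT (fun x => (J x)%:C%C : C) by exact: cmeasurable_real.
have mQ' : cmeasurable setT (fun x => (\1_Q x)%:C%C : C) by exact: cmeasurable_real.
have [|||||_ cL] := @cintegral_dominated R
  (fun n x => 2 * 'i%C * cintegral setT (h n x))
  (fun x => (\1_Q x)%:C%C * ((J x)%:C%C * T (Z x)))
  (fun x => M2 * KF * \1_(ball c r) x).
- by move=> n; exact: cintegrable_measurable.
- rewrite (_ : (fun x => _) = (fun x => (\1_Q x)%:C%C * ((J x)%:C%C * ((\1_(ball c r3) x)%:C%C * T (Z x))))).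
    by apply: cmeasurableM => //; exact: cmeasurableM.
  apply/funext => x; rewrite [\1_Q x]indicE; case: (boolP (x \in Q)); last by rewrite !mul0r.
  by move=> /set_mem/Q3 h3; rewrite indicE mem_set// [1%:C%C * T _]mul1r.
- exact: iB.
- move=> n x; rewrite eL modcM modcR normrM indicE.
  case: (boolP (x \in Q)) => [/set_mem/Qin hx|_]; last first.
    by rewrite normr0 !mul0r !mulr_ge0// indicE.
  rewrite indicE mem_set ?mulr1 ?normr1 ?mul1r; last by apply/plane_ballP; exact: lt_trans r3r.
  apply: ler_pM => //; first exact: modc_ge0.
  have [G [iG FG GK]] := hKF x hx.
  have [i1 i2 _] := ker n x.
  rewrite (le_trans (modc_cintegral_le i2))//; apply: le_trans GK.
  apply: le_Rintegral => //; first exact: integrable_modc.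
  move=> y _; rewrite modcM (le_trans _ (FG y))// ler_wpM2l ?modc_ge0//.
  exact: modc_cauchy_le.
- apply: ae_all => x; apply: (ccvg_ext (fun n => esym (eL n x))).
  case: (boolP (x \in Q)) => [/set_mem Qx|xQ]; last first.
    have q0' : \1_Q x = 0 :> R by rewrite indicE (negbTE xQ).
    rewrite q0' [X in ccvg _ X]mul0r; apply: (ccvg_ext _ (ccvg_cst 0)) => n.
    by rewrite !mul0r.
  rewrite indicE mem_set// mul1r [1%:C%C * _]mul1r; apply: ccvgM; first exact: ccvg_cst.
  have [G [iG FG GK]] := hKF x (Qin _ Qx).
  by have [] := cauchy_transform_cvg mZ (cintegrable_measurable iF) iG FG.
have [|||||_ cR] := @cintegral_dominated R
  (fun n y => 2 * 'i%C * cintegral setT ((h n)^~ y))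
  (fun x => (\1_Q x)%:C%C * ((J x)%:C%C * (w x * chi_transform (Z c))))
  (fun x => M2 * Kp * modc (w x)).
- by move=> n; exact: cintegrable_measurable.
- apply: cmeasurableM => //; apply: cmeasurableM => //; apply: cmeasurableM.
    exact: cintegrable_measurable.
  exact: cmeasurable_cst.
- exact: (integrableZl measurableT _ (integrable_modc iw)).
- move=> n y; rewrite eR modcM modcM modcR normrM.
  have h1 : `|chi y| * `|J y| <= M2 by rewrite -[M2]mul1r; apply: ler_pM.
  have h2 := hKp _ (Z y) (n0 n).
  rewrite -mulrA [leRHS]mulrC; apply: ler_wpM2l; first exact: modc_ge0.
  by apply: ler_pM => //; rewrite ?mulr_ge0 ?modc_ge0.
- apply: ae_leb2_impl Qae => y hy; apply: (ccvg_ext (fun n => esym (eR n y))).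
  have [yr|yr] := leP r `|y - c|.
    rewrite Qoff// mul0r; apply: (ccvg_ext _ (ccvg_cst 0)) => n.
    by rewrite chi_off// mul0r mulr0 mul0r.
  case: hy => [[delta d0 hd]|[delta d0 hd]].
    have yQ : Q y by apply: hd; exact: ballxx.
    rewrite indicE mem_set// [1%:C%C * _]mul1r chi1 ?Qr2// mul1r mulrA [_ * w y]mulrC.
    apply: ccvgM; first exact: ccvg_cst.
    rewrite -(chi_transform_constant r32 (Qin _ yQ)) ?subrr ?normr0//.
    exact: Qcvg_in hd.
  rewrite indicE memNset; last by move=> /hd; rewrite subrr normr0 leNgt d0.
  rewrite mul0r -[0 : C](mulr0 (w y * (chi y * J y)%:C%C)).
  by apply: ccvgM; [exact: ccvg_cst|exact: Qcvg_out hd].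
apply: ccvg_unique cR _; apply: (ccvg_ext _ cL) => n; exact: eLR.
Qed.

Theorem local_hoelder : exists v : plane R -> C,
  {ae mu, forall x : plane R, `|x - c| < r3 -> w x = v x} /\
  exists K, forall x y, `|x - c| < r3 -> `|y - c| < r3 ->
    modc (v x - v y) <= K * `|x - y| `^ alpha.
Proof.
have mB : measurable (ball c r3 : set (mplane R)) := measurable_plane_ball c r3.
have cr3 : `|c - c| < r3 by rewrite subrr normr0.
pose H := chi_transform (Z c).
have H0 : H != 0.
  have [x [hx hxr Jx]] := jac_dense (lt_trans cr3 r3r) r30.
  rewrite /H (chi_transform_constant r32 cr3 hx).
  by apply: chi_transform_neq0 => //; exact: lt_trans r32.
have [K K0 hK] := T_holder.
exists (fun x => T (Z x) * H^-1); split; last first.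
  exists (K * modc H^-1) => x y hx hy; rewrite -mulrBl modcM mulrAC.
  by rewrite ler_wpM2r ?modc_ge0//; exact: hK.
pose g1 x := (J x)%:C%C * (w x * H).
pose g2 x := (J x)%:C%C * T (Z x).
have ig1 : cintegrable (fun x => (\1_(ball c r3) x)%:C%C * g1 x).
  apply: cintegrable_indicM => //.
  apply: (cintegrable_le _ (integrableZl measurableT (2 * M ^+ 2 * modc H) (integrable_modc iw))).
    apply: cmeasurableM; first exact: cmeasurable_real.
    by apply: cmeasurableM; [exact: cintegrable_measurable|exact: cmeasurable_cst].
  move=> x; rewrite (_ : _ * modc (w x) = 2 * M ^+ 2 * (modc (w x) * modc H)); last by ring.
  rewrite !modcM modcR.
  by apply: ler_pM; rewrite ?mulr_ge0 ?modc_ge0.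
have T_bound : exists2 KT, 0 <= KT & forall x, modc ((\1_(ball c r3) x)%:C%C * T (Z x)) <= KT.
  exists (K * r3 `^ alpha + modc (T (Z c))); first by rewrite addr_ge0 ?modc_ge0// mulr_ge0 ?powR_ge0.
  move=> x; rewrite modcM modcR indicE; case: (boolP (x \in _)) => [/set_mem/plane_ballP hx|_].
    rewrite normr1 mul1r.
    have -> : T (Z x) = (T (Z x) - T (Z c)) + T (Z c) by rewrite subrK.
    rewrite (le_trans (modcD _ _))// lerD2r (le_trans (hK x c hx cr3))// ler_wpM2l//.
    by apply: ge0_ler_powR; rewrite ?nnegrE ?(ltW alpha0) ?(ltW r30) ?(ltW hx).
  by rewrite normr0 mul0r addr_ge0 ?modc_ge0// mulr_ge0 ?powR_ge0.
have [KT KT0 hKT] := T_bound.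
have ig2 : cintegrable (fun x => (\1_(ball c r3) x)%:C%C * g2 x).
  rewrite (_ : (fun x => _) = (fun x => (J x)%:C%C * ((\1_(ball c r3) x)%:C%C * T (Z x)))); last first.
    by apply/funext => x; rewrite mulrCA.
  apply: (cintegrable_le _ (iB (2 * M ^+ 2 * KT))).
    by apply: cmeasurableM => //; exact: cmeasurable_real.
  apply: cut_le => x.
    by rewrite modcM modcR; apply: ler_pM; rewrite ?modc_ge0.
  rewrite ltNge; apply: contraNN => hx.
  rewrite indicE memNset ?mul0r ?mulr0// => /plane_ballP.
  by rewrite ltNge (le_trans (ltW r3r)).
pose g x := (\1_(ball c r3) x)%:C%C * g1 x - (\1_(ball c r3) x)%:C%C * g2 x.
have ig : cintegrable g by apply: cintegrableD => //; exact: cintegrableN.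
have g0 : {ae mu, forall x, g x = 0}.
  apply: ae_eq0_rectangles => // a b a' b'.
  set R0 := _ `*` _.
  (* The sup norm pays off: a square meets a rectangle in a rectangle, to which the identity
     applies. *)
  pose Q := (`]Num.max a (c.1 - r3), Num.min b (c.1 + r3)[%classic `*`
    `]Num.max a' (c.2 - r3), Num.min b' (c.2 + r3)[%classic).
  have QE x : \1_Q x = \1_R0 x * \1_(ball c r3) x :> R.
    rewrite !indicE -natrM mulnb; congr (_%:R); congr nat_of_bool.
    apply/idP/andP.
      move=> /set_mem[/=]; rewrite !in_itv/= !gt_max !lt_min.
      move=> /andP[/andP[h1 h2] /andP[h3 h4]] /andP[/andP[h5 h6] /andP[h7 h8]].
      split; apply/mem_set; first by split; rewrite /= in_itv/=; apply/andP; split.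
      apply/plane_ballP; rewrite plane_normE gt_max !ltr_norml /=.
      by apply/andP; split; apply/andP; split; lra.
    move=> [/set_mem[/=]]; rewrite !in_itv/= => /andP[h1 h2] /andP[h3 h4] /set_mem/plane_ballP.
    rewrite plane_normE gt_max !ltr_norml /= => /andP[/andP[h5 h6] /andP[h7 h8]].
    apply/mem_set; split; rewrite /= in_itv/= gt_max lt_min; apply/andP; split; apply/andP; split=> //; lra.
  have mQ : measurable (Q : set (mplane R)) by apply: measurableX.
  have Q3 : Q `<=` ball c r3.
    move=> x Qx; have : \1_R0 x * \1_(ball c r3) x = 1 :> R by rewrite -QE indicE mem_set.
    rewrite [X in _ * X]indicE; case: (boolP (x \in _)) => [/set_mem//|_].
    by rewrite mulr0 => /eqP; rewrite eq_sym oner_eq0.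
  have := rectangle_identity mQ Q3 (@rectangle_ae R _ _ _ _) => e.
  have e1 : (fun x => (\1_R0 x)%:C%C * g x) =
      (fun x => (\1_Q x)%:C%C * g1 x - (\1_Q x)%:C%C * g2 x).
    by apply/funext => x; rewrite QE rmorphM /g mulrBr !mulrA.
  have iQ k : cintegrable (fun x => (\1_(ball c r3) x)%:C%C * k x) ->
      cintegrable (fun x => (\1_Q x)%:C%C * k x).
    move=> ik; rewrite (_ : (fun x => _) = (fun x => (\1_R0 x)%:C%C * ((\1_(ball c r3) x)%:C%C * k x))).
      by apply: cintegrable_indicM => //; apply: measurableX.
    by apply/funext => x; rewrite QE rmorphM mulrA.
  by rewrite e1 cintegralB; [rewrite e subrr|exact: iQ|exact: iQ].
have j0 : {ae mu, forall x : plane R, ~ (`|x - c| < r /\ J x = 0)}.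
  apply: (@negligibleS _ (mplane R) R mu _ _ _ jnull) => x /= hx.
  by apply: contrapT => h; apply: hx => -[h1 h2]; apply: h; split=> //; exact/plane_ballP.
have := @filterI (mplane R) _ (ae_filter_ringOfSetsType mu) _ _ g0 j0.
apply: ae_leb2_impl => x [gx jx] hx.
(* Almost everywhere the weight [J] can be divided out. *)
have Jx : J x != 0 by apply/eqP => e; apply: jx; split=> //; exact: lt_trans r3r.
have Jx' : (J x)%:C%C != 0 :> C by rewrite -modc_gt0 modcR normr_gt0.
move: gx; rewrite /g indicE mem_set; last exact/plane_ballP.
rewrite !mul1r /g1 /g2 -mulrBr => /eqP; rewrite mulf_eq0 (negbTE Jx') /= subr_eq0 => /eqP <-.
by rewrite mulfK.
Qed.

End hoelder.
End representation.

(** * Following a level curve across the zero set of [rho] *)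

Section level_curve.
Variable R : realType.

Lemma is_derive_cvg (f : R -> R) (t l : R) :
  (forall e, 0 < e -> exists2 d, 0 < d & forall h, h != 0 -> `|h| < d ->
     `|h^-1 * (f (t + h) - f t) - l| <= e) -> is_derive t 1 f l.
Proof.
move=> hf.
have cv : (fun h : R => h^-1 *: (f (h *: (1 : R) + t) - f t)) @ 0^' --> l.
  apply/cvgrPdist_le => e e0; have [d d0 hd] := hf e e0.
  near=> h; rewrite distrC [_ *: 1]mulr1 [h + t]addrC; apply: hd.
    by near: h; exact: nbhs_dnbhs_neq.
  by near: h; exact: dnbhs0_lt.
by split; [apply/cvg_ex; exists l|exact: cvg_lim].
Unshelve. all: by end_near. Qed.

Lemma mean_value (f f' : R -> R) (a b : R) : a < b ->
  (forall t, a <= t <= b -> is_derive t 1 f (f' t)) ->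
  exists2 t, a <= t <= b & f b - f a = f' t * (b - a).
Proof.
move=> ab df.
have [t] : exists2 t, t \in `]a, b[%R & f b - f a = f' t * (b - a).
  apply: MVT => //.
  - by move=> t; rewrite in_itv/= => /andP[t0 t1]; apply: df; rewrite !ltW.
  - apply: derivable_within_continuous => t; rewrite in_itv/= => ht.
    by case: (df t ht).
by rewrite in_itv/= => /andP[t0 t1] e; exists t => //; rewrite !ltW.
Qed.

(* [G] moves by at least [k (d (b - a) / 4) ^ s (b - a) / 4] across the quarter of
   [a, b] at the end where the monotone function [S] is the larger. *)
Lemma monotone_gap (G G' S S' : R -> R) (a b k d s : R) : a < b -> 0 <= k -> 0 <= d ->
  0 <= s ->
  (forall t, a <= t <= b -> is_derive t 1 G (G' t)) ->
  (forall t, a <= t <= b -> is_derive t 1 S (S' t)) ->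
  (forall t, a <= t <= b -> d <= S' t) ->
  (forall t, a <= t <= b -> k * `|S t| `^ s <= G' t) ->
  k * (d * (b - a) / 4) `^ s * ((b - a) / 4) <= G b - G a.
Proof.
move=> ab k0 d0 s0 dG dS hS hG.
have G'0 t : a <= t <= b -> 0 <= G' t.
  by move=> /hG; apply: le_trans; rewrite mulr_ge0// powR_ge0.
have sub x y : a <= x -> y <= b -> forall t, x <= t <= y -> a <= t <= b.
  by move=> ax yb t /andP[xt ty]; rewrite (le_trans ax xt) (le_trans ty yb).
have monoG x y : a <= x -> x <= y -> y <= b -> G x <= G y.
  move=> ax; rewrite le_eqVlt => /orP[/eqP -> //|xy] yb.
  have [t /(sub _ _ ax yb) ht e] := mean_value xy (fun t ht => dG t (sub _ _ ax yb t ht)).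
  by rewrite -subr_ge0 e mulr_ge0 ?G'0// subr_ge0 ltW.
have slopeS x y : a <= x -> x <= y -> y <= b -> d * (y - x) <= S y - S x.
  move=> ax; rewrite le_eqVlt => /orP[/eqP -> _|xy yb]; first by rewrite !subrr mulr0.
  have [t /(sub _ _ ax yb) ht ->] := mean_value xy (fun t ht => dS t (sub _ _ ax yb t ht)).
  by apply: ler_wpM2r; [rewrite subr_ge0 ltW|exact: hS].
have gap x y : a <= x -> x < y -> y <= b ->
    (forall t, x <= t <= y -> d * (b - a) / 4 <= `|S t|) ->
    k * (d * (b - a) / 4) `^ s * (y - x) <= G y - G x.
  move=> ax xy yb St.
  have [t ht ->] := mean_value xy (fun t ht => dG t (sub _ _ ax yb t ht)).
  apply: ler_wpM2r; first by rewrite subr_ge0 ltW.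
  apply: (le_trans _ (hG t (sub _ _ ax yb t ht))); apply: ler_wpM2l => //.
  apply: ge0_ler_powR; rewrite ?nnegrE ?St// !mulr_ge0// subr_ge0 ltW//.
pose h := (b - a) / 4; have h0 : 0 < h by rewrite divr_gt0 ?subr_gt0.
have eh : b - a = 4 * h by rewrite /h; field.
have e4 : d * (b - a) / 4 = d * h by rewrite /h; ring.
have m1 := slopeS (a + h) (b - h); have dh0 : 0 <= d * h by rewrite mulr_ge0// ltW.
have {}m1 : d * (2 * h) <= S (b - h) - S (a + h).
  have -> : 2 * h = b - h - (a + h) by lra.
  by apply: m1; lra.
(* [S] grows by at least [2 d h] over the middle half of [[a, b]]. If it stays below [d h] at
   [b - h], then it is below [- d h] at [a + h]; so [|S| >= d h] on one of the two outer
   quarters. *)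
have [Sb|Sb] := leP (d * h) (S (b - h)).
  have := gap (b - h) b; rewrite -/h e4 (_ : b - (b - h) = h); last by ring.
  move=> /(_ _ _ _ _)/le_trans; apply; try lra.
    move=> t /andP[t1 t2]; apply: le_trans (ler_norm _); apply: le_trans Sb _.
    have : d * (t - (b - h)) <= S t - S (b - h) by apply: slopeS; lra.
    have : 0 <= d * (t - (b - h)) by rewrite mulr_ge0// subr_ge0.
    by lra.
  by rewrite lerD2l lerN2; apply: monoG; lra.
have := gap a (a + h); rewrite -/h e4 (_ : a + h - a = h); last by ring.
move=> /(_ _ _ _ _)/le_trans; apply; try lra.
  move=> t /andP[t1 t2]; rewrite -normrN; apply: le_trans (ler_norm _).
  have : d * (a + h - t) <= S (a + h) - S t by apply: slopeS; lra.
  have : 0 <= d * (a + h - t) by rewrite mulr_ge0// subr_ge0.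
  by lra.
by rewrite lerD2r; apply: monoG; lra.
Qed.

Variables (c : plane R) (r m0 M k d s : R) (X Xx Xy Y Yx Yy rho rhox rhoy : plane R -> R).
Hypotheses (r0 : 0 < r) (m00 : 0 < m0) (k0 : 0 < k) (d0 : 0 < d) (s0 : 0 <= s)
  (gX : forall p, `|p - c| < r -> has_grad X p (Xx p) (Xy p))
  (gY : forall p, `|p - c| < r -> has_grad Y p (Yx p) (Yy p))
  (grho : forall p, `|p - c| < r -> has_grad rho p (rhox p) (rhoy p))
  (cX : forall p, `|p - c| < r -> {for p, continuous Xx} /\ {for p, continuous Xy})
  (bX : forall p, `|p - c| < r -> [/\ m0 <= Xx p, Xx p <= M & `|Xy p| <= M])
  (bY : forall p, `|p - c| < r -> `|Yx p| <= M)
  (hrho : forall p, `|p - c| < r -> d <= Xx p * rhoy p - Xy p * rhox p)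
  (hD : forall p, `|p - c| < r -> k * `|rho p| `^ s <= Xx p * Yy p - Xy p * Yx p).

Let M0 : 0 < M.
Proof.
by have [|h1 h2 _] := bX (p := c); [rewrite subrr normr0|exact: lt_le_trans (lt_le_trans m00 h1) h2].
Qed.

(** Heights in the smaller square differ by less than [4 r'], which changes [X] by at most [4 M r'].
    A horizontal move of [4 M r' / m0] makes up for this, and the denominator leaves room for it
    inside radius [r]. *)
Let r' := r / (2 + 4 * M / m0).

Let a0 : 0 < 2 + 4 * M / m0. Proof. by rewrite ltr_wpDr// divr_ge0 ?mulr_ge0 ?ltW. Qed.

Let r'0 : 0 < r'. Proof. by rewrite divr_gt0. Qed.

Let r'E : 2 * r' + 4 * M / m0 * r' = r.
Proof. by rewrite -mulrDl /r' mulrC divfK// gt_eqF. Qed.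

Let r'r : r' < r.
Proof.
have : 0 <= 4 * M / m0 * r' by rewrite mulr_ge0 ?(ltW r'0)// divr_ge0 ?mulr_ge0 ?ltW.
by move: r'E r'0; lra.
Qed.

Let X_slope x x' y : `|(x, y) - c| < r -> `|(x', y) - c| < r -> x <= x' ->
  m0 * (x' - x) <= X (x', y) - X (x, y).
Proof.
move=> hx hx' xx'; have [z [hz _ ->]] := mean_value_ball gX hx' hx.
rewrite /= subrr mulr0 addr0 ler_wpM2r ?subr_ge0//.
by case: (bX hz).
Qed.

Let X_slope_abs x x' y : `|(x, y) - c| < r -> `|(x', y) - c| < r ->
  m0 * `|x - x'| <= `|X (x, y) - X (x', y)|.
Proof.
move=> hx hx'; have [xx'|xx'] := leP x x'.
  rewrite distrC [leRHS]distrC ger0_norm ?subr_ge0// (le_trans (X_slope hx hx' xx'))// ler_norm//.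
have xx := ltW xx'.
by rewrite ger0_norm ?subr_ge0// (le_trans (X_slope hx' hx xx))// ler_norm.
Qed.

Let inr (x y : R) : `|x - c.1| < r -> `|y - c.2| < r' -> `|(x, y) - c| < r.
Proof. by move=> hx hy; rewrite plane_normE gt_max /= hx (lt_trans hy r'r). Qed.

(** The intermediate value theorem on a horizontal segment, along which [X] increases at the rate
    [m0] at least. *)
Let level (p : plane R) (y : R) : `|p - c| < r' -> `|y - c.2| < r' ->
  exists2 x, `|x - c.1| < r & X (x, y) = X p.
Proof.
case: p => x1 y1 hp hy.
have [hx1 hy1] : `|x1 - c.1| < r' /\ `|y1 - c.2| < r'.
  by move: hp; rewrite plane_normE gt_max /= => /andP[].
have hx1r := lt_trans hx1 r'r.
pose t := 4 * M / m0 * r'.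
have t0 : 0 <= t by rewrite mulr_ge0 ?(ltW r'0)// divr_ge0 ?mulr_ge0 ?ltW.
have hpm e : `|e| <= t -> `|x1 + e - c.1| < r.
  move=> he; rewrite (_ : x1 + e - c.1 = (x1 - c.1) + e); last by ring.
  by have := ler_normD (x1 - c.1) e; move: r'E r'0; rewrite -/t; lra.
have near_ : `|X (x1, y) - X (x1, y1)| <= m0 * t.
  have [z [hz _ ->]] := mean_value_ball gX (inr hx1r hy) (inr hx1r hy1).
  rewrite /= subrr mulr0 add0r normrM.
  have -> : m0 * t = M * (4 * r') by rewrite /t; field; rewrite gt_eqF.
  have [_ _ h] := bX hz; apply: ler_pM => //.
  by have := ler_distD c.2 y y1; rewrite (distrC c.2); move: r'0; lra.
have hm : `|x1 - t - c.1| < r by apply: hpm; rewrite normrN ger0_norm.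
have hp' : `|x1 + t - c.1| < r by apply: hpm; rewrite ger0_norm.
have lo : X (x1 - t, y) <= X (x1, y1).
  have := X_slope (inr hm hy) (inr hx1r hy); move: near_; rewrite ler_norml => /andP[_ h1] /(_ _).
  by rewrite (_ : x1 - (x1 - t) = t) => [h|]; [have : x1 - t <= x1 by lra|ring]; move=> /h; lra.
have hi : X (x1, y1) <= X (x1 + t, y).
  have := X_slope (inr hx1r hy) (inr hp' hy); move: near_; rewrite ler_norml => /andP[h1 _] /(_ _).
  by rewrite (_ : x1 + t - x1 = t) => [h|]; [have : x1 <= x1 + t by lra|ring]; move=> /h; lra.
have inI x : x1 - t <= x <= x1 + t -> `|x - c.1| < r.
  move=> /andP[l1 l2]; rewrite (_ : x - c.1 = x1 + (x - x1) - c.1); last by ring.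
  by apply: hpm; rewrite ler_norml; lra.
have [|||x] := @IVT R (fun x => X (x, y)) (x1 - t) (x1 + t) (X (x1, y1)).
- by lra.
- apply: derivable_within_continuous => x; rewrite in_itv/= => /inI hx.
  have := has_grad_curve (is_derive_id x 1) (is_derive_cst y x 1) (gX (inr hx hy)).
  by case.
- by rewrite ge_min le_max lo hi orbT.
by rewrite in_itv/= => /inI hx e; exists x.
Qed.

(** The level curve of [X] through [p] is followed up to the height of [q]. Along it [Y] grows as in
    [monotone_gap]; its end differs from [q] by a horizontal segment, of length at most
    [|X q - X p| / m0]. *)
Let estimate_lt (p q : plane R) : `|p - c| < r' -> `|q - c| < r' -> p.2 < q.2 ->
  k / M * (d / M * (q.2 - p.2) / 4) `^ s * ((q.2 - p.2) / 4) <=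
    `|Y q - Y p| + M / m0 * `|X q - X p|.
Proof.
move=> hp hq pq.
have inr' (z : plane R) : `|z - c| < r' -> `|z.1 - c.1| < r' /\ `|z.2 - c.2| < r'.
  by rewrite plane_normE gt_max /= => /andP[].
have [hp1 hp2] := inr' p hp; have [hq1 hq2] := inr' q hq.
have /choice[A hA] : forall y, exists x, `|y - c.2| < r' -> `|x - c.1| < r /\ X (x, y) = X p.
  move=> y; have [hy|hy] := pselect (`|y - c.2| < r'); last by exists 0.
  by have [x ? ?] := level hp hy; exists x.
have Ain y : `|y - c.2| < r' -> `|(A y, y) - c| < r.
  by move=> hy; apply: inr => //; case: (hA y hy).
have AX y : `|y - c.2| < r' -> X (A y, y) = X p by move=> /hA[].
(* The slope of the level curve. *)
pose sl z := - Xy z / Xx z.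
(* Differentiability of the implicit function: the mean value theorem for [X] on a chord of the
   curve shows that the increments of [A] have the exact ratio [sl z], with [z] near the base
   point. *)
have dA y : `|y - c.2| < r' -> is_derive y 1 A (sl (A y, y)).
  move=> hy; apply: is_derive_cvg => e e0.
  have hP := Ain y hy.
  have Xx0 : Xx (A y, y) != 0 by have [h _ _] := bX hP; rewrite gt_eqF// (lt_le_trans m00).
  have cs : {for (A y, y), continuous sl}.
    have [c1 c2] := cX hP; apply: cvgM; first exact: cvgN.
    exact: cvgV.
  have /cvgrPdist_le/(_ e e0)/nbhs_ballP[t /= t0 ht] := cs.
  pose L := M / m0 + 1; have L0 : 0 < L by rewrite ltr_wpDl// divr_ge0 ?ltW.
  exists (Num.min (r' - `|y - c.2|) (t / L)); first by rewrite lt_min subr_gt0 hy divr_gt0.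
  move=> h h0; rewrite lt_min => /andP[h1 h2].
  have hyh : `|y + h - c.2| < r'.
    rewrite addrAC; have := ler_normD (y - c.2) h; lra.
  have [z [hz zP e1]] := mean_value_ball gX (Ain _ hyh) hP.
  move: e1; rewrite !AX// subrr /= (_ : y + h - y = h); last by ring.
  move=> e1; have [zm zM zM'] := bX hz.
  have z0 : 0 < Xx z by exact: lt_le_trans zm.
  have eA : A (y + h) - A y = sl z * h.
    apply: (mulfI (lt0r_neq0 z0)); rewrite /sl mulrA mulrCA mulfV ?gt_eqF// mulr1 mulNr.
    by apply/eqP; rewrite -addr_eq0 -e1.
  rewrite eA mulrC mulfK//.
  have slz : `|sl z| <= M / m0.
    rewrite normrM normrN normfV (gtr0_norm z0); apply: ler_pM => //.
      by rewrite invr_ge0 ltW.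
    by rewrite lef_pV2.
  rewrite distrC; apply: (ht z); apply/plane_ballP; apply: (le_lt_trans zP).
  rewrite plane_normE gt_max /= (_ : y + h - y = h); last by ring.
  rewrite eA normrM; move: h2; rewrite ltr_pdivlMr// => h2.
  apply/andP; split; apply: le_lt_trans h2.
    by rewrite mulrC ler_wpM2l// (le_trans slz)// lerDl.
  by rewrite ler_peMr// lerDr divr_ge0 ?ltW.
pose G y := Y (A y, y); pose S y := rho (A y, y).
have dG y : `|y - c.2| < r' -> is_derive y 1 G (Yx (A y, y) * sl (A y, y) + Yy (A y, y) * 1).
  by move=> hy; exact: (has_grad_curve (dA y hy) (is_derive_id y 1) (gY (Ain y hy))).
have dS y : `|y - c.2| < r' -> is_derive y 1 S (rhox (A y, y) * sl (A y, y) + rhoy (A y, y) * 1).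
  by move=> hy; exact: (has_grad_curve (dA y hy) (is_derive_id y 1) (grho (Ain y hy))).
have inI t : p.2 <= t <= q.2 -> `|t - c.2| < r'.
  by move=> /andP[t1 t2]; move: hp2 hq2; rewrite !ltr_norml; lra.
have XxP y : `|y - c.2| < r' -> 0 < Xx (A y, y).
  by move=> hy; have [h _ _] := bX (Ain y hy); exact: lt_le_trans h.
(* Along the curve, [Y] and [rho] have as derivatives the determinants in [hD] and [hrho] divided by
   [Xx], and [Xx <= M]. *)
have gap : k / M * (d / M * (q.2 - p.2) / 4) `^ s * ((q.2 - p.2) / 4) <= G q.2 - G p.2.
  apply: (@monotone_gap G _ S _ p.2 q.2 (k / M) (d / M) s pq _ _ s0
    (fun t ht => dG t (inI t ht)) (fun t ht => dS t (inI t ht))).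
  - by rewrite divr_ge0 ?ltW.
  - by rewrite divr_ge0 ?ltW.
  - move=> t /inI ht; have P0 := XxP t ht; have [_ PM _] := bX (Ain t ht).
    have e : rhox (A t, t) * sl (A t, t) + rhoy (A t, t) * 1 =
       (Xx (A t, t) * rhoy (A t, t) - Xy (A t, t) * rhox (A t, t)) / Xx (A t, t).
      by rewrite /sl; field; rewrite gt_eqF.
    rewrite e; apply: ler_pM; rewrite ?invr_ge0 ?(ltW d0) ?(ltW M0)//; first exact: (hrho (Ain t ht)).
    by rewrite lef_pV2.
  - move=> t /inI ht; have P0 := XxP t ht; have [_ PM _] := bX (Ain t ht).
    have e : Yx (A t, t) * sl (A t, t) + Yy (A t, t) * 1 =
       (Xx (A t, t) * Yy (A t, t) - Xy (A t, t) * Yx (A t, t)) / Xx (A t, t).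
      by rewrite /sl; field; rewrite gt_eqF.
    rewrite e -mulrAC -/(S t); apply: ler_pM; rewrite ?invr_ge0 ?(ltW M0) ?mulr_ge0 ?powR_ge0 ?(ltW k0)//.
      exact: (hD (Ain t ht)).
    by rewrite lef_pV2.
have Ap : A p.2 = p.1.
  have hPp := Ain _ hp2; have hpr : `|(p.1, p.2) - c| < r by apply: inr => //; exact: lt_trans r'r.
  have := X_slope_abs hPp hpr; rewrite AX// -surjective_pairing subrr normr0 pmulr_rle0//.
  by rewrite normr_le0 subr_eq0 => /eqP.
have Gp : G p.2 = Y p by rewrite /G Ap -surjective_pairing.
have hqr : `|(q.1, q.2) - c| < r by apply: inr => //; exact: lt_trans r'r.
have Aq : `|q.1 - A q.2| <= `|X q - X p| / m0.
  rewrite ler_pdivlMr// mulrC; have := X_slope_abs hqr (Ain _ hq2).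
  by rewrite AX// -surjective_pairing.
have Gq : `|Y q - G q.2| <= M / m0 * `|X q - X p|.
  have [z [hz _ e]] := mean_value_ball gY hqr (Ain _ hq2).
  move: e; rewrite -surjective_pairing /= subrr mulr0 addr0 => ->.
  rewrite normrM mulrAC -mulrA; apply: ler_pM => //; exact: bY.
apply: (le_trans gap); rewrite Gp.
have := ler_norm (G q.2 - Y q); rewrite distrC; have := ler_norm (Y q - Y p); lra.
Qed.

(** The first bound collects the powers in [estimate_lt] into [|p.2 - q.2| ^ (1 + s)]. The second
    solves the mean value formula of [X] for the horizontal increment, as [Xx >= m0]. *)
Lemma level_curve_estimate : exists r1 K, [/\ 0 < r1, r1 < r, 0 < K &
  forall p q, `|p - c| < r1 -> `|q - c| < r1 ->
    `|p.2 - q.2| `^ (1 + s) <= K * (`|X p - X q| + `|Y p - Y q|) /\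
    `|p.1 - q.1| <= K * (`|X p - X q| + `|p.2 - q.2|)].
Proof.
pose g := k / M * (d / M / 4) `^ s / 4.
have g0 : 0 < g by rewrite !mulr_gt0 ?powR_gt0 ?divr_gt0 ?invr_gt0.
pose K1 := (1 + M / m0) / g; pose K2 := (1 + M) / m0.
have K10 : 0 < K1 by rewrite divr_gt0// ltr_pwDl// divr_ge0 ?ltW.
have K20 : 0 < K2 by rewrite divr_gt0// addr_gt0.
exists r', (K1 + K2); split=> //; first exact: addr_gt0.
have est p q : `|p - c| < r' -> `|q - c| < r' -> p.2 < q.2 ->
    `|p.2 - q.2| `^ (1 + s) <= K1 * (`|X p - X q| + `|Y p - Y q|).
  move=> hp hq pq; have := estimate_lt hp hq pq.
  have h0 : 0 < q.2 - p.2 by rewrite subr_gt0.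
  rewrite [`|p.2 - _|]distrC [`|q.2 - _|]ger0_norm; last exact: ltW.
  rewrite [`|X q - _|]distrC [`|Y q - _|]distrC => h.
  rewrite /K1 mulrAC ler_pdivlMr// powRD; last by rewrite (gt_eqF h0) implybT.
  rewrite powRr1 ?(ltW h0)//; move: h.
  rewrite (_ : d / M * (q.2 - p.2) / 4 = (d / M / 4) * (q.2 - p.2)); last by ring.
  rewrite powRM ?(ltW h0) ?divr_ge0 ?(ltW d0) ?(ltW M0)//.
  set u := (q.2 - p.2) `^ s; set v := q.2 - p.2.
  rewrite (_ : k / M * ((d / M / 4) `^ s * u) * (v / 4) = v * u * g); last by rewrite /g; ring.
  move=> /le_trans; apply; rewrite mulrDr !mulrDl !mul1r.
  have Mm : 0 <= M / m0 by rewrite divr_ge0 ?ltW.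
  have := mulr_ge0 Mm (normr_ge0 (Y p - Y q)); have := normr_ge0 (X p - X q); lra.
move=> p q hp hq; split.
  apply: (@le_trans _ _ (K1 * (`|X p - X q| + `|Y p - Y q|))); last first.
    by rewrite ler_wpM2r ?addr_ge0// lerDl ltW.
  have [pq|pq|e] := ltgtP p.2 q.2; first exact: est.
    by rewrite distrC (distrC (X p)) (distrC (Y p)); exact: est.
  rewrite e subrr normr0 powR0; last by rewrite gt_eqF// ltr_pwDl.
  by rewrite mulr_ge0 ?addr_ge0// ltW.
apply: (@le_trans _ _ (K2 * (`|X p - X q| + `|p.2 - q.2|))); last first.
  by rewrite ler_wpM2r ?addr_ge0// lerDr ltW.
have hpr : `|p - c| < r by exact: lt_trans r'r.
have hqr : `|q - c| < r by exact: lt_trans r'r.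
have [z [hz _ e]] := mean_value_ball gX hpr hqr.
have [z1 z2 z3] := bX hz.
rewrite /K2 mulrAC ler_pdivlMr//.
have e1 : Xx z * `|p.1 - q.1| <= `|X p - X q| + M * `|p.2 - q.2|.
  rewrite -[X in X * _]ger0_norm; last exact: le_trans (ltW m00) z1.
  rewrite -normrM (_ : Xx z * (p.1 - q.1) = (X p - X q) - Xy z * (p.2 - q.2)); last by rewrite e; ring.
  by rewrite (le_trans (ler_normB _ _))// lerD2l normrM ler_wpM2r.
have e2 : m0 * `|p.1 - q.1| <= Xx z * `|p.1 - q.1| by rewrite ler_wpM2r.
have := normr_ge0 (p.2 - q.2); have := mulr_ge0 (ltW M0) (normr_ge0 (X p - X q)).
rewrite mulrDl !mulrDr !mul1r; move: e1 e2; rewrite [m0 * _]mulrC; lra.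
Qed.

End level_curve.

(** * The Hölder inverse of [Z] and the area of its sublevel sets *)

Section transversal.
Variable R : realType.
Local Notation mu := (leb2 R).
Local Notation C := R[i].

Definition coordinate (b : bool) (p : plane R) : R := if b then p.1 else p.2.

(** [b] selects the coordinate that parametrises the level curves being followed. That coordinate is
    controlled with exponent [1 / (1 + s)], the other one linearly once the first is known. *)
Definition transversal_bound (c : plane R) (r K s : R) (b : bool) (P Q : plane R -> R) :=
  forall p q, `|p - c| < r -> `|q - c| < r ->
  `|coordinate b p - coordinate b q| `^ (1 + s) <= K * (`|P p - P q| + `|Q p - Q q|) /\
  `|coordinate (~~ b) p - coordinate (~~ b) q| <=
    K * (`|P p - P q| + `|Q p - Q q| + `|coordinate b p - coordinate b q|).

Definition C1_near (c : plane R) (r : R) (f fx fy : plane R -> R) :=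
  forall p, `|p - c| < r ->
    [/\ has_grad f p (fx p) (fy p), {for p, continuous fx} & {for p, continuous fy}].

Lemma C1_nearZ e c r f fx fy : C1_near c r f fx fy ->
  C1_near c r (fun p => e * f p) (fun p => e * fx p) (fun p => e * fy p).
Proof.
move=> hf p /hf[g h1 h2]; split.
- by apply: (has_grad_eq (has_gradM (has_grad_cst e p) g)); rewrite mul0r addr0.
- by apply: cvgM => //; exact: cvg_cst.
- by apply: cvgM => //; exact: cvg_cst.
Qed.

Definition swap (p : plane R) : plane R := (p.2, p.1).

Lemma swap_continuous : continuous swap.
Proof.
move=> p A /nbhs_ballP[e /= e0 eA]; apply/nbhs_ballP; exists e => // q [h1 h2].
by apply: eA; split.
Qed.

Lemma swapK p : swap (swap p) = p. Proof. by rewrite /swap -surjective_pairing. Qed.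

Lemma swap_norm p q : `|swap p - swap q| = `|p - q|.
Proof. by rewrite !plane_normE /= maxC. Qed.

Lemma C1_near_swap c r f fx fy : C1_near c r f fx fy ->
  C1_near (swap c) r (f \o swap) (fy \o swap) (fx \o swap).
Proof.
move=> hf p hp; have hp' : `|swap p - c| < r by rewrite -[c]swapK swap_norm.
have [g h1 h2] := hf _ hp'; split.
- have d1 := is_diff_pair (has_grad_snd p) (has_grad_fst p).
  have h := is_diff_comp d1 g; rewrite /has_grad.
  by apply: (is_diff_eq h); apply/funext => v /=; ring.
- by apply: continuous_comp => //; exact: swap_continuous.
- by apply: continuous_comp => //; exact: swap_continuous.
Qed.

Lemma powR_norm1 (e : R) : `|e| = 1 -> e * e = 1.
Proof. by move=> e1; rewrite -expr2 -real_normK ?num_real// e1 expr1n. Qed.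

(** Multiplying [P], [Q] and [rho] by signs makes the derivative of [P] in [x] and both determinants
    positive. Continuity at [c] then supplies the uniform bounds on a smaller square. *)
Lemma transversal_x (c : plane R) (r k s eps : R) (P Px Py Q Qx Qy rho rhox rhoy : plane R -> R) :
  0 < r -> 0 < k -> 0 <= s -> `|eps| = 1 ->
  C1_near c r P Px Py -> C1_near c r Q Qx Qy -> C1_near c r rho rhox rhoy ->
  (forall p, `|p - c| < r -> k * `|rho p| `^ s <= eps * (Px p * Qy p - Py p * Qx p)) ->
  Px c != 0 -> Px c * rhoy c - Py c * rhox c != 0 ->
  exists r1 K, [/\ 0 < r1, r1 < r, 0 < K & transversal_bound c r1 K s false P Q].
Proof.
move=> r0 k0 s0 eps1 hP hQ hrho hD Pc Ec.
have cc : `|c - c| < r by rewrite subrr normr0.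
pose e1 := Num.sg (Px c); pose E p := Px p * rhoy p - Py p * rhox p; pose e2 := e1 * Num.sg (E c).
have n1 : `|e1| = 1 by rewrite normr_sg Pc.
have n2 : `|e2| = 1 by rewrite normrM n1 mul1r normr_sg Ec.
have s1 := powR_norm1 n1.
have cE : {for c, continuous E}.
  have [_ a1 a2] := hP c cc; have [_ b1 b2] := hrho c cc.
  by apply: cvgB; apply: cvgM.
have [_ cPx cPy] := hP c cc; have [_ cQx _] := hQ c cc.
have Pc0 : 0 < `|Px c| by rewrite normr_gt0.
have Ec0 : 0 < `|E c| by rewrite normr_gt0.
pose M := 2 * `|Px c| + `|Py c| + 1 + `|Qx c|.
have near_ (f : plane R -> R) t : {for c, continuous f} -> 0 < t ->
    \forall p \near c, `|f c - f p| < t by move=> /cvgrPdist_lt; apply.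
have [r2 [r20 r2r hr2]] : exists r2, [/\ 0 < r2, r2 <= r & forall p, `|p - c| < r2 ->
    [/\ `|Px c - Px p| < `|Px c| / 2, `|E c - E p| < `|E c| / 2,
        `|Py c - Py p| < 1 & `|Qx c - Qx p| < 1]].
  have : \forall p \near c, (`|Px c - Px p| < `|Px c| / 2 /\ `|E c - E p| < `|E c| / 2) /\
      (`|Py c - Py p| < 1 /\ `|Qx c - Qx p| < 1).
    by apply: filterI; apply: filterI; apply: near_ => //; rewrite divr_gt0.
  move=> /nbhs_ballP[d /= d0 hd]; exists (Num.min d r); rewrite lt_min d0 ge_min lexx orbT; split=> // p.
  by rewrite lt_min => /andP[h _]; have [[h1 h2] [h3 h4]] := hd p (iffRL (plane_ballP c p d) h).
have sgn (x y : R) : `|x - y| < `|x| / 2 -> `|x| / 2 <= Num.sg x * y.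
  have [x0|x0|->] := ltgtP x 0; last by rewrite normr0 mul0r ltNge normr_ge0.
    by rewrite (ltr0_norm x0) (ltr0_sg x0) mulN1r ltr_norml => /andP[h1 h2]; lra.
  by rewrite (gtr0_norm x0) (gtr0_sg x0) mul1r ltr_norml => /andP[h1 h2]; lra.
have lt2 p : `|p - c| < r2 -> `|p - c| < r by move=> /lt_le_trans; apply.
have m0 : 0 < `|Px c| / 2 by rewrite divr_gt0.
have t0 : 0 < `|E c| / 2 by rewrite divr_gt0.
have [||||||||r1 [K [r10 r1r K0 hK]]] := @level_curve_estimate R c r2 (`|Px c| / 2) M k (`|E c| / 2) s
  (fun p => e1 * P p) (fun p => e1 * Px p) (fun p => e1 * Py p)
  (fun p => e1 * eps * Q p) (fun p => e1 * eps * Qx p) (fun p => e1 * eps * Qy p)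
  (fun p => e2 * rho p) (fun p => e2 * rhox p) (fun p => e2 * rhoy p) r20 m0 k0 t0 s0.
- by move=> p /lt2/(C1_nearZ e1 hP)[].
- by move=> p /lt2/(C1_nearZ (e1 * eps) hQ)[].
- by move=> p /lt2/(C1_nearZ e2 hrho)[].
- by move=> p /lt2/(C1_nearZ e1 hP)[].
- move=> p /hr2[h1 _ h3 _]; have h := sgn _ _ h1; split=> //.
    rewrite (le_trans (ler_norm _))// normrM n1 mul1r /M.
    have := ler_distD (Px c) (Px p) 0; rewrite !subr0 distrC.
    have := normr_ge0 (Py c); have := normr_ge0 (Qx c); lra.
  rewrite normrM n1 mul1r /M; have := ler_distD (Py c) (Py p) 0; rewrite !subr0 distrC.
  have := normr_ge0 (Qx c); lra.
- move=> p /hr2[_ _ _ h4]; rewrite normrM normrM n1 eps1 !mul1r /M.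
  have := ler_distD (Qx c) (Qx p) 0; rewrite !subr0 distrC.
  have := normr_ge0 (Py c); lra.
- move=> p /hr2[_ h2 _ _]; apply: le_trans (sgn _ _ h2) _.
  rewrite [leRHS](_ : _ = e1 * e1 * (Num.sg (E c) * E p)); first by rewrite s1 mul1r.
  by rewrite /E /e2; ring.
- move=> p /lt2/hD; rewrite normrM n2 mul1r => /le_trans; apply.
  rewrite [leRHS](_ : _ = e1 * e1 * (eps * (Px p * Qy p - Py p * Qx p))); first by rewrite s1 mul1r.
  by ring.
exists r1, K; split=> //; first exact: lt_le_trans r1r r2r.
move=> p q hp hq; have [h1 h2] := hK p q hp hq.
move: h1 h2; rewrite -!mulrBr !normrM n1 eps1 !mul1r => h1 h2; split=> //.
apply: le_trans h2 _; rewrite ler_wpM2l ?(ltW K0)//.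
by rewrite lerD2r lerDl.
Qed.

(** If [Px c = 0], then [Py c != 0] and the coordinates are exchanged. This reverses the sign of the
    Jacobian, hence [- eps]. *)
Lemma transversal_PQ (c : plane R) (r k s eps : R) (P Px Py Q Qx Qy rho rhox rhoy : plane R -> R) :
  0 < r -> 0 < k -> 0 <= s -> `|eps| = 1 ->
  C1_near c r P Px Py -> C1_near c r Q Qx Qy -> C1_near c r rho rhox rhoy ->
  (forall p, `|p - c| < r -> k * `|rho p| `^ s <= eps * (Px p * Qy p - Py p * Qx p)) ->
  Px c * rhoy c - Py c * rhox c != 0 ->
  exists b r1 K, [/\ 0 < r1, r1 < r, 0 < K & transversal_bound c r1 K s b P Q].
Proof.
move=> r0 k0 s0 eps1 hP hQ hrho hD Ec.
have [Px0|Px0] := eqVneq (Px c) 0; last first.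
  have [r1 [K h]] := transversal_x r0 k0 s0 eps1 hP hQ hrho hD Px0 Ec.
  by exists false, r1, K.
have Py0 : Py c != 0 by apply: contraNneq Ec => ->; rewrite Px0 !mul0r subrr.
have sc := swapK c.
have [||||r1 [K [r10 r1r K0 hK]]] := @transversal_x (swap c) r k s (- eps) (P \o swap) (Py \o swap) (Px \o swap)
  (Q \o swap) (Qy \o swap) (Qx \o swap) (rho \o swap) (rhoy \o swap) (rhox \o swap) r0 k0 s0 _
  (C1_near_swap hP) (C1_near_swap hQ) (C1_near_swap hrho).
- by rewrite normrN.
- move=> p hp /=; have hp' : `|swap p - c| < r by rewrite -sc swap_norm.
  apply: le_trans (hD _ hp') _; rewrite le_eqVlt; apply/orP; left; apply/eqP; ring.
- by rewrite /= sc.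
- by rewrite /= sc -oppr_eq0 opprB.
exists true, r1, K; split=> // p q hp hq.
have [] := hK (swap p) (swap q); rewrite ?swap_norm//=.
by rewrite /swap /= -!surjective_pairing.
Qed.

(** One of [P], [Q] has level curves crossing those of [rho]; exchanging the two functions again
    reverses the sign of the Jacobian. *)
Lemma transversal (c : plane R) (r k s eps : R) (P Px Py Q Qx Qy rho rhox rhoy : plane R -> R) :
  0 < r -> 0 < k -> 0 <= s -> `|eps| = 1 ->
  C1_near c r P Px Py -> C1_near c r Q Qx Qy -> C1_near c r rho rhox rhoy ->
  (forall p, `|p - c| < r -> k * `|rho p| `^ s <= eps * (Px p * Qy p - Py p * Qx p)) ->
  Px c * rhoy c - Py c * rhox c != 0 \/ Qx c * rhoy c - Qy c * rhox c != 0 ->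
  exists b r1 K, [/\ 0 < r1, r1 < r, 0 < K & transversal_bound c r1 K s b P Q].
Proof.
move=> r0 k0 s0 eps1 hP hQ hrho hD [Ec|Ec]; first exact: (transversal_PQ r0 k0 s0 eps1 hP hQ hrho).
have [||b [r1 [K [r10 r1r K0 hK]]]] := @transversal_PQ c r k s (- eps) Q Qx Qy P Px Py rho rhox rhoy
  r0 k0 s0 _ hQ hP hrho _ Ec.
- by rewrite normrN.
- move=> p hp; apply: le_trans (hD _ hp) _; rewrite le_eqVlt; apply/orP; left; apply/eqP; ring.
exists b, r1, K; split=> // p q hp hq; have := hK p q hp hq.
by rewrite [`|Q p - _| + _]addrC.
Qed.

Lemma norm_coordinate b (p q : plane R) :
  `|p - q| = Num.max `|coordinate b p - coordinate b q| `|coordinate (~~ b) p - coordinate (~~ b) q|.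
Proof. by rewrite plane_normE; case: b => //=; rewrite maxC. Qed.

Section consequences.
Variables (c : plane R) (r K s : R) (b : bool) (Z : plane R -> C).
Hypotheses (r0 : 0 < r) (K0 : 0 < K) (s0 : 0 <= s)
  (hK : transversal_bound c r K s b (Rec Z) (Imc Z)).

Let ReIm_le p q : `|complex.Re (Z p) - complex.Re (Z q)| + `|complex.Im (Z p) - complex.Im (Z q)| <=
  2 * modc (Z p - Z q).
Proof.
rewrite mulr_natl mulr2n; apply: lerD.
  by rewrite -ReN -ReD normr_Re_le.
by rewrite -ImN -ImD normr_Im_le.
Qed.

(** Either the coordinate [b] differs by [d1] at least, and the first bound applies; or it differs
    by less than [d / (2 K)], and in the second bound this contribution is below [d / 2] and is
    absorbed. *)
Lemma transversal_separation d : 0 < d -> exists2 e, 0 < e & forall p q, `|p - c| < r ->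
  `|q - c| < r -> d <= `|p - q| -> e <= modc (Z p - Z q).
Proof.
move=> d0; pose d1 := Num.min d (d / (2 * K)).
have K2 : 0 < 2 * K by rewrite mulr_gt0.
have d10 : 0 < d1 by rewrite lt_min d0 divr_gt0.
exists (Num.min (d1 `^ (1 + s) / (2 * K)) (d / (4 * K))).
  by rewrite lt_min !divr_gt0 ?powR_gt0 ?mulr_gt0.
move=> p q hp hq; have [e1 e2] := hK hp hq; have e3 := ReIm_le p q.
rewrite (norm_coordinate b) le_max; set h := `|coordinate b p - _| in e1 e2 *.
have [dh _|hd] := leP d1 h.
  rewrite ge_min ler_pdivrMr//; apply/orP; left.
  apply: (@le_trans _ _ (h `^ (1 + s))).
    by apply: ge0_ler_powR; rewrite ?nnegrE ?addr_ge0 ?normr_ge0 ?(ltW d10).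
  apply: (le_trans e1); rewrite (_ : modc _ * (2 * K) = K * (2 * modc (Z p - Z q))); last by ring.
  by rewrite ler_wpM2l// ltW.
have hd' : h < d by rewrite (lt_le_trans hd)// ge_min lexx.
have hK' : h < d / (2 * K) by rewrite (lt_le_trans hd)// ge_min lexx orbT.
rewrite [d <= h]leNgt hd' /= => /le_trans/(_ e2) e4.
rewrite ge_min; apply/orP; right; rewrite ler_pdivrMr ?mulr_gt0//.
move: hK'; rewrite ltr_pdivlMr// => hK'.
have e5 := ler_wpM2l (ltW K0) e3.
move: e4; rewrite mulrDr; lra.
Qed.

(** On the sublevel set the coordinate [b] stays within [l = (4 K t) ^ (1 / (1 + s))] of a fixed
    value, and sections with [b] fixed have diameter at most [4 K t]. The area is thus of order
    [t ^ (1 + 1 / (1 + s))]. *)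
Lemma transversal_volume sigma : s <= sigma -> cmeasurable setT Z ->
  exists2 C0, 0 <= C0 & forall z t, 0 < t ->
    (mu (ball c r `&` [set p | (modc (Z p - z) < t)%R]) <=
     (C0 * t `^ (1 + (1 + sigma)^-1))%:E)%E.
Proof.
move=> ss mZ.
have sg0 : 0 <= sigma by exact: le_trans ss.
have ks : 0 < 1 + s by rewrite ltr_pwDl.
have kg : 0 < 1 + sigma by rewrite ltr_pwDl.
pose C1 := 16 * K * (4 * K) `^ (1 + s)^-1.
have C10 : 0 <= C1 by rewrite !mulr_ge0 ?powR_ge0 ?(ltW K0).
exists (C1 + (r *+ 2) ^+ 2); first by rewrite addr_ge0 ?sqr_ge0.
move=> z t t0; set E := _ `&` _.
have mB : measurable (ball c r : set (mplane R)) := measurable_plane_ball c r.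
have mE : measurable (E : set (mplane R)).
  apply: measurableI => //; rewrite -[X in measurable X]setTI.
  have mf : measurable_fun setT (fun p : mplane R => modc (Z p - z)).
    by apply: measurable_modc; apply: cmeasurableD => //; exact: (cmeasurable_cst _ (- z)).
  rewrite (_ : setT `&` _ = setT `&` (fun p : mplane R => modc (Z p - z)) @^-1` `]-oo, t[%classic).
    exact: mf.
  by apply/seteqP; split=> p [_ h]; split=> //=; move: h; rewrite /= in_itv.
(* For [t > 1] the area of the whole square suffices. For [t <= 1] the exponent may be lowered by
   passing from [s] to [sigma]. *)
have [t1|t1] := leP t 1; last first.
  apply: (@le_trans _ _ (mu (ball c r))).
    by apply: le_measure; rewrite ?inE//; apply: subIsetl.
  have := leb2_ball c (ltW r0); set x := leb2 R _ => ->.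
  rewrite lee_fin -[leLHS]mulr1; apply: ler_pM; rewrite ?sqr_ge0 ?lerDr//.
  apply: (le_trans (ltW t1)); apply: le1r_powR; first exact: ltW.
  by rewrite lerDl invr_ge0 ltW.
pose l := (4 * K * t) `^ (1 + s)^-1.
have l0 : 0 <= l by exact: powR_ge0.
have Ez p q : E p -> E q -> `|complex.Re (Z p) - complex.Re (Z q)| + `|complex.Im (Z p) - complex.Im (Z q)| <= 4 * t /\
    `|coordinate b p - coordinate b q| <= l.
  move=> [/plane_ballP pB /= pz] [/plane_ballP qB /= qz].
  have h : `|complex.Re (Z p) - complex.Re (Z q)| + `|complex.Im (Z p) - complex.Im (Z q)| <= 4 * t.
    apply: (le_trans (ReIm_le p q)).
    have := modcB (Z p - z) (Z q - z); rewrite (_ : Z p - z - (Z q - z) = Z p - Z q); last by ring.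
    lra.
  split=> //; have [e1 _] := hK pB qB.
  have e2 : `|coordinate b p - coordinate b q| `^ (1 + s) <= 4 * K * t.
    apply: (le_trans e1); rewrite [4 * K]mulrC -mulrA ler_wpM2l ?(ltW K0)//.
  have := @ge0_ler_powR R (1 + s)^-1; rewrite invr_ge0 => /(_ (ltW ks) (`|coordinate b p - coordinate b q| `^ (1 + s)) (4 * K * t)).
  rewrite !nnegrE powR_ge0 !mulr_ge0 ?(ltW K0) ?(ltW t0)// => /(_ isT isT e2).
  by rewrite -powRrM mulfV ?gt_eqF// powRr1.
have sl p q : E p -> E q -> coordinate b p = coordinate b q ->
    `|coordinate (~~ b) p - coordinate (~~ b) q| <= 4 * K * t.
  move=> pE qE e; have [e1 _] := Ez p q pE qE; case: pE qE => [/plane_ballP pB _] [/plane_ballP qB _].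
  have [_ e2] := hK pB qB; move: e2; rewrite e subrr normr0 addr0 => /le_trans; apply.
  by rewrite [4 * K]mulrC -mulrA ler_wpM2l ?(ltW K0).
have h0 : 0 <= 4 * K * t by rewrite !mulr_ge0 ?(ltW K0) ?(ltW t0).
have bound : (mu E <= ((4 * K * t) *+ 2 * (2 * l))%:E)%E.
  have [[q0 qE]|/forallNP hE] := pselect (exists q, E q); last first.
    have -> : E = set0 by apply/seteqP; split=> // p /hE.
    by rewrite measure0 lee_fin !mulr_ge0// mulrn_wge0.
  have l20 : 0 <= 2 * l by rewrite mulr_ge0.
  have range p : E p -> coordinate b q0 - l <= coordinate b p <= (coordinate b q0 - l) + 2 * l.
    by move=> pE; have [_] := Ez p q0 pE qE; rewrite ler_norml => /andP[h1 h2]; apply/andP; split; lra.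
  case: b sl range => /= sl range.
    exact: (leb2_xsection_le mE h0 l20 range sl).
  exact: (leb2_ysection_le mE h0 l20 range sl).
apply: (le_trans bound); rewrite lee_fin.
have -> : (4 * K * t) *+ 2 * (2 * l) = C1 * (t * t `^ (1 + s)^-1).
  by rewrite /l powRM ?mulr_ge0 ?(ltW K0) ?(ltW t0)// /C1 -mulr_natl; ring.
apply: ler_pM => //; first by rewrite mulr_ge0 ?powR_ge0 ?(ltW t0).
  by rewrite lerDl sqr_ge0.
rewrite powRD; last by rewrite (gt_eqF t0) implybT.
rewrite powRr1 ?(ltW t0)// ler_wpM2l ?(ltW t0)//.
apply: ger_powR; first by rewrite t0 t1.
by rewrite lef_pV2 ?posrE// lerD2l.
Qed.

End consequences.
End transversal.

(** * Hölder regularity near one point *)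

Section local_regularity.
Variable R : realType.
Local Notation mu := (leb2 R).
Local Notation C := R[i].

Lemma C1_near_sub (c : plane R) (r r' : R) f fx fy : r' <= r ->
  C1_near c r f fx fy -> C1_near c r' f fx fy.
Proof. by move=> rr h p hp; apply: h; exact: lt_le_trans hp rr. Qed.

Lemma near_neq0 (f : plane R -> R) (c : plane R) (r : R) : 0 < r ->
  {for c, continuous f} -> f c != 0 ->
  exists r1, [/\ 0 < r1, r1 <= r & forall p, `|p - c| < r1 -> f p != 0].
Proof.
move=> r0 cf fc; have a0 : 0 < `|f c| by rewrite normr_gt0.
have : \forall p \near c, `|f c - f p| < `|f c| by move: cf => /cvgrPdist_lt; apply.
move=> /nbhs_ballP[d /= d0 hd]; exists (Num.min d r); rewrite lt_min d0 ge_min lexx orbT; split=> // p.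
rewrite lt_min => /andP[/(iffRL (plane_ballP c p d))/hd/= h _].
by apply: contraTneq h => ->; rewrite subr0 ltxx.
Qed.

(** Where one partial derivative of [rho] does not vanish, [rho] is injective in that variable, so
    that sections of its zero set have diameter 0. *)
Lemma level_negligible (c : plane R) (r : R) (rho rhox rhoy : plane R -> R) : 0 < r ->
  C1_near c r rho rhox rhoy -> rhox c != 0 \/ rhoy c != 0 ->
  exists r1, [/\ 0 < r1, r1 <= r & mu.-negligible (ball c r1 `&` [set p | rho p = 0])].
Proof.
move=> r0 hrho hc.
have cc : `|c - c| < r by rewrite subrr normr0.
have [_ cx cy] := hrho c cc.
have null r1 : 0 < r1 -> r1 <= r ->
    (forall p, `|p - c| < r1 -> rhox p != 0) \/ (forall p, `|p - c| < r1 -> rhoy p != 0) ->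
    mu.-negligible (ball c r1 `&` [set p | rho p = 0]).
  move=> r10 r1r hn; have hrho1 := C1_near_sub r1r hrho.
  have g p : `|p - c| < r1 -> has_grad rho p (rhox p) (rhoy p) by move=> /hrho1[].
  set E := _ `&` _.
  have mB : measurable (ball c r1 : set (mplane R)) := measurable_plane_ball c r1.
  have mE : measurable (E : set (mplane R)).
    have mr : measurable_fun setT (fun p : mplane R => \1_(ball c r1) p * rho p).
      by apply: measurable_ballM => p /g; exact: has_grad_continuous.
    have -> : E = ball c r1 `&` (setT `&` (fun p : mplane R => \1_(ball c r1) p * rho p) @^-1` [set 0]).
      apply/seteqP; split=> p [hp].
        by move=> /= h; split=> //; split=> //=; rewrite h mulr0.
      by move=> [_ /=]; rewrite indicE mem_set// mul1r.
    by apply: measurableI => //; exact: mr.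
  have l0 : 0 <= r1 *+ 2 by rewrite mulrn_wge0// ltW.
  apply/negligibleP => //; apply/eqP; rewrite eq_le measure_ge0 andbT.
  have inE p : E p -> `|p - c| < r1 /\ rho p = 0 by move=> [/plane_ballP].
  have z0 : (0 : R) *+ 2 * (r1 *+ 2) = 0 by rewrite mul0rn mul0r.
  case: hn => hn.
    have := @leb2_ysection_le R E (c.2 - r1) (r1 *+ 2) 0 mE (lexx _) l0; rewrite z0; apply.
      move=> p /inE[h _]; move: h; rewrite plane_normE gt_max => /andP[_].
      by rewrite ltr_norml mulr2n /= => /andP[h1 h2]; apply/andP; split; lra.
    move=> p q /inE[hp p0] /inE[hq q0] e.
    have [z [hz _]] := mean_value_ball g hp hq; rewrite p0 q0 e !subrr mulr0 addr0.
    by move=> /esym/eqP; rewrite mulf_eq0 (negbTE (hn z hz)) /= => /eqP ->; rewrite normr0.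
  have := @leb2_xsection_le R E (c.1 - r1) (r1 *+ 2) 0 mE (lexx _) l0; rewrite z0; apply.
    move=> p /inE[h _]; move: h; rewrite plane_normE gt_max => /andP[+ _].
    by rewrite ltr_norml mulr2n /= => /andP[h1 h2]; apply/andP; split; lra.
  move=> p q /inE[hp p0] /inE[hq q0] e.
  have [z [hz _]] := mean_value_ball g hp hq; rewrite p0 q0 e !subrr mulr0 add0r.
  by move=> /esym/eqP; rewrite mulf_eq0 (negbTE (hn z hz)) /= => /eqP ->; rewrite normr0.
case: hc => hc.
  have [r1 [r10 r1r h]] := near_neq0 r0 cx hc.
  by exists r1; split=> //; apply: null => //; left.
have [r1 [r10 r1r h]] := near_neq0 r0 cy hc.
by exists r1; split=> //; apply: null => //; right.
Qed.

Lemma near_bounded (f : plane R -> R) (c : plane R) (r : R) : 0 < r ->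
  {for c, continuous f} -> exists r1, [/\ 0 < r1, r1 <= r &
    forall p, `|p - c| < r1 -> `|f p| <= `|f c| + 1].
Proof.
move=> r0 cf.
have : \forall p \near c, `|f c - f p| < 1 by move: cf => /cvgrPdist_lt; apply.
move=> /nbhs_ballP[d /= d0 hd]; exists (Num.min d r); rewrite lt_min d0 ge_min lexx orbT; split=> // p.
rewrite lt_min => /andP[/(iffRL (plane_ballP c p d))/hd/= h _].
by have := ler_distD (f c) (f p) 0; rewrite !subr0 distrC; lra.
Qed.

(** Extension by zero from a square: what is known near [c] only becomes measurable and bounded, or
    integrable, on the whole plane. *)
Definition cut (c : plane R) (r : R) (g : plane R -> C) : plane R -> C :=
  fun p => (\1_(ball c r) p)%:C%C * g p.

Lemma cut_in c r g p : `|p - c| < r -> cut c r g p = g p.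
Proof. by move=> hp; rewrite /cut indicE mem_set ?mul1r//; exact/plane_ballP. Qed.

Lemma cut_out c r g p : r <= `|p - c| -> cut c r g p = 0.
Proof.
move=> hp; rewrite /cut indicE memNset ?mul0r// => /plane_ballP.
by rewrite ltNge hp.
Qed.

Lemma cmeasurable_cut c r (g : plane R -> C) :
  (forall p, `|p - c| < r -> {for p, continuous (Rec g)} /\ {for p, continuous (Imc g)}) ->
  cmeasurable setT (cut c r g).
Proof.
move=> hg; split.
- have h : measurable_fun setT (fun p : mplane R => \1_(ball c r) p * complex.Re (g p)).
    by apply: measurable_ballM => p /hg[].
  by move: h; congr (measurable_fun _ _); apply/funext => p; rewrite ReM /= mul0r subr0.
- have h : measurable_fun setT (fun p : mplane R => \1_(ball c r) p * complex.Im (g p)).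
    by apply: measurable_ballM => p /hg[].
  by move: h; congr (measurable_fun _ _); apply/funext => p; rewrite ImM /= mul0r addr0.
Qed.

Lemma cut_bound c r (g : plane R -> C) (M : R) : 0 <= M ->
  (forall p, `|p - c| < r -> modc (g p) <= M) -> forall p, modc (cut c r g p) <= M.
Proof.
move=> M0 hg p; have [h|h] := leP r `|p - c|; first by rewrite cut_out// modc0.
by rewrite cut_in// hg.
Qed.

Lemma radii (r : R) : 0 < r ->
  [/\ 0 < r / 4, r / 4 < r / 2, 0 < r / 2, r / 2 < 3 * r / 4 & 3 * r / 4 < r].
Proof. by move=> r0; split; lra. Qed.

(** [m (p - 1) - p = (p - (2 + sigma)) / (1 + sigma)]: the assumption on [p] is exactly what gives
    [q < m]. The other side of the range follows from [m <= 2 < 2 q]. *)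
Lemma exponents (sigma p : R) (q := p / (p - 1)) (m := 1 + (1 + sigma)^-1) :
  0 <= sigma -> 2 + sigma < p ->
  [/\ 0 < p, 1 < m, 1 < q, q < m & m < 2 * q /\ p^-1 + q^-1 = 1].
Proof.
move=> sg0 hp.
have sg1 : 0 < 1 + sigma by rewrite ltr_pwDl.
have p1 : 0 < p - 1 by lra.
have p0 : 0 < p by lra.
have m1 : 1 < m by rewrite ltrDl invr_gt0.
have q1 : 1 < q by rewrite /q ltr_pdivlMr// mul1r ltrBlDr ltrDl.
split=> //; last split.
- rewrite /q ltr_pdivrMr// /m -subr_gt0.
  have -> : (1 + (1 + sigma)^-1) * (p - 1) - p = (p - (2 + sigma)) / (1 + sigma).
    by field; rewrite gt_eqF.
  by rewrite divr_gt0// subr_gt0.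
- have : m <= 2 by rewrite /m -[2]/(1 + 1) lerD2l invf_le1// lerDl.
  by move: q1; clear; lra.
by rewrite /q; field; rewrite !gt_eqF.
Qed.

Theorem local_regularity (c : plane R) (r0 k s sigma eps p : R)
    (Z Zx Zy u f : plane R -> C) (rho rhox rhoy : plane R -> R) :
  0 < r0 -> 0 < k -> 0 <= s -> s <= sigma -> `|eps| = 1 ->
  C1_near c r0 (Rec Z) (Rec Zx) (Rec Zy) -> C1_near c r0 (Imc Z) (Imc Zx) (Imc Zy) ->
  C1_near c r0 rho rhox rhoy ->
  (forall x, `|x - c| < r0 -> k * `|rho x| `^ s <= eps * jac Zx Zy x) ->
  complex.Re (Zx c) * rhoy c - complex.Re (Zy c) * rhox c != 0 \/
    complex.Im (Zx c) * rhoy c - complex.Im (Zy c) * rhox c != 0 ->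
  2 + sigma < p -> cintegrable u -> cintegrable f ->
  (\int[mu]_x (\1_(ball c r0) x * modc (f x) `^ p)%:E < +oo)%E ->
  (forall r, 0 < r -> r <= r0 -> weak_on c r Zx Zy u f) ->
  let q := p / (p - 1) in
  let alpha := (2 - q - sigma / (sigma + 1)) / q in
  exists r v, 0 < r /\ {ae mu, forall x : plane R, `|x - c| < r -> u x = v x} /\
    exists K, forall x y, `|x - c| < r -> `|y - c| < r ->
      modc (v x - v y) <= K * `|x - y| `^ alpha.
Proof.
move=> r00 k0 s0 ss eps1 hP hQ hrho hD hE hp iu if_ fp wk q alpha.
have cc : `|c - c| < r0 by rewrite subrr normr0.
have sg0 : 0 <= sigma by exact: le_trans ss.
have [b [r1 [K [r10 r1r K0 hK]]]] := transversal r00 k0 s0 eps1 hP hQ hrho hD hE.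
have hgr : rhox c != 0 \/ rhoy c != 0.
  have [x0|] := eqVneq (rhox c) 0; last by left.
  by right; apply/eqP => y0; move: hE; rewrite x0 y0 !mulr0 !subrr eqxx => -[].
have [r2 [r20 r2r hnull]] := level_negligible r00 hrho hgr.
have [_ cPx cPy] := hP c cc; have [_ cQx cQy] := hQ c cc.
have [r3 [r30 r3r hPx]] := near_bounded r00 cPx.
have [r4 [r40 r4r hPy]] := near_bounded r00 cPy.
have [r5 [r50 r5r hQx]] := near_bounded r00 cQx.
have [r6 [r60 r6r hQy]] := near_bounded r00 cQy.
have [r [rr rlr0 [l1 l2] [l3 l4] [l5 l6]]] : exists r, [/\ 0 < r, r < r0, r < r1 /\ r < r2,
    r < r3 /\ r < r4 & r < r5 /\ r < r6].
  exists (Num.min (Num.min r1 r2) (Num.min (Num.min r3 r4) (Num.min r5 r6)) / 2).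
  set x := Num.min _ _; have x0 : 0 < x by rewrite !lt_min r10 r20 r30 r40 r50 r60.
  have : x / 2 < x by rewrite ltr_pdivrMr// ltr_pMr// ltr1n.
  rewrite {2}/x !lt_min => /andP[/andP[l1 l2] /andP[/andP[l3 l4] /andP[l5 l6]]].
  by split=> //; [rewrite divr_gt0|exact: lt_trans l1 r1r].
have lt_r x : `|x - c| < r -> [/\ `|x - c| < r0, `|x - c| < r1 & `|x - c| < r2] by move=> h; split; apply: lt_trans h _.
pose a := `|complex.Re (Zx c)|; pose a' := `|complex.Re (Zy c)|.
pose d := `|complex.Im (Zx c)|; pose d' := `|complex.Im (Zy c)|.
pose M := a + 1 + (a' + 1) + (d + 1) + (d' + 1).
have [a0 a0' d0 d0'] : [/\ 0 <= a, 0 <= a', 0 <= d & 0 <= d'] by split; exact: normr_ge0.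
have M0 : 0 <= M by rewrite /M; lra.
have hM x : `|x - c| < r -> modc (Zx x) <= M /\ modc (Zy x) <= M.
  move=> hx; have := hPx x; have := hPy x; have := hQx x; have := hQy x.
  move=> /(_ _)b4 /(_ _)b3 /(_ _)b2 /(_ _)b1.
  have {}b1 : `|complex.Re (Zx x)| <= a + 1 by apply: b1; exact: lt_trans hx _.
  have {}b2 : `|complex.Re (Zy x)| <= a' + 1 by apply: b2; exact: lt_trans hx _.
  have {}b3 : `|complex.Im (Zx x)| <= d + 1 by apply: b3; exact: lt_trans hx _.
  have {}b4 : `|complex.Im (Zy x)| <= d' + 1 by apply: b4; exact: lt_trans hx _.
  rewrite /M; move: a0 a0' d0 d0' b1 b2 b3 b4; clear => a0 a0' d0 d0' b1 b2 b3 b4.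
  by split; apply: (le_trans (modc_le_ReIm _)); lra.
have [chi [schi chi01 chi1 chi0]] := smooth_bump c rr rlr0.
have [chix [chiy [? [? [? [_ _ gchi _ _]]]]]] := smooth_expr_grad schi.
(* [Z] is controlled on the square only. Multiplied by a bump it is measurable everywhere and
   unchanged near [c]. *)
pose Zc x := (chi x)%:C%C * Z x.
have ZcE x : `|x - c| < r -> Zc x = Z x by move=> hx; rewrite /Zc chi1 ?mul1r// ltW.
have chi_cont x : {for x, continuous chi} by exact: has_grad_continuous (gchi x).
have mZc : cmeasurable setT Zc.
  split.
  - rewrite (_ : (fun x => _) = (fun x => chi x * complex.Re (Z x))); last first.
      by apply/funext => x; rewrite ReM /= mul0r subr0.
    apply: (@measurable_ball_support R _ c r0) => x hx; last by rewrite chi0// mul0r.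
    by have [g _ _] := hP x hx; apply: cvgM; [exact: chi_cont|exact: has_grad_continuous g].
  - rewrite (_ : (fun x => _) = (fun x => chi x * complex.Im (Z x))); last first.
      by apply/funext => x; rewrite ImM /= mul0r addr0.
    apply: (@measurable_ball_support R _ c r0) => x hx; last by rewrite chi0// mul0r.
    by have [g _ _] := hQ x hx; apply: cvgM; [exact: chi_cont|exact: has_grad_continuous g].
have chi_grad0 x : `|x - c| < r -> chix x = 0 /\ chiy x = 0.
  move=> hx; have h : \forall y \near x, chi y - 1 = 0.
    apply/nbhs_ballP; exists (r - `|x - c|) => /=; first by rewrite subr_gt0.
    move=> y /plane_ballP hy; rewrite chi1 ?subrr//.
    by have := ler_distD x y c; move: hy hx; clear; lra.
  by have := has_grad_near0 h (has_gradD (gchi x) (has_grad_cst (-1) x)); rewrite !addr0.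
have gZc x : `|x - c| < r ->
    has_grad (Rec Zc) x (complex.Re (cut c r Zx x)) (complex.Re (cut c r Zy x)) /\
    has_grad (Imc Zc) x (complex.Im (cut c r Zx x)) (complex.Im (cut c r Zy x)).
  move=> hx; have [hx0 _ _] := lt_r x hx; rewrite !cut_in//.
  have [gP _ _] := hP x hx0; have [gQ _ _] := hQ x hx0.
  have [x0 y0] := chi_grad0 x hx; have c1 : chi x = 1 by rewrite chi1// ltW.
  rewrite (_ : Rec Zc = (fun x => chi x * complex.Re (Z x))); last first.
    by apply/funext => y; rewrite ReM /= mul0r subr0.
  rewrite (_ : Imc Zc = (fun x => chi x * complex.Im (Z x))); last first.
    by apply/funext => y; rewrite ImM /= mul0r addr0.
  by split; [apply: (has_grad_eq (has_gradM (gchi x) gP))|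
    apply: (has_grad_eq (has_gradM (gchi x) gQ))];
    rewrite ?x0 ?y0 ?c1 ?mul0r ?addr0 ?mul1r.
have ccut (g : plane R -> R) (h : plane R -> R) x : `|x - c| < r ->
    (forall y, `|y - c| < r -> g y = h y) -> {for x, continuous g} -> {for x, continuous h}.
  move=> hx gh cg; rewrite /prop_for /continuous_at -(gh x hx).
  apply: cvg_trans cg; apply: near_eq_cvg; change (nbhs x [set y | g y = h y]).
  apply/nbhs_ballP; exists (r - `|x - c|) => /=; first by rewrite subr_gt0.
  move=> y /plane_ballP hy; apply: gh.
  by have := ler_distD x y c; move: hy hx; clear; lra.
have hZ : local_integral c r M Zc (cut c r Zx) (cut c r Zy).
  have ctx x : `|x - c| < r -> [/\ {for x, continuous (Rec Zx)}, {for x, continuous (Imc Zx)},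
      {for x, continuous (Rec Zy)} & {for x, continuous (Imc Zy)}].
    move=> hx; have [hx0 _ _] := lt_r x hx.
    by have [_ ? ?] := hP x hx0; have [_ ? ?] := hQ x hx0; split.
  split=> //.
  - by split=> //; apply: cmeasurable_cut => x /ctx[].
  - by move=> x; split; apply: cut_bound => // y /hM[].
  - move=> x hx; have [c1 c2 c3 c4] := ctx x hx; split.
    + by apply: (ccut (Rec Zx)) c1 => // y hy; rewrite cut_in.
    + by apply: (ccut (Imc Zx)) c2 => // y hy; rewrite cut_in.
    + by apply: (ccut (Rec Zy)) c3 => // y hy; rewrite cut_in.
    + by apply: (ccut (Imc Zy)) c4 => // y hy; rewrite cut_in.
have hKc : transversal_bound c r K s b (Rec Zc) (Imc Zc).
  move=> x y hx hy; have [_ hx1 _] := lt_r x hx; have [_ hy1 _] := lt_r y hy.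
  by have := hK x y hx1 hy1; rewrite !ZcE.
have [C0 C00 vol] := transversal_volume rr K0 s0 hKc ss mZc.
have jE x : `|x - c| < r -> jac (cut c r Zx) (cut c r Zy) x = jac Zx Zy x.
  by move=> hx; rewrite /jac !cut_in.
have jsgn x : `|x - c| < r -> 0 <= eps * jac (cut c r Zx) (cut c r Zy) x.
  move=> hx; rewrite jE//; have [hx0 _ _] := lt_r x hx; apply: le_trans (hD x hx0).
  by rewrite mulr_ge0 ?powR_ge0// ltW.
(* The lower bound of the Jacobian by [|rho| ^ s] confines its zeros to those of [rho]. *)
have jnull : mu.-negligible (ball c r `&` [set x | jac (cut c r Zx) (cut c r Zy) x = 0]).
  apply: (@negligibleS _ (mplane R) R mu _ _ _ hnull) => x [/plane_ballP hx /= j0].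
  have [hx0 _ hx2] := lt_r x hx; split; first exact/plane_ballP.
  have := hD x hx0; rewrite -(jE x hx) j0 mulr0 pmulr_rle0// => h.
  have /eqP : `|rho x| `^ s = 0 by apply/eqP; rewrite eq_le h powR_ge0.
  by rewrite powR_eq0 normr_eq0 => /andP[/eqP].
have weak : weak_on c r (cut c r Zx) (cut c r Zy) u f.
  move=> t phi phix phiy hphi; rewrite -(wk r rr (ltW rlr0) t phi phix phiy hphi).
  congr (- cintegral _ _); apply/funext => x.
  have [hx|hx] := leP r `|x - c|; last by rewrite /Lgrad !cut_in.
  have [_ tr _ _ _] := hphi.
  have [_ x0 y0] := cutoff_grad0 hphi (lt_le_trans tr hx).
  by rewrite /Lgrad x0 y0 !mulr0.
pose m := 1 + (1 + sigma)^-1.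
have [p0 m1 q1 qm [mq pq]] := exponents sg0 hp.
pose F0 := fine (\int[mu]_x (\1_(ball c r0) x * modc (f x) `^ p)%:E)%E.
have I0 : (0 <= \int[mu]_x (\1_(ball c r0) x * modc (f x) `^ p)%:E)%E.
  by apply: integral_ge0 => x _; rewrite lee_fin mulr_ge0 ?powR_ge0.
have mfp r' : measurable_fun setT (fun x : mplane R => \1_(ball c r') x * modc (f x) `^ p).
  apply: measurable_indicM; first exact: measurable_plane_ball.
  apply: measurable_funTS; apply: (measurableT_comp (measurable_powR _)).
  by apply: measurable_modc; exact: cintegrable_measurable.
have fp' : (\int[mu]_x (\1_(ball c r) x * modc (f x) `^ p)%:E <= F0%:E)%E.
  rewrite /F0 fineK ?ge0_fin_numE//; apply: ge0_le_integral => //.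
  - by move=> x _; rewrite lee_fin mulr_ge0 ?powR_ge0.
  - by apply/measurable_EFinP; exact: mfp.
  - by apply/measurable_EFinP; exact: mfp.
  move=> x _; rewrite lee_fin ler_wpM2r ?powR_ge0// !indicE.
  case: (boolP (x \in _)) => // /set_mem/plane_ballP hx.
  by rewrite mem_set//; apply/plane_ballP; exact: lt_trans rlr0.
(* [r / 4] is where the estimate will hold, [r / 2] where the cutoff is 1, and [3 r / 4] where it
   ends. *)
have [r30' r32 r20' r2rho rhor] := radii rr.
have [eta [seta eta01 eta1 eta0]] := smooth_bump c r20' r2rho.
have [etax [etay [? [? [? [_ _ geta _ _]]]]]] := smooth_expr_grad seta.
have rho0 : 0 < 3 * r / 4 by exact: lt_trans r2rho.
have heta : cutoff c r (3 * r / 4) eta etax etay by split.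
have [v [v1 [K' v2]]] := local_hoelder hZ (transversal_separation K0 s0 hKc) C00 vol m1 eps1 jsgn
  jnull heta eta01 r2rho eta1 iu if_ weak q1 qm mq p0 pq fp' r30' r32.
exists (r / 4), v; split=> //; split=> //; exists K'.
rewrite (_ : alpha = (m - q) / q)//; rewrite /alpha /m; congr (_ / _).
by field; rewrite [1 + sigma]addrC gt_eqF// ltr_wpDl.
Qed.

End local_regularity.

(** * From local to global representatives *)

Section gluing.
Variable R : realType.
Local Notation mu := (leb2 R).
Local Notation C := R[i].

Lemma ae_eq_continuous (g h : plane R -> R) (x : plane R) (d : R) : 0 < d ->
  {for x, continuous g} -> {for x, continuous h} ->
  {ae mu, forall y : plane R, `|y - x| < d -> g y = h y} -> g x = h x.
Proof.
move=> d0 cg ch gh; apply/eqP; rewrite -subr_eq0; apply/negPn/negP => n0.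
have cf : {for x, continuous (fun y => g y - h y)} by apply: cvgB.
have [r [r0 rd hr]] := near_neq0 d0 cf n0.
have sub : ball x r `<=` ~` [set y : plane R | `|y - x| < d -> g y = h y].
  move=> y /plane_ballP yr /= e; have := hr y yr.
  by rewrite e ?subrr ?eqxx// (lt_le_trans yr).
have /(measure_negligible (measurable_plane_ball x r)) :=
  @negligibleS _ (mplane R) R mu _ _ sub gh.
move=> h0; have := etrans (esym h0) (leb2_ball x (ltW r0)) => /esym/eqP; rewrite eqe.
by rewrite expf_eq0/= mulrn_eq0/= gt_eqF.
Qed.

Lemma near_nat (N : R) : \forall n \near \oo, N <= n%:R.
Proof.
exists (Num.truncn `|N|).+1 => // n /= hn.
rewrite (le_trans (ler_norm N))//; apply: ltW; apply: lt_le_trans (truncnS_gt _) _.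
by rewrite ler_nat.
Qed.

(** Two local representatives agree wherever both are defined, being continuous and almost
    everywhere equal; the diagonal [v p p] is therefore a global one. On a compact set, close pairs
    use a local constant, and distant pairs only the boundedness of the function. *)
Lemma glue_hoelder (Om : set (plane R)) (u : plane R -> C) (alpha : R) : open Om -> 0 < alpha ->
  (forall p, Om p -> exists r v, 0 < r /\ {ae mu, forall x : plane R, `|x - p| < r -> u x = v x} /\
    exists K, forall x y, `|x - p| < r -> `|y - p| < r ->
      modc (v x - v y) <= K * `|x - y| `^ alpha) ->
  exists v : plane R -> C, {ae mu, forall x, Om x -> u x = v x} /\
    loc_holder alpha Om (v : plane R -> Rcomplex R).
Proof.
move=> oOm a0 loc.
have /choice[d hd] : forall p, exists d : R * (plane R -> C) * R, Om p ->
    [/\ 0 < d.1.1, {ae mu, forall x : plane R, `|x - p| < d.1.1 -> u x = d.1.2 x} &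
      forall x y, `|x - p| < d.1.1 -> `|y - p| < d.1.1 ->
        modc (d.1.2 x - d.1.2 y) <= d.2 * `|x - y| `^ alpha].
  move=> p; have [/loc[r [v [r0 [uv [K hK]]]]]|nOm] := pselect (Om p).
    by exists (r, v, K).
  by exists (0, fun=> 0, 0).
pose r p := (d p).1.1; pose v p := (d p).1.2; pose K p := (d p).2.
pose V p := v p p.
have r0 p : Om p -> 0 < r p by move=> /hd[].
have agree p x : Om p -> Om x -> `|x - p| < r p -> V x = v p x.
  move=> pO xO xp; have [rp up vp] := hd p pO; have [rx ux vx] := hd x xO.
  have xx : `|x - x| < r x by rewrite subrr normr0.
  pose e := Num.min (r x) (r p - `|x - p|).
  have e0 : 0 < e by rewrite lt_min rx subr_gt0.
  have uv : {ae mu, forall y : plane R, `|y - x| < e -> v x y = v p y}.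
    have := @filterI (mplane R) _ (ae_filter_ringOfSetsType mu) _ _ up ux.
    apply: ae_leb2_impl => y [h1 h2]; rewrite lt_min => /andP[y1 y2].
    rewrite -[v x y]h2// -[v p y]h1//.
    by have := ler_distD x y p; rewrite -/(r p); lra.
  apply: complex_ext; apply: (@ae_eq_continuous (fun y => _ (v x y)) (fun y => _ (v p y)) x e e0).
  - apply: (@holder_continuous R _ x x (r x) (K x) alpha) => // y hy.
    by rewrite -ReN -ReD (le_trans (normr_Re_le _))//; exact: vx.
  - apply: (@holder_continuous R _ p x (r p) (K p) alpha) => // y hy.
    by rewrite -ReN -ReD (le_trans (normr_Re_le _))//; exact: vp.
  - by apply: ae_leb2_impl uv => y h /h ->.
  - apply: (@holder_continuous R _ x x (r x) (K x) alpha) => // y hy.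
    by rewrite -ImN -ImD (le_trans (normr_Im_le _))//; exact: vx.
  - apply: (@holder_continuous R _ p x (r p) (K p) alpha) => // y hy.
    by rewrite -ImN -ImD (le_trans (normr_Im_le _))//; exact: vp.
  - by apply: ae_leb2_impl uv => y h /h ->.
exists V; split.
  have : mu.-negligible ([set x | u x <> V x] `&` Om).
    apply: locally_negligible => p pO; have [rp up _] := hd p pO.
    have /nbhs_ballP[e /= e0 eO] := open_nbhs_nbhs (conj oOm pO).
    exists (Num.min e (r p)); first by rewrite lt_min e0.
    apply: (@negligibleS _ (mplane R) R mu _ _ _ up) => x [/= ux /plane_ballP].
    rewrite lt_min => /andP[xe xr] h; apply: ux; rewrite (agree p x)//; first exact: h.
    by apply: eO; exact/plane_ballP.
  apply: (@negligibleS _ (mplane R) R mu) => x /= h; split.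
    by move=> /= e; apply: h.
  by apply: contrapT => nO; apply: h.
move=> S cS SO.
(* Compactness as a near covering, with integers tending to infinity: a bound that holds near each
   point for all large [n] holds on [S] for a single [n]. *)
have /compact_near_coveringP/near_covering_withinP nc := cS.
have oball (p : plane R) (e : R) : 0 < e -> \forall x \near p, `|x - p| < e.
  by move=> e0; apply/nbhs_ballP; exists e => // x /plane_ballP.
have [B hB] : exists B : R, forall x, S x -> modc (V x) <= B.
  have : \forall n \near \oo, S `<=` (fun x => modc (V x) <= n%:R).
    apply: nc => p Sp; have pO := SO p Sp; have [rp _ vp] := hd p pO.
    exists ([set x | `|x - p| < r p], [set n : nat | modc (v p p) + `|K p| * r p `^ alpha <= n%:R]).
      by split; [exact: oball|exact: near_nat].
    move=> [x n] [/= xp hn] Sx; apply: le_trans hn; rewrite (agree p x)//; last exact: SO.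
    have -> : v p x = v p p + (v p x - v p p) by rewrite addrC subrK.
    rewrite (le_trans (modcD _ _))// lerD2l.
    have h := vp x p xp; rewrite subrr normr0 in h; apply: (le_trans (h rp)).
    apply: (@le_trans _ _ (`|K p| * `|x - p| `^ alpha)); first by rewrite ler_wpM2r ?powR_ge0 ?ler_norm.
    rewrite ler_wpM2l//; apply: ge0_ler_powR; rewrite ?nnegrE ?(ltW a0) ?(ltW rp)//.
    exact: ltW.
  by move=> /filter_ex[n hn]; exists n%:R => x /hn.
have : \forall n \near \oo, S `<=` (fun x => forall y, S y ->
    modc (V x - V y) <= n%:R * `|x - y| `^ alpha).
  apply: nc => p Sp; have pO := SO p Sp; have [rp _ vp] := hd p pO.
  have r20 : 0 < (r p / 2) `^ alpha by rewrite powR_gt0// divr_gt0.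
  (* [n] has to exceed the constant [K p] for the case that [y] lies in the square of [p], and
     [2 B / (r p / 2) ^ alpha] for [y] outside, where [|x - y| >= r p / 2]. *)
  exists ([set x | `|x - p| < r p / 2], [set n : nat | K p <= n%:R] `&`
      [set n : nat | (B + B) / (r p / 2) `^ alpha <= n%:R]).
    split; first by apply: oball; rewrite divr_gt0.
    by apply: filterI; exact: near_nat.
  move=> [x n] [/= xp [h1 h2]] Sx y Sy.
  have xp' : `|x - p| < r p by rewrite (lt_trans xp)// ltr_pdivrMr// ltr_pMr// ltr1n.
  have [yp|yp] := ltP `|y - p| (r p).
    rewrite (agree p x) ?(agree p y)//; try exact: SO.
    by rewrite (le_trans (vp x y xp' yp))// ler_wpM2r ?powR_ge0.
  apply: (@le_trans _ _ (B + B)).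
    by rewrite (le_trans (modcB _ _))// lerD// hB.
  move: h2; rewrite ler_pdivrMr// => /le_trans; apply; apply: ler_wpM2l => //.
  apply: ge0_ler_powR; rewrite ?nnegrE ?(ltW a0) ?divr_ge0 ?(ltW rp)//.
  by have := ler_distD x y p; rewrite (distrC y x) -/(r p); lra.
by move=> /filter_ex[n hn]; exists n%:R => x y Sx Sy; exact: hn.
Qed.

End gluing.

(** * Local data at elliptic and characteristic points *)

Section localization.
Variable R : realType.
Local Notation mu := (leb2 R).
Local Notation C := R[i].

Lemma open_square (U : set (plane R)) (c : plane R) : open U -> U c ->
  exists2 r, 0 < r & forall p, `|p - c| <= r -> U p.
Proof.
move=> oU Uc; have /nbhs_ballP[e /= e0 eU] := open_nbhs_nbhs (conj oU Uc).
exists (e / 2); first by rewrite divr_gt0.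
move=> p pe; apply: eU; apply/plane_ballP; apply: (le_lt_trans pe).
by rewrite ltr_pdivrMr// ltr_pMr// ltr1n.
Qed.

Lemma loc_holder_continuous (U : set (plane R)) (h : plane R -> R) (e : R) (p : plane R) :
  0 < e -> open U -> U p -> loc_holder e U h -> {for p, continuous h}.
Proof.
move=> e0 oU Up hU; have [r r0 rU] := open_square oU Up.
have [K hK] := hU _ (@compact_square R p r) (fun q hq => rU q hq).
have pp : `|p - p| <= r by rewrite subrr normr0 ltW.
apply: (@holder_continuous R _ p p r K e) => //; last by rewrite subrr normr0.
by move=> q /ltW hq; exact: hK.
Qed.

Lemma C1holder_near (U : set (plane R)) (h : plane R -> R) (e : R) (c : plane R) (r : R) :
  0 < e -> open U -> (forall p, `|p - c| < r -> U p) -> C1holder e U h ->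
  C1_near c r h (fun p => 'D_(dirx R) h p) (fun p => 'D_(diry R) h p).
Proof.
move=> e0 oU rU [dh hx hy] p /rU Up; split; first exact: (differentiable_has_grad (dh p Up)).
- exact: (loc_holder_continuous e0 oU Up hx).
- exact: (loc_holder_continuous e0 oU Up hy).
Qed.

Lemma first_integral_near (Om : set (plane R)) (Z Zx Zy : plane R -> C) (c : plane R) (r : R) :
  open Om -> (forall p, `|p - c| < r -> Om p) -> cC1holder_closure Om Z Zx Zy ->
  C1_near c r (Rec Z) (Rec Zx) (Rec Zy) /\ C1_near c r (Imc Z) (Imc Zx) (Imc Zy).
Proof.
move=> oOm rOm [_ dZ [e [e0 [Kx hx] [Ky hy]]]].
have cl p : `|p - c| < r -> closure Om p by move=> /rOm; exact: subset_closure.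
have ct (g : plane R -> C) K p : (forall x y, closure Om x -> closure Om y ->
    modc (g x - g y) <= K * `|x - y| `^ e) -> `|p - c| < r ->
    {for p, continuous (Rec g)} /\ {for p, continuous (Imc g)}.
  move=> hg hp; split; apply: (@holder_continuous R _ c p r K e) => // q hq.
    by rewrite -ReN -ReD (le_trans (normr_Re_le _))//; apply: hg; exact: cl.
  by rewrite -ImN -ImD (le_trans (normr_Im_le _))//; apply: hg; exact: cl.
have part p : `|p - c| < r -> has_grad (Rec Z) p (complex.Re (Zx p)) (complex.Re (Zy p)) /\
    has_grad (Imc Z) p (complex.Im (Zx p)) (complex.Im (Zy p)).
  move=> hp; have [[d1 d2] ex ey] := dZ p (rOm p hp); rewrite -ex -ey /=.
  by split; exact: differentiable_has_grad.
split=> p hp; have [c1 c2] := ct Zx Kx p hx hp; have [c3 c4] := ct Zy Ky p hy hp;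
  by have [? ?] := part p hp; split.
Qed.

Lemma sg_near (g : plane R -> R) (c : plane R) (r : R) : 0 < r ->
  {for c, continuous g} -> g c != 0 -> exists r1, [/\ 0 < r1, r1 <= r &
    forall p, `|p - c| < r1 -> `|g c| / 2 <= Num.sg (g c) * g p].
Proof.
move=> r0 cg gc; have a0 : 0 < `|g c| / 2 by rewrite divr_gt0 ?normr_gt0.
have : \forall p \near c, `|g c - g p| < `|g c| / 2 by move: cg => /cvgrPdist_lt; apply.
move=> /nbhs_ballP[d /= d0 hd]; exists (Num.min d r); rewrite lt_min d0 ge_min lexx orbT; split=> // p.
rewrite lt_min => /andP[/(iffRL (plane_ballP c p d))/hd/= + _].
move: (g p) => y {hd d0 a0 cg}; move: (g c) gc => x x0.
have [x1|x1|e] := ltgtP x 0; last by rewrite e eqxx in x0.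
  by rewrite (ltr0_norm x1) (ltr0_sg x1) mulN1r ltr_norml => /andP[h1 h2]; lra.
by rewrite (gtr0_norm x1) (gtr0_sg x1) mul1r ltr_norml => /andP[h1 h2]; lra.
Qed.

(** [rho] vanishes along the curve, so its gradient is orthogonal to the velocity of the chart, and
    in the plane the rotated gradient is then a multiple of this velocity. *)
Lemma tangent_gradient (S U V : set (plane R)) (J : set R) (g : R -> plane R) (p : plane R)
    (rho : plane R -> R) (a b : R) : S p -> U p ->
  curve_chart S U J g -> open V -> V p -> (forall q, S q -> V q -> rho q = 0) ->
  has_grad rho p a b -> a != 0 \/ b != 0 -> tangent S p (- b, a).
Proof.
move=> Sp Up chart oV Vp rho0 hrho ab.
have [oU [iJ [s0 [t0 [Js Jt st]]]] [dg _] gn0 [SUJ _]] := chart.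
have [t Jtt gt] : (g @` J) p by rewrite -SUJ.
have dgt := dg t.
pose x s := (g s).1; pose y s := (g s).2.
have [dx dy] : is_derive t 1 x (derive1 g t).1 /\ is_derive t 1 y (derive1 g t).2.
  have dd : differentiable g t by apply/derivable1_diffP.
  have hg := differentiableP dd.
  rewrite derive1E deriveE//; split.
  - have := is_diff_comp hg (has_grad_fst (g t)).
    move=> [h1 h2]; split; first by apply/derivable1_diffP.
    by rewrite deriveE// h2 /=; ring.
  - have := is_diff_comp hg (has_grad_snd (g t)).
    move=> [h1 h2]; split; first by apply/derivable1_diffP.
    by rewrite deriveE// h2 /=; ring.
have hrho' : has_grad rho (x t, y t) a b by rewrite /x /y -surjective_pairing gt.
have [dr er] := has_grad_curve dx dy hrho'.
have cg : {for t, continuous g} by apply: differentiable_continuous; apply/derivable1_diffP.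
have zero : a * (derive1 g t).1 + b * (derive1 g t).2 = 0.
  rewrite -er; apply/eqP/negPn/negP => n0.
  pose F s := rho (x s, y s).
  have Ft : F t = 0 by rewrite /F /x /y -surjective_pairing gt rho0.
  have cv : (fun h : R => h^-1 *: (F (h *: (1 : R) + t) - F t)) @ 0^' --> 'D_1 F t by exact: dr.
  have nz : \forall h \near 0^', h^-1 *: (F (h *: (1 : R) + t) - F t) != 0.
    have D0 : 0 < `|'D_1 F t| by rewrite normr_gt0.
    move: (cv) => /cvgrPdist_lt/(_ _ D0); apply: filterS => h; apply: contraTneq => ->.
    by rewrite subr0 ltxx.
  have VV : \forall h \near (0 : R)^', V (g (h *: (1 : R) + t)).
    apply: nbhs_dnbhs.
    have cc : {for 0, continuous (fun h : R => g (h *: (1 : R) + t))}.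
      apply: continuous_comp; last by rewrite scale0r add0r.
      by apply: cvgD; [exact: scalel_continuous|exact: cvg_cst].
    by apply: cc; rewrite scale0r add0r gt; exact: open_nbhs_nbhs.
  (* [J] may end at [t], so that only increments towards another point of [J] keep the curve in [S];
     a one-sided approach is enough to contradict a nonzero derivative. *)
  have [s1 Js1 s1t] : exists2 s1, J s1 & s1 != t.
    by have [e|ne] := eqVneq s0 t; [exists t0 => //; rewrite -e gt_eqF|exists s0].
  have /nbhs_ballP[d /= d0 hd] : nbhs (0 : R) [set h | h != 0 ->
      h^-1 *: (F (h *: (1 : R) + t) - F t) != 0 /\ V (g (h *: (1 : R) + t))].
    have H : \forall h \near (0 : R)^', h^-1 *: (F (h *: (1 : R) + t) - F t) != 0 /\ V (g (h *: (1 : R) + t)).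
      by apply: filterS2 nz VV => h; split.
    exact: H.
  have n1 : 0 < `|s1 - t| by rewrite normr_gt0 subr_eq0.
  pose e := Num.min 1 (d / 2 / `|s1 - t|).
  have e0 : 0 < e by rewrite lt_min ltr01/= !divr_gt0.
  have e1 : e <= 1 by rewrite ge_min lexx.
  pose h := e * (s1 - t).
  have h0 : h != 0 by rewrite mulf_neq0 ?subr_eq0// gt_eqF.
  have hb : ball (0 : R) d h.
    rewrite /ball/= sub0r normrN normrM (gtr0_norm e0).
    apply: (@le_lt_trans _ _ (d / 2)); last by rewrite ltr_pdivrMr// ltr_pMr// ltr1n.
    by rewrite -ler_pdivlMr// ge_min lexx orbT.
  have [+ hV] := hd h hb h0.
  have Jh : J (h *: (1 : R) + t).
    have -> : h *: (1 : R) + t = (1 - e) * t + e * s1 by rewrite /h /GRing.scale/=; ring.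
    have [ts|st1] := lerP t s1.
      apply: (iJ t s1 Jtt Js1).
      have : 0 <= e * (s1 - t) /\ 0 <= (1 - e) * (s1 - t) by rewrite !mulr_ge0 ?subr_ge0// ltW.
      by clear; move=> [? ?]; apply/andP; split; lra.
    apply: (iJ s1 t Js1 Jtt).
    have : 0 <= e * (t - s1) /\ 0 <= (1 - e) * (t - s1) by rewrite !mulr_ge0 ?subr_ge0// ltW.
    by clear; move=> [? ?]; apply/andP; split; lra.
  have Sh : S (g (h *: (1 : R) + t)).
    by have : (g @` J) (g (h *: (1 : R) + t)) by [exists (h *: (1 : R) + t)]; rewrite -SUJ => -[].
  by rewrite Ft {1}/F /x /y -surjective_pairing rho0// subr0 scaler0 eqxx.
have [c0 c1] : exists c, (- b, a) = c *: derive1 g t.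
  have := gn0 t Jtt; move: (derive1 g t) zero => [v w]/= zero vw.
  have sc (c v' w' : R) : c *: ((v', w') : plane R) = (c * v', c * w') by [].
  have [v0|v0] := eqVneq v 0.
    have w0 : w != 0 by apply: contra vw => /eqP->; rewrite v0.
    have b0 : b = 0 by move: zero; rewrite v0 mulr0 add0r => /eqP; rewrite mulf_eq0 (negbTE w0) orbF => /eqP.
    by exists (a / w); rewrite v0 b0 sc mulr0 oppr0 divfK.
  exists (- b / v); rewrite sc divfK//.
  congr pair; apply: (mulIf v0); move: zero; rewrite mulrAC divfK// => /eqP.
  by rewrite addr_eq0 => /eqP->; ring.
by exists U, J, g, t, c0.
Qed.

Lemma jac_ImAB (A B Zx Zy : plane R -> C) (x : plane R) :
  A x = - Zy x -> B x = Zx x -> jac Zx Zy x = - ImAB A B x.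
Proof.
move=> a b; rewrite /jac /ImAB a b; case: (Zx x) => u1 v1; case: (Zy x) => u2 v2 /=.
by rewrite /=; ring.
Qed.

(** If both determinants vanished, [Zx b = Zy a] would make [(A, B) = (- Zy, Zx)] a complex multiple
    of the tangent vector [(- b, a)]. *)
Lemma nontangency (A B Zx Zy : plane R -> C) (S U : set (plane R)) (x : plane R)
    (rho : plane R -> R) (a b : R) :
  nontangent A B S -> C1holder_curve S -> S x -> open U -> U x ->
  (forall q, S q -> U q -> rho q = 0) -> has_grad rho x a b -> a != 0 \/ b != 0 ->
  A x = - Zy x -> B x = Zx x ->
  complex.Re (Zx x) * b - complex.Re (Zy x) * a != 0 \/
  complex.Im (Zx x) * b - complex.Im (Zy x) * a != 0.
Proof.
move=> nt crv Sx oU Ux rho0 hr ab Ax Bx.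
have [V [J [g [Vx ch]]]] := crv x Sx.
have tg := tangent_gradient Sx Vx ch oU Ux rho0 hr ab.
apply/orP; rewrite -negb_and; apply/negP => /andP[/eqP e1 /eqP e2].
have e : Zx x * b%:C%C = Zy x * a%:C%C.
  move: e1 e2; case: (Zx x) => u1 v1; case: (Zy x) => u2 v2 /= e1 e2.
  by move: e1 e2 => /subr0_eq e1 /subr0_eq e2; apply: complex_ext;
    rewrite /= !mulr0 ?subr0 ?add0r.
apply: (nt x _ Sx tg) => /=; rewrite Ax Bx.
have rc t : (- t)%:C%C = - t%:C%C :> C by apply: complex_ext; rewrite /= ?oppr0.
have nz t : t != 0 -> t%:C%C != 0 :> C by move=> t0; rewrite (inj_eq (@complexI R)).
have [a0|a0] := eqVneq a 0.
  have b0 : b != 0 by case: ab; rewrite ?a0 ?eqxx.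
  exists (Zy x / b%:C%C); rewrite rc mulrN divfK ?nz//; split=> //.
  by apply: (mulIf (nz _ b0)); rewrite e mulrAC divfK ?nz.
exists (Zx x / a%:C%C); rewrite rc divfK ?nz//; split=> //.
by rewrite mulrN mulrAC e mulfK ?nz.
Qed.

Lemma cutoff_test_function (Om : set (plane R)) (c : plane R) (r rho : R) (chi chix chiy : plane R -> R) :
  cutoff c r rho chi chix chiy -> (forall p, `|p - c| <= rho -> Om p) ->
  test_function Om (fun p => (chi p)%:C%C).
Proof.
move=> [rho0 rhor schi hchi chi0] sub; pose K := [set p : plane R | `|p - c| <= rho].
have cK : compact K by exact: compact_square.
have clK : closed K by apply: compact_closed => //; exact: norm_hausdorff.
have sK : closure [set x | (chi x)%:C%C != 0 :> C] `<=` K.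
  rewrite [X in _ `<=` X]((closure_id K).1 clK); apply: closure_subset => x /=; apply: contra_neqP.
  by move=> /negP; rewrite -ltNge => /ltW /chi0 ->.
split.
- exact: smooth_expr_smooth schi.
- exact: smooth_expr_smooth (smooth_cst 0).
- by apply: subclosed_compact cK sK; exact: closed_closure.
- by move=> x /sK; exact: sub.
Qed.

Lemma vfield_real (A B Zx Zy : plane R -> C) (chi : plane R -> R) (a b : R) (x : plane R) :
  A x = - Zy x -> B x = Zx x -> has_grad chi x a b ->
  vfield A B (fun p => (chi p)%:C%C) x = Zx x * b%:C%C - Zy x * a%:C%C.
Proof.
move=> Ax Bx /has_gradE[ea eb]; have [e1 e2] := has_gradE (has_grad_cst 0 x).
rewrite /vfield /pdx /pdy Ax Bx /=.
rewrite -[X in 'D_(dirx R) X x]/chi -[X in 'D_(diry R) X x]/chi ea eb e1 e2 mulNr addrC.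
by [].
Qed.

Lemma weak_solution_weak_on (Om : set (plane R)) (A B Zx Zy u f : plane R -> C) (c : plane R) (r0 r : R) :
  weak_solution A B Om u f -> (forall x, Om x -> A x = - Zy x /\ B x = Zx x) ->
  (forall p, `|p - c| < r0 -> Om p) -> r <= r0 ->
  weak_on c r Zx Zy (cut c r0 u) (cut c r0 f).
Proof.
move=> [_ ws] AB sub rr0 rho phi phix phiy cf; have [rho0 rhor _ hphi _] := cf.
have rhor0 : rho < r0 by exact: lt_le_trans rr0.
have := ws _ (cutoff_test_function cf (fun p hp => sub p (le_lt_trans hp rhor0))).
rewrite !(cintegral_mkcond Om) => E.
have ind p : `|p - c| < r0 -> (\1_Om p)%:C%C = 1 :> C.
  by move=> /sub h; rewrite indicE mem_set.
transitivity (- cintegral setT (fun x => (\1_Om x)%:C%C * (u x * vfield A B (fun p => (phi p)%:C%C) x))).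
  congr (- cintegral setT _); apply/funext => p; have [hp|hp] := leP `|p - c| rho.
    have hp0 := le_lt_trans hp rhor0; have [a b] := AB p (sub p hp0).
    by rewrite cut_in// ind// mul1r (vfield_real a b (hphi p)).
  have [_ a b] := cutoff_grad0 cf hp; rewrite /Lgrad a b mulr0 mulr0 subr0 mulr0.
  have [hO|hO] := pselect (Om p); last by rewrite indicE memNset// mul0r.
  have [a' b'] := AB p hO.
  by rewrite (vfield_real a' b' (hphi p)) a b !mulr0 subr0 !mulr0.
rewrite E; congr (cintegral setT _); apply/funext => p; have [hp|hp] := leP `|p - c| rho.
  by have hp0 := le_lt_trans hp rhor0; rewrite cut_in// ind// mul1r.
by have [-> _ _] := cutoff_grad0 cf hp; rewrite !mulr0.
Qed.

Lemma closed_plane_measurable (K : set (plane R)) : closed K -> measurable (K : set (mplane R)).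
Proof. by move=> /closed_openC/open_plane_measurable/measurableC; rewrite setCK. Qed.

Lemma cLp_integrable (p : R) (D : set (plane R)) (f : plane R -> C) : 0 < p ->
  measurable (D : set (mplane R)) -> cLp p D f ->
  mu.-integrable setT (EFin \o (fun x => \1_D x * modc (f x) `^ p) : mplane R -> \bar R).
Proof.
move=> p0 mD [mf fin].
have mg : measurable_fun setT (fun x : mplane R => \1_D x * modc (f x) `^ p).
  apply: measurable_indicM => //.
  by apply: (measurableT_comp (measurable_powR p)); exact: measurable_modc.
apply/integrableP; split; first exact/measurable_EFinP.
have : ('N[mu]_(p%:E)[((fun x => (modc (f x))%:E) \_ D : mplane R -> \bar R)] `^ p < +oo)%E.
  by rewrite poweR_lty.
rewrite poweR_Lnorm ?gt_eqF//; apply: le_lt_trans; rewrite le_eqVlt; apply/orP; left; apply/eqP.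
apply: eq_integral => x _; rewrite /= /patch indicE; case: ifP => hx.
  by rewrite mul1r /= !ger0_norm ?modc_ge0 ?powR_ge0.
by rewrite mul0r /= normr0 powR0 ?gt_eqF.
Qed.

(** On a bounded set integrability follows from [|f| <= 1 + |f| ^ p]. *)
Lemma cintegrable_cut (p : R) (D : set (plane R)) (f : plane R -> C) (c : plane R) (r : R) :
  1 <= p -> 0 <= r -> measurable (D : set (mplane R)) -> (forall q, `|q - c| < r -> D q) -> cLp p D f ->
  cintegrable (cut c r f) /\ (\int[mu]_x (\1_(ball c r) x * modc (cut c r f x) `^ p)%:E < +oo)%E.
Proof.
move=> p1 r0 mD sub Lf; have p0 : 0 < p by exact: lt_le_trans p1.
have mB : measurable (ball c r : set (mplane R)) by exact: measurable_plane_ball.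
have intf := cLp_integrable p0 mD Lf.
have [m1 m2] := Lf.1.
have sB : (ball c r : set (mplane R)) `<=` D by move=> x /plane_ballP; exact: sub.
have mc : cmeasurable setT (cut c r f).
  split.
  - have := measurable_indicM mB (measurable_funS mD sB m1).
    by congr (measurable_fun _ _); apply/funext => q; rewrite ReM /= mul0r subr0.
  - have := measurable_indicM mB (measurable_funS mD sB m2).
    by congr (measurable_fun _ _); apply/funext => q; rewrite ImM /= mul0r addr0.
have cutE x : modc (cut c r f x) = \1_(ball c r) x * modc (f x).
  by rewrite /cut modcM modcR ger0_norm.
have bnd x : \1_(ball c r) x * modc (cut c r f x) `^ p <= \1_D x * modc (f x) `^ p.
  rewrite cutE indicE; case: (boolP (x \in _)) => [h|_]; last by rewrite mul0r mulr_ge0// powR_ge0.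
  by rewrite !mul1r indicE mem_set ?mul1r//; apply: sB; exact: set_mem h.
split; last first.
  have /integrableP[_] := intf; apply: le_lt_trans; apply: ge0_le_integral => //.
  - by move=> x _; rewrite lee_fin mulr_ge0// powR_ge0.
  - apply/measurable_EFinP; apply: measurable_funM; first exact: measurable_indic.
    by apply: (measurableT_comp (measurable_powR p)); exact: measurable_modc.
  - by apply: measurableT_comp => //; exact: (measurable_int mu).
  - by move=> x _; rewrite lee_fin (le_trans (bnd x))// ler_norm.
apply: (@cintegrable_le _ _ (fun x => \1_(ball c r) x + \1_D x * modc (f x) `^ p)) => //.
  have i1 : mu.-integrable setT (EFin \o (\1_(ball c r)) : mplane R -> \bar R).
    apply: (@integrable_bounded_support R _ c r 1) => [|q|q hq].
    - exact: (@measurable_indic _ (mplane R) R setT (ball c r) mB).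
    - by rewrite indicE; case: (_ \in _); rewrite ?normr1 ?normr0.
    - by rewrite indicE memNset// => /plane_ballP; rewrite ltNge (ltW hq).
  have := integrableD measurableT i1 intf.
  by congr (_.-integrable _ _); apply/funext => x.
move=> x; rewrite cutE; have [h|h] := leP (modc (f x)) 1.
  by rewrite -[leLHS]addr0 lerD ?mulr_ge0 ?powR_ge0// -[leRHS]mulr1 ler_wpM2l.
rewrite -[leLHS]add0r lerD//.
rewrite indicE; case: (boolP (x \in _)) => [hx|_]; last by rewrite mul0r mulr_ge0// powR_ge0.
rewrite mul1r indicE mem_set ?mul1r; last by apply: sB; exact: set_mem hx.
by rewrite -[leLHS]powRr1 ?modc_ge0// ler_powR// ltW.
Qed.

(** Common form of the two kinds of points. At a characteristic point [rho] defines the curve and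
    [s] is its type; at an elliptic point [s = 0] and the lower bound on the Jacobian no longer
    involves [rho]. *)
Definition weight (c : plane R) (r k s eps : R) (Zx Zy : plane R -> C) (rho rhox rhoy : plane R -> R) :=
  [/\ 0 < r, 0 < k, 0 <= s, `|eps| = 1 &
    [/\ C1_near c r rho rhox rhoy,
      forall x, `|x - c| < r -> k * `|rho x| `^ s <= eps * jac Zx Zy x &
      complex.Re (Zx c) * rhoy c - complex.Re (Zy c) * rhox c != 0 \/
      complex.Im (Zx c) * rhoy c - complex.Im (Zy c) * rhox c != 0]].

Lemma weight_elliptic (Zx Zy : plane R -> C) (c : plane R) (r : R) : 0 < r ->
  {for c, continuous (jac Zx Zy)} -> jac Zx Zy c != 0 ->
  exists r1 k eps rho rhox rhoy, r1 <= r /\ weight c r1 k 0 eps Zx Zy rho rhox rhoy.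
Proof.
move=> r0 cJ Jc; have [r1 [r10 r1r h]] := sg_near r0 cJ Jc.
(* With exponent 0 the factor [|rho| ^ 0] is 1, at zeros of [rho] too. Any [rho] whose level curves
   cross those of a part of [Z] will do; with [snd] this means [Zx c != 0], a consequence of
   [jac Zx Zy c != 0]. *)
exists r1, (`|jac Zx Zy c| / 2), (Num.sg (jac Zx Zy c)), snd, (fun=> 0), (fun=> 1); split=> //.
split=> //; first by rewrite divr_gt0 ?normr_gt0.
  by rewrite normr_sg Jc.
split.
- by move=> x _; split; [exact: has_grad_snd|exact: cvg_cst|exact: cvg_cst].
- by move=> x hx; rewrite powRr0 mulr1; exact: h.
rewrite !mulr1 !mulr0 !subr0; apply/orP; rewrite -negb_and; apply: contra Jc => /andP[/eqP a /eqP b].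
by rewrite /jac a b mul0r mulr0 subr0.
Qed.

Lemma weight_characteristic (Omt Om : set (plane R)) (A B Zx Zy : plane R -> C) (c : plane R) (r s : R) :
  0 < r -> (forall p, `|p - c| < r -> Om p) -> (forall x, Om x -> A x = - Zy x /\ B x = Zx x) ->
  C1holder_curve (char_set A B Om) -> nontangent A B (char_set A B Om) ->
  char_set A B Om c -> has_type A B Omt Om c s ->
  exists r1 k eps rho rhox rhoy, r1 <= r /\ weight c r1 k s eps Zx Zy rho rhox rhoy.
Proof.
move=> r0 sub AB crv nt Sc [s0 [U [rho [g [[oU Uc _] [e [e0 hrho]] [drho SU] [cg g0] E]]]]].
have [r2 r20 r2U] := open_square oU Uc.
have cgc : {for c, continuous g}.
  by move: cg; rewrite continuous_open_subspace// => /(_ c); apply; exact: mem_set.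
have rr0 : 0 < Num.min r r2 by rewrite lt_min r0.
have [r1 [r10 r1r h]] := sg_near rr0 cgc (g0 c Uc).
have [r1a r1b] : r1 <= r /\ r1 <= r2 by apply/andP; rewrite -le_min.
have subU p : `|p - c| < r1 -> U p by move=> hp; apply: r2U; exact: (le_trans (ltW hp)).
have subO p : `|p - c| < r1 -> Om p by move=> hp; apply: sub; exact: (lt_le_trans hp).
have near := C1holder_near e0 oU subU hrho.
(* [jac] is [- ImAB], hence the sign [- sg (g c)]. Near [c] the factor [g] keeps its sign and at
   least half of its size. *)
exists r1, (`|g c| / 2), (- Num.sg (g c)), rho, (fun p => 'D_(dirx R) rho p), (fun p => 'D_(diry R) rho p).
split=> //; split=> //.
- by rewrite divr_gt0 ?normr_gt0 ?g0.
- exact: ltW.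
- by rewrite normrN normr_sg g0.
have cc : `|c - c| < r1 by rewrite subrr normr0.
split=> //.
- move=> x hx; have [a b] := AB x (subO x hx).
  rewrite (jac_ImAB a b) mulrNN E; last exact: subU.
  by rewrite mulrC [leRHS]mulrCA ler_wpM2l ?powR_ge0// h.
- have [a b] := AB c (subO c cc); have [hg _ _] := near c cc.
  apply: (nontangency nt crv Sc oU Uc _ hg _ a b).
    by move=> q Sq Uq; have : (char_set A B Om `&` U) q by []; rewrite SU => -[].
  exact: drho.
Qed.

Lemma continuous_jac (c : plane R) (r : R) (Z Zx Zy : plane R -> C) : 0 < r ->
  C1_near c r (Rec Z) (Rec Zx) (Rec Zy) -> C1_near c r (Imc Z) (Imc Zx) (Imc Zy) ->
  {for c, continuous (jac Zx Zy)}.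
Proof.
move=> r0 n1 n2; have cc : `|c - c| < r by rewrite subrr normr0.
have [_ a b] := n1 c cc; have [_ a' b'] := n2 c cc.
by apply: cvgB; apply: cvgM.
Qed.

End localization.

Theorem theorem16 (R : realType) (Omt Om : set (plane R))
    (A B : plane R -> R[i])
    (Omt_open : open Omt)
    (AB_holder : exists e : R, [/\ 0 < e,
       loc_holder e Omt (A : plane R -> Rcomplex R) &
       loc_holder e Omt (B : plane R -> Rcomplex R)])
    (AB_neq0 : forall x, Omt x -> 0 < modc (A x) + modc (B x))
    (Om_open : open Om)
    (Om_relcompact : compact (closure Om))
    (Om_sub : closure Om `<=` Omt)
    (bd_piecewise_C1 : piecewise_C1 (closure Om `\` Om))
    (L_hypocomplex : hypocomplex A B Omt (closure Om))
    (Sigma_curve : C1holder_curve (char_set A B Om))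
    (Sigma_nontangent : nontangent A B (char_set A B Om))
    (Sigma_type : forall x, char_set A B Om x ->
       exists s, has_type A B Omt Om x s)
    (N : nat) (Sigma_ : 'I_N -> set (plane R)) (sigma_ : 'I_N -> R)
    (Sigma_inj : injective Sigma_)
    (Sigma_components : range Sigma_ =
       [set connected_component (char_set A B Om) x
          | x in char_set A B Om])
    (sigma_type : forall j x, Sigma_ j x -> has_type A B Omt Om x (sigma_ j))
    (Z Zx Zy : plane R -> R[i])
    (Z_C1holder : cC1holder_closure Om Z Zx Zy)
    (Z_homeo : homeo_onto_image (closure Om) (Z : plane R -> R[i]^o))
    (LZ0 : forall x, closure Om x -> A x * Zx x + B x * Zy x = 0)
    (dZ_neq0 : forall x, closure Om x -> Zx x != 0 \/ Zy x != 0)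
    (LE : forall x, closure Om x -> A x = - Zy x /\ B x = Zx x)
    (f u : plane R -> R[i]) (p : R) :
  let sigma := \big[Num.max/0]_(j < N) sigma_ j in
  let q := p / (p - 1) in
  let tau := sigma / (sigma + 1) in
  let alpha := (2 - q - tau) / q in
  2 + sigma < p ->
  cLp p Om f ->
  weak_solution A B Om u f ->
  q < 2 - tau /\
  exists v : plane R -> R[i],
    {ae leb2 R, forall x, Om x -> u x = v x} /\
    loc_holder alpha Om (v : plane R -> Rcomplex R).
Proof.
move=> sigma q tau alpha hp Lf ws.
(* The maximum starts from 0, so that [sigma = 0] if there is no characteristic curve. *)
have sigma0 : 0 <= sigma by exact: bigmax_ge_id.
have [p0 m1 q1 qm [m2 pq]] := exponents sigma0 hp.
have q2 : q < 2 - tau.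
  have E (t : R) : 0 <= t -> 2 - t / (t + 1) = 1 + (1 + t)^-1.
    by move=> t0; rewrite [1 + t]addrC; field; rewrite gt_eqF// ltr_wpDl.
  by rewrite /tau E.
split=> //.
have AB x : Om x -> A x = - Zy x /\ B x = Zx x by move=> /(@subset_closure _ Om)/LE.
apply: glue_hoelder => //.
  by rewrite /alpha divr_gt0 ?(lt_trans _ q1)// /alpha; move: q2; clear; lra.
move=> c Oc; have [r r0 rO] := open_square Om_open Oc.
have rO' x : `|x - c| < r -> Om x by move=> /ltW/rO.
have [n1 n2] := first_integral_near Om_open rO' Z_C1holder.
have [r1 [k [s [eps [rho [rhox [rhoy [r1r [ss w]]]]]]]]] :
    exists r1 k s eps rho rhox rhoy, r1 <= r /\ s <= sigma /\ weight c r1 k s eps Zx Zy rho rhox rhoy.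
  (* Elliptic points have [s = 0]. A point with vanishing Jacobian lies on some component of the
     characteristic set, whose type is at most [sigma]. *)
  have [J0|J0] := eqVneq (jac Zx Zy c) 0; last first.
    have [r1 [k [eps [rho [rhox [rhoy [? ?]]]]]]] := weight_elliptic r0 (continuous_jac r0 n1 n2) J0.
    by exists r1, k, 0, eps, rho, rhox, rhoy.
  have Sc : char_set A B Om c.
    split; first exact: subset_closure.
    by have [a b] := AB c Oc; apply/eqP; rewrite -oppr_eq0 -(jac_ImAB a b) J0.
  have [j _ Sj] : range Sigma_ (connected_component (char_set A B Om) c).
    by rewrite Sigma_components; exists c.
  have ty : has_type A B Omt Om c (sigma_ j).
    by apply: sigma_type; rewrite Sj; exact: connected_component_refl.
  have [r1 [k [eps [rho [rhox [rhoy [? ?]]]]]]] :=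
    weight_characteristic r0 rO' AB Sigma_curve Sigma_nontangent Sc ty.
  exists r1, k, (sigma_ j), eps, rho, rhox, rhoy; split=> //; split=> //.
  exact: le_bigmax.
have [r10 k0 s0 e1 [nr sg tr]] := w.
have p1 : 1 <= p by move: sigma0 hp; clear; lra.
have mOm : measurable (Om : set (mplane R)) by exact: open_plane_measurable.
have r1O x : `|x - c| < r1 -> Om x by move=> h; apply: rO'; exact: lt_le_trans r1r.
have [fi fp] := @cintegrable_cut R p Om f c r1 p1 (ltW r10) mOm r1O Lf.
(* [u] is integrable on compact subsets of [Om] only; this closed square is one and contains the
   square to which [u] is cut. *)
pose K := [set x : plane R | `|x - c| <= r].
have cK : compact K by exact: compact_square.
have mK : measurable (K : set (mplane R)).
  by apply: closed_plane_measurable; apply: compact_closed => //; exact: norm_hausdorff.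
have r1K x : `|x - c| < r1 -> K x by move=> h; apply: ltW; exact: lt_le_trans r1r.
have [ui _] := @cintegrable_cut R 1 K u c r1 (lexx 1) (ltW r10) mK r1K (ws.1.2 K cK rO).
have := @local_regularity R c r1 k s sigma eps p Z Zx Zy (cut c r1 u) (cut c r1 f) rho rhox rhoy
  r10 k0 s0 ss e1 (C1_near_sub r1r n1) (C1_near_sub r1r n2) nr sg tr hp ui fi fp
  (fun r' r'0 r'r => weak_solution_weak_on ws AB r1O r'r).
move=> [r2 [v [r20 [uv hv]]]].
exists (Num.min r1 r2), v; split; first by rewrite lt_min r10.
split; last first.
  have [H hH] := hv; exists H => x y; rewrite !lt_min => /andP[_ ?] /andP[_ ?]; exact: hH.
apply: (ae_leb2_impl _ uv) => x + hx; move: hx; rewrite lt_min => /andP[h1 h2] /(_ h2) <-.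
by rewrite cut_in.
Qed.
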